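(* The set of positive Thompson links contains the set of arborescent links associated with weighted plane rooted trees with all strictly positive weights. That is, if $t$ is a finite rooted plane tree all of whose vertices carry strictly positive integer weights, then there is a finite rooted binary plane tree $T$ with at least two leaves such that the closure of the arborescent tangle $\tau(t)$ is isotopic to $\mathcal{L}(T)$.
   Context: All links are unoriented links in $S^3$, considered up to isotopy. **Thompson links.** A pair $(T_+,T_-)$ of finite rooted binary plane trees with the same number $n$ of leaves represents an element of the Thompson group $F$. The link $\mathcal{L}(T_+,T_-)$ is defined as follows. Draw $T_+$ in the upper half-plane with its leaves at the points $1,\dots,n$ of the $x$-axis and the root on top, with an edge sprouting upwards from the root. At each trivalent vertex $v$ (including the root) add an edge going down from $v$, between its left and right child edges, to the point $i+\tfrac12$ of the $x$-axis, where $i$ is the right-most leaf of the left subtree at $v$. Each $v$ is now 4-valent; turn it into a crossing in which the strand formed by the two edges to the left and right child passes over the strand formed by the parent edge (for the root: the sprouting edge) and the new edge. Extend the strand sprouting from the root until it meets the $x$-axis at $0$. This gives a tangle consisting of $n$ arcs in the upper half-plane with endpoints $0,1,\tfrac32,2,\dots,n-\tfrac12,n$. Do the same with $T_-$ in the lower half-plane (drawn upside down relative to $T_+$, leaves on the $x$-axis, root at the bottom; again the strand formed by the two child edges passes over). Gluing the two tangles along the $x$-axis gives the link diagram $\mathcal{L}(T_+,T_-)$. The positive elements of $F$ (the elements of the positive monoid $F_+$) are those represented by pairs whose bottom tree $T_-$ is the right vine: the binary tree in which the left child of every interior vertex is a leaf. One writes $\mathcal{L}(T)=\mathcal{L}(T,T_-)$,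 where $T_-$ is the right vine with as many leaves as $T$. The links $\mathcal{L}(T)$ are called positive Thompson links. **Arborescent tangles and links.** Let $t$ be a finite rooted plane tree with integer vertex weights. The arborescent tangle $\tau(t)$ (with four endpoints NW, NE, SW, SE) is defined recursively. For an integer $w$ let $E(w)$ be the horizontal twist region with $|w|$ crossings side by side; a crossing is positive if its strand going from the bottom left to the top right is above the other strand, the crossings are positive if $w>0$ and negative if $w<0$, and $E(0)$ consists of two horizontal arcs. If the root of $t$ has weight $w$ and the subtrees rooted at its children are, in planar order, $t_1,\dots,t_k$ ($k\ge 0$), then $\tau(t)$ is the horizontal sum $\rho(\tau(t_1))+\dots+\rho(\tau(t_k))+E(w)$, where $\rho$ reflects a planar tangle diagram in the diagonal from bottom left to top right, keeping over/under information (so $\rho$ turns horizontal twist regions into vertical twist regions of the same sign). The closure of a tangle is obtained by joining NW to NE and SW to SE by simple arcs outside the tangle. The arborescent link associated with $t$ is the closure of $\tau(t)$. *)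

(* Defs.v *)
From HB Require Import structures.
From mathcomp Require Import all_boot all_order all_algebra.
From mathcomp Require Import all_classical all_reals all_analysis.
Import Order.TTheory GRing.Theory Num.Theory.
Import numFieldNormedType.Exports.
Local Open Scope classical_set_scope.
Local Open Scope ring_scope.

(** Links in S^3 are represented by subsets of R^3, where S^3 is the one-point
    compactification of R^3; two links are isotopic when an ambient isotopy of
    S^3 carries one onto the other.

    A diagram is drawn in the (x, y)-plane and seen from z = +oo, so that "over"
    means larger z.  Every tangle or link below is a finite union of segments in
    R^3 whose projection to the (x, y)-plane is the diagram: at a crossing the
    over strand has z = 1 and the under strand has z = -1. *)

Definition space3 (R : realType) : Type := (R * R * R)%type.

Definition sphere3 (R : realType) : topologicalType :=
  one_point_compactification (R * R * R)%type.

Definition homeomorphism {X Y : topologicalType} (f : X -> Y) : Prop :=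
  continuous f /\ exists2 g : Y -> X, continuous g & cancel f g /\ cancel g f.

Definition ambient_isotopy {R : realType} (H : R -> sphere3 R -> sphere3 R)
    : Prop :=
  [/\ {within `[0, 1] `*` [set: sphere3 R],
         continuous (fun p : R * sphere3 R => H p.1 p.2)},
      forall s : R, 0 <= s <= 1 -> homeomorphism (H s) &
      forall x : sphere3 R, H 0 x = x].

Definition isotopic {R : realType} (K L : set (space3 R)) : Prop :=
  exists2 H : R -> sphere3 R -> sphere3 R,
    ambient_isotopy H & H 1 @` (Some @` K) = Some @` L.

Definition segment {R : realType} (p q : space3 R) : set (space3 R) :=
  [set (line_path p.1.1 q.1.1 s, line_path p.1.2 q.1.2 s, line_path p.2 q.2 s)
    | s in `[0, 1]].

(** ** Thompson links *)

Inductive btree : Type := Leaf | Node of btree & btree.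

Fixpoint leaves (T : btree) : nat :=
  if T is Node l r then (leaves l + leaves r)%N else 1%N.

(** The tree drawing.  A subtree [T] whose leaves are a, a + 1, ..., a + m - 1
    (with m = [leaves T] > 1) has its root above the point i + 1/2 of the
    x-axis, where i is the right-most leaf of the left subtree, at height m - 1.
    With this choice all edges are straight, the edge added below a vertex is
    vertical, and edges only meet at common end points. *)

Definition vertex_x (R : realType) (a : nat) (T : btree) : R :=
  if T is Node l _ then (a + leaves l)%:R - 2^-1 else a%:R.

Definition vertex_y (R : realType) (T : btree) : R := (leaves T).-1%:R.

(** The lower end of the edge from the parent into [T]: a leaf on the x-axis, or
    the under-passing point of the crossing at the root of [T]. *)
Definition parent_end (R : realType) (a : nat) (T : btree) : space3 R :=
  (vertex_x R a T, vertex_y R T, if T is Node _ _ then - 1 else 0).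

Fixpoint tree_strands (R : realType) (a : nat) (T : btree) : set (space3 R) :=
  if T is Node l r then
    let over : space3 R := (vertex_x R a T, vertex_y R T, 1) in
    let foot : space3 R := (vertex_x R a T, 0, 0) in
    tree_strands R a l `|` tree_strands R (a + leaves l) r
    `|` segment over (parent_end R a l)
    `|` segment over (parent_end R (a + leaves l) r)
    `|` segment (parent_end R a T) foot
  else set0.

Definition upper_tangle (R : realType) (T : btree) : set (space3 R) :=
  let h : R := (leaves T)%:R in
  tree_strands R 1 T
  `|` segment (parent_end R 1 T) (vertex_x R 1 T, h, 0)
  `|` segment (vertex_x R 1 T, h, 0) (0, h, 0)
  `|` segment (0, h, 0) (0, 0, 0).

(** Turning a tree upside down keeps the crossing information, since the strand
    through the children is the over strand in both half-planes. *)
Definition upside_down {R : realType} (p : space3 R) : space3 R :=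
  (p.1.1, - p.1.2, p.2).

(** Meaningful when [Tp] and [Tm] have the same number of leaves. *)
Definition thompson_link (R : realType) (Tp Tm : btree) : set (space3 R) :=
  upper_tangle R Tp `|` upside_down @` upper_tangle R Tm.

(** The right vine with [k.+1] leaves. *)
Definition right_vine (k : nat) : btree := iter k (Node Leaf) Leaf.

Definition positive_thompson_link (R : realType) (T : btree)
    : set (space3 R) :=
  thompson_link R T (right_vine (leaves T).-1).

(** ** Arborescent links *)

Inductive wtree : Type := WNode of int & seq wtree.

Fixpoint all_weights_positive (t : wtree) : bool :=
  let: WNode w ts := t in (0 < w) && all all_weights_positive ts.

(** A tangle lies over the unit square of the (x, y)-plane: its end points SW,
    SE, NW, NE are the corners (0, 0), (1, 0), (0, 1), (1, 1) at height z = 0,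
    and the rest of it projects into the open square. *)

Definition horizontal_arcs (R : realType) : set (space3 R) :=
  segment (0, 1, 0) (2^-1, 2 / 3, 0) `|` segment (2^-1, 2 / 3, 0) (1, 1, 0)
  `|` segment (0, 0, 0) (2^-1, 1 / 3, 0) `|` segment (2^-1, 1 / 3, 0) (1, 0, 0).

(** The crossing whose strand from SW to NE is over if [z = 1] (a positive
    crossing) and under if [z = - 1]. *)
Definition crossing {R : realType} (z : R) : set (space3 R) :=
  segment (0, 0, 0) (2^-1, 2^-1, z) `|` segment (2^-1, 2^-1, z) (1, 1, 0)
  `|` segment (0, 1, 0) (2^-1, 2^-1, - z)
  `|` segment (2^-1, 2^-1, - z) (1, 0, 0).

(** [A] and [B] are shrunk over the boxes [1/4, 1/2] x [1/4, 3/4] and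
    [1/2, 3/4] x [1/4, 3/4], which joins NE and SE of [A] to NW and SW of [B];
    the other end points are connected to the corners of the unit square. *)
Definition hsum {R : realType} (A B : set (space3 R)) : set (space3 R) :=
  (fun p : space3 R => (p.1.1 / 4 + 1 / 4, p.1.2 / 2 + 1 / 4, p.2)) @` A
  `|` (fun p : space3 R => (p.1.1 / 4 + 1 / 2, p.1.2 / 2 + 1 / 4, p.2)) @` B
  `|` segment (0, 0, 0) (1 / 4, 1 / 4, 0)
  `|` segment (0, 1, 0) (1 / 4, 3 / 4, 0)
  `|` segment (3 / 4, 1 / 4, 0) (1, 0, 0)
  `|` segment (3 / 4, 3 / 4, 0) (1, 1, 0).

Definition twist (R : realType) (w : int) : set (space3 R) :=
  iter `|w|%N (hsum (crossing (Num.sg w)%:~R)) (horizontal_arcs R).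

Definition reflect_diag {R : realType} (p : space3 R) : space3 R :=
  (p.1.2, p.1.1, p.2).

Fixpoint arborescent_tangle (R : realType) (t : wtree) : set (space3 R) :=
  let: WNode w ts := t in
  foldr hsum (twist R w)
    [seq reflect_diag @` arborescent_tangle R u | u <- ts].

Definition closure_tangle {R : realType} (A : set (space3 R))
    : set (space3 R) :=
  A `|` segment (0, 1, 0) (2^-1, 2, 0) `|` segment (2^-1, 2, 0) (1, 1, 0)
  `|` segment (0, 0, 0) (2^-1, - 1, 0) `|` segment (2^-1, - 1, 0) (1, 0, 0).

Definition arborescent_link (R : realType) (t : wtree) : set (space3 R) :=
  closure_tangle (arborescent_tangle R t).

(* Main.v *)
Require Import Defs.
From HB Require Import structures.
From Stdlib Require ZArith QArith.
From Stdlib Require Import BinNums.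
From mathcomp Require Import all_boot all_order all_algebra.
From mathcomp Require Import ring lra zify ssrZ.
From mathcomp Require Import all_classical all_reals all_analysis.
Set Implicit Arguments. Unset Strict Implicit. Unset Printing Implicit Defensive.
Import Order.TTheory GRing.Theory Num.Theory.
Import numFieldNormedType.Exports.
Local Open Scope classical_set_scope.
Local Open Scope ring_scope.

(** Two subsets of space are compared by [equiv_rel F]: a homeomorphism of space with bounded
    support, fixing [F] pointwise, carries one onto the other. By the Alexander trick such a
    homeomorphism is isotopic to the identity on the sphere ([bounded_homeo_isotopic]), so
    equivalent links are isotopic. For tangles over the unit square, [A =~ B] fixes everything that
    does not lie over the open square.

    Geometry to tangles. Every binary tree receives a tangle [tree_tangle]: a leaf gives two
    horizontal arcs, a vertex with subtrees l and r gives hook(l) + r, where hook(X) puts a negative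
    crossing to the right of X and then a positive crossing on top. The link of T is the closure of
    its tree tangle that joins NW to SW and NE to SE ([tree_link_equiv]). To see this, the right
    vine in the lower half-plane is isotoped into a row along the x-axis, with one [cell] under each
    leaf and one [gap] between consecutive leaves ([vine_equiv], [lower_equiv]), and the tree in the
    upper half-plane into vertical lines and horizontal bridges ([upper_equiv]). A subtree, together
    with the row below its leaves, then occupies a zone that it leaves through four ends, and
    induction on the tree ([leaf_step], [node_step], [tree_form_equiv]) replaces its contents by a
    box with the tree tangle.

    Algebra of tangles. Write c for the positive crossing. Since a negative crossing cancels c,
    hook(X + c) is the vertical sum of X and c ([hook_add]), and hook(hook(X + c)) is X turned by a
    half turn about the diagonal ([hook_hook]). The latter is the key identity [vsum_rotate]: a half
    turn of a small ball around X twists the wires leaving it, and the twisted wires amount to three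
    crossings. A tree tangle is a sum along the right spine of the tree, so grafting trees at the
    right-most leaf adds tangles ([tree_graft]), and c itself is a hook ([hook_tree1]).

    For a weighted tree t with positive weights, two binary trees are built together ([trees_ofP]):
    the first has tangle τ(t), the hook of the second is ρ(τ(t)). The first uses the second trees of
    the children and copies of c, which suffice because the weight of the root is positive. The
    second uses the first trees of the children: two hooks turn each τ(t_i) into the mirror image of
    ρ(τ(t_i)), two more hooks turn the sum of these into ρ of the sum of the ρ(τ(t_i)), and the w
    crossings follow one at a time ([hook_iter]). Finally, a half turn of the whole link makes the
    closure of τ(t) the side closure of the rotated tangle ([closure_equiv]), and the rotated tangle
    is again a tree tangle ([tree_tangle_surj]).

    The isotopies rest on three constructions: the triangle move ([triangle_move]), moving a box
    joined by straight wires to a surrounding rectangle ([relocation]), and a half turn of a ball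
    ([twist_homeo]). Concrete identities of tangles are proved by scripts of such moves on pictures
    with rational coordinates, whose side conditions are decided by evaluation ([script_equiv]). *)

(** * Isotopies of the sphere from homeomorphisms with bounded support *)

Section Topology.
Context {R : realType}.
Notation sp := (R * R * R)%type.
Implicit Types (h g : sp -> sp) (A B F K : set sp).

Lemma norm3 (p : sp) : `|p| = Num.max (Num.max `|p.1.1| `|p.1.2|) `|p.2|.
Proof. by case: p => -[x y] z; rewrite !prod_normE. Qed.

Lemma norm3_le (p : sp) (M : R) :
  (`|p| <= M) = [&& `|p.1.1| <= M, `|p.1.2| <= M & `|p.2| <= M].
Proof. by rewrite norm3 !ge_max andbA. Qed.

Lemma compact_ball3 (M : R) : compact [set p : sp | `|p| <= M].
Proof.
have -> : [set p : sp | `|p| <= M] = setX (setX `[- M, M] `[- M, M]) `[- M, M].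
  apply/seteqP; split=> p /=; rewrite norm3_le !in_itv /= -!ler_norml.
    by case/and3P.
  by case=> -[-> ->] ->.
by do 2?apply: compact_setX; exact: segment_compact.
Qed.

Lemma hausdorff3 : hausdorff_space sp.
Proof. exact: norm_hausdorff. Qed.

Lemma locally_compact3 : locally_compact [set: sp].
Proof.
move=> p _; rewrite withinET.
exists [set q : sp | `|q| <= `|p| + 1]; last first.
  split; first exact: compact_ball3.
  exact: compact_closed hausdorff3 (@compact_ball3 _).
apply/nbhs_ballP; exists 1 => //= q; rewrite -ball_normE /= => pq.
have -> : q = p - (p - q) by rewrite opprB addrC subrK.
by rewrite (le_trans (ler_normB _ _))// lerD2l ltW.
Qed.

Lemma closed_ball3 (M : R) : closed [set p : sp | `|p| <= M].
Proof. exact: compact_closed hausdorff3 (@compact_ball3 _). Qed.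

Definition extend h : sphere3 R -> sphere3 R := omap h.

Lemma sphere_hausdorff : hausdorff_space (sphere3 R).
Proof.
exact: one_point_compactification_hausdorff locally_compact3 hausdorff3.
Qed.

(** Closed subsets of the sphere are compact, so their images under [f] are compact, hence closed
    because the sphere is Hausdorff; this is continuity of [g]. *)
Lemma sphere_bijection_homeomorphism (f g : sphere3 R -> sphere3 R) :
  continuous f -> cancel f g -> cancel g f -> homeomorphism f.
Proof.
move=> cf fK gK; split => //; exists g => //; apply/continuous_closedP => C cC.
have -> : g @^-1` C = f @` C.
  apply/seteqP; split=> [x Cgx|_ [x Cx <-]] /=; last by rewrite fK.
  by exists (g x).
apply: compact_closed; first exact: sphere_hausdorff.
apply: continuous_compact; first exact: continuous_subspaceT.
apply: (subclosed_compact _ (@one_point_compactification_compact sp)) => //.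
Qed.

Definition supported h (M : R) := forall p, M < `|p| -> h p = p.

(** At infinity: outside the ball of radius [M] the map is the identity, so the complement of a
    compact set together with that ball goes into the complement of the compact set. *)
Lemma continuous_extend h M : continuous h -> supported h M ->
  continuous (extend h).
Proof.
move=> ch sh [p|] /=.
  move=> U /= Up; have := ch p; move=> /(_ (Some @^-1` U)); exact.
move=> U /= [C [cC clC] CU].
exists (C `|` [set q : sp | `|q| <= M]).
  split; first by apply: compactU => //; exact: compact_ball3.
  by apply: closedU => //; exact: closed_ball3.
move=> [q|_] /=; last by apply: CU; right.
case=> [[r /not_orP[Cr /negP]]|//]; rewrite -ltNge => Mr [<-].
by rewrite sh//; apply: CU; left; exists r.
Qed.

(** Alexander trick: [h] shrinks to the identity through [s |-> s h (p / s)]. *)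
Definition alexander h (s : R) (p : sp) : sp :=
  if 0 < s then s *: h (s^-1 *: p) else p.

(** The inverse is only required to exist as a map; its continuity comes from compactness of the
    sphere, in [bounded_homeo_inv]. *)
Definition bounded_homeo F h :=
  [/\ continuous h, exists2 g, cancel h g & cancel g h,
      exists M, supported h M & forall p, F p -> h p = p].

Lemma supported_mono h (M N : R) : M <= N -> supported h M -> supported h N.
Proof. by move=> MN sh p Np; apply: sh; exact: le_lt_trans Np. Qed.

Lemma alexander_supported h M s : 0 <= M -> s <= 1 -> supported h M ->
  supported (alexander h s) M.
Proof.
move=> M0 s1 sh p Mp; rewrite /alexander; case: ifPn => // s0.
have e : s *: (s^-1 *: p) = p by rewrite scalerA divff ?gt_eqF// scale1r.
rewrite sh// normrZ normfV gtr0_norm// (lt_le_trans Mp)// ler_peMl//.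
by rewrite invf_ge1.
Qed.

Lemma alexander_cancel h g s : cancel h g ->
  cancel (alexander h s) (alexander g s).
Proof.
move=> hK p; rewrite /alexander; have [s0|//] := boolP (0 < s).
rewrite (scalerA s^-1) mulVf ?gt_eqF// scale1r hK.
by rewrite scalerA divff ?gt_eqF// scale1r.
Qed.

(** The displacement of [h] is bounded by compactness, and shrinking multiplies it by [s]. This is
    what makes the family continuous at time 0. *)
Lemma alexander_dist h M : continuous h ->
  supported h M -> exists2 C, 0 < C & forall s, 0 <= s -> forall p,
    `|alexander h s p - p| <= s * C.
Proof.
move=> ch sh.
have /compact_bounded[C [_ hC]] : compact ((fun p => h p - p) @` [set p : sp | `|p| <= M]).
  apply: continuous_compact; last exact: compact_ball3.
  by apply: continuous_subspaceT => p; apply: cvgB; [exact: ch|].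
exists (`|C| + 1); first by rewrite ltr_wpDl.
move=> s s0 p; have bnd q : `|h q - q| <= `|C| + 1.
  case: (lerP `|q| M) => [qM|/sh ->]; last by rewrite subrr normr0 addr_ge0.
  apply: hC; last by exists q.
  by rewrite (le_lt_trans (ler_norm _))// ltrDl.
rewrite /alexander; case: ifPn => [sp0|]; last first.
  by rewrite subrr normr0 mulr_ge0// addr_ge0.
have e : s *: (s^-1 *: p) = p by rewrite scalerA divff ?gt_eqF// scale1r.
by rewrite -[X in _ - X]e -scalerBr normrZ gtr0_norm// ler_wpM2l.
Qed.

(** Capping the time at 1 keeps all supports in one ball, so the family is continuous on the whole
    line of times. At positive times it is a composition of continuous maps; at times at most 0 it
    is squeezed to the identity by [alexander_dist]. *)
Lemma alexander_continuous h M : continuous h -> supported h M ->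
  continuous (fun p : R * sp => alexander h (Num.min p.1 1) p.2).
Proof.
move=> ch sh [s p]; have [C C0 hC] := alexander_dist ch sh.
suff: (fun q : R * sp => alexander h (Num.min q.1 1) q.2) @ (s, p) -->
  alexander h (Num.min s 1) p by [].
have cmin : (fun q : R * sp => Num.min q.1 1) @ (s, p) --> Num.min s 1.
  by apply: continuous_min; [exact: cvg_fst|exact: cvg_cst].
have [s0|s0] := ltP 0 s.
  have m0 : 0 < Num.min s 1 by rewrite lt_min s0 ltr01.
  rewrite [X in _ --> X](_ : _ = Num.min s 1 *: h ((Num.min s 1)^-1 *: p)); last first.
    by rewrite /alexander m0.
  apply: (@cvg_trans _ ((fun q : R * sp =>
      Num.min q.1 1 *: h ((Num.min q.1 1)^-1 *: q.2)) @ (s, p))).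
    apply: near_eq_cvg; near=> q; rewrite /alexander ifT//.
    near: q; exact: (cvgr_gt _ cmin).
  have cinv : (fun q : R * sp => (Num.min q.1 1)^-1 *: q.2) @ (s, p) -->
      (Num.min s 1)^-1 *: p.
    have c1 : (fun q : R * sp => (Num.min q.1 1)^-1) @ (s, p) --> (Num.min s 1)^-1.
      by apply: cvgV cmin; rewrite gt_eqF.
    exact: cvgZ c1 cvg_snd.
  apply: cvgZ cmin _.
  exact: continuous_cvg (ch _) cinv.
rewrite [X in _ --> X](_ : _ = p); last first.
  by rewrite /alexander ifF//; apply/negbTE; rewrite -leNgt ge_min s0.
have -> : (fun q : R * sp => alexander h (Num.min q.1 1) q.2) =
    (fun q => (alexander h (Num.min q.1 1) q.2 - q.2) + q.2).
  by apply/funext => q; rewrite subrK.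
rewrite -[X in _ --> X]add0r; apply: cvgD; last exact: cvg_snd.
apply/norm_cvg0P.
have cmax : (fun q : R * sp => Num.max 0 (Num.min q.1 1) * C) @ (s, p) --> (0 : R).
  have e : 0 = Num.max 0 (Num.min s 1) * C.
    by rewrite (_ : Num.max _ _ = 0) ?mul0r//; apply/max_idPl; rewrite ge_min s0.
  rewrite [X in _ --> X]e.
  apply: cvgM; last exact: cvg_cst.
  have := @continuous_max R (R * sp)%type (fun=> 0) (fun q => Num.min q.1 1) (s, p) (cvg_cst _) cmin.
  exact.
apply: (squeeze_cvgr _ _ cmax); last exact: cvg_cst.
near=> q; rewrite normr_ge0 /=.
have [m0|m0] := leP 0 (Num.min q.1 1); first exact: hC.
by rewrite /alexander ifF ?subrr ?normr0 ?mul0r//; apply/negbTE; rewrite -leNgt ltW.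
Unshelve. all: by end_near. Qed.

Lemma bounded_homeo_isotopic F h K : bounded_homeo F h -> isotopic K (h @` K).
Proof.
move=> [ch [g hK gK] [M0 sM0] _].
pose M := Num.max 0 M0.
have sM : supported h M by apply: supported_mono sM0; rewrite le_max lexx orbT.
have M_ge0 : 0 <= M by rewrite le_max lexx.
have smin (s : R) : Num.min s 1 <= 1 by rewrite ge_min lexx orbT.
have cG := alexander_continuous ch sM.
pose H (s : R) : sphere3 R -> sphere3 R := extend (alexander h (Num.min s 1)).
have ca s : continuous (alexander h (Num.min s 1)).
  move=> p U /= /(cG (s, p)) [[A B] /= [sA pB] AB]; apply: filterS pB => q Bq.
  by apply: (AB (s, q)); split => //=; exact: nbhs_singleton sA.
exists H; last first.
  rewrite /H minxx; apply/seteqP; split=> _ [_ [p Kp <-] <-] /=.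
    exists (h p); first by exists p.
    by rewrite /alexander ltr01 invr1 !scale1r.
  exists (Some p); first by exists p.
  by rewrite /= /alexander ltr01 invr1 !scale1r.
split.
- apply: continuous_subspaceT => -[s [p|]].
    move=> U /= /(cG (s, p)) [[A B] /= [sA pB] AB].
    exists (A, Some @` B) => /=.
      by split=> //; exact: one_point_compactification_some_nbhs.
    move=> [s' x] /= [As' [q Bq <-]] /=.
    exact: (AB (s', q)).
  move=> U /= [C [cC clC] CU].
  exists (setT, Some @` (~` (C `|` [set q : sp | `|q| <= M])) `|` [set None]).
    split; first exact: filterT.
    exists (C `|` [set q : sp | `|q| <= M]) => //.
    split; first by apply: compactU => //; exact: compact_ball3.
    by apply: closedU => //; exact: closed_ball3.
  move=> [s' [q|]] [_] /=; last by move=> _; apply: CU; right.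
  case=> [[r /not_orP[Cr /negP]]|//]; rewrite -ltNge => Mr [<-].
  rewrite (alexander_supported (M := M))//; apply: CU; left; by exists r.
- move=> s _; apply: (@sphere_bijection_homeomorphism _
    (extend (alexander g (Num.min s 1)))).
  + apply: continuous_extend; first exact: ca.
    exact: alexander_supported M_ge0 (smin s) sM.
  + by case=> //= p; rewrite alexander_cancel.
  + by case=> //= p; rewrite alexander_cancel.
- by case=> //= p; rewrite /alexander ifF//; apply/negbTE; rewrite -leNgt ge_min lexx.
Qed.

Lemma bounded_homeo_inv F h : bounded_homeo F h ->
  exists g, [/\ bounded_homeo F g, cancel h g & cancel g h].
Proof.
move=> [ch [g hK gK] [M sM] hF]; exists g; split=> //; split.
- have [_ [G cG [GK _]]] : homeomorphism (extend h).
    apply: (@sphere_bijection_homeomorphism _ (extend g)).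
    + exact: continuous_extend sM.
    + by case=> //= p; rewrite hK.
    + by case=> //= p; rewrite gK.
  have eG x : G (Some x) = Some (g x) by rewrite -[RHS]GK /= gK.
  move=> p U /= Up.
  have : nbhs (G (Some p)) (Some @` U : set (sphere3 R)).
    by rewrite eG; exact: (@one_point_compactification_some_nbhs sp).
  move=> /(cG (Some p)) cGp.
  have : nbhs p [set q : sp | (Some @` U : set (sphere3 R)) (G (Some q))] := cGp.
  apply: filterS => q /=.
  by rewrite eG => -[r Ur [<-]].
- by exists h.
- by exists M => p Mp; rewrite -[in LHS](sM p Mp) hK.
- by move=> p Fp; rewrite -[in LHS](hF p Fp) hK.
Qed.

Lemma bounded_homeo_comp F h1 h2 : bounded_homeo F h1 -> bounded_homeo F h2 ->
  bounded_homeo F (h2 \o h1).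
Proof.
move=> [c1 [g1 hK1 gK1] [M1 s1] f1] [c2 [g2 hK2 gK2] [M2 s2] f2]; split.
- by move=> p; apply: continuous_comp; [exact: c1|exact: c2].
- exists (g1 \o g2); exact: can_comp.
- exists (Num.max M1 M2) => p; rewrite gt_max => /andP[M1p M2p] /=.
  by rewrite s1// s2.
- by move=> p Fp /=; rewrite f1// f2.
Qed.

(** Equivalence under homeomorphisms of space with bounded support that fix
    [F] pointwise. *)
Definition equiv_rel F A B := exists2 h, bounded_homeo F h & h @` A = B.

Lemma equiv_refl F A : equiv_rel F A A.
Proof.
exists id; last exact: image_id.
split; [by move=> p; exact: cvg_id|by exists id|by exists 0|by []].
Qed.

Lemma equiv_sym F A B : equiv_rel F A B -> equiv_rel F B A.
Proof.
move=> [h hh <-]; have [g [hg hK gK]] := bounded_homeo_inv hh.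
exists g => //; rewrite image_comp (_ : g \o h = id) ?image_id//.
exact/funext.
Qed.

Lemma equiv_trans F A B C : equiv_rel F A B -> equiv_rel F B C -> equiv_rel F A C.
Proof.
move=> [h hh <-] [g hg <-]; exists (g \o h); first exact: bounded_homeo_comp.
by rewrite image_comp.
Qed.

Lemma equiv_mono F G A B : G `<=` F -> equiv_rel F A B -> equiv_rel G A B.
Proof.
move=> GF [h [ch hK hs hF] <-]; exists h => //; split=> // p Gp.
by apply: hF; exact: GF.
Qed.

Lemma equiv_isotopic F K L : equiv_rel F K L -> isotopic K L.
Proof. by move=> [h hh <-]; exact: bounded_homeo_isotopic hh. Qed.

(** [K] may be added to both sides once it is fixed. *)
Lemma equiv_frame F A B K : equiv_rel (F `|` K) A B ->
  equiv_rel F (K `|` A) (K `|` B).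
Proof.
move=> [h [ch hK hs hF] <-]; exists h.
  by split=> // p Fp; apply: hF; left.
rewrite image_setU; congr (_ `|` _); apply/seteqP; split=> [_ [p Kp <-]|p Kp].
  by rewrite hF//; right.
by exists p => //; apply: hF; right.
Qed.

(** Changes of coordinates [h] may move points arbitrarily far: the conjugate of a homeomorphism
    with bounded support again has bounded support, because [h] maps a ball to a bounded set. Affine
    and piecewise linear coordinates are used through this lemma. *)
Lemma equiv_conj F G A B h g : continuous h -> continuous g ->
  cancel h g -> cancel g h -> (forall p, G (h p) -> F p) ->
  equiv_rel F A B -> equiv_rel G (h @` A) (h @` B).
Proof.
move=> ch cg hK gK GF [f [cf [f' fK f'K] [M sM] fF] <-].
exists (h \o f \o g); last first.
  rewrite !image_comp (_ : h \o f \o g \o h = h \o f)//.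
  by apply/funext => p /=; rewrite hK.
split.
- move=> p; apply: (@continuous_comp _ _ _ g (h \o f)); first exact: cg.
  by apply: continuous_comp; [exact: cf|exact: ch].
- exists (h \o f' \o g) => p /=.
    by rewrite hK fK gK.
  by rewrite hK f'K gK.
- have /compact_bounded[N [_ hN]] : compact (h @` [set p : sp | `|p| <= M]).
    apply: continuous_compact; last exact: compact_ball3.
    exact: continuous_subspaceT.
  exists (`|N| + 1) => p Np /=; rewrite sM ?gK// ltNge; apply/negP => gpM.
  have NN : N < `|N| + 1 by rewrite (le_lt_trans (ler_norm _))// ltrDl.
  have /(hN _ NN) /= : (h @` [set p : sp | `|p| <= M]) p by exists (g p); rewrite ?gK.
  by rewrite leNgt Np.
- by move=> p Gp /=; rewrite fF ?gK//; apply: GF; rewrite gK.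
Qed.
End Topology.

(** * Continuity of maps given by formulas *)

Section Continuity.
Context {R : realType} {T : topologicalType}.
Implicit Types f g : T -> R.

Lemma contD f g : continuous f -> continuous g -> continuous (fun x => f x + g x).
Proof. by move=> cf cg x; apply: cvgD; [exact: cf|exact: cg]. Qed.

Lemma contN f : continuous f -> continuous (fun x => - f x).
Proof. by move=> cf x; apply: cvgN; exact: cf. Qed.

Lemma contB f g : continuous f -> continuous g -> continuous (fun x => f x - g x).
Proof. by move=> cf cg x; apply: cvgB; [exact: cf|exact: cg]. Qed.

Lemma contM f g : continuous f -> continuous g -> continuous (fun x => f x * g x).
Proof. by move=> cf cg x; apply: cvgM; [exact: cf|exact: cg]. Qed.

Lemma cont_max f g : continuous f -> continuous g ->
  continuous (fun x => Num.max (f x) (g x)).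
Proof. by move=> cf cg x; exact: (@continuous_max _ _ f g x (cf x) (cg x)). Qed.

Lemma cont_min f g : continuous f -> continuous g ->
  continuous (fun x => Num.min (f x) (g x)).
Proof. by move=> cf cg x; exact: (@continuous_min _ _ f g x (cf x) (cg x)). Qed.

Lemma cont_norm f : continuous f -> continuous (fun x => `|f x|).
Proof. by move=> cf x; apply: cvg_norm; exact: cf. Qed.

Lemma cont_cst (a : R) : continuous (fun _ : T => a).
Proof. by move=> x; exact: cvg_cst. Qed.

Lemma cont_mk3 f g (e : T -> R) : continuous f -> continuous g -> continuous e ->
  continuous (fun x => (f x, g x, e x)).
Proof.
move=> cf cg ce x; have := cvg_pair (cvg_pair (cf x) (cg x)) (ce x); exact.
Qed.
End Continuity.

Section Coordinates.
Context {R : realType}.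
Notation sp := (R * R * R)%type.

Lemma cont_x : continuous (fun p : sp => p.1.1).
Proof. by move=> p; exact: (cvg_comp _ _ cvg_fst cvg_fst). Qed.
Lemma cont_y : continuous (fun p : sp => p.1.2).
Proof. by move=> p; exact: (cvg_comp _ _ cvg_fst cvg_snd). Qed.
Lemma cont_z : continuous (fun p : sp => p.2).
Proof. by move=> p; exact: cvg_snd. Qed.
End Coordinates.

Ltac cont :=
  lazymatch goal with
  | |- forall x, continuous_at x ?f =>
    lazymatch f with
    | fun _ => ?c => exact: cont_cst
    | fun p => fst (fst p) => exact: cont_x
    | fun p => snd (fst p) => exact: cont_y
    | fun p => snd p => exact: cont_z
    | fun p => (@?a p, @?b p, @?c p) => apply: (@cont_mk3 _ _ a b c); cont
    | fun p => (@?a p + @?b p)%R => apply: (@contD _ _ a b); cont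
    | fun p => (- @?a p)%R => apply: (@contN _ _ a); cont
    | fun p => (@?a p * @?b p)%R => apply: (@contM _ _ a b); cont
    | fun p => Num.max (@?a p) (@?b p) => apply: (@cont_max _ _ a b); cont
    | fun p => Num.min (@?a p) (@?b p) => apply: (@cont_min _ _ a b); cont
    | fun p => `|@?a p|%R => apply: (@cont_norm _ _ a); cont
    | fun p => p => move=> ?; exact: cvg_id
    | _ => try exact
    end
  | _ => idtac
  end.

(** * Vertical pushes and the move across a standard triangle *)

Section Push.
Context {R : realType}.
Notation sp := (R * R * R)%type.
Implicit Types (A B F K : set sp) (p q r : sp).

(** On each line parallel to the y-axis the map is strictly increasing and far away the identity,
    hence a bijection by the intermediate value theorem. *)
Lemma push_homeo F (b : sp -> R) (M : R) : continuous b ->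
  (forall p, M < `|p| -> b p = 0) ->
  (forall x y y' z, y < y' -> y + b (x, y, z) < y' + b (x, y', z)) ->
  (forall p, F p -> b p = 0) ->
  bounded_homeo F (fun p => (p.1.1, p.1.2 + b p, p.2)).
Proof.
move=> cb bM bmono bF.
have ch : continuous (fun p : sp => (p.1.1, p.1.2 + b p, p.2)) by cont.
have surj p : exists q : sp, (q.1.1, q.1.2 + b q, q.2) = p.
  case: p => -[x v] z; pose N := Num.max `|M| `|v| + 1.
  have NM : `|M| < N by rewrite /N ltr_pwDr// le_max lexx.
  have Nv : `|v| < N by rewrite /N ltr_pwDr// le_max lexx orbT.
  have N0 : 0 < N by rewrite (le_lt_trans _ NM).
  have bN y : `|y| = N -> b (x, y, z) = 0.
    move=> yN; apply: bM; rewrite (le_lt_trans (ler_norm _))// (lt_le_trans NM)//.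
    by rewrite norm3 /= yN !le_max lexx orbT.
  have cf : continuous (fun y => y + b (x, y, z)).
    apply: contD; first by move=> y; exact: cvg_id.
    move=> y; apply: (@continuous_comp _ _ _ (fun y => (x, y, z)) b); last exact: cb.
    by have := @cont_mk3 R R (fun=> x) id (fun=> z); apply;
      [exact: cont_cst|move=> ?; exact: cvg_id|exact: cont_cst].
  have [|||y _ yv] := @IVT R (fun y => y + b (x, y, z)) (- N) N v.
  - by lra.
  - exact: continuous_subspaceT.
  - rewrite !bN ?normrN ?gtr0_norm// !addr0.
    rewrite ge_min le_max; case/ltr_normlP: Nv => ? ?.
    by apply/andP; split; apply/orP; [left|right]; lra.
  - by exists (x, y, z); rewrite /= yv.
have [g gP] := choice surj.
split=> //.
- exists g => // -[[x y] z]; have := gP (x, y + b (x, y, z), z).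
  case: (g _) => -[x' y'] z' /= [ex e ez]; subst x' z'.
  case: (ltgtP y y') e => [yy e|yy e|-> //].
    by have := bmono x _ _ z yy; rewrite e ltxx.
  by have := bmono x _ _ z yy; rewrite e ltxx.
- by exists M => -[[x y] z] Mp; rewrite bM//= addr0.
- by move=> [[x y] z] Fp; rewrite bF//= addr0.
Qed.

Lemma clamp_shift (a a' c c' d : R) : 0 <= d -> a <= a' + d -> c <= c' + d ->
  Num.max 0 (Num.min a c) <= Num.max 0 (Num.min a' c') + d.
Proof.
by rewrite !maxEle !minEle; do 4?[case: ifPn]; rewrite -?ltNge => *; lra.
Qed.

Lemma lipschitz_continuous (f : R -> R) (C : R) : 0 < C ->
  (forall x y, f x <= f y + C * `|x - y|) -> continuous f.
Proof.
move=> C0 fC x; apply/cvgrPdist_lt => e e0; near=> y.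
have xy : C * `|x - y| < e.
  rewrite mulrC -ltr_pdivlMr//; near: y.
  by apply: cvgr_dist_lt; [exact: cvg_id|exact: divr_gt0].
rewrite ltr_norml; have := fC x y; have := fC y x; rewrite (distrC y).
move: xy; set d := C * _; move: (f x) (f y) => u v; lra.
Unshelve. all: by end_near. Qed.

(** The tent over the base [0, 1] of the standard triangle. *)
Let tent (x : R) : R := Num.max 0 (Num.min (2 * x) (2 - 2 * x)).

Let tent_ge0 x : 0 <= tent x. Proof. by rewrite le_max lexx. Qed.
Let tent_le1 x : tent x <= 1.
Proof. by rewrite ge_max ler01 ge_min; case: (lerP (2 * x) 1) => //= ?; lra. Qed.

Let cont_tent : continuous tent.
Proof. by rewrite /tent; cont. Qed.

Let tent_lip x y : tent x <= tent y + 2 * `|x - y|.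
Proof.
rewrite /tent; have := ler_norm (x - y); have := lerNnormlW (lexx `|x - y|).
move: `|x - y| => n; rewrite !maxEle !minEle.
by do 4?[case: ifPn]; rewrite -?ltNge => *; lra.
Qed.

(** The distance in the maximum norm from [k] to the segment between [(x, 0, 0)] and
    [(x, tent x, 0)]. *)
Let gap (x : R) (k : sp) : R :=
  Num.max (Num.max `|k.1.1 - x| `|k.2|) (Num.max (- k.1.2) (k.1.2 - tent x)).

Let gap_ge0 x k : 0 <= gap x k.
Proof. by rewrite !le_max normr_ge0. Qed.

Let gap_lip x y k : gap x k <= gap y k + 2 * `|x - y|.
Proof.
rewrite /gap !ge_max -!andbA; set m := Num.max _ _.
have m1 : `|k.1.1 - y| <= m by rewrite !le_max lexx.
have m2 : `|k.2| <= m by rewrite !le_max lexx orbT.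
have m3 : - k.1.2 <= m by rewrite !le_max lexx !orbT.
have m4 : k.1.2 - tent y <= m by rewrite !le_max lexx !orbT.
have n0 := normr_ge0 (x - y).
have t := tent_lip y x; rewrite distrC in t.
apply/and4P; split; [|lra|lra|lra].
have -> : k.1.1 - x = (k.1.1 - y) - (x - y) by lra.
by rewrite (le_trans (ler_normB _ _))//; lra.
Qed.

(** Space is pushed in the y-direction, by [tent x] on the base and by less away from it. The part
    that moves stays within [eta x] of the triangle, and [eta x] is at most half the distance
    [width x] from [K], so that [K] does not move. That [K] contains the origin makes the infimum in
    [width] one of a nonempty set. *)
Lemma std_delta K : closed K -> K (0, 0, 0) -> 
  (forall x y, 0 < x < 1 -> 0 <= y <= tent x -> ~ K (x, y, 0)) ->
  equiv_rel K [set (x, 0, 0) | x in `[0, 1]] [set (x, tent x, 0) | x in `[0, 1]].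
Proof.
move=> clK K0 Kdisj.
pose width x := inf (gap x @` K).
have inf_gap x : has_inf (gap x @` K).
  split; first by exists (gap x (0, 0, 0)), (0, 0, 0).
  by exists 0 => _ [k _ <-].
have width_ge0 x : 0 <= width x.
  by apply: lb_le_inf; [case: (inf_gap x)|move=> _ [k _ <-]].
have width_le x k : K k -> width x <= gap x k.
  by move=> Kk; apply: ge_inf; [case: (inf_gap x)|exists k].
have cont_width : continuous width.
  apply: (@lipschitz_continuous _ 2) => // x y.
  rewrite -lerBlDr; apply: lb_le_inf; first by case: (inf_gap y).
  move=> _ [k Kk <-]; rewrite lerBlDr (le_trans (width_le x k Kk))//.
(* On a bounded part of [K] the gaps form a closed set without 0; on the rest of [K] they are at
   least 1. *)
have width_gt0 x : 0 < x < 1 -> 0 < width x.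
  move=> x01; pose M := `|x| + 3.
  have cS : compact (gap x @` (K `&` [set k | `|k| <= M])).
    apply: continuous_compact.
      by apply: continuous_subspaceT; rewrite /gap; cont.
    apply: (subclosed_compact _ (@compact_ball3 R M)); last by move=> k [].
    exact: closedI clK (@closed_ball3 R M).
  have nS : (~` (gap x @` (K `&` [set k | `|k| <= M]))) 0.
    move=> [[[kx ky] kz] [Kk _]] /eqP; rewrite eq_le gap_ge0 andbT !ge_max /= -!andbA.
    rewrite !normr_le0 subr_eq0 subr_le0 oppr_le0 => /and4P[/eqP ex /eqP ez y0 yt].
    by apply: (Kdisj x ky) => //; [rewrite y0|rewrite -ex -ez].
  have := compact_closed (@norm_hausdorff _ _) cS => /closed_openC.
  rewrite openE => /(_ 0 nS) /nbhs_ballP[e /= e0 eS].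
  have em : 0 < Num.min e 1 by rewrite lt_min e0 ltr01.
  apply: (lt_le_trans em); apply: lb_le_inf; first by case: (inf_gap x).
  move=> _ [k Kk <-]; rewrite ge_min.
  have [kM|kM] := leP `|k| M.
    apply/orP; left; rewrite leNgt; apply/negP => ke.
    apply: (eS (gap x k)); last by exists k.
    by rewrite -ball_normE /= sub0r normrN ger0_norm.
  apply/orP; right; move: kM; rewrite norm3 !lt_max !le_max -orbA /M.
  have := tent_le1 x; have := normr_ge0 x; case: k Kk => -[kx ky] kz _ /=.
  move=> n0 t1 /or3P[kM|kM|kM]; apply/orP.
  - left; apply/orP; left; have := ler_normD (kx - x) x; rewrite subrK; lra.
  - right; move: kM; have [y0|y0] := leP 0 ky.
      by rewrite (ger0_norm y0) => kM; apply/orP; right; lra.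
    by rewrite (ltr0_norm y0) => kM; apply/orP; left; lra.
  - by left; apply/orP; right; lra.
pose eta x := Num.min 1 (width x / 2).
have cont_eta : continuous eta by apply: cont_min; [cont|apply: contM => //; cont].
have eta_ge0 x : 0 <= eta x by rewrite le_min ler01 divr_ge0.
have eta_gt0 x : 0 < tent x -> 0 < eta x.
  rewrite /tent lt_max ltxx /= lt_min => /andP[? ?].
  by rewrite lt_min ltr01 divr_gt0// width_gt0//; apply/andP; split; lra.
(* [lam] cuts off in the z-direction. [prof] is 1 on the base and falls linearly to 0 at [- eta]
   below and at [tent + eta] above; the second slope makes [b] decrease at a rate below
   [tent / (tent + eta)], so the push is increasing. Where [tent] vanishes so does [b], whatever the
   quotients are. *)
pose lam (p : sp) := Num.max 0 (1 - `|p.2| / eta p.1.1).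
pose prof (p : sp) := Num.max 0 (Num.min (1 + p.1.2 / eta p.1.1)
  (1 - p.1.2 / (tent p.1.1 + eta p.1.1))).
pose b p := tent p.1.1 * (lam p * prof p).
have lam_ge0 p : 0 <= lam p by rewrite le_max lexx.
have lam_le1 p : lam p <= 1.
  by rewrite ge_max ler01 gerBl divr_ge0.
have prof_ge0 p : 0 <= prof p by rewrite le_max lexx.
have prof_le1 p : prof p <= 1.
  rewrite ge_max ler01 ge_min gerBl /=; have [y0|y0] := leP 0 p.1.2.
    by rewrite divr_ge0 ?orbT// addr_ge0.
  by rewrite -subr_ge0 opprD addrA subrr sub0r -mulNr divr_ge0// oppr_ge0 ltW.
have b_ge0 p : 0 <= b p by rewrite !mulr_ge0.
have b_le p : b p <= tent p.1.1.
  by rewrite ler_piMr// mulr_ile1.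
have cb : continuous b.
  have ctx : continuous (fun p : sp => tent p.1.1).
    move=> q; apply: (@continuous_comp _ _ _ (fun p : sp => p.1.1) tent q).
      exact: cont_x.
    exact: cont_tent.
  have cex : continuous (fun p : sp => eta p.1.1).
    move=> q; apply: (@continuous_comp _ _ _ (fun p : sp => p.1.1) eta q).
      exact: cont_x.
    exact: cont_eta.
  move=> p; have ct := ctx p; have ce := cex p.
  have [t0|t0] := leP (tent p.1.1) 0.
    have bp : b p = 0.
      by apply/eqP; rewrite eq_le b_ge0 (le_trans (b_le p)).
    have e0 : tent p.1.1 = 0 by apply/eqP; rewrite eq_le t0 tent_ge0.
    suff : b @ p --> (0 : R) by rewrite -[X in _ --> X]bp.
    apply: (squeeze_cvgr _ (cvg_cst 0)); last by rewrite -[X in _ --> X]e0; exact: ct.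
    by near=> q; rewrite b_ge0 b_le.
  have e0 : eta p.1.1 != 0 by rewrite gt_eqF// eta_gt0.
  have te0 : tent p.1.1 + eta p.1.1 != 0 by rewrite gt_eqF// addr_gt0// eta_gt0.
  have cV : (fun p : sp => (eta p.1.1)^-1) @ p --> (eta p.1.1)^-1 by apply: cvgV ce.
  have cVt : (fun p : sp => (tent p.1.1 + eta p.1.1)^-1) @ p -->
      (tent p.1.1 + eta p.1.1)^-1 by apply: cvgV => //; apply: cvgD.
  have cy := @cont_y R p.
  apply: cvgM; first exact: ct.
  apply: cvgM.
    apply: (@continuous_max _ _ (fun=> 0) (fun p : sp => 1 - `|p.2| / eta p.1.1) p).
      exact: cvg_cst.
    apply: cvgB; first exact: cvg_cst.
    by apply: cvgM cV; apply: cvg_norm; exact: (@cont_z R p).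
  apply: (@continuous_max _ _ (fun=> 0) (fun p : sp => Num.min (1 + p.1.2 / eta p.1.1)
    (1 - p.1.2 / (tent p.1.1 + eta p.1.1))) p).
    exact: cvg_cst.
  apply: (@continuous_min _ _ (fun p : sp => 1 + p.1.2 / eta p.1.1)
    (fun p : sp => 1 - p.1.2 / (tent p.1.1 + eta p.1.1)) p).
    by apply: cvgD; [exact: cvg_cst|exact: cvgM].
  by apply: cvgB; [exact: cvg_cst|exact: cvgM].
have bE p : b p != 0 -> [/\ 0 < tent p.1.1, `|p.2| < eta p.1.1, - eta p.1.1 < p.1.2 &
    p.1.2 < tent p.1.1 + eta p.1.1].
  rewrite /b !mulf_eq0 !negb_or => /and3P[t0 l0 f0].
  have tp : 0 < tent p.1.1 by rewrite lt_neqAle eq_sym t0 tent_ge0.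
  have ep := eta_gt0 _ tp; have tep : 0 < tent p.1.1 + eta p.1.1 by exact: addr_gt0.
  have : 0 < lam p by rewrite lt_neqAle eq_sym l0 lam_ge0.
  rewrite lt_max ltxx /= subr_gt0 ltr_pdivrMr// mul1r => zl.
  have : 0 < prof p by rewrite lt_neqAle eq_sym f0 prof_ge0.
  rewrite lt_max ltxx /= lt_min subr_gt0 ltr_pdivrMr// mul1r => /andP[yl ->].
  split=> //; move: yl; rewrite -(pmulr_lgt0 _ ep) mulrDl mul1r divfK ?gt_eqF//.
  by rewrite addrC -subr_lt0 => ?; lra.
exists (fun p => (p.1.1, p.1.2 + b p, p.2)); last first.
  have bbase x : b (x, 0, 0) = tent x.
    rewrite /b /lam /prof /= normr0 !mul0r subr0 addr0 minxx.
    by rewrite (_ : Num.max 0 1 = 1) ?mulr1//; apply/max_idPr.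
  by apply/seteqP; split=> [_ [_ [x x01 <-] <-]|_ [x x01 <-]] /=;
    [exists x|exists (x, 0, 0)]; rewrite ?bbase ?add0r//=; exists x.
apply: (@push_homeo _ _ 3) => //.
- move=> p; apply: contraTeq => /bE[t0 zl yl yu]; rewrite -leNgt norm3_le.
  have e1 : eta p.1.1 <= 1 by rewrite ge_min lexx.
  have t1 := tent_le1 p.1.1.
  move: t0; rewrite lt_max ltxx /= lt_min => /andP[? ?].
  by rewrite !ler_norml; move: zl; rewrite ltr_norml => /andP[? ?]; apply/and3P; split; lra.
- move=> x y y' z yy; rewrite /b /=.
  have [t0|t0] := leP (tent x) 0.
    by have -> : tent x = 0 by [apply/eqP; rewrite eq_le t0 tent_ge0]; rewrite !mul0r !addr0.
  have ep := eta_gt0 _ t0; have tep : 0 < tent x + eta x by exact: addr_gt0.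
  set l := lam _; set f := prof _; set f' := prof _.
  have ll : lam (x, y', z) = l by [].
  rewrite ll.
  have ff : f - (y' - y) / (tent x + eta x) <= f'.
    rewrite lerBlDr; have d0 : 0 <= (y' - y) / (tent x + eta x).
      by apply: divr_ge0; [rewrite subr_ge0|]; exact: ltW.
    apply: clamp_shift => //; last by rewrite /= !mulrBl; lra.
    by rewrite /= -addrA lerD2l ler_wpDr// ler_pM2r ?invr_gt0// ltW.
  have l0 := lam_ge0 (x, y, z); have l1 := lam_le1 (x, y, z); rewrite -/l in l0 l1.
  have tl : tent x * l < tent x + eta x.
    by rewrite (le_lt_trans (ler_piMr (tent_ge0 _) l1))// ltrDl.
  have tl0 : 0 <= tent x * l by rewrite mulr_ge0.
  have : tent x * l * ((y' - y) / (tent x + eta x)) < y' - y.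
    by rewrite mulrCA -[ltRHS]mulr1 ltr_pM2l ?subr_gt0// ltr_pdivrMr// mul1r.
  have := ler_wpM2l tl0 ff; rewrite mulrBr !mulrA.
  move: (tent x * l * f) (tent x * l * f') => u v; lra.
- move=> p Kp; apply/eqP; apply: contraT => /bE[t0 zl yl yu].
  have := width_le p.1.1 p Kp; rewrite leNgt => /negP[].
  have ew : eta p.1.1 <= width p.1.1 / 2 by rewrite ge_min lexx orbT.
  have ep := eta_gt0 _ t0.
  by rewrite !gt_max subrr normr0; apply/andP; split; apply/andP; split; lra.
Unshelve. all: by end_near. Qed.
End Push.

(** * The triangle move in general position *)

Section Delta.
Context {R : realType}.
Notation sp := (R * R * R)%type.
Implicit Types (A B F K : set sp) (p q r : sp).

Lemma segmentP p q x : segment p q x <-> exists2 t, 0 <= t <= 1 &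
  x = ((1 - t) * p.1.1 + t * q.1.1, (1 - t) * p.1.2 + t * q.1.2,
       (1 - t) * p.2 + t * q.2).
Proof.
split=> [[t /= t01 <-]|[t t01 ->]].
  by exists t => //; move: t01; rewrite in_itv.
by exists t => //=; rewrite in_itv.
Qed.

Definition triangle p q r : set sp := [set x | exists a b c : R,
  [/\ [/\ 0 <= a, 0 <= b, 0 <= c & a + b + c = 1],
      x.1.1 = a * p.1.1 + b * q.1.1 + c * r.1.1,
      x.1.2 = a * p.1.2 + b * q.1.2 + c * r.1.2 &
      x.2 = a * p.2 + b * q.2 + c * r.2]].

Definition vsub p q : sp := (p.1.1 - q.1.1, p.1.2 - q.1.2, p.2 - q.2).
Definition dot p q : R := p.1.1 * q.1.1 + p.1.2 * q.1.2 + p.2 * q.2.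
Definition cross p q : sp :=
  (p.1.2 * q.2 - p.2 * q.1.2, p.2 * q.1.1 - p.1.1 * q.2,
   p.1.1 * q.1.2 - p.1.2 * q.1.1).

Definition lin3 p a b n (v : sp) : sp :=
  (p.1.1 + v.1.1 * a.1.1 + v.1.2 * b.1.1 + v.2 * n.1.1,
   p.1.2 + v.1.1 * a.1.2 + v.1.2 * b.1.2 + v.2 * n.1.2,
   p.2 + v.1.1 * a.2 + v.1.2 * b.2 + v.2 * n.2).

(** The inverse of [lin3] for [n = cross a b]: the reciprocal basis consists of [cross b n],
    [cross n a] and [n], each divided by [dot n n]. *)
Definition lin3_inv p a b (w : sp) : sp :=
  let n := cross a b in
  (dot (vsub w p) (cross b n) / dot n n, dot (vsub w p) (cross n a) / dot n n,
   dot (vsub w p) n / dot n n).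

Lemma cont_lin3 p a b n : continuous (lin3 p a b n).
Proof. by rewrite /lin3; cont. Qed.

Lemma cont_lin3_inv p a b : continuous (lin3_inv p a b).
Proof. by rewrite /lin3_inv /dot /vsub /=; cont. Qed.

Lemma dot_eq0 p : (dot p p == 0) = (p == 0).
Proof.
case: p => -[x y] z; rewrite /dot /= -!expr2 !paddr_eq0 ?addr_ge0 ?sqr_ge0//.
by rewrite !sqrf_eq0.
Qed.

Lemma lin3K p a b : cross a b != 0 ->
  cancel (lin3 p a b (cross a b)) (lin3_inv p a b).
Proof.
rewrite -dot_eq0 => D0 [[x y] z]; rewrite /lin3_inv.
set D := dot _ _ in D0 *.
have e u v : u = v * D -> u / D = v by move=> ->; rewrite mulfK.
by congr (_, _, _); apply: e; rewrite /D; case: p a b {D0 D} => -[? ?] ? [[? ?] ?] [[? ?] ?];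
  rewrite /dot /vsub /lin3 /cross /=; ring.
Qed.

Lemma lin3_invK p a b : cross a b != 0 ->
  cancel (lin3_inv p a b) (lin3 p a b (cross a b)).
Proof.
rewrite -dot_eq0 => D0 [[x y] z]; rewrite /lin3_inv /lin3 /=.
set D := dot (cross a b) _ in D0 *.
have e u v w s t s1 s2 s3 : u * s1 + v * s2 + w * s3 = (s - t) * D ->
    t + u / D * s1 + v / D * s2 + w / D * s3 = s.
  move=> h; rewrite -!addrA !(mulrAC _ D^-1) -!mulrDl addrA h mulfK//.
  by rewrite addrC subrK.
by congr (_, _, _); apply: e; rewrite /D; case: p a b {D0 D} => -[? ?] ? [[? ?] ?] [[? ?] ?];
  rewrite /dot /vsub /cross /=; ring.
Qed.

Lemma tent_left (t : R) : 0 <= t -> t <= 2^-1 ->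
  Num.max 0 (Num.min (2 * t) (2 - 2 * t)) = 2 * t.
Proof.
by rewrite minEle maxEle; do 2?[case: ifPn]; rewrite -?ltNge => *; lra.
Qed.

Lemma tent_right (t : R) : 2^-1 <= t -> t <= 1 ->
  Num.max 0 (Num.min (2 * t) (2 - 2 * t)) = 2 - 2 * t.
Proof.
by rewrite minEle maxEle; do 2?[case: ifPn]; rewrite -?ltNge => *; lra.
Qed.

Definition noncollinear p q r := cross (vsub q p) (vsub r p) != 0.

(** The elementary triangle move of piecewise linear topology. *)
Lemma triangle_move F K p q r : closed F -> closed K -> noncollinear p q r ->
  (forall x, triangle p q r x -> F x \/ K x -> x = p \/ x = q) ->
  equiv_rel F (K `|` segment p q) (K `|` (segment p r `|` segment r q)).
Proof.
move=> cF cK ncol dis.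
(* The standard triangle has apex (1/2, 1, 0), so its altitude must go to the median from the
   midpoint of [p q] to [r]. *)
pose a := vsub q p; pose b := vsub r ((p.1.1 + q.1.1) / 2, (p.1.2 + q.1.2) / 2, (p.2 + q.2) / 2).
have ncab : cross a b != 0.
  suff -> : cross a b = cross (vsub q p) (vsub r p) by [].
  by rewrite /a /b; case: (p) (q) (r) => -[? ?] ? [[? ?] ?] [[? ?] ?];
    rewrite /cross /vsub /=; congr (_, _, _); field.
pose L := lin3 p a b (cross a b); pose L' := lin3_inv p a b.
have LK : cancel L L' := lin3K p ncab; have LK' : cancel L' L := lin3_invK p ncab.
(* The point [p] is added since [std_delta] wants the origin, which corresponds to [p], in the fixed
   set. *)
pose G := F `|` K `|` [set p].
have LE x y : L (x, y, 0) =
   ((1 - x - y / 2) * p.1.1 + (x - y / 2) * q.1.1 + y * r.1.1,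
    (1 - x - y / 2) * p.1.2 + (x - y / 2) * q.1.2 + y * r.1.2,
    (1 - x - y / 2) * p.2 + (x - y / 2) * q.2 + y * r.2).
  rewrite /L /lin3 /a /b; case: (p) (q) (r) => -[? ?] ? [[? ?] ?] [[? ?] ?].
  by rewrite /vsub /=; congr (_, _, _); field.
have Lp : L (0, 0, 0) = p.
  by rewrite LE; case: (p) => -[? ?] ? /=; congr (_, _, _); ring.
have Lq : L (1, 0, 0) = q.
  by rewrite LE; case: (q) => -[? ?] ? /=; congr (_, _, _); ring.
have cG : closed G.
  apply: closedU; first exact: closedU.
  exact: (accessible_closed_set1 (hausdorff_accessible hausdorff3)).
have cLG : closed (L @^-1` G).
  apply: closed_comp => //; move=> ? _; exact: cont_lin3.
have tri x y : 0 < x < 1 -> 0 <= y <= Num.max 0 (Num.min (2 * x) (2 - 2 * x)) ->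
    ~ (L @^-1` G) (x, y, 0).
  move=> /andP[x0 x1] /andP[y0 yt] /= Gx.
  have [yt1 yt2] : y <= 2 * x /\ y <= 2 - 2 * x.
    move: yt; rewrite le_max le_min => /orP[?|/andP[? ?]]; split; lra.
  have inj u v : L u = L v -> u = v by move=> /(congr1 L'); rewrite !LK.
  have tx : triangle p q r (L (x, y, 0)).
    exists (1 - x - y / 2), (x - y / 2), y; rewrite LE; split => //.
    by split=> //; lra.
  have : L (x, y, 0) = p \/ L (x, y, 0) = q.
    by case: Gx => [|->]; [exact: dis|left].
  by rewrite -Lp -Lq => -[] /inj [ex _]; [move: x0|move: x1]; rewrite ex ltxx.
have := std_delta cLG (or_intror (Lp : [set p] _)) tri.
move=> /(equiv_conj (@cont_lin3 _ _ _ _) (@cont_lin3_inv _ _ _) LK LK' (G := G)).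
move=> /(_ (fun _ => id)).
have -> : L @` [set (x, 0, 0) | x in `[0, 1]] = segment p q.
  apply/seteqP; split=> [_ [_ [x x01 <-] <-]|x /segmentP[t t01 ->]].
    apply/segmentP; exists x; first by move: x01; rewrite /= in_itv.
    by rewrite LE mul0r !subr0 !mul0r !addr0.
  exists (t, 0, 0); first by exists t; rewrite //= in_itv.
  by rewrite LE mul0r !subr0 !mul0r !addr0.
have -> : L @` [set (x, Num.max 0 (Num.min (2 * x) (2 - 2 * x)), 0) | x in `[0, 1]] =
    segment p r `|` segment r q.
  apply/seteqP; split=> [_ [_ [x x01 <-] <-]|x].
    have /andP[x0 x1] : 0 <= x <= 1 by move: x01; rewrite /= in_itv.
    have [xh|xh] := leP x 2^-1.
      left; apply/segmentP; exists (2 * x); first by apply/andP; split; lra.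
      by rewrite tent_left// LE; congr (_, _, _); field.
    right; apply/segmentP; exists (2 * x - 1); first by apply/andP; split; lra.
    by rewrite tent_right ?(ltW xh)// LE; congr (_, _, _); field.
  case=> /segmentP[t t01 ->]; case/andP: t01 => t0 t1.
    exists (t / 2, Num.max 0 (Num.min (2 * (t / 2)) (2 - 2 * (t / 2))), 0).
      by exists (t / 2) => //=; rewrite in_itv /=; apply/andP; split; lra.
    by rewrite tent_left; [rewrite LE; congr (_, _, _); field|lra|lra].
  exists ((t + 1) / 2, Num.max 0 (Num.min (2 * ((t + 1) / 2)) (2 - 2 * ((t + 1) / 2))), 0).
    by exists ((t + 1) / 2) => //=; rewrite in_itv /=; apply/andP; split; lra.
  by rewrite tent_right; [rewrite LE; congr (_, _, _); field|lra|lra].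
move=> e; apply: equiv_frame; apply: equiv_mono e; exact: subsetUl.
Qed.
End Delta.

(** * A half turn of a ball that is the identity outside a larger ball *)

Section Twist.
Context {R : realType}.
Notation sp := (R * R * R)%type.

Definition ramp (a b x : R) : R := Num.min (Num.max x a) b - a.

Lemma ramp_le a b x y : x <= y -> ramp a b x <= ramp a b y.
Proof.
rewrite /ramp !maxEle !minEle => xy.
by do 4?[case: ifPn]; rewrite -?ltNge => *; lra.
Qed.

Lemma ramp_ge0 a b x : a <= b -> 0 <= ramp a b x.
Proof. by move=> ab; rewrite subr_ge0 le_min ab le_max lexx orbT. Qed.

Lemma ramp_lt a b x y : a < b -> x < y -> a <= x -> x < b -> ramp a b x < ramp a b y.
Proof.
rewrite /ramp !maxEle !minEle => ab xy ax xb.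
by do 4?[case: ifPn]; rewrite -?ltNge => *; lra.
Qed.

Lemma ramp_in a b x : a <= x -> x <= b -> ramp a b x = x - a.
Proof.
rewrite /ramp !maxEle !minEle => ax xb.
by do 4?[case: ifPn]; rewrite -?ltNge => *; lra.
Qed.

Lemma ramp_lo a b x : a <= b -> x <= a -> ramp a b x = 0.
Proof.
rewrite /ramp !maxEle !minEle => ax xb.
by do 4?[case: ifPn]; rewrite -?ltNge => *; lra.
Qed.

Lemma ramp_hi a b x : a <= b -> b <= x -> ramp a b x = b - a.
Proof.
rewrite /ramp !maxEle !minEle => ax xb.
by do 4?[case: ifPn]; rewrite -?ltNge => *; lra.
Qed.

(** The polygonal path [-1, -1 + 2i, 1 + 3i, 10], along which the modulus
    strictly increases, continued by [- r] for [r <= 1] and by [r] for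
    [10 <= r]. *)
Definition path_re (r : R) : R :=
  2 * ramp 2 3 r + 9 / 7 * ramp 3 10 r + (Num.max r 10 - 10) - Num.min r 1.
Definition path_im (r : R) : R :=
  2 * ramp 1 2 r + ramp 2 3 r - 3 / 7 * ramp 3 10 r.
Definition path_sqr (r : R) : R := path_re r ^+ 2 + path_im r ^+ 2.

(** The corners of the path are chosen so that each leg starts perpendicular to the position vector:
    2i at -1, then 2 + i at -1 + 2i, then 9 - 3i at 1 + 3i. By Pythagoras the squared modulus is a
    sum of squares, one for each leg. *)
Lemma path_sqrE r : 0 <= r -> path_sqr r =
  Num.min r 1 ^+ 2 + 4 * ramp 1 2 r ^+ 2 + 5 * ramp 2 3 r ^+ 2 +
  90 / 49 * ramp 3 10 r ^+ 2 + (Num.max r 10 ^+ 2 - 100).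
Proof.
move=> r0; rewrite /path_sqr /path_re /path_im.
have [r1|r1] := leP r 1.
  have -> : Num.max r 10 = 10 by apply/max_idPr; lra.
  have -> : ramp 1 2 r = 0 by apply: ramp_lo; lra.
  have -> : ramp 2 3 r = 0 by apply: ramp_lo; lra.
  have -> : ramp 3 10 r = 0 by apply: ramp_lo; lra.
  by field.
have [r2|r2] := leP r 2.
  have -> : Num.max r 10 = 10 by apply/max_idPr; lra.
  have -> : ramp 1 2 r = r - 1 by apply: ramp_in; lra.
  have -> : ramp 2 3 r = 0 by apply: ramp_lo; lra.
  have -> : ramp 3 10 r = 0 by apply: ramp_lo; lra.
  by field.
have -> : ramp 1 2 r = 2 - 1 by apply: ramp_hi; lra.
have [r3|r3] := leP r 3.
  have -> : Num.max r 10 = 10 by apply/max_idPr; lra.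
  have -> : ramp 2 3 r = r - 2 by apply: ramp_in; lra.
  have -> : ramp 3 10 r = 0 by apply: ramp_lo; lra.
  by field.
have -> : ramp 2 3 r = 3 - 2 by apply: ramp_hi; lra.
have [r4|r4] := leP r 10.
  have -> : ramp 3 10 r = r - 3 by apply: ramp_in; lra.
  by field.
have -> : ramp 3 10 r = 10 - 3 by apply: ramp_hi; lra.
by field.
Qed.

(** No term decreases and the one of the current leg increases strictly. Hence [twist_map] sends
    spheres about the origin to spheres of strictly increasing radius, which gives injectivity. *)
Lemma path_sqr_lt r s : 0 <= r -> r < s -> path_sqr r < path_sqr s.
Proof.
move=> r0 rs; have s0 : 0 <= s by lra.
rewrite !path_sqrE//.
have sqr_le (x y : R) : 0 <= x -> x <= y -> x ^+ 2 <= y ^+ 2.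
  by move=> x0 xy; rewrite ler_pXn2r// nnegrE; lra.
have sqr_lt (x y : R) : 0 <= x -> x < y -> x ^+ 2 < y ^+ 2.
  by move=> x0 xy; rewrite ltr_pXn2r// nnegrE; lra.
have rs' := ltW rs.
have h0 : Num.min r 1 ^+ 2 <= Num.min s 1 ^+ 2.
  apply: sqr_le; first by rewrite le_min r0 ler01.
  by rewrite le_min !ge_min rs' lexx !orbT.
have h a b : a <= b -> ramp a b r ^+ 2 <= ramp a b s ^+ 2.
  by move=> ab; apply: sqr_le; [exact: ramp_ge0|exact: ramp_le].
have hl a b : a < b -> a <= r -> r < b -> ramp a b r ^+ 2 < ramp a b s ^+ 2.
  by move=> ab ar rb; apply: sqr_lt; [apply: ramp_ge0; exact: ltW|exact: ramp_lt].
have h12 : ramp 1 2 r ^+ 2 <= ramp 1 2 s ^+ 2 by apply: h; lra.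
have h23 : ramp 2 3 r ^+ 2 <= ramp 2 3 s ^+ 2 by apply: h; lra.
have h34 : ramp 3 10 r ^+ 2 <= ramp 3 10 s ^+ 2 by apply: h; lra.
have h4 : Num.max r 10 ^+ 2 <= Num.max s 10 ^+ 2.
  apply: sqr_le; first by rewrite le_max r0.
  by rewrite ge_max !le_max rs' lexx !orbT.
have [r1|r1] : r < 1 \/ 1 <= r by case: (ltP r 1); [left|right].
  suff : Num.min r 1 ^+ 2 < Num.min s 1 ^+ 2 by lra.
  rewrite (_ : Num.min r 1 = r); last by apply/min_idPl; lra.
  apply: sqr_lt => //; rewrite minEle; case: ifPn => _; lra.
have [r2|r2] : r < 2 \/ 2 <= r by case: (ltP r 2); [left|right].
  suff : ramp 1 2 r ^+ 2 < ramp 1 2 s ^+ 2 by lra.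
  by apply: hl; lra.
have [r3|r3] : r < 3 \/ 3 <= r by case: (ltP r 3); [left|right].
  suff : ramp 2 3 r ^+ 2 < ramp 2 3 s ^+ 2 by lra.
  by apply: hl; lra.
have [r4|r4] : r < 10 \/ 10 <= r by case: (ltP r 10); [left|right].
  suff : ramp 3 10 r ^+ 2 < ramp 3 10 s ^+ 2 by lra.
  by apply: hl; lra.
suff : Num.max r 10 ^+ 2 < Num.max s 10 ^+ 2 by lra.
rewrite !max_l//; last by lra.
exact: sqr_lt.
Qed.

Lemma path_id r : 10 <= r -> path_re r = r /\ path_im r = 0.
Proof.
move=> r10; rewrite /path_re /path_im.
have -> : Num.max r 10 = r by apply/max_idPl.
have -> : Num.min r 1 = 1 by apply/min_idPr; lra.
have -> : ramp 1 2 r = 2 - 1 by apply: ramp_hi; lra.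
have -> : ramp 2 3 r = 3 - 2 by apply: ramp_hi; lra.
have -> : ramp 3 10 r = 10 - 3 by apply: ramp_hi; lra.
by split; field.
Qed.

Lemma path_opp r : r <= 1 -> path_re r = - r /\ path_im r = 0.
Proof.
move=> r1; rewrite /path_re /path_im.
have -> : Num.max r 10 = 10 by apply/max_idPr; lra.
have -> : Num.min r 1 = r by apply/min_idPl; lra.
have -> : ramp 1 2 r = 0 by apply: ramp_lo; lra.
have -> : ramp 2 3 r = 0 by apply: ramp_lo; lra.
have -> : ramp 3 10 r = 0 by apply: ramp_lo; lra.
by split; field.
Qed.

Lemma path_piece1 r : 1 <= r -> r <= 2 -> path_re r = - 1 /\ path_im r = 2 * (r - 1).
Proof.
move=> r1 r2; rewrite /path_re /path_im.
have -> : Num.max r 10 = 10 by apply/max_idPr; lra.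
have -> : Num.min r 1 = 1 by apply/min_idPr; lra.
have -> : ramp 1 2 r = r - 1 by apply: ramp_in; lra.
have -> : ramp 2 3 r = 0 by apply: ramp_lo; lra.
have -> : ramp 3 10 r = 0 by apply: ramp_lo; lra.
by split; field.
Qed.

Lemma path_piece2 r : 2 <= r -> r <= 3 ->
  path_re r = - 1 + 2 * (r - 2) /\ path_im r = 2 + (r - 2).
Proof.
move=> r1 r2; rewrite /path_re /path_im.
have -> : Num.max r 10 = 10 by apply/max_idPr; lra.
have -> : Num.min r 1 = 1 by apply/min_idPr; lra.
have -> : ramp 1 2 r = 2 - 1 by apply: ramp_hi; lra.
have -> : ramp 2 3 r = r - 2 by apply: ramp_in; lra.
have -> : ramp 3 10 r = 0 by apply: ramp_lo; lra.
by split; field.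
Qed.

Lemma path_piece3 r : 3 <= r -> r <= 10 ->
  path_re r = 1 + 9 / 7 * (r - 3) /\ path_im r = 3 - 3 / 7 * (r - 3).
Proof.
move=> r1 r2; rewrite /path_re /path_im.
have -> : Num.max r 10 = 10 by apply/max_idPr; lra.
have -> : Num.min r 1 = 1 by apply/min_idPr; lra.
have -> : ramp 1 2 r = 2 - 1 by apply: ramp_hi; lra.
have -> : ramp 2 3 r = 3 - 2 by apply: ramp_hi; lra.
have -> : ramp 3 10 r = r - 3 by apply: ramp_in; lra.
by split; field.
Qed.

Definition norm2 (p : sp) : R := Num.sqrt (p.1.1 ^+ 2 + p.1.2 ^+ 2 + p.2 ^+ 2).

(** In the coordinates [(d, u, z)], the sphere of radius [r] is turned about the
    [d]-axis by the argument of the path at [r] and rescaled by its modulus: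
    a half turn near the origin, the identity outside the ball of radius 10. *)
Definition twist_map (p : sp) : sp :=
  let r := norm2 p in
  (Num.sqrt (path_sqr r) / r * p.1.1,
   (path_re r * p.1.2 - path_im r * p.2) / r,
   (path_im r * p.1.2 + path_re r * p.2) / r).

Lemma norm2_ge0 p : 0 <= norm2 p. Proof. exact: sqrtr_ge0. Qed.

Lemma norm2_sqr p : norm2 p ^+ 2 = p.1.1 ^+ 2 + p.1.2 ^+ 2 + p.2 ^+ 2.
Proof. by rewrite sqr_sqrtr// !addr_ge0 ?sqr_ge0. Qed.

Lemma norm2_eq0 p : norm2 p = 0 -> p = (0, 0, 0).
Proof.
move=> /(congr1 (fun x => x ^+ 2)); rewrite norm2_sqr expr0n /= => /eqP.
rewrite !paddr_eq0 ?addr_ge0 ?sqr_ge0// !sqrf_eq0.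
by case: p => -[x y] z /= /andP[/andP[/eqP-> /eqP->] /eqP->].
Qed.

Lemma path_sqr_ge0 r : 0 <= path_sqr r.
Proof. by rewrite addr_ge0 ?sqr_ge0. Qed.

Lemma norm2_twist p : norm2 (twist_map p) = Num.sqrt (path_sqr (norm2 p)).
Proof.
rewrite {1}/norm2 /twist_map /=; set r := norm2 p.
have [r0|rn0] := eqVneq r 0.
  have [e1 e2] := path_opp ler01; rewrite r0 /path_sqr e1 e2 invr0 !mulr0.
  by rewrite !mul0r oppr0 expr0n /= !addr0.
congr Num.sqrt.
have -> : (Num.sqrt (path_sqr r) / r * p.1.1) ^+ 2 = path_sqr r / r ^+ 2 * p.1.1 ^+ 2.
  by rewrite !exprMn sqr_sqrtr ?path_sqr_ge0// exprVn.
have e : p.1.1 ^+ 2 = r ^+ 2 - p.1.2 ^+ 2 - p.2 ^+ 2 by rewrite norm2_sqr; ring.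
by rewrite e /path_sqr; field.
Qed.

Lemma path_sqr_gt0 r : 0 < r -> 0 < path_sqr r.
Proof. by move=> r0; exact: le_lt_trans (path_sqr_ge0 0) (path_sqr_lt (lexx 0) r0). Qed.

Lemma cont_path_re : continuous path_re.
Proof. by rewrite /path_re /ramp; cont. Qed.

Lemma cont_path_im : continuous path_im.
Proof. by rewrite /path_im /ramp; cont. Qed.

Lemma cont_path_sqr : continuous path_sqr.
Proof.
have -> : path_sqr = fun r => path_re r * path_re r + path_im r * path_im r.
  by apply/funext => r; rewrite /path_sqr !expr2.
by cont; [exact: cont_path_re..|exact: cont_path_im|exact: cont_path_im].
Qed.

Lemma norm2_le p (M : R) : M < `|p| -> 0 <= M -> M <= norm2 p.
Proof.
move=> Mp M0; rewrite -(ger0_norm M0) -sqrtr_sqr ler_sqrt; last first.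
  by rewrite !addr_ge0 ?sqr_ge0.
have h (x : R) : M < `|x| -> M ^+ 2 <= x ^+ 2.
  by move=> Mx; rewrite -(real_normK (num_real x)) ler_pXn2r ?nnegrE// ltW.
have x0 := sqr_ge0 p.1.1; have y0 := sqr_ge0 p.1.2; have z0 := sqr_ge0 p.2.
by move: Mp; rewrite norm3 !lt_max -orbA => /or3P[] /h; lra.
Qed.

Lemma twist_inj p q : twist_map p = twist_map q -> p = q.
Proof.
move=> e; have : norm2 (twist_map p) = norm2 (twist_map q) by rewrite e.
rewrite !norm2_twist => /eqP; rewrite eqr_sqrt ?path_sqr_ge0// => /eqP es.
have er : norm2 p = norm2 q.
  case: (ltgtP (norm2 p) (norm2 q)) => // /path_sqr_lt.
    by move=> /(_ (norm2_ge0 _)); rewrite es ltxx.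
  by move=> /(_ (norm2_ge0 _)); rewrite es ltxx.
have [r0|rn0] := eqVneq (norm2 p) 0.
  by rewrite (norm2_eq0 r0); move: r0; rewrite er => /norm2_eq0 ->.
have r0 : 0 < norm2 q by rewrite -er lt_neqAle eq_sym rn0 norm2_ge0.
have s0 := path_sqr_gt0 r0.
move: e; rewrite /twist_map er; set r := norm2 q in r0 s0 *.
have rn : r^-1 != 0 by rewrite invr_eq0 gt_eqF.
have sn : Num.sqrt (path_sqr r) != 0 by rewrite sqrtr_eq0 -ltNge.
case: p q {rn0 er es} @r r0 s0 rn sn => -[d u] z [[d' u'] z'] r r0 s0 rn sn /= [].
move=> /(mulfI (mulf_neq0 sn rn)) -> /(mulIf rn) h1 /(mulIf rn) h2.
have S0 : path_re r ^+ 2 + path_im r ^+ 2 != 0 by rewrite gt_eqF.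
congr (_, _, _); apply: (mulfI S0).
  transitivity (path_re r * (path_re r * u - path_im r * z) +
    path_im r * (path_im r * u + path_re r * z)); first by ring.
  by rewrite h1 h2; ring.
transitivity (path_re r * (path_im r * u + path_re r * z) -
    path_im r * (path_re r * u - path_im r * z)); first by ring.
by rewrite h1 h2; ring.
Qed.

Lemma twist_surj q : exists p, twist_map p = q.
Proof.
have [t0|tn0] := eqVneq (norm2 q) 0.
  exists (0, 0, 0); rewrite (norm2_eq0 t0) /twist_map.
  by rewrite /= !mulr0 subr0 addr0 !mul0r.
have t0 : 0 < norm2 q by rewrite lt_neqAle eq_sym tn0 norm2_ge0.
pose M := Num.max 10 (norm2 q).
have M10 : 10 <= M by rewrite le_max lexx.
have Mt : norm2 q <= M by rewrite le_max lexx orbT.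
have [|||r r0M rE] := @IVT R path_sqr 0 M (norm2 q ^+ 2).
- lra.
- exact/continuous_subspaceT/cont_path_sqr.
- rewrite ge_min le_max; apply/andP; split; apply/orP; [left|right].
    rewrite /path_sqr; have [-> ->] := path_opp ler01.
    by rewrite oppr0 !expr0n /= addr0 sqr_ge0.
  rewrite /path_sqr; have [-> ->] := path_id M10.
  by rewrite expr0n /= addr0 ler_pXn2r ?nnegrE//; lra.
have {r0M} r_ge0 : 0 <= r by move: r0M; rewrite in_itv => /andP[].
have r0 : 0 < r.
  rewrite lt_neqAle r_ge0 andbT; apply/eqP => r0; move: rE.
  rewrite -r0 /path_sqr; have [-> ->] := path_opp ler01.
  by rewrite oppr0 !expr0n /= addr0 => /esym/eqP; rewrite sqrf_eq0 (negbTE tn0).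
have := norm2_sqr q; move: t0 tn0 rE; clear M M10 Mt.
move: (norm2 q) => t; case: q => -[d u] z t0 tn0 rE /= tE.
have rn : r != 0 by rewrite gt_eqF.
set a := path_re r; set b := path_im r.
have abE : a ^+ 2 = t ^+ 2 - b ^+ 2 by rewrite -rE /path_sqr -/a -/b; ring.
exists (r * d / t, r * (a * u + b * z) / t ^+ 2, r * (a * z - b * u) / t ^+ 2).
have -> : twist_map (r * d / t, r * (a * u + b * z) / t ^+ 2, r * (a * z - b * u) / t ^+ 2) =
  (t / r * (r * d / t), (a * (r * (a * u + b * z) / t ^+ 2) - b * (r * (a * z - b * u) / t ^+ 2)) / r,
   (b * (r * (a * u + b * z) / t ^+ 2) + a * (r * (a * z - b * u) / t ^+ 2)) / r).
  have nr : norm2 (r * d / t, r * (a * u + b * z) / t ^+ 2, r * (a * z - b * u) / t ^+ 2) = r.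
    rewrite /norm2 /= -[RHS]ger0_norm// -sqrtr_sqr; congr Num.sqrt.
    transitivity ((d ^+ 2 * t ^+ 2 + (a ^+ 2 + b ^+ 2) * (u ^+ 2 + z ^+ 2)) * (r / t ^+ 2) ^+ 2).
      by field.
    rewrite abE subrK (_ : u ^+ 2 + z ^+ 2 = t ^+ 2 - d ^+ 2); last by rewrite tE; ring.
    by field.
  rewrite /twist_map nr /= -/a -/b (_ : Num.sqrt (path_sqr r) = t)//.
  by rewrite rE sqrtr_sqr ger0_norm// ltW.
congr (_, _, _); first by field; rewrite rn tn0.
  transitivity ((a ^+ 2 + b ^+ 2) * u / t ^+ 2); first by field; rewrite rn tn0.
  by rewrite abE subrK; field.
transitivity ((a ^+ 2 + b ^+ 2) * z / t ^+ 2); first by field; rewrite rn tn0.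
by rewrite abE subrK; field.
Qed.

Lemma twist_out p : 10 <= norm2 p -> twist_map p = p.
Proof.
move=> r10; rewrite /twist_map /path_sqr; have [-> ->] := path_id r10.
have r0 : norm2 p != 0 by rewrite gt_eqF//; lra.
rewrite expr0n /= addr0 sqrtr_sqr ger0_norm ?norm2_ge0//.
case: p {r10} r0 => -[d u] z r0; set r := norm2 _ in r0 *.
by congr (_, _, _); rewrite /=; field.
Qed.

Lemma twist_in p : norm2 p <= 1 -> twist_map p = (p.1.1, - p.1.2, - p.2).
Proof.
move=> r1; have [r0|r0] := eqVneq (norm2 p) 0.
  rewrite (norm2_eq0 r0) /twist_map /= !mulr0 subr0 addr0 !mul0r oppr0.
  by [].
rewrite /twist_map /path_sqr; have [-> ->] := path_opp r1.
rewrite expr0n /= addr0 sqrrN sqrtr_sqr ger0_norm ?norm2_ge0//.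
case: p {r1} r0 => -[d u] z r0; set r := norm2 _ in r0 *.
by congr (_, _, _); rewrite /=; field.
Qed.

Lemma cont_norm2 : continuous norm2.
Proof.
move=> p; apply: (@continuous_comp _ _ _
  (fun p : sp => p.1.1 ^+ 2 + p.1.2 ^+ 2 + p.2 ^+ 2) Num.sqrt).
  have : continuous (fun p : sp => p.1.1 * p.1.1 + p.1.2 * p.1.2 + p.2 * p.2) by cont.
  exact.
exact: sqrt_continuous.
Qed.

Lemma cont_twist : continuous twist_map.
Proof.
(* The formula divides by the norm; inside the unit ball the linear half turn of [twist_in] replaces
   it. *)
move=> p; have [r1|r1] := ltP (norm2 p) 1.
  have c : continuous (fun p : sp => (p.1.1, - p.1.2, - p.2)) by cont.
  suff : twist_map @ p --> (p.1.1, - p.1.2, - p.2) by rewrite -twist_in// ltW.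
  apply: cvg_trans (c p); apply: near_eq_cvg; near=> q.
  rewrite twist_in// ltW//; near: q; apply: (cvgr_lt _ (cont_norm2 (x := p))) => //.
have rn : norm2 p != 0 by rewrite gt_eqF//; lra.
have cn : norm2 @ p --> norm2 p by exact: cont_norm2.
have cV : (fun q => (norm2 q)^-1) @ p --> (norm2 p)^-1 by apply: cvgV.
have ca : (fun q => path_re (norm2 q)) @ p --> path_re (norm2 p).
  by apply: continuous_cvg; [exact: cont_path_re|].
have cb : (fun q => path_im (norm2 q)) @ p --> path_im (norm2 p).
  by apply: continuous_cvg; [exact: cont_path_im|].
have cs : (fun q => Num.sqrt (path_sqr (norm2 q))) @ p --> Num.sqrt (path_sqr (norm2 p)).
  apply: continuous_cvg; first exact: sqrt_continuous.
  by apply: continuous_cvg; [exact: cont_path_sqr|].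
have cx := @cont_x R p; have cy := @cont_y R p; have cz := @cont_z R p.
have c1 : (fun q => (twist_map q).1.1) @ p --> (twist_map p).1.1.
  exact: cvgM (cvgM cs cV) cx.
have c2 : (fun q => (twist_map q).1.2) @ p --> (twist_map p).1.2.
  exact: cvgM (cvgB (cvgM ca cy) (cvgM cb cz)) cV.
have c3 : (fun q => (twist_map q).2) @ p --> (twist_map p).2.
  exact: cvgM (cvgD (cvgM cb cy) (cvgM ca cz)) cV.
have := cvg_pair (cvg_pair c1 c2) c3; exact.
Unshelve. all: by end_near. Qed.

Lemma twist_homeo : bounded_homeo [set p | 10 <= norm2 p] twist_map.
Proof.
have [g gP] := choice twist_surj.
split; first exact: cont_twist.
- exists g => p; last exact: gP.
  by apply: twist_inj; rewrite gP.
- by exists 10 => p p10; apply: twist_out; exact: norm2_le.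
- exact: twist_out.
Qed.
End Twist.

(** * Rational coordinates for computation and separation by linear functionals *)

Notation Q := QArith_base.Q.

Section RationalCoordinates.
Context {R : realType}.
Notation sp := (R * R * R)%type.

(** Sums and products are reduced to lowest terms, which keeps the numbers small when scripts are
    evaluated. *)
Definition qadd a b := Qreduction.Qred (QArith_base.Qplus a b).
Definition qmul a b := Qreduction.Qred (QArith_base.Qmult a b).
Definition qopp a := QArith_base.Qopp a.
Definition qsub a b := qadd a (qopp b).
Definition qle := QArith_base.Qle_bool.
Definition qlt a b := ~~ qle b a.
Definition qeq := QArith_base.Qeq_bool.

Definition zR (z : Z) : R := (int_of_Z z)%:~R.
Definition qR (q : Q) : R := zR (QArith_base.Qnum q) / zR (Zpos (QArith_base.Qden q)).

Lemma zRD a b : zR (BinInt.Z.add a b) = zR a + zR b.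
Proof. by rewrite /zR -intrD; congr intmul; lia. Qed.

Lemma zRM a b : zR (BinInt.Z.mul a b) = zR a * zR b.
Proof. by rewrite /zR -intrM; congr intmul; lia. Qed.

Lemma zRN a : zR (BinInt.Z.opp a) = - zR a.
Proof. by rewrite /zR -mulrNz; congr intmul; lia. Qed.

Lemma zR_le a b : BinInt.Z.le a b -> zR a <= zR b.
Proof. by move=> ab; rewrite /zR ler_int; lia. Qed.

Lemma zR_pos p : 0 < zR (Zpos p).
Proof. by rewrite /zR ltr0z; lia. Qed.

Lemma qR_eq a b : QArith_base.Qeq a b -> qR a = qR b.
Proof.
rewrite /QArith_base.Qeq /qR => /(congr1 zR); rewrite !zRM => e.
have ha := zR_pos (QArith_base.Qden a); have hb := zR_pos (QArith_base.Qden b).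
by apply/eqP; rewrite eqr_div; [apply/eqP|rewrite gt_eqF..].
Qed.

Lemma qR_eqb a b : qeq a b -> qR a = qR b.
Proof. by move=> /QArith_base.Qeq_bool_iff /qR_eq. Qed.

Lemma qRD a b : qR (qadd a b) = qR a + qR b.
Proof.
rewrite /qadd (qR_eq (Qreduction.Qred_correct _)) /qR /QArith_base.Qplus /=.
have ha := zR_pos (QArith_base.Qden a); have hb := zR_pos (QArith_base.Qden b).
rewrite BinInt.Pos2Z.inj_mul zRD !zRM; field.
by rewrite !gt_eqF.
Qed.

Lemma qRM a b : qR (qmul a b) = qR a * qR b.
Proof.
rewrite /qmul (qR_eq (Qreduction.Qred_correct _)) /qR /QArith_base.Qmult /=.
have ha := zR_pos (QArith_base.Qden a); have hb := zR_pos (QArith_base.Qden b).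
rewrite BinInt.Pos2Z.inj_mul !zRM; field.
by rewrite !gt_eqF.
Qed.

Lemma qRN a : qR (qopp a) = - qR a.
Proof. by rewrite /qR /= zRN mulNr. Qed.

Lemma qRB a b : qR (qsub a b) = qR a - qR b.
Proof. by rewrite qRD qRN. Qed.

Lemma qR_le a b : qle a b -> qR a <= qR b.
Proof.
move=> /QArith_base.Qle_bool_iff; rewrite /QArith_base.Qle => /zR_le.
have ha := zR_pos (QArith_base.Qden a); have hb := zR_pos (QArith_base.Qden b).
by rewrite !zRM /qR ler_pdivrMr// mulrAC ler_pdivlMr.
Qed.

Lemma qR_lt a b : qlt a b -> qR a < qR b.
Proof.
move=> /negP h; rewrite ltNge; apply/negP; apply: contra_not h.
have ha := zR_pos (QArith_base.Qden a); have hb := zR_pos (QArith_base.Qden b).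
rewrite /qR ler_pdivrMr// mulrAC ler_pdivlMr// -!zRM /zR ler_int => h.
by apply/QArith_base.Qle_bool_iff; rewrite /QArith_base.Qle; lia.
Qed.

Definition frac (n d : nat) : Q :=
  QArith_base.Qmake (BinInt.Z.of_nat n) (BinPos.Pos.of_nat d).

Lemma fracR n d : (0 < d)%N -> qR (frac n d) = n%:R / d%:R.
Proof.
move=> d0; rewrite /qR /frac /zR /= !pmulrn; congr (_%:~R / _%:~R); lia.
Qed.

Lemma frac0 : qR (frac 0 1) = 0.
Proof. by rewrite fracR// mul0r. Qed.

Lemma frac1 : qR (frac 1 1) = 1.
Proof. by rewrite fracR// divr1. Qed.

Definition qpt := (Q * Q * Q)%type.
Definition ptR (p : qpt) : sp := (qR p.1.1, qR p.1.2, qR p.2).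

Definition pt_eq (p q : qpt) := [&& qeq p.1.1 q.1.1, qeq p.1.2 q.1.2 & qeq p.2 q.2].

Lemma pt_eqR p q : pt_eq p q -> ptR p = ptR q.
Proof. by case/and3P => /qR_eqb e1 /qR_eqb e2 /qR_eqb e3; rewrite /ptR e1 e2 e3. Qed.

Definition pt_neq (p q : qpt) :=
  [|| qlt p.1.1 q.1.1, qlt q.1.1 p.1.1, qlt p.1.2 q.1.2, qlt q.1.2 p.1.2,
      qlt p.2 q.2 | qlt q.2 p.2].

Lemma pt_neqR p q : pt_neq p q -> ptR p <> ptR q.
Proof.
by move=> h [e1 e2 e3]; move: h => /or4P[| | |/or3P[]] /qR_lt; rewrite ?e1 ?e2 ?e3 ltxx.
Qed.

Definition qdot (p q : qpt) : Q :=
  qadd (qadd (qmul p.1.1 q.1.1) (qmul p.1.2 q.1.2)) (qmul p.2 q.2).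

Lemma qdotR p q : qR (qdot p q) = dot (ptR p) (ptR q).
Proof. by rewrite !qRD !qRM. Qed.

Definition qvsub (p q : qpt) : qpt :=
  (qsub p.1.1 q.1.1, qsub p.1.2 q.1.2, qsub p.2 q.2).
Definition qcross (p q : qpt) : qpt :=
  (qsub (qmul p.1.2 q.2) (qmul p.2 q.1.2),
   qsub (qmul p.2 q.1.1) (qmul p.1.1 q.2),
   qsub (qmul p.1.1 q.1.2) (qmul p.1.2 q.1.1)).

Lemma qvsubR p q : ptR (qvsub p q) = vsub (ptR p) (ptR q).
Proof. by rewrite /ptR /= !qRB. Qed.

Lemma qcrossR p q : ptR (qcross p q) = cross (ptR p) (ptR q).
Proof. by rewrite /ptR /= !qRB !qRM. Qed.

(** Separation of a triangle from a segment or a box by a linear functional. *)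
Lemma triangle_dot n p q r x : triangle p q r x -> exists a b c : R,
  [/\ [/\ 0 <= a, 0 <= b, 0 <= c & a + b + c = 1],
     x = (a * p.1.1 + b * q.1.1 + c * r.1.1, a * p.1.2 + b * q.1.2 + c * r.1.2,
          a * p.2 + b * q.2 + c * r.2) &
     dot n x = a * dot n p + b * dot n q + c * dot n r].
Proof.
move=> [a [b [c [abc ex ey ez]]]]; exists a, b, c; split=> //.
  by case: x ex ey ez => -[x y] z /= -> -> ->.
by rewrite /dot ex ey ez; ring.
Qed.

Lemma triangle_lt n p q r x (t : R) : triangle p q r x ->
  dot n p < t -> dot n q < t -> dot n r < t -> dot n x < t.
Proof.
move=> /(triangle_dot n) [a [b [c [[a0 b0 c0 abc] _ ->]]]] pt qt rt.
have ea : a = 1 - b - c by lra.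
have [b1|b1] := leP b 0; have [c1|c1] := leP c 0; nra.
Qed.

Lemma triangle_touch n p q r x (t : R) : triangle p q r x ->
  dot n p <= t -> dot n q < t -> dot n r < t -> t <= dot n x -> x = p.
Proof.
move=> /(triangle_dot n) [a [b [c [[a0 b0 c0 abc] -> ->]]]] pt qt rt tx.
have b1 : b = 0 by nra.
have c1 : c = 0 by nra.
have a1 : a = 1 by lra.
by rewrite a1 b1 c1 !mul0r !mul1r !addr0; case: (p) => -[].
Qed.

Lemma segment_dot n p q x : segment p q x -> exists2 t : R, 0 <= t <= 1 &
  x = ((1 - t) * p.1.1 + t * q.1.1, (1 - t) * p.1.2 + t * q.1.2,
       (1 - t) * p.2 + t * q.2) /\ dot n x = (1 - t) * dot n p + t * dot n q.
Proof.
move=> /segmentP [t t01 ->]; exists t => //; split=> //.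
by rewrite /dot /=; ring.
Qed.

Lemma segment_ge n p q x (t : R) : segment p q x ->
  t <= dot n p -> t <= dot n q -> t <= dot n x.
Proof. by move=> /(segment_dot n) [s /andP[s0 s1] [_ ->]] pt qt; nra. Qed.

Lemma segment_touch n p q x (t : R) : segment p q x ->
  t <= dot n p -> t < dot n q -> dot n x <= t -> x = p.
Proof.
move=> /(segment_dot n) [s /andP[s0 s1] [-> ->]] pt qt xt.
have s00 : s = 0 by nra.
by rewrite s00 !mul0r subr0 !mul1r !addr0; case: (p) => -[].
Qed.

Lemma triangle_perm1 (p q r : sp) : triangle p q r `<=` triangle q p r.
Proof.
move=> x [a [b [c [[a0 b0 c0 e] e1 e2 e3]]]]; exists b, a, c.
by split; [split=> //; lra|lra..].
Qed.

Lemma triangle_perm2 (p q r : sp) : triangle p q r `<=` triangle r q p.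
Proof.
move=> x [a [b [c [[a0 b0 c0 e] e1 e2 e3]]]]; exists c, b, a.
by split; [split=> //; lra|lra..].
Qed.

Lemma segment_sym (p q : sp) : segment p q = segment q p.
Proof.
have h p' q' : segment p' q' `<=` (segment q' p' : set sp).
  move=> x /segmentP[t /andP[t0 t1] ->]; apply/segmentP; exists (1 - t).
    by apply/andP; split; lra.
  by congr (_, _, _); ring.
by apply/seteqP; split; exact: h.
Qed.
End RationalCoordinates.

(** * Pictures and certificates that a triangle avoids segments and boxes *)

Section Pictures.
Context {R : realType}.
Notation sp := (R * R * R)%type.

Definition slot (x0 x1 y0 y1 : R) (p : sp) : sp :=
  (x0 + p.1.1 * (x1 - x0), y0 + p.1.2 * (y1 - y0), p.2).

Definition unit_box : set sp :=
  [set p | [/\ 0 <= p.1.1 <= 1, 0 <= p.1.2 <= 1 & -1 <= p.2 <= 1]].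

(** The complement of the part of space over the open unit square. *)
Definition outside : set sp :=
  [set p | [\/ p.1.1 <= 0, 1 <= p.1.1, p.1.2 <= 0 | 1 <= p.1.2]].

Definition tangle (A : set sp) := closed A /\ A `<=` unit_box.

Definition qrect := (Q * Q * Q * Q)%type.
Definition qslot (b : qrect) : sp -> sp :=
  slot (qR b.1.1.1) (qR b.1.1.2) (qR b.1.2) (qR b.2).

(** A picture is a list of segments together with a list of rectangles holding
    numbered tangles. *)
Definition picture := (seq (qpt * qpt) * seq (qrect * nat))%type.

Fixpoint segs_set (l : seq (qpt * qpt)) : set sp :=
  if l is s :: l' then segment (ptR s.1) (ptR s.2) `|` segs_set l' else set0.
Fixpoint boxes_set (env : nat -> set sp) (l : seq (qrect * nat)) : set sp :=
  if l is b :: l' then qslot b.1 @` env b.2 `|` boxes_set env l' else set0.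
Definition realize env (P : picture) : set sp := segs_set P.1 `|` boxes_set env P.2.

Definition seg_eq (p q u v : qpt) := pt_eq p u && pt_eq q v || pt_eq p v && pt_eq q u.

Fixpoint rm_seg (p q : qpt) (l : seq (qpt * qpt)) : option (seq (qpt * qpt)) :=
  if l is s :: l' then
    if seg_eq p q s.1 s.2 then Some l' else omap (cons s) (rm_seg p q l')
  else None.

Lemma seg_eqR p q u v : seg_eq p q u v ->
  segment (ptR p) (ptR q) = segment (ptR u) (ptR v) :> set sp.
Proof.
case/orP => /andP[/(@pt_eqR R) -> /(@pt_eqR R) ->] //; exact: segment_sym.
Qed.

Lemma rm_segP p q l l' : rm_seg p q l = Some l' ->
  segs_set l = segment (ptR p) (ptR q) `|` segs_set l'.
Proof.
elim: l l' => //= s l IH l'; case: ifPn => [/seg_eqR -> [->] //|_].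
case E : (rm_seg p q l) => [l1|//] [<-] /=.
by rewrite (IH _ E) !setUA [X in X `|` _]setUC.
Qed.

Definition axes : seq qpt :=
  let o := frac 0 1 in let i := frac 1 1 in [:: (i, o, o); (o, i, o); (o, o, i)].

Definition pt_opp (n : qpt) : qpt := (qopp n.1.1, qopp n.1.2, qopp n.2).

Definition edges (p q r : qpt) := [:: qvsub q p; qvsub r q; qvsub p r].

(** Directions in which separating planes are sought: the axes, the normal of the triangle, and
    cross products of this normal and of the edges with edges and given directions. Each candidate
    is tested, so soundness does not depend on the choice. *)
Definition candidates (p q r : qpt) (ds : seq qpt) : seq qpt :=
  let es := edges p q r in
  let n := qcross (qvsub q p) (qvsub r q) in
  let cs := n :: [seq qcross n e | e <- es ++ ds] ++ [seq qcross e d | e <- es, d <- ds] in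
  let ns := axes ++ cs in ns ++ map pt_opp ns.

(** The values at the vertices [p], [q], [r] of a triangle are below [m], except
    perhaps at one of [p] and [q]. *)
Definition below (a b c m : Q) :=
  qlt c m && (qle a m && qlt b m || qle b m && qlt a m).

(** Either the functional separates the segment from the triangle except at [p] or [q], or the
    segment can meet the triangle only at its end with the smaller value. In the second case this
    end must be [p] or [q], or else differ from [r] while [r] is the only vertex that can reach its
    level. *)
Definition sep_seg (p q r u v n : qpt) :=
  let a := qdot n p in let b := qdot n q in let c := qdot n r in
  let touch u v :=
    let m := qdot n u in let k := qdot n v in
    [&& qlt m k, qle a m, qle b m, qle c m &
      [|| pt_eq u p, pt_eq u q | [&& qlt a m, qlt b m & pt_neq u r]]] in
  let m := qdot n u in let k := qdot n v in
  [|| below a b c (if qle m k then m else k), touch u v | touch v u].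

Definition tri_seg (p q r u v : qpt) :=
  has (sep_seg p q r u v) (candidates p q r [:: qvsub v u]).

Lemma has_ex T (a : pred T) s : has a s -> exists x, a x.
Proof. by elim: s => //= x s IH /orP[ax|/IH //]; exists x. Qed.

Lemma belowP (p q r n : sp) (a b c m : Q) x : qR a = dot n p -> qR b = dot n q ->
  qR c = dot n r -> below a b c m -> triangle p q r x -> qR m <= dot n x ->
  x = p \/ x = q.
Proof.
move=> ea eb ec /andP[/(@qR_lt R) cm /orP[]/andP[/(@qR_le R) h1 /(@qR_lt R) h2]] tx mx.
  by left; apply: (triangle_touch (n := n) tx) mx; rewrite -?ea -?eb -?ec.
right; apply: (triangle_touch (n := n) (triangle_perm1 tx)) mx; by rewrite -?ea -?eb -?ec.
Qed.

Lemma tri_segP p q r u v x : tri_seg p q r u v ->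
  triangle (ptR p) (ptR q) (ptR r) x -> segment (ptR u) (ptR v) x ->
  x = ptR p \/ x = ptR q :> sp.
Proof.
move=> /has_ex[n sep] tx sx.
have touch u' v' : segment (ptR u') (ptR v') x ->
   [&& qlt (qdot n u') (qdot n v'), qle (qdot n p) (qdot n u'), qle (qdot n q) (qdot n u'),
   qle (qdot n r) (qdot n u') & [|| pt_eq u' p, pt_eq u' q |
   [&& qlt (qdot n p) (qdot n u'), qlt (qdot n q) (qdot n u') & pt_neq u' r]]] ->
   x = ptR p \/ x = ptR q.
  move=> sx' /and5P[/(@qR_lt R) mk /(@qR_le R) am /(@qR_le R) bm /(@qR_le R) cm].
  rewrite !qdotR in mk am bm cm.
  have xm : dot (ptR n) x <= dot (ptR n) (ptR u').
    have [a [b [c [[a0 b0 c0 abc] _ ->]]]] := triangle_dot (ptR n) tx.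
    have ea : a = 1 - b - c by lra.
    nra.
  have xu := segment_touch sx' (lexx _) mk xm.
  case/or3P => [/(@pt_eqR R) e|/(@pt_eqR R) e|/and3P[/(@qR_lt R) al /(@qR_lt R) bl /(@pt_neqR R) ne]].
  - by left; rewrite xu.
  - by right; rewrite xu.
  - rewrite !qdotR in al bl; case: ne; rewrite -xu.
    apply: (triangle_touch (n := ptR n) (triangle_perm2 tx) cm bl al).
    by rewrite xu.
move: sep => /or3P[bl|/(touch _ _ sx) //|/touch]; last first.
  by apply; rewrite segment_sym.
apply: (belowP _ _ _ bl tx); rewrite ?qdotR//.
apply: (segment_ge sx); case: ifPn => [/(@qR_le R)|/(@qR_lt R)]; rewrite !qdotR//.
exact: ltW.
Qed.

Definition qmin a b := if qle a b then a else b.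

(** The minimum of the functional on the box over the rectangle, with heights between -1 and 1; it
    is computed coordinate by coordinate. *)
Definition box_min (n : qpt) (b : qrect) : Q :=
  qadd (qadd (qmin (qmul n.1.1 b.1.1.1) (qmul n.1.1 b.1.1.2))
    (qmin (qmul n.1.2 b.1.2) (qmul n.1.2 b.2))) (qmin n.2 (qopp n.2)).

Definition tri_box (p q r : qpt) (b : qrect) :=
  has (fun n => below (qdot n p) (qdot n q) (qdot n r) (box_min n b))
    (candidates p q r axes).

Lemma qminR a b : qR (qmin a b) <= qR a :> R /\ qR (qmin a b) <= qR b :> R.
Proof.
rewrite /qmin; case: ifPn => [/(@qR_le R) //|/(@qR_lt R)]; split=> //.
exact: ltW.
Qed.

Lemma tri_boxP p q r b (A : set sp) x : A `<=` unit_box -> tri_box p q r b ->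
  triangle (ptR p) (ptR q) (ptR r) x -> (qslot b @` A) x ->
  x = ptR p \/ x = ptR q.
Proof.
move=> Au /has_ex[n bl] tx [y /Au [/andP[x0 x1] /andP[y0 y1] /andP[z0 z1]] xE].
apply: (belowP (n := ptR n) _ _ _ bl tx); rewrite ?qdotR//.
rewrite /box_min !qRD -xE /dot /=.
have [h1 h2] := qminR (qmul n.1.1 b.1.1.1) (qmul n.1.1 b.1.1.2).
have [h3 h4] := qminR (qmul n.1.2 b.1.2) (qmul n.1.2 b.2).
have [h5 h6] := qminR n.2 (qopp n.2).
move: h1 h2 h3 h4 h5 h6; rewrite !qRM !qRN.
move: (qR (qmin _ _)) => m1; move: (qR (qmin _ _)) => m2; move: (qR (qmin _ _)) => m3.
move: x0 x1 y0 y1 z0 z1; move: y.1.1 y.1.2 y.2 => s t w s0 s1 t0 t1 w0 w1 h1 h2 h3 h4 h5 h6.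
apply: lerD; first apply: lerD.
- rewrite (_ : _ * _ = (1 - s) * (qR n.1.1 * qR b.1.1.1) + s * (qR n.1.1 * qR b.1.1.2)); last by ring.
  move: h1 h2; move: (_ * _) (_ * _) => k l h1 h2; nra.
- rewrite (_ : _ * _ = (1 - t) * (qR n.1.2 * qR b.1.2) + t * (qR n.1.2 * qR b.2)); last by ring.
  move: h3 h4; move: (_ * _) (_ * _) => k l h3 h4; nra.
- by move: h5 h6; move: (qR n.2) => k h5 h6; nra.
Qed.

Definition tri_out (p q r : qpt) :=
  let o := frac 0 1 in let i := frac 1 1 in let j := qopp i in
  all (fun nm => below (qdot nm.1 p) (qdot nm.1 q) (qdot nm.1 r) nm.2)
    [:: ((j, o, o), o); ((i, o, o), i); ((o, j, o), o); ((o, i, o), i)].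

Lemma tri_outP p q r x : tri_out p q r -> triangle (ptR p) (ptR q) (ptR r) x ->
  outside x -> x = ptR p \/ x = ptR q :> sp.
Proof.
case/and5P => h1 h2 h3 h4 _ tx; have d a b c : dot (ptR (a, b, c)) x =
  qR a * x.1.1 + qR b * x.1.2 + qR c * x.2 by [].
case=> xo.
- apply: (belowP _ _ _ h1 tx); rewrite ?qdotR// d qRN frac0 frac1; lra.
- apply: (belowP _ _ _ h2 tx); rewrite ?qdotR// d frac0 frac1; lra.
- apply: (belowP _ _ _ h3 tx); rewrite ?qdotR// d qRN frac0 frac1; lra.
- apply: (belowP _ _ _ h4 tx); rewrite ?qdotR// d frac0 frac1; lra.
Qed.
End Pictures.

(** * Moving a box joined by straight wires to the corners of a rectangle *)

Section Relocation.
Context {R : realType}.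
Notation sp := (R * R * R)%type.
Implicit Types (A B K : set sp).

Lemma contV {T : topologicalType} (f : T -> R) : continuous f ->
  (forall x, f x != 0) -> continuous (fun x => (f x)^-1).
Proof. by move=> cf f0 x; apply: cvgV => //; exact: cf. Qed.

Lemma ramp_add (a b c y : R) : a <= b -> b <= c ->
  ramp a b y + ramp b c y = ramp a c y.
Proof.
rewrite /ramp !maxEle !minEle => *.
by do 6?[case: ifPn]; rewrite -?ltNge => *; lra.
Qed.

Lemma ramp_same (a x : R) : ramp a a x = 0.
Proof. by rewrite /ramp (min_idPr _) ?subrr// le_max lexx orbT. Qed.

Lemma ramp_lip (a b y y' : R) : y <= y' -> ramp a b y' - ramp a b y <= y' - y.
Proof.
rewrite /ramp !maxEle !minEle => *.
by do 4?[case: ifPn]; rewrite -?ltNge => *; lra.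
Qed.

Lemma ramp_sum (l r y y' : R) : 0 <= l -> l <= r -> r <= 1 -> y <= y' ->
  (ramp 0 l y' - ramp 0 l y) + (ramp l r y' - ramp l r y) +
  (ramp r 1 y' - ramp r 1 y) <= y' - y.
Proof.
move=> l0 lr r1 yy; have := ramp_lip 0 1 yy.
by rewrite -!(@ramp_add 0 r 1) -?(@ramp_add 0 l r)//; lra.
Qed.

Definition wires (x0 x1 y0 y1 : R) : set sp :=
  segment (0, 0, 0) (x0, y0, 0) `|` segment (1, 0, 0) (x1, y0, 0)
  `|` segment (0, 1, 0) (x0, y1, 0) `|` segment (1, 1, 0) (x1, y1, 0).

Definition shrunk (x0 x1 y0 y1 : R) A := slot x0 x1 y0 y1 @` A `|` wires x0 x1 y0 y1.

Lemma band (m u v : R) : 0 <= m -> m <= 1 -> 0 <= u -> u <= v -> v <= 1 ->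
  0 <= m * u /\ m * u + (v - u) <= 1 - m * (1 - v) /\ 1 - m * (1 - v) <= 1.
Proof.
move=> m0 m1 u0 uv v1; have h1 : 0 <= m * u by rewrite mulr_ge0.
have h2 : 0 <= m * (1 - v) by rewrite mulr_ge0//; lra.
have h3 : 0 <= (1 - m) * (1 - v + u) by rewrite mulr_ge0//; lra.
by split=> //; split; lra.
Qed.

Section Vertical.
Variables x0 x1 y0 y1 y0' y1' : R.
Hypotheses (x0_gt0 : 0 < x0) (x01 : x0 < x1) (x1_lt1 : x1 < 1).
Hypotheses (y0_gt0 : 0 < y0) (y01 : y0 < y1) (y1_lt1 : y1 < 1).
Hypotheses (y0'_gt0 : 0 < y0') (y01' : y0' < y1') (y1'_lt1 : y1' < 1).

Ltac hyps :=
  have ? := x0_gt0; have ? := x01; have ? := x1_lt1; have ? := y0_gt0;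
  have ? := y01; have ? := y1_lt1; have ? := y0'_gt0; have ? := y01'; have ? := y1'_lt1.

(** It rises linearly from 0 to 1 on [[0, x0]], equals 1 on [[x0, x1]] and falls back to 0 on
    [[x1, 1]]. The graph of [lo] therefore consists of the two lower wires and the bottom of the
    box, and that of [hi] of the two upper wires and its top. *)
Definition mu (x : R) := Num.max 0 (Num.min 1 (Num.min (x / x0) ((1 - x) / (1 - x1)))).
Definition lo x := mu x * y0.
Definition hi x := 1 - mu x * (1 - y1).
Definition lo' x := mu x * y0'.
Definition hi' x := 1 - mu x * (1 - y1').

Lemma mu_ge0 x : 0 <= mu x. Proof. by rewrite le_max lexx. Qed.
Lemma mu_le1 x : mu x <= 1. Proof. by rewrite ge_max ler01 ge_min lexx. Qed.

Lemma lohi x : 0 <= lo x /\ lo x + (y1 - y0) <= hi x /\ hi x <= 1.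
Proof. by apply: band; [exact: mu_ge0|exact: mu_le1|exact: ltW..]. Qed.

Lemma lohi' x : 0 <= lo' x /\ lo' x + (y1' - y0') <= hi' x /\ hi' x <= 1.
Proof. by apply: band; [exact: mu_ge0|exact: mu_le1|exact: ltW..]. Qed.

Definition k1 := y0' / y0.
Definition k2 x := (hi' x - lo' x) / (hi x - lo x).
Definition k3 := (1 - y1') / (1 - y1).

Definition lam (z : R) := Num.max 0 (Num.min 1 (2 - `|z|)).

(** For heights between -1 and 1 the push is piecewise linear on each line, with slopes [k1], [k2]
    and [k3], and takes 0, [lo], [hi], 1 to 0, [lo'], [hi'], 1. The factor [lam] makes it vanish
    where the height exceeds 2 in absolute value. *)
Definition bump (p : sp) := lam p.2 * ((k1 - 1) * ramp 0 (lo p.1.1) p.1.2 +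
  (k2 p.1.1 - 1) * ramp (lo p.1.1) (hi p.1.1) p.1.2 +
  (k3 - 1) * ramp (hi p.1.1) 1 p.1.2).

Lemma mu_out x : x <= 0 \/ 1 <= x -> mu x = 0.
Proof.
hyps.
move=> h; apply/max_idPl; rewrite !ge_min; apply/orP; right; apply/orP.
case: h => h; [left|right].
  by rewrite pmulr_lle0 ?invr_gt0//.
by rewrite pmulr_lle0 ?invr_gt0; lra.
Qed.

Lemma bump_out p : outside p -> bump p = 0.
Proof.
hyps.
case: p => -[x y] z; rewrite /bump /=; have [h0 [h1 h2]] := lohi x.
have lohix : lo x <= hi x by lra.
move=> [|||] /= h.
- have m0 : mu x = 0 by apply: mu_out; left.
  rewrite /k2 /lo /hi /lo' /hi' m0 !mul0r !subr0 divr1 subrr mul0r.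
  by rewrite !ramp_same !mulr0 !addr0 mulr0.
- have m0 : mu x = 0 by apply: mu_out; right.
  rewrite /k2 /lo /hi /lo' /hi' m0 !mul0r !subr0 divr1 subrr mul0r.
  by rewrite !ramp_same !mulr0 !addr0 mulr0.
- rewrite !ramp_lo ?mulr0 ?addr0 ?mulr0//; lra.
- rewrite !ramp_hi//; try lra.
  have yn : 1 - y1 != 0 by rewrite gt_eqF//; lra.
  have yn0 : y0 != 0 by rewrite gt_eqF.
  have dn : hi x - lo x != 0 by rewrite gt_eqF//; lra.
  apply/eqP; rewrite mulf_eq0; apply/orP; right; apply/eqP.
  rewrite subr0 !mulrBl !mul1r /k2 divfK//.
  have -> : k1 * lo x = lo' x by rewrite /k1 /lo /lo'; field.
  have -> : k3 * (1 - hi x) = 1 - hi' x by rewrite /k3 /hi /hi'; field.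
  ring.
Qed.

Lemma k1_gt0 : 0 < k1. Proof. exact: divr_gt0. Qed.
Lemma k3_gt0 : 0 < k3. Proof. by hyps; apply: divr_gt0; lra. Qed.
Lemma k2_gt0 x : 0 < k2 x.
Proof. by hyps; have := lohi x; have := lohi' x => *; apply: divr_gt0; lra. Qed.

Lemma lam_ge0 z : 0 <= lam z. Proof. by rewrite le_max lexx. Qed.
Lemma lam_le1 z : lam z <= 1. Proof. by rewrite ge_max ler01 ge_min lexx. Qed.

Lemma vertical_homeo : bounded_homeo outside (fun p => (p.1.1, p.1.2 + bump p, p.2)).
Proof.
hyps.
have cmu : continuous mu by rewrite /mu; cont.
have cmux : continuous (fun p : sp => mu p.1.1).
  by move=> q; apply: (@continuous_comp _ _ _ (fun p : sp => p.1.1) mu q);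
    [exact: cont_x|exact: cmu].
have ck2 : continuous (fun p : sp => k2 p.1.1).
  apply: contM; first by rewrite /hi' /lo'; cont.
  apply: contV; first by rewrite /hi /lo; cont.
  by move=> p; have := lohi p.1.1 => *; rewrite gt_eqF//; lra.
apply: (@push_homeo _ _ _ 3).
- by rewrite /bump /ramp /lam /lo /hi; cont.
- move=> p; rewrite norm3 !lt_max -orbA => /or3P[] h.
  + apply: bump_out; have [h0|h0] := ltrP p.1.1 0.
      by apply: Or41; exact: ltW.
    by apply: Or42; rewrite ger0_norm// in h; lra.
  + apply: bump_out; have [h0|h0] := ltrP p.1.2 0.
      by apply: Or43; exact: ltW.
    by apply: Or44; rewrite ger0_norm// in h; lra.
  + rewrite /bump (_ : lam p.2 = 0) ?mul0r//; apply/max_idPl.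
    by rewrite ge_min; apply/orP; right; lra.
- move=> x y y' z yy; rewrite /bump /=; have [h0 [h1 h2]] := lohi x.
  have lohix : lo x <= hi x by lra.
  have := ramp_sum h0 lohix h2 (ltW yy).
  have := ramp_le 0 (lo x) (ltW yy); have := ramp_le (lo x) (hi x) (ltW yy).
  have := ramp_le (hi x) 1 (ltW yy); have := k2_gt0 x; have := k1_gt0; have := k3_gt0.
  have := lam_ge0 z; have := lam_le1 z; move: yy; clear.
  move: k1 (k2 x) k3 (lam z) (ramp 0 _ y) (ramp 0 _ y') (ramp (lo x) _ y) (ramp (lo x) _ y')
    (ramp (hi x) _ y) (ramp (hi x) _ y') => a b c l r1 r1' r2 r2' r3 r3'.
  move=> yy l1 l0 c0 a0 b0 d3 d2 d1 s.
  (* All slopes are at least [k], which is positive, also after mixing with slope 1 by the factor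
     [l]; so an increment [y' - y] becomes at least [k * (y' - y)]. *)
  pose k := Num.min 1 (Num.min a (Num.min b c)).
  have k0 : 0 < k by rewrite !lt_min ltr01 a0 b0 c0.
  have kle1 : k <= 1 by rewrite ge_min lexx.
  have ka : k <= a by rewrite !ge_min lexx ?orbT.
  have kb : k <= b by rewrite !ge_min lexx ?orbT.
  have kc : k <= c by rewrite !ge_min lexx ?orbT.
  have e1 : (k - 1) * (r1' - r1) <= (a - 1) * (r1' - r1) by rewrite ler_wpM2r//; lra.
  have e2 : (k - 1) * (r2' - r2) <= (b - 1) * (r2' - r2) by rewrite ler_wpM2r//; lra.
  have e3 : (k - 1) * (r3' - r3) <= (c - 1) * (r3' - r3) by rewrite ler_wpM2r//; lra.
  have e4 : (k - 1) * (y' - y) <= (k - 1) * ((r1' - r1) + (r2' - r2) + (r3' - r3)).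
    by rewrite ler_wnM2l//; lra.
  have e5 : (k - 1) * (y' - y) <= l * ((k - 1) * (y' - y)).
    have : (k - 1) * (y' - y) <= 0 by rewrite mulr_le0_ge0; lra.
    move: ((k - 1) * (y' - y)) => t t0; nra.
  have e6 : l * ((k - 1) * (y' - y)) <= l * (((a - 1) * r1' + (b - 1) * r2' + (c - 1) * r3') -
      ((a - 1) * r1 + (b - 1) * r2 + (c - 1) * r3)) by rewrite ler_wpM2l//; lra.
  have e7 : 0 < k * (y' - y) by rewrite mulr_gt0//; lra.
  lra.
- exact: bump_out.
Qed.

Lemma vertical_value x (t z : R) : 0 < x < 1 -> 0 <= t <= 1 -> -1 <= z <= 1 ->
  lo x + t * (hi x - lo x) + bump (x, lo x + t * (hi x - lo x), z) =
  lo' x + t * (hi' x - lo' x).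
Proof.
hyps.
move=> x01' /andP[t0 t1] /andP[z0 z1]; rewrite /bump /=; have [h0 [h1 h2]] := lohi x.
have -> : lam z = 1.
  have z1' : `|z| <= 1 by rewrite ler_norml z0 z1.
  rewrite /lam (_ : Num.min _ _ = 1); first by apply/max_idPr; rewrite ler01.
  by apply/min_idPl; lra.
have td : 0 <= t * (hi x - lo x) by apply: mulr_ge0 => //; lra.
have td1 : t * (hi x - lo x) <= hi x - lo x by rewrite ler_piMl//; lra.
rewrite ramp_hi//; last by lra.
rewrite ramp_in; [|lra|lra].
rewrite ramp_lo; [|lra|lra].
have dn : hi x - lo x != 0 by rewrite gt_eqF//; lra.
have yn0 : y0 != 0 by rewrite gt_eqF.
have e1 : k1 * lo x = lo' x by rewrite /k1 /lo /lo'; field.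
have e2 : k2 x * (t * (hi x - lo x)) = t * (hi' x - lo' x).
  by rewrite mulrCA /k2 divfK.
have -> : lo x + t * (hi x - lo x) - lo x = t * (hi x - lo x) by ring.
move: e2; move: (t * (hi x - lo x)) => w e2.
rewrite mulr0 addr0 mul1r !mulrBl !mul1r e2 subr0 e1; ring.
Qed.

Lemma mu_left s : 0 <= s <= 1 -> mu (s * x0) = s.
Proof.
hyps.
move=> /andP[s0 s1]; have e : s * x0 / x0 = s by rewrite mulfK// gt_eqF.
rewrite /mu e (_ : Num.min s _ = s).
  by rewrite (_ : Num.min 1 s = s) ?(max_idPr s0)//; apply/min_idPr.
by apply/min_idPl; rewrite ler_pdivlMr; nra.
Qed.

Lemma mu_right s : 0 <= s <= 1 -> mu (1 - s * (1 - x1)) = s.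
Proof.
hyps.
move=> /andP[s0 s1]; have n0 : 1 - x1 != 0 by rewrite gt_eqF//; lra.
have e : (1 - (1 - s * (1 - x1))) / (1 - x1) = s by rewrite subKr mulfK.
rewrite /mu e (_ : Num.min _ s = s).
  by rewrite (_ : Num.min 1 s = s) ?(max_idPr s0)//; apply/min_idPr.
by apply/min_idPr; rewrite ler_pdivlMr; nra.
Qed.

Lemma mu_mid x : x0 <= x <= x1 -> mu x = 1.
Proof.
hyps.
move=> /andP[h0 h1]; rewrite /mu (_ : Num.min 1 _ = 1); first by apply/max_idPr; rewrite ler01.
apply/min_idPl; rewrite le_min !ler_pdivlMr; lra.
Qed.

Lemma vertical_relocation A : A `<=` unit_box ->
  equiv_rel outside (shrunk x0 x1 y0 y1 A) (shrunk x0 x1 y0' y1' A).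
Proof.
hyps.
move=> Au; exists (fun p => (p.1.1, p.1.2 + bump p, p.2)); first exact: vertical_homeo.
pose h (p : sp) := (p.1.1, p.1.2 + bump p, p.2).
have hE x (t z : R) y y' : 0 < x < 1 -> 0 <= t <= 1 -> -1 <= z <= 1 ->
    y = lo x + t * (hi x - lo x) -> y' = lo' x + t * (hi' x - lo' x) ->
    h (x, y, z) = (x, y', z).
  by move=> xx tt zz -> ->; rewrite /h /= vertical_value.
have hcorner (p : sp) : outside p -> h p = p.
  by move=> /bump_out; case: p => -[? ?] ? e; rewrite /h e /= addr0.
have hseg p q q' : (forall s, 0 <= s <= 1 ->
    h ((1 - s) * p.1.1 + s * q.1.1, (1 - s) * p.1.2 + s * q.1.2, (1 - s) * p.2 + s * q.2) =
    ((1 - s) * p.1.1 + s * q'.1.1, (1 - s) * p.1.2 + s * q'.1.2, (1 - s) * p.2 + s * q'.2)) ->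
    h @` segment p q = segment p q'.
  move=> hs; apply/seteqP; split=> [_ [x /segmentP[s s01 ->] <-]|x /segmentP[s s01 ->]].
    by apply/segmentP; exists s => //; rewrite hs.
  by rewrite -hs//; eexists; last reflexivity; apply/segmentP; exists s.
have zz : -1 <= (0 : R) <= 1 by apply/andP; split; lra.
have t00 : 0 <= (0 : R) <= 1 by apply/andP; split; lra.
have t11 : 0 <= (1 : R) <= 1 by apply/andP; split; lra.
have s0P (s : R) : 0 <= s <= 1 -> s = 0 \/ 0 < s by move=> /andP[]; rewrite le_eqVlt => /orP[/eqP|]; [left|right].
rewrite -/h /shrunk /wires !image_setU; congr (_ `|` (_ `|` _ `|` _ `|` _)).
- rewrite !image_comp; apply: eq_imagel => p /Au [/andP[a0 a1] /andP[b0 b1] c] /=.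
  have xx : x0 <= x0 + p.1.1 * (x1 - x0) <= x1 by apply/andP; split; nra.
  have m1 := mu_mid xx.
  apply: (hE _ p.1.2) => //; first by case/andP: xx => *; apply/andP; split; lra.
  + by rewrite b0 b1.
  + by rewrite /lo /hi m1; ring.
  + by rewrite /lo' /hi' m1; ring.
- apply: hseg => s s01; have [->|s0] := s0P _ s01.
    by rewrite /= hcorner; [rewrite !mul0r|apply: Or41; rewrite /=; lra].
  have m1 := mu_left s01; case/andP: s01 => _ s1.
  rewrite /= !mulr0 !add0r; apply: (hE _ 0) => //; first by apply/andP; split; nra.
  + by rewrite /lo m1; ring.
  + by rewrite /lo' m1; ring.
- apply: hseg => s s01; have [->|s0] := s0P _ s01.
    by rewrite /= hcorner; [rewrite !mul0r|apply: Or42; rewrite /=; lra].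
  have m1 := mu_right s01; case/andP: s01 => _ s1.
  have e : (1 - s) * 1 + s * x1 = 1 - s * (1 - x1) by ring.
  rewrite /= !mulr0 !add0r e; apply: (hE _ 0) => //; first by apply/andP; split; nra.
  + by rewrite /lo m1; ring.
  + by rewrite /lo' m1; ring.
- apply: hseg => s s01; have [->|s0] := s0P _ s01.
    by rewrite /= hcorner; [rewrite !mul0r|apply: Or41; rewrite /=; lra].
  have m1 := mu_left s01; case/andP: s01 => _ s1.
  rewrite /= !mulr0 !add0r; apply: (hE _ 1) => //; first by apply/andP; split; nra.
  + by rewrite /lo /hi m1; ring.
  + by rewrite /lo' /hi' m1; ring.
- apply: hseg => s s01; have [->|s0] := s0P _ s01.
    by rewrite /= hcorner; [rewrite !mul0r|apply: Or42; rewrite /=; lra].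
  have m1 := mu_right s01; case/andP: s01 => _ s1.
  have e : (1 - s) * 1 + s * x1 = 1 - s * (1 - x1) by ring.
  rewrite /= !mulr0 !add0r e; apply: (hE _ 1) => //; first by apply/andP; split; nra.
  + by rewrite /lo /hi m1; ring.
  + by rewrite /lo' /hi' m1; ring.
Qed.
End Vertical.
End Relocation.

(** * Affine images, transport of equivalences, closedness *)

Section Moves.
Context {R : realType}.
Notation sp := (R * R * R)%type.
Implicit Types (A B F K : set sp) (p q r : sp).

Lemma image_segment (h : sp -> sp) p q : (forall s : R, 0 <= s <= 1 ->
    h ((1 - s) * p.1.1 + s * q.1.1, (1 - s) * p.1.2 + s * q.1.2, (1 - s) * p.2 + s * q.2) =
    ((1 - s) * (h p).1.1 + s * (h q).1.1, (1 - s) * (h p).1.2 + s * (h q).1.2,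
     (1 - s) * (h p).2 + s * (h q).2)) ->
  h @` segment p q = segment (h p) (h q).
Proof.
move=> hs; apply/seteqP; split=> [_ [x /segmentP[s s01 ->] <-]|x /segmentP[s s01 ->]].
  by apply/segmentP; exists s => //; rewrite hs.
by rewrite -hs//; eexists; last reflexivity; apply/segmentP; exists s.
Qed.

Lemma slot_segment (x0 x1 y0 y1 : R) p q :
  slot x0 x1 y0 y1 @` segment p q = segment (slot x0 x1 y0 y1 p) (slot x0 x1 y0 y1 q).
Proof. by apply: image_segment => s _; rewrite /slot /=; congr (_, _, _); ring. Qed.

Lemma reflect_segment p q :
  reflect_diag @` segment p q = segment (reflect_diag p) (reflect_diag q).
Proof. by apply: image_segment. Qed.

Lemma slot_slot (x0 x1 y0 y1 u0 u1 v0 v1 : R) p :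
  slot x0 x1 y0 y1 (slot u0 u1 v0 v1 p) =
  slot (x0 + u0 * (x1 - x0)) (x0 + u1 * (x1 - x0)) (y0 + v0 * (y1 - y0)) (y0 + v1 * (y1 - y0)) p.
Proof. by rewrite /slot /=; congr (_, _, _); ring. Qed.

Lemma cont_slot (x0 x1 y0 y1 : R) : continuous (slot x0 x1 y0 y1).
Proof. by rewrite /slot; cont. Qed.

Lemma cont_reflect : continuous (@reflect_diag R).
Proof. by rewrite /reflect_diag; cont. Qed.

Lemma reflectK : involutive (@reflect_diag R).
Proof. by move=> [[x y] z]. Qed.

Lemma reflect_image A : reflect_diag @` (reflect_diag @` A) = A.
Proof.
rewrite image_comp (_ : reflect_diag \o reflect_diag = id) ?image_id//.
by apply/funext => p; exact: reflectK.
Qed.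

Definition slot_inv (x0 x1 y0 y1 : R) (p : sp) : sp :=
  ((p.1.1 - x0) / (x1 - x0), (p.1.2 - y0) / (y1 - y0), p.2).

(** Conjugation by the affine map of the unit square onto the rectangle: whatever does not lie over
    the open rectangle stays fixed. *)
Lemma equiv_slot (x0 x1 y0 y1 : R) F A B : x0 < x1 -> y0 < y1 ->
  (forall p, F p -> [\/ p.1.1 <= x0, x1 <= p.1.1, p.1.2 <= y0 | y1 <= p.1.2]) ->
  equiv_rel outside A B ->
  equiv_rel F (slot x0 x1 y0 y1 @` A) (slot x0 x1 y0 y1 @` B).
Proof.
move=> x01 y01 Fo; have xn : x1 - x0 != 0 by rewrite gt_eqF//; lra.
have yn : y1 - y0 != 0 by rewrite gt_eqF//; lra.
apply: (@equiv_conj _ _ _ _ _ _ (slot_inv x0 x1 y0 y1)).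
- exact: cont_slot.
- by rewrite /slot_inv; cont.
- by move=> [[x y] z]; rewrite /slot /slot_inv /=; congr (_, _, _); field.
- by move=> [[x y] z]; rewrite /slot /slot_inv /=; congr (_, _, _); field.
- move=> [[x y] z] /Fo /= [] h; [apply: Or41|apply: Or42|apply: Or43|apply: Or44].
  + by move: h; rewrite gerDl pmulr_lle0//; lra.
  + by move: h; rewrite -lerBlDl -{1}(mul1r (x1 - x0)) ler_pM2r//; lra.
  + by move: h; rewrite gerDl pmulr_lle0//; lra.
  + by move: h; rewrite -lerBlDl -{1}(mul1r (y1 - y0)) ler_pM2r//; lra.
Qed.

Lemma equiv_reflect A B : equiv_rel outside A B ->
  equiv_rel outside (reflect_diag @` A) (reflect_diag @` B).
Proof.
apply: (@equiv_conj _ _ _ _ _ _ reflect_diag); try exact: cont_reflect; try exact: reflectK.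
by move=> [[x y] z] [] /= h; [apply: Or43|apply: Or44|apply: Or41|apply: Or42].
Qed.

Lemma reflect_shrunk (x0 x1 y0 y1 : R) A :
  reflect_diag @` shrunk x0 x1 y0 y1 A = shrunk y0 y1 x0 x1 (reflect_diag @` A).
Proof.
rewrite /shrunk /wires !image_setU !reflect_segment !image_comp /reflect_diag /=.
congr (_ `|` (_ `|` _)); exact: setUAC.
Qed.

Lemma unit_box_reflect A : A `<=` unit_box -> reflect_diag @` A `<=` unit_box.
Proof. by move=> Au _ [p /Au [a b c] <-]; split. Qed.

(** The box is moved in the y-direction, then in the x-direction, which is the y-direction after a
    reflection in the diagonal. *)
Lemma relocation (x0 x1 y0 y1 x0' x1' y0' y1' : R) A :
  0 < x0 -> x0 < x1 -> x1 < 1 -> 0 < y0 -> y0 < y1 -> y1 < 1 ->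
  0 < x0' -> x0' < x1' -> x1' < 1 -> 0 < y0' -> y0' < y1' -> y1' < 1 ->
  A `<=` unit_box ->
  equiv_rel outside (shrunk x0 x1 y0 y1 A) (shrunk x0' x1' y0' y1' A).
Proof.
move=> ? ? ? ? ? ? ? ? ? ? ? ? Au.
apply: (@equiv_trans _ _ _ (shrunk x0 x1 y0' y1' A)).
  exact: vertical_relocation.
rewrite -(reflect_image (shrunk x0 x1 y0' y1' A)) -(reflect_image (shrunk x0' x1' y0' y1' A)).
apply: equiv_reflect; rewrite !reflect_shrunk; apply: vertical_relocation => //.
exact: unit_box_reflect.
Qed.

Lemma compact_segment p q : compact (segment p q).
Proof.
have -> : segment p q = (fun s : R => ((1 - s) * p.1.1 + s * q.1.1,
   (1 - s) * p.1.2 + s * q.1.2, (1 - s) * p.2 + s * q.2)) @` `[0, 1].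
  apply/seteqP; split=> [x /segmentP[s s01 ->]|_ [s s01 <-]].
    by exists s => //; rewrite /= in_itv.
  by apply/segmentP; exists s => //; move: s01; rewrite /= in_itv.
apply: continuous_compact; last exact: segment_compact.
by apply: continuous_subspaceT; cont.
Qed.

Lemma closed_segment p q : closed (segment p q).
Proof. exact: compact_closed hausdorff3 (@compact_segment _ _). Qed.

Lemma compact_tangle A : tangle A -> compact A.
Proof.
move=> [cA Au]; apply: (subclosed_compact cA (@compact_ball3 R 1)) => p /Au [].
by rewrite /= norm3_le !ler_norml => /andP[a b] /andP[c d] ->; rewrite andbT; apply/andP; split; apply/andP; split; lra.
Qed.

Lemma closed_slot (x0 x1 y0 y1 : R) A : tangle A -> closed (slot x0 x1 y0 y1 @` A).
Proof.
move=> tA; apply: compact_closed hausdorff3 _; apply: continuous_compact.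
  by apply: continuous_subspaceT; exact: cont_slot.
exact: compact_tangle.
Qed.

Lemma closed_segs (l : seq (qpt * qpt)) : closed (segs_set l : set sp).
Proof.
elim: l => [|s l IH] /=; first exact: closed0.
by apply: closedU => //; exact: closed_segment.
Qed.

Lemma closed_boxes (env : nat -> set sp) l : (forall i, tangle (env i)) ->
  closed (boxes_set env l).
Proof.
move=> tenv; elim: l => [|b l IH] /=; first exact: closed0.
by apply: closedU => //; exact: closed_slot.
Qed.

Lemma closed_realize (env : nat -> set sp) P : (forall i, tangle (env i)) ->
  closed (realize env P).
Proof. by move=> tenv; apply: closedU; [exact: closed_segs|exact: closed_boxes]. Qed.

Lemma closed_outside : closed (outside : set sp).
Proof.
have -> : outside = [set p : sp | p.1.1 <= 0] `|` [set p | 1 <= p.1.1] `|`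
    [set p | p.1.2 <= 0] `|` [set p | 1 <= p.1.2].
  apply/seteqP; split=> p; first by case=> ?; [left; left; left|left; left; right|left; right|right].
  by case=> [[[?|?]|?]|?]; [apply: Or41|apply: Or42|apply: Or43|apply: Or44].
do 3?apply: closedU.
- by apply: (@closed_comp _ _ (fun p : sp => p.1.1) [set x | x <= 0]); [move=> ? _; exact: cont_x|exact: closed_le].
- by apply: (@closed_comp _ _ (fun p : sp => p.1.1) [set x | 1 <= x]); [move=> ? _; exact: cont_x|exact: closed_ge].
- by apply: (@closed_comp _ _ (fun p : sp => p.1.2) [set x | x <= 0]); [move=> ? _; exact: cont_y|exact: closed_le].
- by apply: (@closed_comp _ _ (fun p : sp => p.1.2) [set x | 1 <= x]); [move=> ? _; exact: cont_y|exact: closed_ge].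
Qed.

Lemma cross_dot (d e : sp) : cross d e = (0, 0, 0) ->
  [/\ dot d d * e.1.1 = dot e d * d.1.1, dot d d * e.1.2 = dot e d * d.1.2 &
      dot d d * e.2 = dot e d * d.2].
Proof.
case: d e => -[d1 d2] d3 [[e1 e2] e3] [] /= h1 h2 h3; rewrite /dot /=.
have k1 : d2 * e3 = d3 * e2 by lra.
have k2 : d3 * e1 = d1 * e3 by lra.
have k3 : d1 * e2 = d2 * e1 by lra.
split.
- transitivity (d1 * d1 * e1 + d2 * (d2 * e1) + d3 * (d3 * e1)); first by ring.
  by rewrite -k3 k2; ring.
- transitivity (d1 * (d1 * e2) + d2 * d2 * e2 + d3 * (d3 * e2)); first by ring.
  by rewrite k3 -k1; ring.
- transitivity (d1 * (d1 * e3) + d2 * (d2 * e3) + d3 * d3 * e3); first by ring.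
  by rewrite -k2 k1; ring.
Qed.

Lemma segment_split p q r (t : R) : 0 <= t <= 1 ->
  r = ((1 - t) * p.1.1 + t * q.1.1, (1 - t) * p.1.2 + t * q.1.2, (1 - t) * p.2 + t * q.2) ->
  segment p q = segment p r `|` segment r q.
Proof.
move=> /andP[t0 t1] rE; apply/seteqP; split=> [x|x].
  move=> /segmentP[s /andP[s0 s1] ->]; have [st|ts] := leP s t.
    left; apply/segmentP; have [tz|tn] := eqVneq t 0.
      exists 0; first by rewrite lexx ler01.
      by have -> : s = 0 by [apply/eqP; rewrite eq_le s0 -tz st]; rewrite !mul0r !addr0.
    exists (s / t).
      by rewrite divr_ge0//= ler_pdivrMr ?mul1r// lt_neqAle eq_sym tn.
    by rewrite rE /=; congr (_, _, _); field.
  right; apply/segmentP; have tn : 1 - t != 0 by rewrite gt_eqF//; lra.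
  exists ((s - t) / (1 - t)).
    by rewrite divr_ge0 ?ler_pdivrMr; lra.
  by rewrite rE /=; congr (_, _, _); field.
case=> /segmentP[s s01 ->]; case/andP: s01 => s0 s1; apply/segmentP.
  exists (s * t); first by rewrite mulr_ge0//= mulr_ile1.
  by rewrite rE /=; congr (_, _, _); ring.
exists (t + s * (1 - t)).
  have h1 : 0 <= s * (1 - t) by rewrite mulr_ge0//; lra.
  have h2 : 0 <= (1 - s) * (1 - t) by rewrite mulr_ge0//; lra.
  by apply/andP; split; lra.
by rewrite rE /=; congr (_, _, _); ring.
Qed.
End Moves.

(** * Scripts of moves on pictures and their soundness *)

Section Scripts.
Context {R : realType}.
Notation sp := (R * R * R)%type.

Definition qzero : qpt := (frac 0 1, frac 0 1, frac 0 1).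

Definition between (p q r : qpt) :=
  let d := qvsub q p in let e := qvsub r p in
  [&& pt_eq (qcross d e) qzero, qlt (frac 0 1) (qdot d d), qle (frac 0 1) (qdot e d) &
      qle (qdot e d) (qdot d d)].

(** The picture [P] does not obstruct the replacement of the segment [p q] by
    the segments [p r] and [r q]; with [rel], neither does the complement of the
    open unit square. *)
Definition bendable (rel : bool) (P : picture) (p q r : qpt) :=
  between p q r ||
  [&& pt_neq (qcross (qvsub q p) (qvsub r p)) qzero, rel ==> tri_out p q r,
      all (fun s => tri_seg p q r s.1 s.2) P.1 & all (fun b => tri_box p q r b.1) P.2].

Definition bend rel (P : picture) (p r q : qpt) : option picture :=
  if rm_seg p q P.1 is Some l then
    if bendable rel (l, P.2) p q r then Some ((p, r) :: (r, q) :: l, P.2) else None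
  else None.

Definition unbend rel (P : picture) (p r q : qpt) : option picture :=
  if rm_seg p r P.1 is Some l1 then
    if rm_seg r q l1 is Some l then
      if bendable rel (l, P.2) p q r then Some ((p, q) :: l, P.2) else None
    else None
  else None.

(** The rectangle [b] shrinks or moves inside the rectangle [c], to whose
    corners it is connected by segments. *)
Definition corners (b : qrect) : seq qpt :=
  let o := frac 0 1 in
  [:: (b.1.1.1, b.1.2, o); (b.1.1.2, b.1.2, o); (b.1.1.1, b.2, o); (b.1.1.2, b.2, o)].

Definition rect_eq (b c : qrect) :=
  [&& qeq b.1.1.1 c.1.1.1, qeq b.1.1.2 c.1.1.2, qeq b.1.2 c.1.2 & qeq b.2 c.2].

Definition rect_in (b c : qrect) :=
  [&& qlt c.1.1.1 b.1.1.1, qlt b.1.1.1 b.1.1.2, qlt b.1.1.2 c.1.1.2, qlt c.1.2 b.1.2,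
      qlt b.1.2 b.2 & qlt b.2 c.2].

Fixpoint rm_segs (ps qs : seq qpt) l : option (seq (qpt * qpt)) :=
  match ps, qs with
  | p :: ps', q :: qs' => if rm_seg p q l is Some l' then rm_segs ps' qs' l' else None
  | _, _ => Some l
  end.

Fixpoint rm_box (b : qrect) (i : nat) (l : seq (qrect * nat)) : option (seq (qrect * nat)) :=
  if l is c :: l' then
    if rect_eq b c.1 && (i == c.2) then Some l' else omap (cons c) (rm_box b i l')
  else None.

Definition misses (c : qrect) (u v w z : Q) :=
  [|| qle u c.1.1.1 && qle v c.1.1.1, qle c.1.1.2 u && qle c.1.1.2 v,
      qle w c.1.2 && qle z c.1.2 | qle c.2 w && qle c.2 z].

Definition reloc (rel : bool) (P : picture) (c : qrect) (i : nat) (b b' : qrect) : option picture :=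
  let o := frac 0 1 in let e := frac 1 1 in
  if rm_segs (corners c) (corners b) P.1 is Some l then
    if rm_box b i P.2 is Some m then
      if [&& rect_in b c, rect_in b' c,
          rel ==> [&& qle o c.1.1.1, qle c.1.1.2 e, qle o c.1.2 & qle c.2 e],
          all (fun s => misses c s.1.1.1 s.2.1.1 s.1.1.2 s.2.1.2) l &
          all (fun d => misses c d.1.1.1.1 d.1.1.1.2 d.1.1.2 d.1.2) m]
      then Some (zip (corners c) (corners b') ++ l, (b', i) :: m) else None
    else None
  else None.

Inductive move := Bend of qpt & qpt & qpt | Unbend of qpt & qpt & qpt
  | Reloc of qrect & nat & qrect & qrect | Simplify of seq qpt.

Definition neighbours (r : qpt) (l : seq (qpt * qpt)) : seq qpt :=
  flatten [seq if pt_eq s.1 r then [:: s.2] else if pt_eq s.2 r then [:: s.1] else [::] | s <- l].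

Definition unbend_at rel (P : picture) (r : qpt) : option picture :=
  if neighbours r P.1 is [:: p; q] then unbend rel P p r q else None.

Fixpoint first_some A B (f : A -> option B) (l : seq A) : option B :=
  if l is a :: l' then if f a is Some b then Some b else first_some f l' else None.

(** Greedily straightens the polygonal lines, keeping the vertices [ks]. *)
Fixpoint simplify (n : nat) rel (ks : seq qpt) (P : picture) : picture :=
  if n is n'.+1 then
    let vs := [seq r <- flatten [seq [:: s.1; s.2] | s <- P.1] | ~~ has (pt_eq r) ks] in
    if first_some (unbend_at rel P) vs is Some P' then simplify n' rel ks P' else P
  else P.

Definition step rel (m : move) (P : picture) : option picture :=
  match m with
  | Bend p r q => bend rel P p r q
  | Unbend p r q => unbend rel P p r q
  | Reloc c i b b' => reloc rel P c i b b'
  | Simplify ks => Some (simplify 50 rel ks P)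
  end.

Fixpoint run rel (ms : seq move) (P : picture) : option picture :=
  if ms is m :: ms' then if step rel m P is Some P' then run rel ms' P' else None
  else Some P.

Definition subpicture (P P' : picture) :=
  all (fun s => has (fun s' => seg_eq s.1 s.2 s'.1 s'.2) P'.1) P.1 &&
  all (fun b => has (fun b' => rect_eq b.1 b'.1 && (b.2 == b'.2)) P'.2) P.2.

(** Both pictures are transformed, and the results are compared as sets of unoriented segments and
    of boxes, so that scripts may meet in a common picture. *)
Definition script_check rel ms P ms' P' :=
  match run rel ms P, run rel ms' P' with
  | Some P1, Some P2 => subpicture P1 P2 && subpicture P2 P1
  | _, _ => false
  end.

Definition fixed (rel : bool) : set sp := if rel then outside else set0.

Lemma closed_fixed rel : closed (fixed rel).
Proof. by case: rel; [exact: closed_outside|exact: closed0]. Qed.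

Lemma ptR_zero : ptR qzero = (0, 0, 0) :> sp.
Proof. by rewrite /ptR /= frac0. Qed.

Lemma betweenP p q r : between p q r ->
  segment (ptR p) (ptR q) = segment (ptR p) (ptR r) `|` segment (ptR r) (ptR q) :> set sp.
Proof.
case/and4P => /(@pt_eqR R); rewrite qcrossR !qvsubR ptR_zero => /cross_dot [h1 h2 h3].
move=> /(@qR_lt R); rewrite frac0 !qdotR !qvsubR => d0.
move=> /(@qR_le R); rewrite frac0 !qdotR !qvsubR => e0.
move=> /(@qR_le R); rewrite !qdotR !qvsubR => e1.
set D := dot _ _ in h1 h2 h3 d0 e1; set E := dot _ _ in h1 h2 h3 e0 e1.
have Dn : D != 0 by rewrite gt_eqF.
apply: (@segment_split _ _ _ _ (E / D)).
  by rewrite divr_ge0 ?(ltW d0)//= ler_pdivrMr// mul1r.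
have aux a b c : D * (c - a) = E * (b - a) -> c = (1 - E / D) * a + E / D * b.
  move=> h; apply: (mulfI Dn); transitivity (D * (c - a) + D * a); first by ring.
  by rewrite h; field.
by rewrite [LHS]surjective_pairing [X in (X, _)]surjective_pairing; congr (_, _, _); apply: aux.
Qed.

Lemma allP_seg (f : qpt * qpt -> bool) l x : all f l -> (segs_set l : set sp) x ->
  exists2 s, f s & segment (ptR s.1) (ptR s.2) x.
Proof.
elim: l => //= s l IH /andP[fs fl] [sx|/(IH fl) //]; by exists s.
Qed.

Lemma allP_box env (f : qrect * nat -> bool) l x : all f l -> (boxes_set env l : set sp) x ->
  exists2 b, f b & (qslot b.1 @` env b.2) x.
Proof.
elim: l => //= s l IH /andP[fs fl] [sx|/(IH fl) //]; by exists s.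
Qed.

Section Soundness.
Variable env : nat -> set sp.
Hypothesis env_tangle : forall i, tangle (env i).

Lemma bendableP rel P p q r : bendable rel P p q r ->
  equiv_rel (fixed rel) (realize env P `|` segment (ptR p) (ptR q))
    (realize env P `|` (segment (ptR p) (ptR r) `|` segment (ptR r) (ptR q))).
Proof.
case/orP => [/betweenP ->|]; first exact: equiv_refl.
case/and4P => ncol out okseg okbox; apply: triangle_move.
- exact: closed_fixed.
- exact: closed_realize.
- by rewrite /noncollinear -!qvsubR -qcrossR; apply/eqP => e; apply: (pt_neqR (R := R) ncol); rewrite e ptR_zero.
move=> x tx [|[/(allP_seg okseg) [s ok sx]|/(allP_box okbox) [b ok bx]]].
- case: rel out => [out|_ []]; exact: tri_outP out tx.
- exact: (tri_segP ok tx sx).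
- by apply: (tri_boxP _ ok tx bx); case: (env_tangle b.2).
Qed.

Lemma realize_cons p q l m : realize env ((p, q) :: l, m) =
  realize env (l, m) `|` segment (ptR p) (ptR q).
Proof. by rewrite /realize /= [RHS]setUC setUA. Qed.

Lemma realize_rm p q l l' m : rm_seg p q l = Some l' ->
  realize env (l, m) = realize env (l', m) `|` segment (ptR p) (ptR q).
Proof. by rewrite /realize /= => /(@rm_segP R) ->; rewrite [RHS]setUC setUA. Qed.

Lemma bend_sound rel P p r q P' : bend rel P p r q = Some P' ->
  equiv_rel (fixed rel) (realize env P) (realize env P').
Proof.
rewrite /bend; case: P => l m /=; case E : (rm_seg p q l) => [l1|//].
case: ifP => // ok [<-]; rewrite (realize_rm _ E) !realize_cons -setUA.
by rewrite [X in equiv_rel _ _ (_ `|` X)]setUC; exact: bendableP ok.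
Qed.

Lemma unbend_sound rel P p r q P' : unbend rel P p r q = Some P' ->
  equiv_rel (fixed rel) (realize env P) (realize env P').
Proof.
rewrite /unbend; case: P => l m /=; case E : (rm_seg p r l) => [l1|//].
case E' : (rm_seg r q l1) => [l2|//].
case: ifP => // ok [<-]; rewrite (realize_rm _ E) (realize_rm _ E') realize_cons -setUA.
rewrite [X in equiv_rel _ (_ `|` X)]setUC; apply: equiv_sym; exact: bendableP ok.
Qed.

Lemma rm_segsP ps qs l l' : rm_segs ps qs l = Some l' ->
  segs_set l = segs_set (zip ps qs) `|` segs_set l' :> set sp.
Proof.
elim: ps qs l => [|p ps IH] [|q qs] l //=; try by [case=> ->; rewrite set0U].
by case E : (rm_seg p q l) => [l1|//] /IH h; rewrite (rm_segP E) h setUA.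
Qed.

Lemma rect_eqP b c : rect_eq b c -> qslot b = qslot c :> (sp -> sp).
Proof.
by case/and4P => /(@qR_eqb R) e1 /(@qR_eqb R) e2 /(@qR_eqb R) e3 /(@qR_eqb R) e4;
  rewrite /qslot e1 e2 e3 e4.
Qed.

Lemma rm_boxP b i l l' : rm_box b i l = Some l' ->
  boxes_set env l = qslot b @` env i `|` boxes_set env l'.
Proof.
elim: l l' => //= c l IH l'; case: ifPn => [/andP[/rect_eqP -> /eqP -> [->] //]|_].
case E : (rm_box b i l) => [l1|//] [<-] /=.
by rewrite (IH _ E) !setUA [X in X `|` _]setUC.
Qed.

(** A box wired to the corners of a rectangle is a [shrunk] tangle seen in relative coordinates, so
    that [relocation] applies inside the rectangle. *)
Lemma slot_frac (c0 c1 d0 d1 b0 b1 e0 e1 : R) A : c0 < c1 -> d0 < d1 ->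
  slot c0 c1 d0 d1 @` shrunk ((b0 - c0) / (c1 - c0)) ((b1 - c0) / (c1 - c0))
     ((e0 - d0) / (d1 - d0)) ((e1 - d0) / (d1 - d0)) A =
  slot b0 b1 e0 e1 @` A `|` (segment (c0, d0, 0) (b0, e0, 0) `|`
    segment (c1, d0, 0) (b1, e0, 0) `|` segment (c0, d1, 0) (b0, e1, 0) `|`
    segment (c1, d1, 0) (b1, e1, 0)).
Proof.
move=> c01 d01; have cn : c1 - c0 != 0 by rewrite gt_eqF//; lra.
have dn : d1 - d0 != 0 by rewrite gt_eqF//; lra.
rewrite /shrunk /wires !image_setU !slot_segment image_comp.
have fx u : c0 + (u - c0) / (c1 - c0) * (c1 - c0) = u by field.
have fy u : d0 + (u - d0) / (d1 - d0) * (d1 - d0) = u by field.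
have fc0 : c0 + 1 * (c1 - c0) = c1 by ring.
have fd0 : d0 + 1 * (d1 - d0) = d1 by ring.
rewrite [in slot c0 _ _ _ (0, 0, 0)]/slot /slot /= !fx !fy !mul0r !addr0 !fc0 !fd0.
congr (_ `|` _); apply: eq_imagel => p _ /=.
by congr (_, _, _); field.
Qed.

Lemma misses_seg (c : qrect) (u v : qpt) (p : sp) : misses c u.1.1 v.1.1 u.1.2 v.1.2 ->
  segment (ptR u) (ptR v) p ->
  [\/ p.1.1 <= qR c.1.1.1, qR c.1.1.2 <= p.1.1, p.1.2 <= qR c.1.2 | qR c.2 <= p.1.2] :> Prop.
Proof.
move=> h /segmentP[s /andP[s0 s1] ->] /=.
case/or4P: h => /andP[/(@qR_le R) a /(@qR_le R) b]; [apply: Or41|apply: Or42|apply: Or43|apply: Or44]; nra.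
Qed.

Lemma misses_box (c b : qrect) i (p : sp) : misses c b.1.1.1 b.1.1.2 b.1.2 b.2 ->
  (qslot b @` env i) p ->
  [\/ p.1.1 <= qR c.1.1.1, qR c.1.1.2 <= p.1.1, p.1.2 <= qR c.1.2 | qR c.2 <= p.1.2] :> Prop.
Proof.
move=> h [q /(proj2 (env_tangle i)) [/andP[x0 x1] /andP[y0 y1] _] <-] /=.
case/or4P: h => /andP[/(@qR_le R) a /(@qR_le R) b']; [apply: Or41|apply: Or42|apply: Or43|apply: Or44]; nra.
Qed.

Lemma rect_inR (b c : qrect) : rect_in b c -> 
  [/\ qR c.1.1.1 < qR b.1.1.1 :> R, qR b.1.1.1 < qR b.1.1.2 :> R &
      qR b.1.1.2 < qR c.1.1.2 :> R] /\
  [/\ qR c.1.2 < qR b.1.2 :> R, qR b.1.2 < qR b.2 :> R & qR b.2 < qR c.2 :> R].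
Proof. by case/and5P => /(@qR_lt R) ? /(@qR_lt R) ? /(@qR_lt R) ? /(@qR_lt R) ? /andP[/(@qR_lt R) ? /(@qR_lt R) ?]. Qed.

Lemma corners_set (c b : qrect) : segs_set (zip (corners c) (corners b)) =
  segment (qR c.1.1.1, qR c.1.2, 0) (qR b.1.1.1, qR b.1.2, 0) `|`
  segment (qR c.1.1.2, qR c.1.2, 0) (qR b.1.1.2, qR b.1.2, 0) `|`
  segment (qR c.1.1.1, qR c.2, 0) (qR b.1.1.1, qR b.2, 0) `|`
  segment (qR c.1.1.2, qR c.2, 0) (qR b.1.1.2, qR b.2, 0) :> set sp.
Proof. by rewrite /= setU0 !setUA /ptR /= frac0. Qed.

Lemma reloc_sound rel P c i b b' P' : reloc rel P c i b b' = Some P' ->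
  equiv_rel (fixed rel) (realize env P) (realize env P').
Proof.
rewrite /reloc; case: P => l m.
case E : (rm_segs _ _ _) => [l1|//]; case E' : (rm_box _ _ _) => [m1|//].
case: ifP => // /and5P[bc b'c relc okl okm] [<-].
have [[h1 h2 h3] [h4 h5 h6]] := rect_inR bc.
have [[h1' h2' h3'] [h4' h5' h6']] := rect_inR b'c.
pose K := segs_set l1 `|` boxes_set env m1 : set sp.
have c01 : qR c.1.1.1 < qR c.1.1.2 :> R by lra.
have d01 : qR c.1.2 < qR c.2 :> R by lra.
have dx : 0 < qR c.1.1.2 - qR c.1.1.1 :> R by lra.
have dy : 0 < qR c.2 - qR c.1.2 :> R by lra.
have -> : realize env (l, m) = K `|` (qslot b @` env i `|` segs_set (zip (corners c) (corners b))).
  by rewrite /realize /= (rm_segsP E) (rm_boxP E') /K setUACA setUC [X in _ `|` X]setUC.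
have -> : realize env (zip (corners c) (corners b') ++ l1, (b', i) :: m1) =
    K `|` (qslot b' @` env i `|` segs_set (zip (corners c) (corners b'))).
  have cat_set l2 : segs_set (l2 ++ l1) = segs_set l2 `|` segs_set l1 :> set sp.
    by elim: l2 => [|s l2 IH] /=; rewrite ?set0U// IH setUA.
  by rewrite /realize cat_set /= /K setUACA setUC [X in _ `|` X]setUC.
rewrite !corners_set /qslot -!(slot_frac _ _ _ _ (env i) c01 d01).
apply: equiv_frame; apply: equiv_slot => //.
  move=> p [|[/(allP_seg okl) [s ok sx]|/(allP_box okm) [d ok dx']]]; last 2 first.
  - exact: misses_seg ok sx.
  - exact: misses_box ok dx'.
  rewrite /fixed; case: rel relc => //= /and4P[/(@qR_le R) e1 /(@qR_le R) e2 /(@qR_le R) e3 /(@qR_le R) e4].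
  move: e1 e2 e3 e4; rewrite !frac0 !frac1 => e1 e2 e3 e4.
  by case=> h; [apply: Or41|apply: Or42|apply: Or43|apply: Or44]; lra.
clear E E'; by apply: relocation; rewrite ?ltr_pM2r ?ltr_pdivrMr ?divr_gt0 ?invr_gt0 ?ltr_pdivlMr ?mul1r; try lra;
  case: (env_tangle i).
Qed.

Lemma first_someP A B (f : A -> option B) l b : first_some f l = Some b ->
  exists a, f a = Some b.
Proof.
elim: l => //= a l IH; case E : (f a) => [b'|//] [<-]; by exists a.
Qed.

Lemma simplify_sound n rel ks P :
  equiv_rel (fixed rel) (realize env P) (realize env (simplify n rel ks P)).
Proof.
elim: n P => [|n IH] P /=; first exact: equiv_refl.
case E : (first_some _ _) => [P'|]; last exact: equiv_refl.
apply: equiv_trans (IH P'); case: (first_someP E) => r; rewrite /unbend_at.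
by case: neighbours => [|p [|q []]] //; exact: unbend_sound.
Qed.

Lemma step_sound rel m P P' : step rel m P = Some P' ->
  equiv_rel (fixed rel) (realize env P) (realize env P').
Proof.
rewrite /step; case: m => [p r q|p r q|c i b b'|ks].
- exact: bend_sound.
- exact: unbend_sound.
- exact: reloc_sound.
- by move=> /Some_inj <-; exact: simplify_sound.
Qed.

Lemma run_sound rel ms P P' : run rel ms P = Some P' ->
  equiv_rel (fixed rel) (realize env P) (realize env P').
Proof.
elim: ms P => [|m ms IH] P /=; first by move=> [<-]; exact: equiv_refl.
case E : (step rel m P) => [P1|//] /IH; apply: equiv_trans; exact: step_sound E.
Qed.

Lemma has_seg_sub p q l : has (fun s => seg_eq p q s.1 s.2) l ->
  segment (ptR p) (ptR q) `<=` (segs_set l : set sp).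
Proof.
elim: l => //= s l IH /orP[/(@seg_eqR R) -> | /IH h] x; first by left.
by move=> /h; right.
Qed.

Lemma has_box_sub b i l : has (fun c => rect_eq b c.1 && (i == c.2)) l ->
  qslot b @` env i `<=` boxes_set env l.
Proof.
elim: l => //= c l IH /orP[/andP[/rect_eqP -> /eqP ->] | /IH h] x; first by left.
by move=> /h; right.
Qed.

Lemma subpictureP P P' : subpicture P P' -> realize env P `<=` realize env P'.
Proof.
case/andP => hs hb x [/(allP_seg hs) [s /has_seg_sub h /h]|/(allP_box hb) [b /has_box_sub h /h]].
  by left.
by right.
Qed.

(** The check concerns only rational coordinates and box numbers. For concrete pictures it is
    decided by evaluation, while the tangles in the boxes remain arbitrary. *)
Lemma script_equiv rel ms P ms' P' : script_check rel ms P ms' P' ->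
  equiv_rel (fixed rel) (realize env P) (realize env P').
Proof.
rewrite /script_check; case E : (run rel ms P) => [P1|//].
case E' : (run rel ms' P') => [P2|//] /andP[h1 h2].
apply: equiv_trans (run_sound E) _; apply: equiv_sym.
rewrite (_ : realize env P1 = realize env P2); first exact: run_sound E'.
by apply/seteqP; split; exact: subpictureP.
Qed.
End Soundness.
End Scripts.

(** * Pictures of sums, crossings and wires *)

Section PictureAlgebra.
Context {R : realType}.
Notation sp := (R * R * R)%type.

Definition qp (n x y : nat) (z : int) : qpt :=
  (frac x n, frac y n, QArith_base.Qmake (Z_of_int z) xH).
Definition qrct (n a b c d : nat) : qrect := (frac a n, frac b n, frac c n, frac d n).

Definition slot_pt (b : qrect) (p : qpt) : qpt :=
  (qadd b.1.1.1 (qmul p.1.1 (qsub b.1.1.2 b.1.1.1)),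
   qadd b.1.2 (qmul p.1.2 (qsub b.2 b.1.2)), p.2).
Definition slot_rect (b c : qrect) : qrect :=
  (qadd b.1.1.1 (qmul c.1.1.1 (qsub b.1.1.2 b.1.1.1)),
   qadd b.1.1.1 (qmul c.1.1.2 (qsub b.1.1.2 b.1.1.1)),
   qadd b.1.2 (qmul c.1.2 (qsub b.2 b.1.2)), qadd b.1.2 (qmul c.2 (qsub b.2 b.1.2))).
Definition map_slot b (P : picture) : picture :=
  ([seq (slot_pt b s.1, slot_pt b s.2) | s <- P.1],
   [seq (slot_rect b c.1, c.2) | c <- P.2]).
Definition padd (P P' : picture) : picture := (P.1 ++ P'.1, P.2 ++ P'.2).

Fixpoint polyline (l : seq qpt) : seq (qpt * qpt) :=
  if l is p :: l' then if l' is q :: _ then (p, q) :: polyline l' else [::] else [::].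

Definition unit_rect := qrct 1 0 1 0 1.
Definition pbox i : picture := ([::], [:: (unit_rect, i)]).
Definition pshrink b i : picture := (zip (corners unit_rect) (corners b), [:: (b, i)]).
Definition parcs : picture :=
  (polyline [:: qp 6 0 6 0; qp 6 3 4 0; qp 6 6 6 0] ++
   polyline [:: qp 6 0 0 0; qp 6 3 2 0; qp 6 6 0 0], [::]).
Definition pcross (z : int) : picture :=
  (polyline [:: qp 2 0 0 0; qp 2 1 1 z; qp 2 2 2 0] ++
   polyline [:: qp 2 0 2 0; qp 2 1 1 (- z); qp 2 2 0 0], [::]).
Definition pwires : picture := (zip (corners unit_rect) (corners (qrct 4 1 3 1 3)), [::]).
Definition phsum P P' : picture :=
  padd (map_slot (qrct 4 1 2 1 3) P) (padd (map_slot (qrct 4 2 3 1 3) P') pwires).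
Definition pvsum P P' : picture :=
  padd (map_slot (qrct 4 1 3 1 2) P) (padd (map_slot (qrct 4 1 3 2 3) P') pwires).

(** The vertical sum, with [A] below [B]. *)
Definition vsum (A B : set sp) : set sp :=
  reflect_diag @` hsum (reflect_diag @` A) (reflect_diag @` B).

Lemma ptR_qp n x y z : (0 < n)%N -> ptR (qp n x y z) = (x%:R / n%:R, y%:R / n%:R, z%:~R) :> sp.
Proof.
move=> n0; rewrite /ptR /= !fracR//; congr (_, _, _).
rewrite /qR /zR /= divr1; congr intmul; lia.
Qed.

Lemma qslot_qrct n a b c d : (0 < n)%N -> qslot (qrct n a b c d) =
  slot (a%:R / n%:R) (b%:R / n%:R) (c%:R / n%:R) (d%:R / n%:R) :> (sp -> sp).
Proof. by move=> n0; rewrite /qslot /= !fracR. Qed.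

Lemma slot_ptR b p : ptR (slot_pt b p) = qslot b (ptR p) :> sp.
Proof. by rewrite /ptR /qslot /slot /= !qRD !qRM !qRB. Qed.

Lemma slot_rectR b c : qslot (slot_rect b c) = qslot b \o qslot c :> (sp -> sp).
Proof. by apply/funext => p; rewrite /qslot /= slot_slot !qRD !qRM !qRB. Qed.

Variable env : nat -> set sp.

Lemma realize_map_slot b P : realize env (map_slot b P) = qslot b @` realize env P.
Proof.
rewrite /realize image_setU /=; congr (_ `|` _).
  elim: P.1 => [|s l IH] /=; first by rewrite image_set0.
  by rewrite image_setU slot_segment IH !slot_ptR.
elim: P.2 => [|c l IH] /=; first by rewrite image_set0.
by rewrite image_setU IH slot_rectR image_comp.
Qed.

Lemma realize_padd P P' : realize env (padd P P') = realize env P `|` realize env P'.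
Proof.
have h1 l l' : segs_set (l ++ l') = segs_set l `|` segs_set l' :> set sp.
  by elim: l => [|s l IH] /=; rewrite ?set0U// IH setUA.
have h2 l l' : boxes_set env (l ++ l') = boxes_set env l `|` boxes_set env l'.
  by elim: l => [|s l IH] /=; rewrite ?set0U// IH setUA.
by rewrite /realize h1 h2 setUACA.
Qed.

Lemma slot_id : slot 0 1 0 1 = id :> (sp -> sp).
Proof. by apply/funext => -[[x y] z]; rewrite /slot /= subr0 !mulr1 !add0r. Qed.

Lemma realize_pbox i : realize env (pbox i) = env i.
Proof.
rewrite /realize /= set0U setU0 /unit_rect qslot_qrct// !divr1.
by rewrite slot_id image_id.
Qed.

Lemma realize_wires b : realize env (zip (corners unit_rect) (corners b), [::]) =
  wires (qR b.1.1.1) (qR b.1.1.2) (qR b.1.2) (qR b.2).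
Proof.
rewrite /realize /= !setU0 !setUA /ptR /= frac0.
by rewrite !fracR// !divr1.
Qed.

Lemma realize_pshrink b i : realize env (pshrink b i) =
  shrunk (qR b.1.1.1) (qR b.1.1.2) (qR b.1.2) (qR b.2) (env i).
Proof.
by rewrite /shrunk -realize_wires setUC /realize /= !setU0.
Qed.

Lemma realize_parcs : realize env parcs = horizontal_arcs R.
Proof.
rewrite /realize /horizontal_arcs [segs_set _]/= !ptR_qp// !setU0 !setUA.
by rewrite !mul0r; congr (_ `|` _ `|` _ `|` _); congr segment; congr (_, _, _); field.
Qed.

Lemma realize_pcross z : realize env (pcross z) = crossing z%:~R.
Proof.
rewrite /realize /crossing [segs_set _]/= !ptR_qp// !setU0 !setUA.
by rewrite !mul0r !mulrNz; congr (_ `|` _ `|` _ `|` _); congr segment; congr (_, _, _); field.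
Qed.

Lemma hsumE (A B : set sp) : hsum A B = slot (1 / 4) (2 / 4) (1 / 4) (3 / 4) @` A `|`
  (slot (2 / 4) (3 / 4) (1 / 4) (3 / 4) @` B `|` wires (1 / 4) (3 / 4) (1 / 4) (3 / 4)).
Proof.
rewrite /hsum /wires -!setUA; congr (_ `|` (_ `|` (_ `|` _))).
- by apply: eq_imagel => p _; rewrite /slot; congr (_, _, _); field.
- by apply: eq_imagel => p _; rewrite /slot; congr (_, _, _); field.
- rewrite setUCA (segment_sym (3 / 4, 1 / 4, 0)) (segment_sym (3 / 4, 3 / 4, 0)).
  by rewrite setUCA.
Qed.

Lemma realize_phsum P P' : realize env (phsum P P') = hsum (realize env P) (realize env P').
Proof.
rewrite /phsum !realize_padd !realize_map_slot realize_wires !qslot_qrct//.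
by rewrite hsumE /= !fracR.
Qed.

Lemma vsumE (A B : set sp) : vsum A B = slot (1 / 4) (3 / 4) (1 / 4) (2 / 4) @` A `|`
  (slot (1 / 4) (3 / 4) (2 / 4) (3 / 4) @` B `|` wires (1 / 4) (3 / 4) (1 / 4) (3 / 4)).
Proof.
rewrite /vsum hsumE /wires !image_setU.
have h x0 x1 y0 y1 (C : set sp) :
    reflect_diag @` (slot x0 x1 y0 y1 @` (reflect_diag @` C)) = slot y0 y1 x0 x1 @` C.
  by rewrite !image_comp; apply: eq_imagel => -[[x y] z] _.
rewrite !h; congr (_ `|` (_ `|` _)).
by rewrite !reflect_segment /reflect_diag /= (setUAC (segment _ _)).
Qed.

Lemma realize_pvsum P P' : realize env (pvsum P P') = vsum (realize env P) (realize env P').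
Proof.
rewrite /pvsum !realize_padd !realize_map_slot realize_wires !qslot_qrct//.
by rewrite vsumE /= !fracR.
Qed.
End PictureAlgebra.

(** * Identities between tangles proved by scripts *)

Notation "A =~ B" := (equiv_rel outside A B) (at level 70, no associativity).

Section TangleMoves.
Context {R : realType}.
Notation sp := (R * R * R)%type.
Implicit Types A B C X Y Z : set sp.

Definition env3 X Y Z (i : nat) : set sp := if i is j.+1 then if j is _.+1 then Z else Y else X.

Lemma script_tangle ms ms' X Y Z P P' : tangle X -> tangle Y -> tangle Z ->
  script_check true ms P ms' P' -> realize (env3 X Y Z) P =~ realize (env3 X Y Z) P'.
Proof. by move=> tX tY tZ; apply: script_equiv => -[|[|i]]. Qed.

Lemma tangle_set0 : tangle (set0 : set sp).
Proof. by split=> //; exact: closed0. Qed.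

Lemma script_knot ms ms' P P' : script_check true ms P ms' P' ->
  realize (fun=> set0 : set sp) P =~ realize (fun=> set0) P'.
Proof. by apply: script_equiv => _; exact: tangle_set0. Qed.

Definition shr X := shrunk (1 / 4) (3 / 4) (1 / 4) (3 / 4) X.

Definition pshr P := padd (map_slot (qrct 4 1 3 1 3) P) pwires.

Lemma realize_pshr (env : nat -> set sp) P : realize env (pshr P) = shr (realize env P).
Proof.
by rewrite realize_padd realize_map_slot realize_wires !qslot_qrct// /shr /shrunk /= !fracR.
Qed.

Lemma realize_pshrunk (env : nat -> set sp) n a b c d i : (0 < n)%N ->
  realize env (pshrink (qrct n a b c d) i) =
  shrunk (a%:R / n%:R) (b%:R / n%:R) (c%:R / n%:R) (d%:R / n%:R) (env i).
Proof. by move=> n0; rewrite realize_pshrink /= !fracR. Qed.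

Definition realizeE := (@realize_padd R, @realize_phsum R, @realize_pvsum R, @realize_parcs R,
  @realize_pcross R, @realize_pbox R, realize_pshr).

Lemma arcs_shr : horizontal_arcs R =~ shr (horizontal_arcs R).
Proof.
have := @script_knot [:: Simplify [::];
    Bend (qp 6 3 2 0) (qp 4 3 1 0) (qp 1 1 0 0);
    Unbend (qp 1 0 0 0) (qp 6 3 2 0) (qp 4 3 1 0);
    Bend (qp 6 3 4 0) (qp 4 3 3 0) (qp 1 1 1 0);
    Unbend (qp 1 0 1 0) (qp 6 3 4 0) (qp 4 3 3 0)] [:: Simplify [::]]
  parcs (pshr parcs).
by rewrite !realizeE; apply; vm_cast_no_check (erefl true).
Qed.

Lemma crossing_shr (z : int) : z = 1 \/ z = -1 -> crossing z%:~R =~ shr (crossing z%:~R : set sp).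
Proof.
have h z' := @script_knot [:: Simplify [::]] [:: Simplify [::]] (pcross z') (pshr (pcross z')).
case=> ->; [have := h 1|have := h (-1)]; rewrite !realizeE; apply;
  vm_cast_no_check (erefl true).
Qed.

(** The second Reidemeister move: both strands are straightened and then bent to the shape of the
    horizontal arcs. *)
Definition r2_script := [:: Simplify [::];
  Bend (qp 1 0 1 0) (qp 6 3 4 0) (qp 4 3 3 0);
  Unbend (qp 6 3 4 0) (qp 4 3 3 0) (qp 1 1 1 0);
  Bend (qp 1 0 0 0) (qp 6 3 2 0) (qp 4 3 1 0);
  Unbend (qp 6 3 2 0) (qp 4 3 1 0) (qp 1 1 0 0)].

Lemma crossing_cancel : hsum (crossing 1) (crossing (-1)) =~ horizontal_arcs R.
Proof.
have := @script_knot r2_script [::] (phsum (pcross 1) (pcross (-1))) parcs.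
by rewrite !realizeE; apply; vm_cast_no_check (erefl true).
Qed.

Lemma crossing_cancelV : hsum (crossing (-1)) (crossing 1) =~ horizontal_arcs R.
Proof.
have := @script_knot r2_script [::] (phsum (pcross (-1)) (pcross 1)) parcs.
by rewrite !realizeE; apply; vm_cast_no_check (erefl true).
Qed.

Lemma arcs_hsum_shr X : tangle X -> hsum (horizontal_arcs R) (shr X) =~ shr X.
Proof.
move=> tX; apply: (@equiv_trans _ _ _ (shrunk (9 / 16) (11 / 16) (6 / 16) (10 / 16) X)); last first.
  by apply: relocation; try lra; case: tX.
have := @script_tangle [:: Simplify [::]] [::] X X X (phsum parcs (pshr (pbox 0)))
  (pshrink (qrct 16 9 11 6 10) 0).
by rewrite !realizeE realize_pshrunk//; apply=> //; vm_cast_no_check (erefl true).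
Qed.

Lemma hsum_arcs_shr X : tangle X -> hsum (shr X) (horizontal_arcs R) =~ shr X.
Proof.
move=> tX; apply: (@equiv_trans _ _ _ (shrunk (5 / 16) (7 / 16) (6 / 16) (10 / 16) X)); last first.
  by apply: relocation; try lra; case: tX.
have := @script_tangle [:: Simplify [::]] [::] X X X (phsum (pshr (pbox 0)) parcs)
  (pshrink (qrct 16 5 7 6 10) 0).
by rewrite !realizeE realize_pshrunk//; apply=> //; vm_cast_no_check (erefl true).
Qed.

(** The rectangles are chosen so that [X] and [Z] sit in the same places for both bracketings; only
    the box of [Y] has to be relocated. *)
Lemma hsumA_shr X Y Z : tangle X -> tangle Y -> tangle Z ->
  hsum (hsum (shr X) (shr Y)) (shrunk (9 / 16) (11 / 16) (6 / 16) (10 / 16) Z) =~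
  hsum (shrunk (5 / 16) (7 / 16) (6 / 16) (10 / 16) X) (hsum (shr Y) (shr Z)).
Proof.
move=> tX tY tZ.
have := @script_tangle [:: Simplify [::];
    Bend (qp 64 23 28 0) (qp 8 3 3 0) (qp 64 25 28 0);
    Bend (qp 64 27 28 0) (qp 8 5 3 0) (qp 64 41 28 0);
    Bend (qp 64 23 36 0) (qp 8 3 5 0) (qp 64 25 36 0);
    Bend (qp 64 27 36 0) (qp 8 5 5 0) (qp 64 41 36 0);
    Reloc (qrct 8 3 5 3 5) 1 (qrct 64 25 27 28 36) (qrct 64 37 39 28 36)]
  [:: Simplify [::];
    Bend (qp 64 23 28 0) (qp 8 3 3 0) (qp 64 37 28 0);
    Bend (qp 64 39 28 0) (qp 8 5 3 0) (qp 64 41 28 0);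
    Bend (qp 64 23 36 0) (qp 8 3 5 0) (qp 64 37 36 0);
    Bend (qp 64 39 36 0) (qp 8 5 5 0) (qp 64 41 36 0)] X Y Z
  (phsum (phsum (pshr (pbox 0)) (pshr (pbox 1))) (pshrink (qrct 16 9 11 6 10) 2))
  (phsum (pshrink (qrct 16 5 7 6 10) 0) (phsum (pshr (pbox 1)) (pshr (pbox 2)))).
by rewrite !realizeE !realize_pshrunk//; apply=> //; vm_cast_no_check (erefl true).
Qed.

(** A drawing of [hsum (hook X) Y] to which the diagram around a vertex of the tree is brought
    later, in [pnode_join]. *)
Definition join_picture : picture :=
  (polyline [:: qp 128 0 0 0; qp 128 45 54 0] ++
   polyline [:: qp 128 45 58 0; qp 128 45 64 1; qp 128 64 64 1; qp 128 72 58 0] ++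
   polyline [:: qp 128 47 54 0; qp 128 64 56 (- 1); qp 128 64 80 (- 1); qp 128 32 80 (- 1);
     qp 128 0 128 0] ++
   polyline [:: qp 128 47 58 0; qp 128 64 56 1; qp 128 72 54 0] ++
   polyline [:: qp 128 88 54 0; qp 128 128 0 0] ++ polyline [:: qp 128 88 58 0; qp 128 128 128 0],
   [:: (qrct 128 45 47 54 58, 0%N); (qrct 128 72 88 54 58, 1%N)]).

Lemma join_shr X Y : tangle X -> tangle Y ->
  hsum (vsum (hsum (shr X) (crossing (-1))) (crossing 1))
    (shrunk (8 / 32) (24 / 32) (11 / 32) (13 / 32) Y) =~
  realize (env3 X Y Y) join_picture.
Proof.
move=> tX tY.
have := @script_tangle [:: Simplify [::];
    Bend (qp 1 0 1 0) (qp 8 2 5 (- 1)) (qp 16 6 9 (- 1));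
    Bend (qp 4 2 3 0) (qp 2 1 1 1) (qp 64 36 29 0);
    Bend (qp 128 45 58 0) (qp 128 45 64 1) (qp 4 2 3 0);
    Unbend (qp 128 45 64 1) (qp 4 2 3 0) (qp 2 1 1 1);
    Bend (qp 16 6 9 (- 1)) (qp 8 4 5 (- 1)) (qp 128 47 54 0);
    Unbend (qp 8 2 5 (- 1)) (qp 16 6 9 (- 1)) (qp 8 4 5 (- 1));
    Bend (qp 128 47 58 0) (qp 16 8 7 1) (qp 64 36 27 0);
    Bend (qp 8 4 5 (- 1)) (qp 16 8 7 (- 1)) (qp 128 47 54 0)] [::] X Y Y
  (phsum (pvsum (phsum (pshr (pbox 0)) (pcross (-1))) (pcross 1)) (pshrink (qrct 32 8 24 11 13) 1))
  join_picture.
by rewrite !realizeE !realize_pshrunk//; apply=> //; vm_cast_no_check (erefl true).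
Qed.

(** A small box whose wires have been twisted by a half turn about the diagonal: the SW and NE wires
    lie on the axis, one of the other two wires passes in front of the box and one behind it. It
    arises in [shrunk_twist]. *)
Definition twisted_picture : picture :=
  (polyline [:: qp 64 0 0 0; qp 64 31 31 0] ++ polyline [:: qp 64 33 33 0; qp 64 64 64 0] ++
   polyline [:: qp 64 31 33 0; qp 64 30 34 0; qp 64 30 34 8; qp 64 34 30 12; qp 64 52 12 0;
     qp 64 64 0 0] ++
   polyline [:: qp 64 33 31 0; qp 64 34 30 0; qp 64 34 30 (- 8); qp 64 30 34 (- 12); qp 64 12 52 0;
     qp 64 0 64 0],
   [:: (qrct 64 31 33 31 33, 0%N)]).

(** Sliding the front and the back wire of [twisted_picture] relative to the box relates them to the
    three crossings around [X] on the left-hand side. *)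
Lemma vsum_twisted X : tangle X ->
  vsum (hsum (vsum (shrunk (3 / 8) (5 / 8) (2 / 8) (6 / 8) X) (crossing 1)) (crossing (-1))) (crossing 1) =~
  shrunk (12 / 64) (44 / 64) (7 / 64) (39 / 64) (realize (env3 X X X) twisted_picture).
Proof.
move=> tX; pose Q0 := qrct 64 12 44 7 39.
have := @script_tangle [:: Simplify [::];
    Bend (qp 128 55 47 0) (qp 64 27 24 8) (qp 16 9 6 1);
    Unbend (qp 64 27 24 8) (qp 16 9 6 1) (qp 1 1 0 0);
    Bend (qp 1 0 1 0) (qp 64 29 22 (- 8)) (qp 8 4 5 (- 1));
    Unbend (qp 64 29 22 (- 8)) (qp 8 4 5 (- 1)) (qp 128 57 45 0)] [:: Simplify [::]] X X X
  (pvsum (phsum (pvsum (pshrink (qrct 8 3 5 2 6) 0) (pcross 1)) (pcross (-1))) (pcross 1))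
  (padd (map_slot Q0 twisted_picture) (zip (corners unit_rect) (corners Q0), [::])).
rewrite !realizeE !realize_pshrunk// realize_map_slot realize_wires qslot_qrct// /= !fracR//.
by apply=> //; vm_cast_no_check (erefl true).
Qed.
End TangleMoves.

(** * Tangles with a collar and the laws of the horizontal sum *)

Section Nice.
Context {R : realType}.
Notation sp := (R * R * R)%type.
Implicit Types A B C X Y Z : set sp.

Lemma unit_box_segment p q : unit_box p -> unit_box q -> segment p q `<=` (unit_box : set sp).
Proof.
move=> [/andP[a1 a2] /andP[a3 a4] /andP[a5 a6]] [/andP[b1 b2] /andP[b3 b4] /andP[b5 b6]] x.
move=> /segmentP[s /andP[s0 s1] ->].
by split=> /=; apply/andP; split; nra.
Qed.

Lemma tangle_segment p q : unit_box p -> unit_box q -> tangle (segment p q : set sp).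
Proof. by move=> hp hq; split; [exact: closed_segment|exact: unit_box_segment]. Qed.

Lemma tangleU A B : tangle A -> tangle B -> tangle (A `|` B).
Proof.
move=> [cA uA] [cB uB]; split; first exact: closedU.
by move=> x [/uA|/uB].
Qed.

Lemma unit_boxP (x y z : R) : 0 <= x -> x <= 1 -> 0 <= y -> y <= 1 -> -1 <= z -> z <= 1 ->
  unit_box (x, y, z).
Proof. by move=> *; split; apply/andP. Qed.

Lemma tangle_slot (x0 x1 y0 y1 : R) A :
  0 <= x0 -> x0 <= x1 -> x1 <= 1 -> 0 <= y0 -> y0 <= y1 -> y1 <= 1 ->
  tangle A -> tangle (slot x0 x1 y0 y1 @` A).
Proof.
move=> ? ? ? ? ? ? tA; split; first exact: closed_slot.
move=> _ [p /(proj2 tA) [/andP[? ?] /andP[? ?] ?] <-].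
by split=> //=; apply/andP; split; nra.
Qed.

Lemma tangle_shrunk (x0 x1 y0 y1 : R) A :
  0 <= x0 -> x0 <= x1 -> x1 <= 1 -> 0 <= y0 -> y0 <= y1 -> y1 <= 1 ->
  tangle A -> tangle (shrunk x0 x1 y0 y1 A).
Proof.
move=> ? ? ? ? ? ? tA; apply: tangleU; first exact: tangle_slot.
by do ?apply: tangleU; apply: tangle_segment; apply: unit_boxP; lra.
Qed.

Lemma tangle_shr A : tangle A -> tangle (shr A).
Proof. by apply: tangle_shrunk; lra. Qed.

Definition juxtaposed A B := slot 0 (1 / 2) 0 1 @` A `|` slot (1 / 2) 1 0 1 @` B.

(** A sum is a shrunk set joined to the corners by straight wires, so it is [nice] whatever its
    summands are. *)
Lemma hsum_shr A B : hsum A B = shr (juxtaposed A B).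
Proof.
rewrite hsumE /shr /shrunk setUA /juxtaposed image_setU !image_comp.
congr (_ `|` _ `|` _); apply: eq_imagel => p _; rewrite /= slot_slot; congr slot; by field.
Qed.

Lemma tangle_juxtaposed A B : tangle A -> tangle B -> tangle (juxtaposed A B).
Proof. by move=> tA tB; apply: tangleU; apply: tangle_slot => //; lra. Qed.

Lemma tangle_hsum A B : tangle A -> tangle B -> tangle (hsum A B).
Proof. by move=> tA tB; rewrite hsum_shr; apply: tangle_shr; exact: tangle_juxtaposed. Qed.

Lemma tangle_reflect A : tangle A -> tangle (reflect_diag @` A).
Proof.
move=> tA; split; last by move=> _ [p /(proj2 tA) [a b c] <-]; split.
apply: compact_closed hausdorff3 _; apply: continuous_compact; last exact: compact_tangle.
by apply: continuous_subspaceT; exact: cont_reflect.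
Qed.

Lemma tangle_vsum A B : tangle A -> tangle B -> tangle (vsum A B).
Proof. by move=> tA tB; apply: tangle_reflect; apply: tangle_hsum; exact: tangle_reflect. Qed.

Lemma tangle_arcs : tangle (horizontal_arcs R).
Proof.
by do ?apply: tangleU; apply: tangle_segment; apply: unit_boxP; lra.
Qed.

Lemma tangle_crossing (z : R) : -1 <= z <= 1 -> tangle (crossing z).
Proof.
move=> /andP[? ?].
by do ?apply: tangleU; apply: tangle_segment; apply: unit_boxP; lra.
Qed.

Lemma hsum_equiv A A' B B' : tangle A -> tangle A' -> tangle B -> tangle B' ->
  A =~ A' -> B =~ B' -> hsum A B =~ hsum A' B'.
Proof.
move=> [_ uA] [_ uA'] [_ uB] [_ uB'] AA BB.
have Wo p : wires (1 / 4) (3 / 4) (1 / 4) (3 / 4) p ->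
    [\/ p.1.1 <= 1 / 4, 3 / 4 <= p.1.1, p.1.2 <= 1 / 4 | 3 / 4 <= p.1.2 :> R].
  by case=> [[[]|]|] /segmentP[s /andP[s0 s1] -> /=];
    [apply: Or41|apply: Or42|apply: Or41|apply: Or42]; lra.
apply: (@equiv_trans _ _ _ (hsum A' B)); rewrite !hsumE.
  rewrite setUC [X in _ =~ X]setUC; apply: equiv_frame; apply: equiv_slot => //; try lra.
  move=> p [[]|[]].
  - by move=> h; apply: Or41; lra.
  - by move=> h; apply: Or42; lra.
  - by move=> h; apply: Or43; lra.
  - by move=> h; apply: Or44; lra.
  - by move=> [q /uB [/andP[? ?] _ _] <-] /=; apply: Or42; lra.
  - move=> /Wo [] h; [apply: Or41|apply: Or42|apply: Or43|apply: Or44]; lra.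
rewrite setUCA [X in _ =~ X]setUCA setUC [X in _ =~ X]setUC.
apply: equiv_frame; apply: equiv_slot => //; try lra.
move=> p [[]|[]].
- by move=> h; apply: Or41; lra.
- by move=> h; apply: Or42; lra.
- by move=> h; apply: Or43; lra.
- by move=> h; apply: Or44; lra.
- by move=> [q /uA' [/andP[? ?] _ _] <-] /=; apply: Or41; lra.
- move=> /Wo [] h; [apply: Or41|apply: Or42|apply: Or43|apply: Or44]; lra.
Qed.

Lemma vsum_equiv A A' B B' : tangle A -> tangle A' -> tangle B -> tangle B' ->
  A =~ A' -> B =~ B' -> vsum A B =~ vsum A' B'.
Proof.
move=> tA tA' tB tB' hA hB; apply: equiv_reflect.
by apply: hsum_equiv; try exact: tangle_reflect; exact: equiv_reflect.
Qed.

Lemma shrunk_equiv (x0 x1 y0 y1 : R) A A' : 0 < x0 -> x0 < x1 -> x1 < 1 ->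
  0 < y0 -> y0 < y1 -> y1 < 1 ->
  A =~ A' -> shrunk x0 x1 y0 y1 A =~ shrunk x0 x1 y0 y1 A'.
Proof.
move=> *; rewrite /shrunk ![_ `|` wires _ _ _ _]setUC; apply: equiv_frame.
apply: equiv_slot => // p [|].
  by case=> h; [apply: Or41|apply: Or42|apply: Or43|apply: Or44]; lra.
by case=> [[[]|]|] /segmentP[s /andP[s0 s1] -> /=];
  [apply: Or41|apply: Or42|apply: Or41|apply: Or42]; nra.
Qed.

(** A [tangle] may behave badly near the corners of the square. A nice one can be pulled inside,
    with straight wires to the corners, which is what the unit and associativity laws of the sum
    use. *)
Definition nice A := tangle A /\ A =~ shr A.

(** Shrinking twice is shrinking once to a smaller square, up to subdividing the wires, and the size
    of the square does not matter by [relocation]. *)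
Lemma nice_shr A : tangle A -> nice (shr A).
Proof.
move=> tA; split; first exact: tangle_shr.
apply: (@equiv_trans _ _ _ (shrunk (3 / 8) (5 / 8) (3 / 8) (5 / 8) A)).
  by apply: relocation; try lra; case: tA.
have := @script_tangle R [::] [:: Simplify [::]] A A A (pshrink (qrct 8 3 5 3 5) 0)
  (pshr (pshr (pbox 0))).
by rewrite !realizeE realize_pshrunk//; apply=> //; vm_cast_no_check (erefl true).
Qed.

Lemma nice_hsum A B : tangle A -> tangle B -> nice (hsum A B).
Proof. by move=> tA tB; rewrite hsum_shr; apply: nice_shr; exact: tangle_juxtaposed. Qed.

Lemma nice_reflect A : nice A -> nice (reflect_diag @` A).
Proof.
move=> [tA nA]; split; first exact: tangle_reflect.
by rewrite /shr -reflect_shrunk; exact: equiv_reflect.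
Qed.

Lemma nice_vsum A B : tangle A -> tangle B -> nice (vsum A B).
Proof. by move=> tA tB; apply: nice_reflect; apply: nice_hsum; exact: tangle_reflect. Qed.

Lemma nice_arcs : nice (horizontal_arcs R).
Proof. split; [exact: tangle_arcs|exact: arcs_shr]. Qed.

Lemma nice_crossing1 : nice (crossing (1 : R)).
Proof. by split; [apply: tangle_crossing; lra|have := @crossing_shr R 1; apply; left]. Qed.

Lemma nice_crossingN1 : nice (crossing (- 1 : R)).
Proof.
by split; [apply: tangle_crossing; lra|have := @crossing_shr R (-1); rewrite mulrNz; apply; right].
Qed.

Lemma nice_shrunk (x0 x1 y0 y1 : R) A : 0 < x0 -> x0 < x1 -> x1 < 1 ->
  0 < y0 -> y0 < y1 -> y1 < 1 -> nice A -> A =~ shrunk x0 x1 y0 y1 A.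
Proof.
move=> ? ? ? ? ? ? [[cA uA] nA]; apply: equiv_trans nA _.
by apply: relocation => //; lra.
Qed.

Lemma arcs_hsum X : nice X -> hsum (horizontal_arcs R) X =~ X.
Proof.
move=> [tX nX]; apply: equiv_trans (equiv_sym nX).
apply: equiv_trans (arcs_hsum_shr tX).
by apply: hsum_equiv => //; [exact: tangle_arcs..|exact: tangle_shr|exact: equiv_refl].
Qed.

Lemma hsum_arcs X : nice X -> hsum X (horizontal_arcs R) =~ X.
Proof.
move=> [tX nX]; apply: equiv_trans (equiv_sym nX).
apply: equiv_trans (hsum_arcs_shr tX).
by apply: hsum_equiv => //; [exact: tangle_shr|exact: tangle_arcs..|exact: equiv_refl].
Qed.

Lemma hsumA X Y Z : nice X -> nice Y -> nice Z ->
  hsum (hsum X Y) Z =~ hsum X (hsum Y Z).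
Proof.
move=> nX nY nZ; have [tX _] := nX; have [tY _] := nY; have [tZ _] := nZ.
have th A B : tangle A -> tangle B -> tangle (hsum A B) := @tangle_hsum A B.
have ts A := @tangle_shr A.
have tZ' : tangle (shrunk (9 / 16) (11 / 16) (6 / 16) (10 / 16) Z) by apply: tangle_shrunk => //; lra.
have tX' : tangle (shrunk (5 / 16) (7 / 16) (6 / 16) (10 / 16) X) by apply: tangle_shrunk => //; lra.
apply: equiv_trans (equiv_trans (hsumA_shr tX tY tZ) (equiv_sym _)).
  apply: hsum_equiv; auto; last by apply: nice_shrunk => //; lra.
  by apply: hsum_equiv; auto; [exact: (proj2 nX)|exact: (proj2 nY)].
apply: hsum_equiv; auto; first by apply: nice_shrunk => //; lra.
by apply: hsum_equiv; auto; [exact: (proj2 nY)|exact: (proj2 nZ)].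
Qed.

Lemma equiv_nice A B : tangle B -> A =~ B -> nice A -> nice B.
Proof.
move=> tB AB [tA nA]; split=> //; apply: equiv_trans (equiv_sym AB) (equiv_trans nA _).
by apply: shrunk_equiv => //; lra.
Qed.
End Nice.

(** * Half turns about the diagonal *)

Section RotateDiag.
Context {R : realType}.
Notation sp := (R * R * R)%type.
Implicit Types A B C X Y Z : set sp.

(** A rotation of space about the line through the SW and NE corners: [reflect_diag] together with a
    change of all crossings. *)
Definition rotate_diag (p : sp) : sp := (p.1.2, p.1.1, - p.2).

(** The first coordinate runs along the diagonal, the axis of the turn. The scale puts points
    outside the open square at norm at least 10, where [twist_map] is the identity, and the central
    square [31/64, 33/64]^2 with heights between -1 and 1 inside the unit ball, where it is a half
    turn. *)
Definition twist_coord (p : sp) : sp :=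
  (16 * (p.1.1 + p.1.2 - 1), 16 * (p.1.1 - p.1.2), p.2 / 4).
Definition twist_point (q : sp) : sp :=
  (1 / 2 + (q.1.1 + q.1.2) / 32, 1 / 2 + (q.1.1 - q.1.2) / 32, 4 * q.2).
Definition square_twist (p : sp) : sp := twist_point (twist_map (twist_coord p)).

Lemma twist_coordK : cancel twist_coord twist_point.
Proof. by move=> -[[x y] z]; rewrite /twist_point /=; congr (_, _, _); field. Qed.

Lemma twist_pointK : cancel twist_point twist_coord.
Proof. by move=> -[[x y] z]; rewrite /twist_coord /=; congr (_, _, _); field. Qed.

Lemma cont_twist_coord : continuous twist_coord.
Proof. by rewrite /twist_coord; cont. Qed.

Lemma cont_twist_point : continuous twist_point.
Proof. by rewrite /twist_point; cont. Qed.

Lemma outside_twist p : outside p -> 10 <= norm2 (twist_coord p).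
Proof.
rewrite /outside /= => h; rewrite -[X in X <= _](@ger0_norm R)// -sqrtr_sqr ler_sqrt; last first.
  by rewrite !addr_ge0 ?sqr_ge0.
rewrite /=; move: p.1.1 p.1.2 p.2 (sqr_ge0 (p.2 / 4)) h => x y z; move: ((z / 4) ^+ 2) => w w0.
have e : (16 * (x + y - 1)) ^+ 2 + (16 * (x - y)) ^+ 2 =
  512 * ((x - 1 / 2) ^+ 2 + (y - 1 / 2) ^+ 2) by field.
have half (v : R) : v <= 0 \/ 1 <= v -> 1 / 4 <= (v - 1 / 2) ^+ 2.
  by case=> hv; rewrite expr2; nra.
rewrite e => h; have h' : 1 / 4 <= (x - 1 / 2) ^+ 2 \/ 1 / 4 <= (y - 1 / 2) ^+ 2.
  by case: h => h; [left|left|right|right]; apply: half; [left|right|left|right].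
by move: (sqr_ge0 (x - 1 / 2)) (sqr_ge0 (y - 1 / 2)); rewrite expr2; case: h' => h' *; lra.
Qed.

Lemma square_twist_equiv A : A =~ square_twist @` A.
Proof.
have := @equiv_conj R [set p | 10 <= norm2 p] outside (twist_coord @` A)
  (twist_map @` (twist_coord @` A)) twist_point twist_coord cont_twist_point cont_twist_coord
  twist_pointK twist_coordK.
rewrite !image_comp (_ : twist_point \o twist_coord = id) ?image_id; last first.
  by apply/funext => p /=; exact: twist_coordK.
apply; last by exists twist_map; [exact: twist_homeo|rewrite image_comp].
by move=> p /outside_twist; rewrite /= twist_pointK.
Qed.

Lemma norm2_axis (d u : R) : d = 0 \/ u = 0 -> norm2 (d, u, 0) = `|d + u|.
Proof. by case=> ->; rewrite /norm2 /= expr0n /= ?add0r ?addr0 sqrtr_sqr. Qed.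

Lemma square_twist_in x y z : 31 / 64 <= x <= 33 / 64 -> 31 / 64 <= y <= 33 / 64 ->
  -1 <= z <= 1 -> square_twist (x, y, z) = rotate_diag (x, y, z).
Proof.
move=> /andP[? ?] /andP[? ?] /andP[? ?]; rewrite /square_twist twist_in.
  by rewrite /twist_point /rotate_diag /=; congr (_, _, _); field.
rewrite -[X in _ <= X](@ger0_norm R)// -sqrtr_sqr ler_sqrt ?sqr_ge0//.
rewrite /twist_coord /=; set d := x + y - 1; set u := x - y.
have [? ?] : - (1 / 32) <= d /\ d <= 1 / 32 by rewrite /d; lra.
have [? ?] : - (1 / 32) <= u /\ u <= 1 / 32 by rewrite /u; lra.
nra.
Qed.

Definition cross_axis (t : R) (z : R) : sp := (1 / 2 + t / 32, 1 / 2 - t / 32, z).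

(** On the antidiagonal the norm is [r], so the image traces the twisting path itself; as that path
    is polygonal, wires on the antidiagonal become polygons. *)
Lemma square_twist_axis t (r := `|t|) : t != 0 ->
  square_twist (cross_axis t 0) =
  cross_axis (path_re r * Num.sg t) (4 * (path_im r * Num.sg t)).
Proof.
move=> t0; rewrite /square_twist /twist_coord /cross_axis /=.
have -> : 16 * (1 / 2 + t / 32 + (1 / 2 - t / 32) - 1) = 0 by field.
have -> : 16 * (1 / 2 + t / 32 - (1 / 2 - t / 32)) = t by field.
rewrite !mul0r /twist_map norm2_axis ?add0r; last by left.
rewrite -/r /= !mulr0 subr0 addr0 /twist_point /=.
have rn : r != 0 by rewrite /r normr_eq0.
have -> : Num.sg t = t / r by rewrite [in RHS](numEsg t) mulfK.
by congr (_, _, _); field.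
Qed.

(** The image of a piece of the anti-diagonal on which the twisting path is affine. *)
Lemma square_twist_piece (e r s a b a' b' : R) : e = 1 \/ e = -1 -> 0 < r -> r < s ->
  (forall t, r <= t -> t <= s ->
    path_re t = a + b * (t - r) /\ path_im t = a' + b' * (t - r)) ->
  square_twist @` segment (cross_axis (e * r) 0) (cross_axis (e * s) 0) =
  segment (cross_axis (e * a) (4 * (e * a')))
    (cross_axis (e * (a + b * (s - r))) (4 * (e * (a' + b' * (s - r))))).
Proof.
move=> e1 r0 rs path_rs.
have val t : r <= t -> t <= s -> square_twist (cross_axis (e * t) 0) =
    cross_axis (e * (a + b * (t - r))) (4 * (e * (a' + b' * (t - r)))).
  move=> rt ts; have [pr pi] := path_rs t rt ts.
  have t0 : 0 < t by lra.
  rewrite square_twist_axis; last first.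
    by rewrite mulf_neq0 ?(gt_eqF t0)//; case: e1 => ->; rewrite ?oppr_eq0 oner_neq0.
  have -> : `|e * t| = t by case: e1 => ->; rewrite ?mul1r ?mulN1r ?normrN gtr0_norm.
  have -> : Num.sg (e * t) = e.
    by case: e1 => ->; rewrite ?mul1r ?mulN1r ?sgrN gtr0_sg.
  by rewrite pr pi; congr cross_axis; ring.
rewrite (image_segment (h := square_twist)).
  have [pr pi] := path_rs r (lexx _) (ltW rs).
  by rewrite !val ?lexx ?(ltW rs)// subrr !mulr0 !addr0.
move=> t /andP[t0 t1].
have -> : ((1 - t) * (cross_axis (e * r) 0).1.1 + t * (cross_axis (e * s) 0).1.1,
   (1 - t) * (cross_axis (e * r) 0).1.2 + t * (cross_axis (e * s) 0).1.2,
   (1 - t) * (cross_axis (e * r) 0).2 + t * (cross_axis (e * s) 0).2) =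
   cross_axis (e * (r + t * (s - r))) 0.
  by rewrite /cross_axis /=; congr (_, _, _); ring.
have ? : 0 <= t * (s - r) by nra.
have ? : t * (s - r) <= s - r by nra.
rewrite (val (r + _)); [|lra..].
rewrite (val r) ?lexx ?(ltW rs)// (val s) ?lexx ?(ltW rs)//.
by rewrite /cross_axis /=; congr (_, _, _); ring.
Qed.

Lemma cross_axis_split (e r s t : R) : r < s -> s < t ->
  segment (cross_axis (e * r) 0) (cross_axis (e * t) 0) =
  segment (cross_axis (e * r) 0) (cross_axis (e * s) 0) `|`
  segment (cross_axis (e * s) 0) (cross_axis (e * t) 0).
Proof.
move=> rs st; have n0 : t - r != 0 by rewrite gt_eqF//; lra.
apply: (@segment_split _ _ _ _ ((s - r) / (t - r))).
  by apply/andP; split; [apply: divr_ge0|rewrite ler_pdivrMr ?mul1r]; lra.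
by rewrite /cross_axis /=; congr (_, _, _); field.
Qed.

Lemma square_twist_cross (e : R) : e = 1 \/ e = -1 ->
  square_twist @` segment (cross_axis (e * (1 / 2)) 0) (cross_axis (e * 16) 0) =
  segment (cross_axis (e * - (1 / 2)) 0) (cross_axis (e * -1) 0) `|`
  (segment (cross_axis (e * -1) 0) (cross_axis (e * -1) (e * 8)) `|`
  (segment (cross_axis (e * -1) (e * 8)) (cross_axis (e * 1) (e * 12)) `|`
  (segment (cross_axis (e * 1) (e * 12)) (cross_axis (e * 10) 0) `|`
  segment (cross_axis (e * 10) 0) (cross_axis (e * 16) 0)))).
Proof.
move=> e1.
(* The twisting path is affine between the radii 1, 2, 3 and 10. *)
rewrite (@cross_axis_split _ _ 1); [|lra..].
rewrite (@cross_axis_split _ _ 2 16); [|lra..].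
rewrite (@cross_axis_split _ _ 3 16); [|lra..].
rewrite (@cross_axis_split _ _ 10 16); [|lra..].
rewrite !image_setU; congr (_ `|` (_ `|` (_ `|` (_ `|` _)))).
- rewrite (@square_twist_piece _ _ _ (- (1 / 2)) (-1) 0 0); [|exact: e1|lra|lra|].
    by congr segment; congr cross_axis; field.
  by move=> t _ /path_opp[-> ->]; split; field.
- rewrite (@square_twist_piece _ _ _ (-1) 0 0 2); [|exact: e1|lra|lra|].
    by congr segment; congr cross_axis; field.
  by move=> t h1 h2; have [-> ->] := path_piece1 h1 h2; split; field.
- rewrite (@square_twist_piece _ _ _ (-1) 2 2 1); [|exact: e1|lra|lra|].
    by congr segment; congr cross_axis; field.
  by move=> t h1 h2; have [-> ->] := path_piece2 h1 h2; split; field.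
- rewrite (@square_twist_piece _ _ _ 1 (9 / 7) 3 (- (3 / 7))); [|exact: e1|lra|lra|].
    by congr segment; congr cross_axis; field.
  by move=> t h1 h2; have [-> ->] := path_piece3 h1 h2; split; field.
- rewrite (@square_twist_piece _ _ _ 10 1 0 0); [|exact: e1|lra|lra|].
    by congr segment; congr cross_axis; field.
  by move=> t /path_id[-> ->] _; split; field.
Qed.

Definition main_axis (t : R) : sp := (1 / 2 + t / 32, 1 / 2 + t / 32, 0).

(** Points of the axis are only rescaled, by an increasing function of the radius that fixes the
    radii 1/2 and 16. *)
Lemma square_twist_main (e : R) : e = 1 \/ e = -1 ->
  square_twist @` segment (main_axis (e * (1 / 2))) (main_axis (e * 16)) =
  segment (main_axis (e * (1 / 2))) (main_axis (e * 16)).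
Proof.
move=> e1; have segE p : segment (main_axis (e * (1 / 2))) (main_axis (e * 16)) p <->
    exists2 t, 1 / 2 <= t <= 16 & p = main_axis (e * t).
  split=> [/segmentP[s /andP[s0 s1] ->]|[t /andP[t0 t1] ->]].
    exists (1 / 2 + s * (16 - 1 / 2)); first by apply/andP; split; nra.
    by rewrite /main_axis /=; congr (_, _, _); ring.
  apply/segmentP; exists ((t - 1 / 2) * (2 / 31)).
    by apply/andP; split; lra.
  by rewrite /main_axis /=; congr (_, _, _); field.
have val t : 0 < t -> square_twist (main_axis (e * t)) = main_axis (e * Num.sqrt (path_sqr t)).
  move=> t0; rewrite /square_twist /twist_coord /main_axis /=.
  have -> : 16 * (1 / 2 + e * t / 32 + (1 / 2 + e * t / 32) - 1) = e * t by field.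
  rewrite subrr !mulr0 !mul0r /twist_map norm2_axis ?addr0; last by right.
  have -> : `|e * t| = t by case: e1 => ->; rewrite ?mul1r ?mulN1r ?normrN gtr0_norm.
  rewrite /twist_point /= !mulr0 subrr !addr0 !mul0r mulr0 addr0 subr0.
  by congr (_, _, _); field; rewrite gt_eqF.
have e0 : e != 0 by case: e1 => ->; rewrite ?oppr_eq0 oner_neq0.
have mono s t : 0 < s -> 0 < t -> (Num.sqrt (path_sqr s) <= Num.sqrt (path_sqr t)) -> s <= t.
  move=> s0 t0; rewrite ler_sqrt ?path_sqr_ge0// => h; rewrite leNgt; apply/negP => ts.
  by have := path_sqr_lt (ltW t0) ts; rewrite ltNge h.
have v1 : Num.sqrt (path_sqr (1 / 2)) = 1 / 2 :> R.
  rewrite /path_sqr; have [-> ->] := @path_opp R (1 / 2) ltac:(lra).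
  by rewrite expr0n /= addr0 sqrrN sqrtr_sqr ger0_norm//; lra.
have v2 : Num.sqrt (path_sqr 16) = 16 :> R.
  rewrite /path_sqr; have [-> ->] := @path_id R 16 ltac:(lra).
  by rewrite expr0n /= addr0 sqrtr_sqr ger0_norm//; lra.
have mono' s t : 0 < s -> s <= t -> Num.sqrt (path_sqr s) <= Num.sqrt (path_sqr t).
  move=> s0; rewrite le_eqVlt => /predU1P[-> //|st].
  by rewrite ler_sqrt ?path_sqr_ge0// ltW// path_sqr_lt// ltW.
apply/seteqP; split=> [_ [_ /segE[t /andP[t0 t1] ->] <-]|q /segE[t /andP[t0 t1] ->]].
  apply/segE; exists (Num.sqrt (path_sqr t)); last by rewrite val//; lra.
  by apply/andP; split; [rewrite -v1|rewrite -v2]; apply: mono'; lra.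
have [p pE] := twist_surj (twist_coord (main_axis (e * t))).
have tE : twist_coord (main_axis (e * t)) = (e * t, 0, 0).
  by rewrite /twist_coord /main_axis /=; congr (_, _, _); field.
pose s := norm2 p.
have np : Num.sqrt (path_sqr s) = t.
  rewrite -norm2_twist pE tE norm2_axis ?addr0; last by right.
  by case: e1 => ->; rewrite ?mul1r ?mulN1r ?normrN gtr0_norm//; lra.
have s0 : 0 < s.
  rewrite lt_neqAle eq_sym norm2_ge0 andbT; apply/eqP => s0; move: np; rewrite s0.
  rewrite /path_sqr; have [-> ->] := @path_opp R 0 ler01.
  by rewrite oppr0 expr0n /= addr0 sqrtr0 => h; move: t0; rewrite -h; lra.
exists (main_axis (e * s)).
  apply/segE; exists s => //; apply/andP; split; apply: mono; rewrite ?np ?v1 ?v2//; lra.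
by rewrite val// np.
Qed.

Lemma segs_cat l l' : segs_set (l ++ l') = segs_set l `|` segs_set l' :> set sp.
Proof. by elim: l => [|s l IH] /=; rewrite ?set0U// IH setUA. Qed.

(** In the central square the half turn undoes [rotate_diag]; the wires on the diagonal keep their
    place and those on the antidiagonal are twisted. *)
Lemma shrunk_twist X : X `<=` unit_box ->
  square_twist @` shrunk (31 / 64) (33 / 64) (31 / 64) (33 / 64) (rotate_diag @` X) =
  realize (env3 X X X) twisted_picture.
Proof.
move=> uX; rewrite /shrunk /wires !image_setU.
have mainE (e x : R) : e = 1 \/ e = -1 -> x = 1 / 2 + e / 2 ->
    square_twist @` segment (x, x, 0) (1 / 2 + e / 64, 1 / 2 + e / 64, 0) =
    segment (x, x, 0) (1 / 2 + e / 64, 1 / 2 + e / 64, 0).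
  move=> e1 ->; have := square_twist_main e1; rewrite segment_sym /main_axis.
  have -> : e * 16 / 32 = e / 2 by field.
  by have -> : e * (1 / 2) / 32 = e / 64 by field.
have box : square_twist @` (slot (31 / 64) (33 / 64) (31 / 64) (33 / 64) @` (rotate_diag @` X)) =
    slot (31 / 64) (33 / 64) (31 / 64) (33 / 64) @` X.
  rewrite !image_comp; apply: eq_imagel => -[[x y] z] /uX [/= /andP[? ?] /andP[? ?] /andP[? ?]].
  rewrite /= /slot /= square_twist_in /rotate_diag /=; first by rewrite opprK.
  - by apply/andP; split; lra.
  - by apply/andP; split; lra.
  - by apply/andP; split; lra.
have pos e : e = 1 \/ e = -1 -> square_twist @` segment (1 / 2 + e / 2, 1 / 2 - e / 2, 0)
     (1 / 2 + e / 64, 1 / 2 - e / 64, 0) = square_twist @` segment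
     (cross_axis (e * (1 / 2)) 0) (cross_axis (e * 16) 0).
  by move=> _; rewrite segment_sym /cross_axis; congr (_ @` segment _ _); congr (_, _, _); field.
have e0 : segment (0, 0, 0) (31 / 64, 31 / 64, 0) =
    segs_set (polyline [:: qp 64 0 0 0; qp 64 31 31 0]) :> set sp.
  by rewrite /= !ptR_qp// setU0; congr segment; congr (_, _, _); field.
have e3 : segment (1, 1, 0) (33 / 64, 33 / 64, 0) =
    segs_set (polyline [:: qp 64 33 33 0; qp 64 64 64 0]) :> set sp.
  by rewrite /= !ptR_qp// setU0 segment_sym; congr segment; congr (_, _, _); field.
have e1 : square_twist @` segment (1, 0, 0) (33 / 64, 31 / 64, 0) =
    segs_set (polyline [:: qp 64 31 33 0; qp 64 30 34 0; qp 64 30 34 8; qp 64 34 30 12;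
      qp 64 52 12 0; qp 64 64 0 0]) :> set sp.
  have := pos 1 (or_introl erefl); rewrite square_twist_cross; last by left.
  rewrite /= !ptR_qp// setU0 /cross_axis.
  rewrite (_ : (1 / 2 + 1 / 2, _, _) = (1, 0, 0)); last by congr (_, _, _); field.
  rewrite (_ : (1 / 2 + 1 / 64, _, _) = (33 / 64, 31 / 64, 0)); last by congr (_, _, _); field.
  by move=> ->; do ?congr (_ `|` _); congr segment; congr (_, _, _); field.
have e2 : square_twist @` segment (0, 1, 0) (31 / 64, 33 / 64, 0) =
    segs_set (polyline [:: qp 64 33 31 0; qp 64 34 30 0; qp 64 34 30 (- 8); qp 64 30 34 (- 12);
      qp 64 12 52 0; qp 64 0 64 0]) :> set sp.
  have := pos (-1) (or_intror erefl); rewrite square_twist_cross; last by right.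
  rewrite /= !ptR_qp// setU0 /cross_axis.
  rewrite (_ : (1 / 2 + -1 / 2, _, _) = (0, 1, 0)); last by congr (_, _, _); field.
  rewrite (_ : (1 / 2 + -1 / 64, _, _) = (31 / 64, 33 / 64, 0)); last by congr (_, _, _); field.
  by move=> ->; do ?congr (_ `|` _); congr segment; congr (_, _, _); rewrite ?mulrNz; field.
have m0 : square_twist @` segment (0, 0, 0) (31 / 64, 31 / 64, 0) =
    segment (0, 0, 0) (31 / 64, 31 / 64, 0).
  by have <- : 1 / 2 + -1 / 64 = 31 / 64 :> R; [field|apply: mainE; [right|field]].
have m1 : square_twist @` segment (1, 1, 0) (33 / 64, 33 / 64, 0) =
    segment (1, 1, 0) (33 / 64, 33 / 64, 0).
  by have <- : 1 / 2 + 1 / 64 = 33 / 64 :> R; [field|apply: mainE; [left|field]].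
rewrite box e1 e2 m0 m1 e0 e3.
rewrite /realize /twisted_picture !segs_cat [boxes_set _ _]/= setU0 qslot_qrct//.
move: (segs_set _) (segs_set _) (segs_set _) (segs_set _) => B C D E.
by move: (slot _ _ _ _ @` X) => A; apply/seteqP; split=> x; rewrite /setU /=; tauto.
Qed.

Definition flip (p : sp) : sp := (p.1.1, p.1.2, - p.2).

Lemma rotate_diagE X : rotate_diag @` X = reflect_diag @` (flip @` X).
Proof. by rewrite image_comp; apply: eq_imagel => -[[x y] z]. Qed.

Lemma flip_segment p q : flip @` segment p q = segment (flip p) (flip q).
Proof. by apply: image_segment => s _; rewrite /flip /=; congr (_, _, _); ring. Qed.

Lemma flip_shrunk (x0 x1 y0 y1 : R) A :
  flip @` shrunk x0 x1 y0 y1 A = shrunk x0 x1 y0 y1 (flip @` A).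
Proof.
rewrite /shrunk /wires !image_setU !flip_segment !image_comp /flip /= oppr0.
by congr (_ `|` _).
Qed.

Lemma flip_hsum A B : flip @` hsum A B = hsum (flip @` A) (flip @` B).
Proof.
rewrite !hsumE /wires !image_setU !flip_segment /flip /= oppr0 !image_comp.
by congr (_ `|` (_ `|` _)).
Qed.

Lemma flip_arcs : flip @` horizontal_arcs R = horizontal_arcs R.
Proof. by rewrite /horizontal_arcs !image_setU !flip_segment /flip /= oppr0. Qed.

Lemma flip_crossing (z : R) : flip @` crossing z = crossing (- z).
Proof. by rewrite /crossing !image_setU !flip_segment /flip /= oppr0. Qed.

Lemma flip_reflect A : flip @` (reflect_diag @` A) = reflect_diag @` (flip @` A).
Proof. by rewrite !image_comp. Qed.

Lemma flipK : involutive flip.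
Proof. by move=> [[x y] z]; rewrite /flip /= opprK. Qed.

Lemma flip_image A : flip @` (flip @` A) = A.
Proof.
by rewrite image_comp (_ : flip \o flip = id) ?image_id//; apply/funext => p; exact: flipK.
Qed.

Lemma cont_flip : continuous flip.
Proof. by rewrite /flip; cont. Qed.

Lemma equiv_flip A B : A =~ B -> flip @` A =~ flip @` B.
Proof. by apply: equiv_conj; [exact: cont_flip..|exact: flipK|exact: flipK|]. Qed.

Lemma tangle_flip A : tangle A -> tangle (flip @` A).
Proof.
move=> tA; split; last first.
  by move=> _ [p /(proj2 tA) [a b /andP[c d]] <-]; split=> //=; apply/andP; split; lra.
apply: compact_closed hausdorff3 _; apply: continuous_compact; last exact: compact_tangle.
by apply: continuous_subspaceT; exact: cont_flip.
Qed.

Lemma nice_flip A : nice A -> nice (flip @` A).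
Proof.
move=> [tA nA]; split; first exact: tangle_flip.
by rewrite /shr -flip_shrunk; exact: equiv_flip.
Qed.

Lemma nice_rotate X : nice X -> nice (rotate_diag @` X).
Proof. by move=> nX; rewrite rotate_diagE; apply: nice_reflect; exact: nice_flip. Qed.

Lemma rotate_twisted X : nice X -> rotate_diag @` X =~ realize (env3 X X X) twisted_picture.
Proof.
move=> nX; rewrite -shrunk_twist; last by case: nX => -[].
apply: equiv_trans (square_twist_equiv _); apply: nice_shrunk; try lra.
exact: nice_rotate.
Qed.

Lemma vsum_rotate X : nice X ->
  vsum (hsum (vsum X (crossing 1)) (crossing (-1))) (crossing 1) =~ rotate_diag @` X.
Proof.
move=> nX; have [tX _] := nX.
have [t1 _] := @nice_crossing1 R; have [tN1 _] := @nice_crossingN1 R.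
have tv A B : tangle A -> tangle B -> tangle (vsum A B) := @tangle_vsum R A B.
have th A B : tangle A -> tangle B -> tangle (hsum A B) := @tangle_hsum R A B.
have tX' : tangle (shrunk (3 / 8) (5 / 8) (2 / 8) (6 / 8) X) by apply: tangle_shrunk => //; lra.
have nrX := nice_rotate nX.
apply: (@equiv_trans _ _ _ (shrunk (12 / 64) (44 / 64) (7 / 64) (39 / 64) (rotate_diag @` X))); last first.
  by apply: equiv_sym; apply: nice_shrunk => //; lra.
apply: (@equiv_trans _ _ _ (shrunk (12 / 64) (44 / 64) (7 / 64) (39 / 64)
    (realize (env3 X X X) twisted_picture))); last first.
  by apply: shrunk_equiv; try lra; apply: equiv_sym; exact: rotate_twisted.
apply: equiv_trans (vsum_twisted tX).
apply: vsum_equiv; auto; last exact: equiv_refl.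
apply: hsum_equiv; auto; last exact: equiv_refl.
apply: vsum_equiv; auto; last exact: equiv_refl.
by apply: nice_shrunk => //; lra.
Qed.
End RotateDiag.

(** * The tangle of a binary tree and the trees of an arborescent tangle *)

Section TreeTangles.
Context {R : realType}.
Notation sp := (R * R * R)%type.
Implicit Types (A B C X Y Z : set sp) (T : btree).

Notation cr := (crossing 1 : set sp).
Notation cn := (crossing (- 1) : set sp).
Notation arcs := (horizontal_arcs R).

(** What a vertex of the tree does to the tangle of its left subtree: the negative crossing comes
    from the row below the leaves, the positive one from the crossing at the vertex. *)
Definition hook X := vsum (hsum X cn) cr.

(** The sum runs along the right spine of the tree, with one summand for the left subtree of each
    spine vertex. *)
Fixpoint tree_tangle T : set sp :=
  if T is Node l r then hsum (hook (tree_tangle l)) (tree_tangle r) else arcs.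

Lemma reflect_crossing (z : R) : reflect_diag @` crossing z = crossing z.
Proof.
rewrite /crossing !image_setU !reflect_segment /reflect_diag /=.
rewrite (segment_sym (1, 0, 0)) (segment_sym _ (0, 1, 0)).
by apply/seteqP; split=> x; rewrite /setU /=; tauto.
Qed.

Lemma vsum_reflect A B : vsum (reflect_diag @` A) (reflect_diag @` B) = reflect_diag @` hsum A B.
Proof. by rewrite /vsum !reflect_image. Qed.

Lemma vsum_crossing A : vsum (reflect_diag @` A) cr = reflect_diag @` hsum A cr.
Proof. by rewrite -vsum_reflect reflect_crossing. Qed.

Lemma tangle_cr : tangle cr. Proof. by case: (@nice_crossing1 R). Qed.
Lemma tangle_cn : tangle cn. Proof. by case: (@nice_crossingN1 R). Qed.
Local Hint Resolve tangle_cr tangle_cn tangle_arcs tangle_hsum tangle_vsum tangle_reflect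
  nice_crossing1 nice_crossingN1 nice_arcs equiv_refl : core.

Lemma hsum_equivl A A' B : tangle A -> tangle A' -> tangle B -> A =~ A' ->
  hsum A B =~ hsum A' B.
Proof. by move=> *; apply: hsum_equiv. Qed.

Lemma hsum_equivr A B B' : tangle A -> tangle B -> tangle B' -> B =~ B' ->
  hsum A B =~ hsum A B'.
Proof. by move=> *; apply: hsum_equiv. Qed.

Lemma tangle_hook X : tangle X -> tangle (hook X).
Proof. by move=> tX; apply: tangle_vsum => //; exact: tangle_hsum. Qed.

Lemma nice_hook X : tangle X -> nice (hook X).
Proof. by move=> tX; apply: nice_vsum => //; exact: tangle_hsum. Qed.
Local Hint Resolve tangle_hook nice_hook : core.

Lemma tangle_tree T : tangle (tree_tangle T).
Proof. by elim: T => //= l tl r tr; apply: tangle_hsum => //; exact: tangle_hook. Qed.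

Lemma nice_tree T : nice (tree_tangle T).
Proof. by case: T => //= l r; apply: nice_hsum; [apply: tangle_hook|]; exact: tangle_tree. Qed.
Local Hint Resolve tangle_tree nice_tree : core.

Lemma hook_equiv X Y : tangle X -> tangle Y -> X =~ Y -> hook X =~ hook Y.
Proof. by move=> tX tY XY; apply: vsum_equiv; auto; apply: hsum_equivl. Qed.

Lemma hsum_cancel X : nice X -> hsum (hsum X cr) cn =~ X.
Proof.
move=> nX; have [tX _] := nX; apply: equiv_trans (hsumA nX _ _) _; auto.
apply: equiv_trans (hsum_arcs nX); apply: hsum_equivr; auto; exact: crossing_cancel.
Qed.

Lemma hook_add X : nice X -> hook (hsum X cr) =~ vsum X cr.
Proof.
by move=> nX; have [tX _] := nX; apply: vsum_equiv; auto; exact: hsum_cancel.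
Qed.

(** The negative crossing of the inner hook cancels the added one, and what remains is the left-hand
    side of [vsum_rotate]. *)
Lemma hook_hook X : nice X -> hook (hook (hsum X cr)) =~ rotate_diag @` X.
Proof.
move=> nX; have [tX _] := nX; apply: equiv_trans (vsum_rotate nX).
by apply: hook_equiv; auto; exact: hook_add.
Qed.

Lemma hook_arcs : hook arcs =~ reflect_diag @` arcs.
Proof.
apply: (@equiv_trans _ _ _ (vsum cn cr)).
  by apply: vsum_equiv; auto; exact: arcs_hsum.
rewrite -[cn]reflect_crossing vsum_crossing; apply: equiv_reflect.
exact: crossing_cancelV.
Qed.

Lemma rotate_vertical : rotate_diag @` (reflect_diag @` arcs) = arcs.
Proof. by rewrite rotate_diagE flip_reflect reflect_image flip_arcs. Qed.

Lemma vsum_vertical : vsum (reflect_diag @` arcs) cr =~ cr.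
Proof.
rewrite vsum_crossing -[X in _ =~ X]reflect_crossing; apply: equiv_reflect.
exact: arcs_hsum.
Qed.

(** The first Reidemeister move, a special case of [vsum_rotate]. *)
Lemma vsum_arcs : vsum arcs cr =~ arcs.
Proof.
have nv := nice_reflect (@nice_arcs R); have [tv _] := nv.
have := vsum_rotate nv; rewrite rotate_vertical; apply: equiv_trans.
apply: vsum_equiv; auto.
apply: equiv_trans (equiv_sym crossing_cancel) _; apply: hsum_equivl; auto.
by apply: equiv_sym; exact: vsum_vertical.
Qed.

Lemma hsum_vertical : hsum (reflect_diag @` arcs) cr =~ reflect_diag @` arcs.
Proof. by have /equiv_reflect := vsum_arcs; rewrite /vsum reflect_image reflect_crossing. Qed.

Lemma hook_vertical : hook (reflect_diag @` arcs) =~ cr.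
Proof.
have nv := nice_reflect (@nice_arcs R); have [tv _] := nv.
apply: equiv_trans vsum_vertical; apply: vsum_equiv; auto.
apply: equiv_trans (hsum_cancel nv); apply: hsum_equivl; auto.
by apply: equiv_sym; exact: hsum_vertical.
Qed.

Definition single T := Node T Leaf.

Fixpoint graft T S := if T is Node l r then Node l (graft r S) else S.

Definition tree1 := single Leaf.
(** Adds one positive crossing on the right, because the hook of [tree1] is a crossing. *)
Definition add1 T := graft T (single tree1).

Lemma tree_single T : tree_tangle (single T) =~ hook (tree_tangle T).
Proof. by apply: hsum_arcs; auto. Qed.

Lemma hook_tree1 : hook (tree_tangle tree1) =~ cr.
Proof.
apply: equiv_trans hook_vertical; apply: hook_equiv; auto.
exact: equiv_trans (tree_single Leaf) hook_arcs.
Qed.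

Lemma tree_graft T S : tree_tangle (graft T S) =~ hsum (tree_tangle T) (tree_tangle S).
Proof.
elim: T => [|l _ r IH] /=; first by apply: equiv_sym; exact: arcs_hsum.
apply: equiv_trans (equiv_sym (hsumA _ _ _)); auto.
by apply: hsum_equivr; auto.
Qed.

Lemma tree_add1 T : tree_tangle (add1 T) =~ hsum (tree_tangle T) cr.
Proof.
apply: equiv_trans (tree_graft _ _) _; apply: hsum_equivr; auto.
exact: equiv_trans (tree_single _) hook_tree1.
Qed.

(** [single] realizes a hook as a tree tangle; one hook comes from it and the other is written in
    the statement, so [hook_hook] applies. *)
Lemma hook_single_add1 T X : nice X -> tree_tangle T =~ X ->
  hook (tree_tangle (single (add1 T))) =~ rotate_diag @` X.
Proof.
move=> nX TX; have [tX _] := nX; apply: equiv_trans (hook_hook nX).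
apply: hook_equiv; auto; apply: equiv_trans (tree_single _) _.
apply: hook_equiv; auto; apply: equiv_trans (tree_add1 _) _.
exact: hsum_equivl.
Qed.

Lemma wtree_rect' (P : wtree -> Prop) :
  (forall w ts, (forall t, List.In t ts -> P t) -> P (WNode w ts)) -> forall t, P t.
Proof.
move=> IH; fix rec 1 => -[w ts]; apply: IH.
elim: ts => [|t ts IHts] u /=; first by clear rec.
by case=> [<-|uts]; [exact: (rec t)|clear rec; exact: IHts].
Qed.

(** Trees representing the arborescent tangle of [t] and, after [hook], its reflection. *)
Fixpoint trees_of (t : wtree) : btree * btree :=
  let: WNode w ts := t in
  let ps := [seq trees_of u | u <- ts] in
  (foldr Node (iter `|w|%N (Node tree1) Leaf) [seq p.2 | p <- ps],
   iter `|w|%N (fun T => add1 (single T))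
     (single (add1 (foldr Node Leaf [seq single (add1 p.1) | p <- ps])))).

Lemma tangle_twist w : 0 < w -> tangle (twist R w).
Proof.
by move=> w0; rewrite /twist gtr0_sg// mulr1z; elim: `|w|%N => //= n IH; exact: tangle_hsum.
Qed.

Lemma nice_twist w : 0 < w -> nice (twist R w).
Proof.
move=> w0; rewrite /twist gtr0_sg// mulr1z; case: `|w|%N => //= n; apply: nice_hsum; auto.
by elim: n => //= n IH; exact: tangle_hsum.
Qed.

Lemma tangle_foldr Z l : tangle Z -> (forall X, List.In X l -> tangle X) ->
  tangle (foldr hsum Z l).
Proof.
move=> tZ; elim: l => //= X l IH tl; apply: tangle_hsum; first by apply: tl; left.
by apply: IH => Y Yl; apply: tl; right.
Qed.

Lemma nice_foldr Z l : nice Z -> (forall X, List.In X l -> tangle X) -> nice (foldr hsum Z l).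
Proof.
move=> nZ; have [tZ _] := nZ; case: l => //= X l tl; apply: nice_hsum; first by apply: tl; left.
by apply: tangle_foldr => // Y Yl; apply: tl; right.
Qed.

Lemma foldr_equiv (I : Type) (f g : I -> set sp) Z Z' (s : seq I) : tangle Z -> tangle Z' ->
  (forall i, List.In i s -> [/\ tangle (f i), tangle (g i) & f i =~ g i]) -> Z =~ Z' ->
  foldr hsum Z [seq f i | i <- s] =~ foldr hsum Z' [seq g i | i <- s].
Proof.
move=> tZ tZ'; elim: s => //= i s IH h ZZ.
have h' j : List.In j s -> [/\ tangle (f j), tangle (g j) & f j =~ g j].
  by move=> js; apply: h; right.
have [tf tg fg] := h i (or_introl erefl).
apply: hsum_equiv => //; last exact: IH.
  by apply: tangle_foldr => // X /List.in_map_iff[j [<- /h'[]]].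
by apply: tangle_foldr => // X /List.in_map_iff[j [<- /h'[]]].
Qed.

Lemma foldr_hsum Z l : nice Z -> (forall X, List.In X l -> nice X) ->
  foldr hsum Z l =~ hsum (foldr hsum arcs l) Z.
Proof.
move=> nZ; elim: l => [|X l IH] nl /=; first by apply: equiv_sym; exact: arcs_hsum.
have nX : nice X by apply: nl; left.
have nl' Y : List.In Y l -> nice Y by move=> Yl; apply: nl; right.
have tl' Y : List.In Y l -> tangle Y by move=> /nl'[].
have na := nice_foldr (@nice_arcs R) tl'.
apply: equiv_trans (equiv_sym (hsumA nX na nZ)); apply: hsum_equivr.
- by case: nX.
- by apply: tangle_foldr => //; case: nZ.
- by apply: tangle_hsum; [case: na|case: nZ].
- exact: IH.
Qed.

Lemma hsum_iter n X : nice X ->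
  hsum X (iter n (hsum cr) arcs) =~ iter n (fun Y => hsum Y cr) X.
Proof.
elim: n X => [|n IH] X nX; first exact: hsum_arcs.
have [tX _] := nX.
have nn : nice (iter n (hsum cr) arcs).
  case: (n) => //= k; apply: nice_hsum; auto; elim: k => //= k tk; exact: tangle_hsum.
apply: (@equiv_trans _ _ _ (hsum (hsum X cr) (iter n (hsum cr) arcs))).
  by apply: equiv_sym; apply: hsumA; auto.
by rewrite iterSr; apply: IH; apply: nice_hsum; auto.
Qed.

Lemma nice_iter n X : nice X -> nice (iter n (fun Y => hsum Y cr) X).
Proof. by elim: n => //= n IH /IH[tX _]; apply: nice_hsum; auto. Qed.

Lemma foldr_flip l : flip @` foldr hsum arcs l = foldr hsum arcs [seq flip @` X | X <- l].
Proof. by elim: l => [|X l IH] /=; rewrite ?flip_arcs// flip_hsum IH. Qed.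

Lemma tree_foldr T Ts : tree_tangle (foldr Node T Ts) =
  foldr hsum (tree_tangle T) [seq hook (tree_tangle U) | U <- Ts].
Proof. by elim: Ts => //= U Us ->. Qed.

(** One step takes [T] to a tree with tangle hook(T) + c; the hook of this is the vertical sum of
    hook(T) and c, hence the reflection of [X] + c. *)
Lemma hook_iter n T X : nice X -> hook (tree_tangle T) =~ reflect_diag @` X ->
  hook (tree_tangle (iter n (fun T => add1 (single T)) T)) =~
  reflect_diag @` iter n (fun Y => hsum Y cr) X.
Proof.
move=> nX TX; elim: n => // n IH; rewrite !iterS -vsum_crossing.
have [tX _] := nice_iter n nX.
set S := iter n _ T in IH *; set Y := iter n _ X in IH tX *.
apply: (@equiv_trans _ _ _ (hook (hsum (hook (tree_tangle S)) cr))).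
  apply: hook_equiv; auto; apply: equiv_trans (tree_add1 _) _.
  by apply: hsum_equivl; auto; exact: tree_single.
by apply: equiv_trans (hook_add _) _; auto; apply: vsum_equiv; auto.
Qed.

Lemma all_In (I : Type) (a : I -> bool) s x : all a s -> List.In x s -> a x.
Proof. by elim: s => //= y s IH /andP[ay /IH h] [<-|]. Qed.

(** The two trees are obtained by a joint induction, because each uses the other one for the
    children. Positivity of the weight makes the twist region a sum of positive crossings, each of
    which is the hook of [tree1]. *)
Lemma trees_ofP t : all_weights_positive t -> [/\ nice (arborescent_tangle R t),
  tree_tangle (trees_of t).1 =~ arborescent_tangle R t &
  hook (tree_tangle (trees_of t).2) =~ reflect_diag @` arborescent_tangle R t].
Proof.
elim/wtree_rect': t => w ts IH /= /andP[w0 ats].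
have {ats}IH t : List.In t ts -> [/\ nice (arborescent_tangle R t),
  tree_tangle (trees_of t).1 =~ arborescent_tangle R t &
  hook (tree_tangle (trees_of t).2) =~ reflect_diag @` arborescent_tangle R t].
  by move=> tts; apply: IH => //; exact: all_In ats tts.
have nt X : List.In X [seq reflect_diag @` arborescent_tangle R u | u <- ts] -> nice X.
  by move=> /List.in_map_iff[u [<- /IH[nu _ _]]]; exact: nice_reflect.
have tt X : List.In X [seq reflect_diag @` arborescent_tangle R u | u <- ts] -> tangle X.
  by move=> /nt[].
split; first by apply: nice_foldr tt; exact: nice_twist.
  rewrite tree_foldr -!map_comp; apply: foldr_equiv; auto; first exact: tangle_twist.
    move=> t /= tts; have [[tA _] _ h] := IH t tts; split; auto.
  rewrite /twist gtr0_sg// mulr1z; elim: `|w|%N => //= n IHn.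
  apply: hsum_equiv; auto; first by elim: (n) => //= k; auto.
  exact: hook_tree1.
pose S := foldr hsum arcs [seq reflect_diag @` arborescent_tangle R u | u <- ts].
have nS : nice S by apply: nice_foldr.
apply: (@equiv_trans _ _ _ (reflect_diag @` iter `|w|%N (fun Y => hsum Y cr) S)); last first.
  apply: equiv_reflect; apply: equiv_sym.
  apply: equiv_trans (foldr_hsum (nice_twist w0) nt) _.
  by rewrite /twist gtr0_sg// mulr1z; exact: hsum_iter.
apply: hook_iter => //.
(* A reflection is the half turn of the mirror image. The mirror image of [S] is a tree tangle since
   each of its summands, the mirror image of a reflected child, is the child after a half turn. *)
have -> : reflect_diag @` S = rotate_diag @` (flip @` S).
  by rewrite rotate_diagE flip_image.
apply: hook_single_add1; first exact: nice_flip.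
rewrite tree_foldr -!map_comp foldr_flip -map_comp; apply: foldr_equiv; auto.
move=> t /= tts; have [nA h _] := IH t tts; have [tA _] := nA; split; auto.
  by apply: tangle_flip; auto.
by rewrite flip_reflect -rotate_diagE; apply: hook_single_add1.
Qed.

(** Two further hooks turn the tangle about the diagonal, which compensates for the different way in
    which Thompson links close it. *)
Lemma tree_tangle_surj t : all_weights_positive t -> exists T : btree,
  (2 <= leaves T)%N /\ tree_tangle T =~ rotate_diag @` arborescent_tangle R t.
Proof.
move=> /trees_ofP[nt ht _]; exists (single (single (add1 (trees_of t).1))); split.
  by rewrite [leaves _]/=; lia.
apply: equiv_trans (tree_single _) _; exact: hook_single_add1.
Qed.
End TreeTangles.

(** * Increasing piecewise linear maps and products of them *)

Section PiecewiseLinear.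
Context {R : realType}.
Notation sp := (R * R * R)%type.

(** The piecewise linear map through the points [(x0, y0) :: l], with slope 1 on the right and
    the slope of the first piece on the left. *)
Fixpoint pl (x0 y0 : R) (l : seq (R * R)) (t : R) : R :=
  if l is p :: l' then
    y0 + (Num.min t p.1 - x0) * ((p.2 - y0) / (p.1 - x0)) + (pl p.1 p.2 l' (Num.max t p.1) - p.2)
  else y0 + (t - x0).

Fixpoint pl_chain (x0 y0 : R) (l : seq (R * R)) : Prop :=
  if l is p :: l' then [/\ x0 < p.1, y0 < p.2 & pl_chain p.1 p.2 l'] else True.

Definition pl_swap (l : seq (R * R)) := [seq (p.2, p.1) | p <- l].

Lemma pl_chain_swap x0 y0 l : pl_chain x0 y0 l -> pl_chain y0 x0 (pl_swap l).
Proof. by elim: l x0 y0 => //= p l IH x0 y0 [h1 h2 /IH h3]. Qed.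

Lemma pl_start x0 y0 l : pl_chain x0 y0 l -> pl x0 y0 l x0 = y0.
Proof.
elim: l x0 y0 => [|p l IH] x0 y0 /=; first by rewrite subrr addr0.
move=> [h1 h2 /IH h3]; rewrite (min_idPl (ltW h1)) (max_idPr (ltW h1)) h3 !subrr.
by rewrite mul0r !addr0.
Qed.

Lemma pl_first x0 y0 p l t : pl_chain x0 y0 (p :: l) -> t <= p.1 ->
  pl x0 y0 (p :: l) t = y0 + (t - x0) * ((p.2 - y0) / (p.1 - x0)).
Proof.
by move=> [h1 h2 h3] tp; rewrite /= (min_idPl tp) (max_idPr tp) pl_start// subrr addr0.
Qed.

Lemma pl_next x0 y0 p l t : pl_chain x0 y0 (p :: l) -> p.1 <= t ->
  pl x0 y0 (p :: l) t = pl p.1 p.2 l t.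
Proof.
move=> [h1 h2 h3] tp; rewrite /= (min_idPr tp) (max_idPl tp) [X in _ + X + _]mulrC.
by rewrite divfK ?gt_eqF ?subr_gt0//; ring.
Qed.

Lemma pl_lt x0 y0 l s t : pl_chain x0 y0 l -> s < t -> pl x0 y0 l s < pl x0 y0 l t.
Proof.
elim: l x0 y0 s t => [|p l IH] x0 y0 s t; first by move=> _ st /=; lra.
move=> ch st; have [h1 h2 h3] := ch; have IH' := fun s t => IH p.1 p.2 s t h3.
have k0 : 0 < (p.2 - y0) / (p.1 - x0) by rewrite divr_gt0 ?subr_gt0.
have kE : y0 + (p.1 - x0) * ((p.2 - y0) / (p.1 - x0)) = p.2.
  by rewrite mulrC divfK ?gt_eqF ?subr_gt0//; ring.
have [tp|tp] := leP t p.1.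
  by rewrite !pl_first//; [nra|lra].
rewrite (@pl_next _ _ _ _ t) ?(ltW tp)//; have [sp|sp] := leP s p.1.
  rewrite pl_first//; apply: (@le_lt_trans _ _ p.2); first by rewrite -[leRHS]kE; nra.
  by rewrite -[ltLHS](pl_start h3); exact: IH'.
by rewrite pl_next ?(ltW sp)//; exact: IH'.
Qed.

Lemma pl_le x0 y0 l s t : pl_chain x0 y0 l -> s <= t -> pl x0 y0 l s <= pl x0 y0 l t.
Proof. by move=> ch; rewrite le_eqVlt => /predU1P[-> //|st]; exact/ltW/pl_lt. Qed.

Lemma plK x0 y0 l : pl_chain x0 y0 l -> cancel (pl x0 y0 l) (pl y0 x0 (pl_swap l)).
Proof.
elim: l x0 y0 => [|p l IH] x0 y0 ch t; first by rewrite /=; ring.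
have [h1 h2 h3] := ch; have ch' := pl_chain_swap ch.
have [tp|tp] := leP t p.1.
  have v : pl x0 y0 (p :: l) t <= p.2.
    rewrite (le_trans (pl_le ch tp))// pl_next// pl_start//.
  rewrite [pl_swap _]/= pl_first// pl_first//=.
  by field; rewrite !gt_eqF ?subr_gt0.
rewrite pl_next ?(ltW tp)// [pl_swap _]/= pl_next//=; first exact: IH.
by rewrite -[leLHS](pl_start h3) pl_le// ltW.
Qed.

Lemma cont_pl x0 y0 l : continuous (pl x0 y0 l).
Proof.
elim: l x0 y0 => [|p l IH] x0 y0 /=.
  by apply: contD; [exact: cont_cst|apply: contB; [by move=> ?; exact: cvg_id|exact: cont_cst]].
have ci : continuous (fun t : R => t) by move=> ?; exact: cvg_id.
apply: contD; last first.
  apply: contB; last exact: cont_cst.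
  by move=> t; apply: (@continuous_comp _ _ _ (fun t => Num.max t p.1) (pl p.1 p.2 l) t);
    [apply: cont_max => //; exact: cont_cst|exact: IH].
apply: contD; first exact: cont_cst.
by apply: contM; [apply: contB; [apply: cont_min => //|]|]; exact: cont_cst.
Qed.

Definition grid_map (f g : R -> R) (p : sp) : sp := (f p.1.1, g p.1.2, p.2).

Lemma cont_grid f g : continuous f -> continuous g -> continuous (grid_map f g).
Proof.
move=> cf cg; apply: cont_mk3; last exact: cont_z.
  by move=> q; apply: (@continuous_comp _ _ _ (fun p : sp => p.1.1) f q); [exact: cont_x|exact: cf].
by move=> q; apply: (@continuous_comp _ _ _ (fun p : sp => p.1.2) g q); [exact: cont_y|exact: cg].
Qed.

Lemma grid_mapK f f' g g' : cancel f f' -> cancel g g' ->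
  cancel (grid_map f g) (grid_map f' g').
Proof. by move=> fK gK -[[x y] z]; rewrite /grid_map /= fK gK. Qed.

Definition affine_on (f : R -> R) (u v : R) : Prop :=
  forall s, 0 <= s <= 1 -> f ((1 - s) * u + s * v) = (1 - s) * f u + s * f v.

Lemma affine_same f u : affine_on f u u.
Proof. by move=> s _; rewrite -!mulrDl subrK !mul1r. Qed.

Lemma affine_pl x0 y0 p l u v : pl_chain x0 y0 (p :: l) -> u <= p.1 -> v <= p.1 ->
  affine_on (pl x0 y0 (p :: l)) u v.
Proof. by move=> ch up vp s /andP[s0 s1]; rewrite !pl_first//; [ring|nra]. Qed.

Lemma affine_pl_next x0 y0 p l u v : pl_chain x0 y0 (p :: l) -> p.1 <= u -> p.1 <= v ->
  affine_on (pl p.1 p.2 l) u v -> affine_on (pl x0 y0 (p :: l)) u v.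
Proof. by move=> ch up vp h s s01; case/andP: (s01) => s0 s1; rewrite !pl_next ?h//; nra. Qed.

Lemma affine_sub f u v u' v' : affine_on f u v -> u < v -> u <= u' <= v -> u <= v' <= v ->
  affine_on f u' v'.
Proof.
move=> h uv /andP[u1 u2] /andP[v1 v2] s /andP[s0 s1].
have n0 : v - u != 0 by rewrite gt_eqF//; lra.
pose c w := (w - u) / (v - u).
have cE w : u <= w <= v -> f w = (1 - c w) * f u + c w * f v.
  move=> /andP[w1 w2]; rewrite -h; first by congr f; rewrite /c; field.
  by apply/andP; split; [apply: divr_ge0|rewrite ler_pdivrMr ?mul1r]; lra.
rewrite (cE ((1 - s) * u' + s * v')) ?(cE u') ?(cE v'); try (apply/andP; split; nra).
by rewrite /c; field.
Qed.

Lemma grid_segment f g p q : affine_on f p.1.1 q.1.1 -> affine_on g p.1.2 q.1.2 ->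
  grid_map f g @` segment p q = segment (grid_map f g p) (grid_map f g q).
Proof.
by move=> hf hg; apply: image_segment => s s01; rewrite /grid_map /= hf// hg.
Qed.

Lemma seg_hP (u v y z : R) p : u <= v -> (segment (u, y, z) (v, y, z) : set sp) p <->
  exists2 x, u <= x <= v & p = (x, y, z).
Proof.
move=> uv; split=> [/segmentP[s /andP[s0 s1] ->]|[x /andP[x0 x1] ->]].
  exists ((1 - s) * u + s * v); first by apply/andP; split; nra.
  by rewrite /=; congr (_, _, _); ring.
have [e|n0] := eqVneq u v.
  have -> : x = u by lra.
  by apply/segmentP; exists 0; rewrite ?lexx ?ler01//= subr0 !mul1r !mul0r !addr0.
apply/segmentP; exists ((x - u) / (v - u)).
  have ? : u < v by rewrite lt_neqAle n0.
  by apply/andP; split; [apply: divr_ge0|rewrite ler_pdivrMr ?mul1r]; lra.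
by rewrite /=; congr (_, _, _); field; rewrite subr_eq0 eq_sym.
Qed.

(** A horizontal segment stays a segment under any increasing bijection of the abscissas, affine or
    not, since only its set of points matters. *)
Lemma grid_horizontal f f' g (u v y z : R) : cancel f' f -> {homo f : x y / x <= y} ->
  {homo f' : x y / x <= y} -> cancel f f' ->
  grid_map f g @` segment (u, y, z) (v, y, z) = segment (f u, g y, z) (f v, g y, z).
Proof.
move=> fK fh f'h f'K.
wlog uv : u v / u <= v.
  move=> h; have [uv|/ltW vu] := leP u v; first exact: h.
  by rewrite segment_sym h// segment_sym.
apply/seteqP; split=> [_ [p /(seg_hP _ _ _ uv) [x /andP[ux xv] ->] <-]|p].
  by apply/(seg_hP _ _ _ (fh _ _ uv)); exists (f x) => //; rewrite !fh.
move=> /(seg_hP _ _ _ (fh _ _ uv)) [x /andP[ux xv] ->].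
exists (f' x, y, z); last by rewrite /grid_map /= fK.
apply/(seg_hP _ _ _ uv); exists (f' x) => //.
by apply/andP; split; [rewrite -(f'K u)|rewrite -(f'K v)]; exact: f'h.
Qed.
End PiecewiseLinear.

(** * Standard diagrams for a vertex, a leaf and a box, drawn in the unit square *)

Definition qph (n x y : nat) (z : int) : qpt :=
  (frac x n, frac y n, QArith_base.Qmake (Z_of_int z) (xO xH)).

Section Grid.
Context {R : realType}.
Notation sp := (R * R * R)%type.
Implicit Types (X Y Z : set sp) (p q : sp).

Lemma ptR_qph n x y z : (0 < n)%N ->
  ptR (qph n x y z) = (x%:R / n%:R, y%:R / n%:R, z%:~R / 2) :> sp.
Proof.
move=> n0; rewrite /ptR /= !fracR//; congr (_, _, _).
rewrite /qR /zR /=; congr (_ / _).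
by congr intmul; lia.
Qed.

Fixpoint segs (l : seq (sp * sp)) : set sp :=
  if l is s :: l' then segment s.1 s.2 `|` segs l' else set0.

Fixpoint path3 (l : seq sp) : seq (sp * sp) :=
  if l is p :: l' then if l' is q :: _ then (p, q) :: path3 l' else [::] else [::].

Lemma segs_catr l l' : segs (l ++ l') = segs l `|` segs l'.
Proof. by elim: l => [|s l IH] /=; rewrite ?set0U// IH setUA. Qed.

Definition ptR2 (s : qpt * qpt) : sp * sp := (ptR s.1, ptR s.2).

Lemma segs_setE l : segs_set l = segs (map ptR2 l).
Proof. by elim: l => //= s l ->. Qed.

Lemma polylineE l : map ptR2 (polyline l) = path3 (map ptR l).
Proof. by elim: l => //= p [|q l] //= ->. Qed.

Section GridMap.
Variables f f' g g' : R -> R.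
Hypotheses (fK : cancel f f') (f'K : cancel f' f) (gK : cancel g g') (g'K : cancel g' g).
Hypotheses (fh : {homo f : x y / x <= y}) (f'h : {homo f' : x y / x <= y}).
Hypotheses (gh : {homo g : x y / x <= y}) (g'h : {homo g' : x y / x <= y}).

(** Three kinds of segments whose images under a product map are segments: horizontal ones, vertical
    ones, and those along which both coordinate maps are affine. *)
Definition grid_ok p q :=
  [\/ p.1.2 = q.1.2 /\ p.2 = q.2, p.1.1 = q.1.1 /\ p.2 = q.2 |
      affine_on f p.1.1 q.1.1 /\ affine_on g p.1.2 q.1.2].

Lemma grid_segmentE p q : grid_ok p q ->
  grid_map f g @` segment p q = segment (grid_map f g p) (grid_map f g q).
Proof.
case: p q => -[x y] z [[x' y'] z'] [] /= [e1 e2].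
- by rewrite -e1 -e2; exact: grid_horizontal f'K fh f'h fK.
- rewrite -e1 -e2.
  have -> : segment (x, y, z) (x, y', z) = reflect_diag @` segment (y, x, z) (y', x, z).
    by rewrite reflect_segment.
  rewrite image_comp (_ : _ \o _ = reflect_diag \o grid_map g f)//.
  by rewrite -image_comp (@grid_horizontal _ g g' f y y' x z g'K gh g'h gK) reflect_segment.
- exact: grid_segment.
Qed.

Lemma grid_segs l : (forall s, List.In s l -> grid_ok s.1 s.2) ->
  grid_map f g @` segs l = segs [seq (grid_map f g s.1, grid_map f g s.2) | s <- l].
Proof.
elim: l => [|s l IH] h /=; first by rewrite image_set0.
rewrite image_setU grid_segmentE ?IH//; first by move=> t tl; apply: h; right.
by apply: h; left.
Qed.

Lemma grid_slot u0 u1 v0 v1 X : affine_on f u0 u1 -> affine_on g v0 v1 -> X `<=` unit_box ->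
  grid_map f g @` (slot u0 u1 v0 v1 @` X) = slot (f u0) (f u1) (g v0) (g v1) @` X.
Proof.
move=> hf hg uX; rewrite image_comp; apply: eq_imagel => p /uX[px py _].
rewrite /grid_map /slot /=; congr (_, _, _).
  by rewrite (_ : u0 + _ = (1 - p.1.1) * u0 + p.1.1 * u1) ?hf//; ring.
by rewrite (_ : v0 + _ = (1 - p.1.2) * v0 + p.1.2 * v1) ?hg//; ring.
Qed.
End GridMap.

(** The diagrams are templates in their coordinates, so that the rational picture in the unit square
    and its image in the link diagram are instances of one list of segments. *)
Definition boxT (s t u v w z y1 y2 top : R) : seq (sp * sp) :=
  path3 [:: (s, y1, 1 / 2); (t, y1, 0); (u, y1, 0)] ++
  path3 [:: (v, y2, 0); (w, y2, 0); (z, y2, 1 / 2)] ++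
  path3 [:: (v, y1, 0); (w, y1, 0); (z, y1, - (1 / 2))] ++
  path3 [:: (u, y2, 0); (u, top, 0)].
Definition gapT (x1 x2 x3 y1 y2 y3 : R) : seq (sp * sp) :=
  path3 [:: (x1, y2, 1 / 2); (x2, y1, 1); (x3, y1, 1 / 2)] ++
  path3 [:: (x1, y1, - (1 / 2)); (x2, y1, - 1); (x2, y3, 0)].
Definition bridge (xl x xr y : R) : seq (sp * sp) :=
  path3 [:: (xl, y, 0); (xl, y, 1); (x, y, 1); (xr, y, 1); (xr, y, 0)].
Definition line (x y1 y2 : R) : seq (sp * sp) := path3 [:: (x, y1, 0); (x, y2, 0)].

Definition boxwires (a x e top : R) :=
  boxT (a - 1 / 4) (a - 1 / 8) x (x + 1 / 16) (e + 1 / 8) (e + 1 / 4) (- (1 / 4)) (- (1 / 8)) top.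
(** A tangle in a small square, whose end NW is joined to the level [top] and whose other ends
    are joined to the sides of the zone [a - 1/4, e + 1/4]. *)
Definition boxform (a x e top : R) X :=
  segs (boxwires a x e top) `|` slot x (x + 1 / 16) (- (1 / 4)) (- (1 / 8)) @` X.

(** The row between the leaves [i] and [i + 1]: one strand continues over to the next leaf, the
    other passes under it and turns up to the edge added below a vertex of the tree. *)
Definition gap (i : R) : seq (sp * sp) :=
  gapT (i + 1 / 4) (i + 1 / 2) (i + 3 / 4) (- (1 / 4)) (- (1 / 8)) 0.
Definition cellT (x1 x2 x3 y1 y2 y3 : R) : seq (sp * sp) :=
  path3 [:: (x2, y3, 0); (x3, y2, 1 / 2)] ++ path3 [:: (x1, y1, 1 / 2); (x3, y1, - (1 / 2))].
(** The row below the leaf [a]: the strand coming down the leaf leaves to the right, and a second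
    strand crosses the cell from left to right. This is the pattern of two horizontal arcs. *)
Definition cell (a : R) : seq (sp * sp) :=
  cellT (a - 1 / 4) a (a + 1 / 4) (- (1 / 4)) (- (1 / 8)) 0.

Definition off_zone (a e top : R) : set sp :=
  [set p | [\/ p.1.1 <= a - 1 / 4, e + 1 / 4 <= p.1.1, p.1.2 <= -1 | top <= p.1.2]].

Definition boxQ (s t u v w z y1 y2 top : nat) : seq (qpt * qpt) :=
  polyline [:: qph 256 s y1 1; qph 256 t y1 0; qph 256 u y1 0] ++
  polyline [:: qph 256 v y2 0; qph 256 w y2 0; qph 256 z y2 1] ++
  polyline [:: qph 256 v y1 0; qph 256 w y1 0; qph 256 z y1 (- 1)] ++
  polyline [:: qph 256 u y2 0; qph 256 u top 0].
Definition gapQ (x1 x2 x3 y1 y2 y3 : nat) : seq (qpt * qpt) :=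
  polyline [:: qph 256 x1 y2 1; qph 256 x2 y1 2; qph 256 x3 y1 1] ++
  polyline [:: qph 256 x1 y1 (- 1); qph 256 x2 y1 (- 2); qph 256 x2 y3 0].
Definition bridgeQ (xl x xr y : nat) : seq (qpt * qpt) :=
  polyline [:: qph 256 xl y 0; qph 256 xl y 2; qph 256 x y 2; qph 256 xr y 2; qph 256 xr y 0].
Definition lineQ (x y1 y2 : nat) : seq (qpt * qpt) :=
  polyline [:: qph 256 x y1 0; qph 256 x y2 0].

Lemma halvesE : [/\ 0%Z%:~R / 2 = 0 :> R, 1%Z%:~R / 2 = 1 / 2 :> R, (- 1)%Z%:~R / 2 = - (1 / 2) :> R,
  2%Z%:~R / 2 = 1 :> R & (- 2)%Z%:~R / 2 = - 1 :> R].
Proof. by split; rewrite ?mulrNz; field. Qed.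

Lemma boxQE s t u v w z y1 y2 top : map ptR2 (boxQ s t u v w z y1 y2 top) =
  boxT (s%:R / 256) (t%:R / 256) (u%:R / 256) (v%:R / 256) (w%:R / 256) (z%:R / 256)
    (y1%:R / 256) (y2%:R / 256) (top%:R / 256).
Proof.
have [h1 h2 h3 _ _] := halvesE.
by rewrite /boxQ !map_cat !polylineE !map_cons !ptR_qph// h1 h2 h3.
Qed.

Lemma gapQE x1 x2 x3 y1 y2 y3 : map ptR2 (gapQ x1 x2 x3 y1 y2 y3) =
  gapT (x1%:R / 256) (x2%:R / 256) (x3%:R / 256) (y1%:R / 256) (y2%:R / 256) (y3%:R / 256).
Proof.
have [h1 h2 h3 h4 h5] := halvesE.
by rewrite /gapQ !map_cat !polylineE !map_cons !ptR_qph// h1 h2 h3 h4 h5.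
Qed.

Lemma bridgeQE xl x xr y : map ptR2 (bridgeQ xl x xr y) =
  bridge (xl%:R / 256) (x%:R / 256) (xr%:R / 256) (y%:R / 256).
Proof.
have [h1 h2 h3 h4 h5] := halvesE.
by rewrite /bridgeQ !polylineE !map_cons !ptR_qph// h1 h4.
Qed.

Lemma lineQE x y1 y2 : map ptR2 (lineQ x y1 y2) = line (x%:R / 256) (y1%:R / 256) (y2%:R / 256).
Proof.
have [h1 h2 h3 h4 h5] := halvesE.
by rewrite /lineQ !polylineE !map_cons !ptR_qph// h1.
Qed.

(** A vertex whose two subtrees have already become boxes: the bridge joins the upper ends of the
    boxes, and the line rising from the gap between them passes below it. *)
Definition pnode_segs : seq (qpt * qpt) :=
  boxQ 0 64 109 111 122 124 118 122 128 ++ boxQ 132 134 136 152 192 256 118 122 128 ++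
  bridgeQ 109 128 136 128 ++ gapQ 124 128 132 118 122 126 ++ lineQ 128 126 256.
Definition pnode : picture := (pnode_segs,
  [:: (qrct 256 109 111 118 122, 0%N); (qrct 256 136 152 118 122, 1%N)]).

Definition pboxform_segs (x0 x1 : nat) := boxQ 0 64 x0 x1 192 256 118 122 256.
Definition pboxform x0 x1 : picture :=
  (pboxform_segs x0 x1, [:: (qrct 256 x0 x1 118 122, 0%N)]).

(** Joins the corners of the middle square to the four ends of a box form: one on the left side, one
    on top, two on the right side. *)
Definition pexits : seq (qpt * qpt) :=
  polyline [:: qp 256 64 64 0; qph 256 0 118 1] ++ polyline [:: qp 256 64 192 0; qp 256 128 256 0] ++
  polyline [:: qp 256 192 64 0; qph 256 256 118 (- 1)] ++
  polyline [:: qp 256 192 192 0; qph 256 256 122 1].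

Definition pmid := qrct 4 1 3 1 3.

Lemma pnode_join X Y : tangle X -> tangle Y ->
  realize (env3 X Y Y) pnode =~ realize (env3 X Y Y) (padd (map_slot pmid join_picture) (pexits, [::])).
Proof.
move=> tX tY; apply: (@script_tangle _ [:: Simplify [::];
    Bend (qp 256 109 122 0) (qp 2 1 1 1) (qp 32 17 16 1);
    Unbend (qp 2 1 1 1) (qp 32 17 16 1) (qp 128 68 61 0);
    Bend (qp 256 111 122 0) (qp 32 16 15 1) (qp 128 68 59 0);
    Unbend (qp 256 111 118 0) (qp 128 64 59 (- 1)) (qp 2 1 2 0)] [:: Simplify [::]] _ _ _ _ _ tX tY tY).
by vm_cast_no_check (erefl true).
Qed.

Lemma pmid_boxform Z : tangle Z ->
  realize (env3 Z Z Z) (padd (pexits, [::]) (map_slot pmid (pbox 0))) =~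
  realize (env3 Z Z Z) (pboxform 128 129).
Proof.
move=> tZ; apply: (@script_tangle _ [:: Simplify [::];
    Bend (qph 128 0 59 1) (qp 8 1 1 0) (qp 4 1 1 0);
    Bend (qph 128 128 59 (- 1)) (qp 8 7 1 0) (qp 4 3 1 0);
    Bend (qp 2 1 2 0) (qp 8 1 7 0) (qp 4 1 3 0);
    Bend (qph 128 128 61 1) (qp 8 7 7 0) (qp 4 3 3 0);
    Reloc (qrct 8 1 7 1 7) 0 (qrct 4 1 3 1 3) (qrct 256 128 129 118 122)]
  [:: Simplify [::];
    Bend (qph 128 0 59 1) (qp 8 1 1 0) (qp 128 64 59 0);
    Bend (qph 128 128 59 (- 1)) (qp 8 7 1 0) (qp 256 129 118 0);
    Bend (qp 2 1 2 0) (qp 8 1 7 0) (qp 128 64 61 0);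
    Bend (qph 128 128 61 1) (qp 8 7 7 0) (qp 256 129 122 0)] _ _ _ _ _ tZ tZ tZ).
by vm_cast_no_check (erefl true).
Qed.

Definition cellQ (x1 x2 x3 y1 y2 y3 : nat) : seq (qpt * qpt) :=
  polyline [:: qph 256 x2 y3 0; qph 256 x3 y2 1] ++
  polyline [:: qph 256 x1 y1 1; qph 256 x3 y1 (- 1)].

Lemma cellQE x1 x2 x3 y1 y2 y3 : map ptR2 (cellQ x1 x2 x3 y1 y2 y3) =
  cellT (x1%:R / 256) (x2%:R / 256) (x3%:R / 256) (y1%:R / 256) (y2%:R / 256) (y3%:R / 256).
Proof.
have [h1 h2 h3 h4 h5] := halvesE.
by rewrite /cellQ !map_cat !polylineE !map_cons !ptR_qph// h1 h2 h3.
Qed.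

Definition pleaf : picture := (cellQ 0 128 256 118 122 126 ++ lineQ 128 126 256, [::]).

Lemma pleaf_boxform : realize (fun=> set0 : set sp) pleaf =~
  realize (fun=> set0) (padd (pboxform_segs 128 160, [::]) (map_slot (qrct 256 128 160 118 122) parcs)).
Proof.
apply: (@script_knot _ [:: Simplify [::]] [:: Simplify [::]]).
by vm_cast_no_check (erefl true).
Qed.
End Grid.

(** * The inductive step at a vertex *)

Section NodeStep.
Context {R : realType}.
Notation sp := (R * R * R)%type.
Implicit Types (X Y Z : set sp) (p q : sp).

Lemma chain_nth (x0 y0 : R) l k : pl_chain x0 y0 l -> (k <= size l)%N ->
  x0 <= (nth (0, 0) ((x0, y0) :: l) k).1.
Proof.
elim: l x0 y0 k => [|p l IH] x0 y0 [|k] //= [h1 h2 h3]; rewrite ltnS => kl.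
by have := IH _ _ k h3 kl; rewrite -surjective_pairing; lra.
Qed.

Lemma pl_piece (x0 y0 : R) l k t (u := nth (0, 0) ((x0, y0) :: l) k)
    (v := nth (0, 0) ((x0, y0) :: l) k.+1) :
  pl_chain x0 y0 l -> (k < size l)%N -> u.1 <= t -> t <= v.1 ->
  pl x0 y0 l t = u.2 + (t - u.1) * ((v.2 - u.2) / (v.1 - u.1)).
Proof.
rewrite {}/u {}/v; elim: l x0 y0 k => // p l IH x0 y0 [|k] ch kl ut tv.
  by rewrite pl_first.
have [h1 h2 h3] := ch; rewrite pl_next//; last first.
  apply: le_trans ut; rewrite /= [in nth _ _ _](surjective_pairing p).
  by apply: (chain_nth (k := k) h3); move: kl => /=; lia.
have := IH p.1 p.2 k h3 kl; rewrite -surjective_pairing; exact.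
Qed.

Lemma pl_affine (x0 y0 : R) l k s t (u := nth (0, 0) ((x0, y0) :: l) k)
    (v := nth (0, 0) ((x0, y0) :: l) k.+1) :
  pl_chain x0 y0 l -> (k < size l)%N -> u.1 <= s -> s <= v.1 -> u.1 <= t -> t <= v.1 ->
  affine_on (pl x0 y0 l) s t.
Proof.
move=> ch kl us sv ut tv r /andP[r0 r1].
by rewrite !(pl_piece ch kl) -/u -/v //; [ring|nra..].
Qed.

Lemma grid_off_zone (f g : R -> R) (a e top : R) :
  {mono f : x y / x <= y} -> {mono g : x y / x <= y} ->
  f 0 = a - 1 / 4 -> f 1 = e + 1 / 4 -> g 0 = -1 -> g 1 = top ->
  forall p, off_zone a e top (grid_map f g p) -> outside p.
Proof.
move=> fm gm f0 f1 g0 g1 p [] /=; rewrite -?f0 -?f1 -?g0 -?g1 ?fm ?gm => h;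
  by [apply: Or41|apply: Or42|apply: Or43|apply: Or44].
Qed.

Lemma pl_mono_le (x0 y0 : R) l : pl_chain x0 y0 l -> {mono pl x0 y0 l : x y / x <= y}.
Proof. by move=> ch; apply: le_mono => x y; exact: pl_lt. Qed.

(** The diagram becomes [join_picture] with exits, the latter is replaced by the equivalent sum
    inside the middle square, and the middle square is relocated to the standard place of the
    box. *)
Lemma pnode_box X Y : nice X -> nice Y ->
  realize (env3 X Y Y) pnode =~ realize (env3 (hsum (hook X) Y) set0 set0) (pboxform 128 129).
Proof.
move=> nX nY; have [tX _] := nX; have [tY _] := nY; have tt := @tangle_set0 R.
set Z := hsum _ _; have [tcr _] := @nice_crossing1 R; have [tcn _] := @nice_crossingN1 R.
have tsX := tangle_shr tX.
have tsY : tangle (shrunk (8 / 32) (24 / 32) (11 / 32) (13 / 32) Y) by apply: tangle_shrunk => //; lra.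
have tZ : tangle Z by apply: tangle_hsum => //; exact: tangle_hook.
have joinZ : realize (env3 X Y Y) join_picture =~ Z.
  apply: equiv_trans (equiv_sym (join_shr tX tY)) _; apply: hsum_equiv => //.
  - by apply: tangle_vsum => //; exact: tangle_hsum.
  - exact: tangle_hook.
  - apply: vsum_equiv => //; first exact: tangle_hsum; first exact: tangle_hsum.
      by apply: hsum_equivl => //; apply: equiv_sym; case: nX.
    exact: equiv_refl.
  - by apply: equiv_sym; apply: nice_shrunk => //; lra.
apply: equiv_trans (pnode_join tX tY) _.
have := pmid_boxform tZ; rewrite !realize_padd !realize_map_slot realize_pbox.
have envE P : realize (env3 Z Z Z) (P, [::]) = realize (env3 X Y Y) (P, [::]) by [].
rewrite envE.
have -> : realize (env3 Z Z Z) (pboxform 128 129) = realize (env3 Z set0 set0) (pboxform 128 129) by [].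
apply: equiv_trans; rewrite [X in X =~ _]setUC; apply: equiv_frame.
rewrite [env3 Z Z Z 0%N]/(env3 Z Z Z 0%N) /= /pmid qslot_qrct//.
apply: equiv_slot => //; try lra.
move=> p [|].
  by case=> h; [apply: Or41|apply: Or42|apply: Or43|apply: Or44]; lra.
rewrite /realize [segs_set _]/= !ptR_qp// !ptR_qph// !setU0.
by case=> [|[|[|]]] /segmentP[s /andP[s0 s1] -> /=];
  [apply: Or41|apply: Or44|apply: Or42|apply: Or42]; lra.
Qed.

Section Coordinates.
Variables (a xl i xr e y top : R).
Hypotheses (axl : a <= xl) (xli : xl <= i) (ixr : i + 1 <= xr) (xre : xr <= e).
Hypotheses (y0 : 0 < y) (ytop : y < top).

(** The change of abscissa from the unit square, where the script for a vertex is run once, to the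
    actual place of the vertex. The whole gap lies in the piece from 122/256 to 134/256, so its
    slanted segments stay straight. *)
Definition node_x : seq (R * R) := [:: (64 / 256, a - 1 / 8); (109 / 256, xl); (111 / 256, xl + 1 / 16);
  (122 / 256, i + 1 / 8); (134 / 256, i + 7 / 8); (136 / 256, xr); (152 / 256, xr + 1 / 16);
  (192 / 256, e + 1 / 8); (256 / 256, e + 1 / 4)].
Definition node_y : seq (R * R) := [:: (118 / 256, - (1 / 4)); (126 / 256, 0); (128 / 256, y); (256 / 256, top)].

Lemma node_x_chain : pl_chain 0 (a - 1 / 4) node_x.
Proof. by move: axl xli ixr xre => ? ? ? ?; do ?split; rewrite /=; lra. Qed.

Lemma node_y_chain : pl_chain 0 (-1) node_y.
Proof. by move: y0 ytop => ? ?; do ?split; rewrite /=; lra. Qed.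

Notation f := (pl 0 (a - 1 / 4) node_x).
Notation g := (pl 0 (-1) node_y).

Lemma node_xE k t (u := nth (0, 0) ((0, a - 1 / 4) :: node_x) k)
    (v := nth (0, 0) ((0, a - 1 / 4) :: node_x) k.+1) : (k < 9)%N ->
  u.1 <= t -> t <= v.1 -> f t = u.2 + (t - u.1) * ((v.2 - u.2) / (v.1 - u.1)).
Proof. by move=> k9; apply: pl_piece => //; exact: node_x_chain. Qed.

Lemma node_yE k t (u := nth (0, 0) ((0, -1) :: node_y) k)
    (v := nth (0, 0) ((0, -1) :: node_y) k.+1) : (k < 4)%N ->
  u.1 <= t -> t <= v.1 -> g t = u.2 + (t - u.1) * ((v.2 - u.2) / (v.1 - u.1)).
Proof. by move=> k9; apply: pl_piece => //; exact: node_y_chain. Qed.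

Lemma node_x_values :
  [/\ f (0 / 256) = a - 1 / 4, f (64 / 256) = a - 1 / 8, f (109 / 256) = xl, f (111 / 256) = xl + 1 / 16 &
   f (122 / 256) = i + 1 / 8] /\
  [/\ f (124 / 256) = i + 1 / 4, f (128 / 256) = i + 1 / 2, f (129 / 256) = i + 1 / 2 + 1 / 16,
    f (132 / 256) = i + 3 / 4 & f (134 / 256) = i + 1 - 1 / 8] /\
  [/\ f (136 / 256) = xr, f (152 / 256) = xr + 1 / 16, f (192 / 256) = e + 1 / 8 &
    f (256 / 256) = e + 1 / 4].
Proof.
split; [|split]; split.
- by rewrite (@node_xE 0) /=; [field|done|lra|lra].
- by rewrite (@node_xE 0) /=; [field|done|lra|lra].
- by rewrite (@node_xE 1) /=; [field|done|lra|lra].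
- by rewrite (@node_xE 2) /=; [field|done|lra|lra].
- by rewrite (@node_xE 3) /=; [field|done|lra|lra].
- by rewrite (@node_xE 4) /=; [field|done|lra|lra].
- by rewrite (@node_xE 4) /=; [field|done|lra|lra].
- by rewrite (@node_xE 4) /=; [field|done|lra|lra].
- by rewrite (@node_xE 4) /=; [field|done|lra|lra].
- by rewrite (@node_xE 4) /=; [field|done|lra|lra].
- by rewrite (@node_xE 5) /=; [field|done|lra|lra].
- by rewrite (@node_xE 6) /=; [field|done|lra|lra].
- by rewrite (@node_xE 7) /=; [field|done|lra|lra].
- by rewrite (@node_xE 8) /=; [field|done|lra|lra].
Qed.

Lemma node_y_values :
  [/\ g (118 / 256) = - (1 / 4), g (122 / 256) = - (1 / 8) & g (126 / 256) = 0] /\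
  [/\ g (128 / 256) = y & g (256 / 256) = top].
Proof.
split; split.
- by rewrite (@node_yE 0) /=; [field|done|lra|lra].
- by rewrite (@node_yE 1) /=; [field|done|lra|lra].
- by rewrite (@node_yE 1) /=; [field|done|lra|lra].
- by rewrite (@node_yE 2) /=; [field|done|lra|lra].
- by rewrite (@node_yE 3) /=; [field|done|lra|lra].
Qed.
Lemma node_x_affine :
  [/\ affine_on f (0 / 256) (64 / 256), affine_on f (122 / 256) (124 / 256),
   affine_on f (124 / 256) (128 / 256), affine_on f (128 / 256) (132 / 256) &
   affine_on f (132 / 256) (134 / 256)] /\
  [/\ affine_on f (192 / 256) (256 / 256), affine_on f (109 / 256) (111 / 256),
   affine_on f (136 / 256) (152 / 256) & affine_on f (128 / 256) (129 / 256)].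
Proof.
have fA k kl s t := @pl_affine 0 (a - 1 / 4) node_x k s t node_x_chain kl.
split; split.
- by apply: (fA 0%N isT); rewrite /=; lra.
- by apply: (fA 4%N isT); rewrite /=; lra.
- by apply: (fA 4%N isT); rewrite /=; lra.
- by apply: (fA 4%N isT); rewrite /=; lra.
- by apply: (fA 4%N isT); rewrite /=; lra.
- by apply: (fA 8%N isT); rewrite /=; lra.
- by apply: (fA 2%N isT); rewrite /=; lra.
- by apply: (fA 6%N isT); rewrite /=; lra.
- by apply: (fA 4%N isT); rewrite /=; lra.
Qed.

Lemma node_y_affine :
  [/\ affine_on g (122 / 256) (118 / 256), affine_on g (118 / 256) (126 / 256) &
   affine_on g (118 / 256) (122 / 256)].
Proof.
have gA k kl s t := @pl_affine 0 (-1) node_y k s t node_y_chain kl.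
by split; apply: (gA 1%N isT); rewrite /=; lra.
Qed.
End Coordinates.
End NodeStep.

Arguments pl : simpl never.

Section GridTemplates.
Context {R : realType}.
Notation sp := (R * R * R)%type.
Implicit Types (X Y Z : set sp) (p q : sp).

Fixpoint all_segs (P : sp -> sp -> Prop) (l : seq (sp * sp)) : Prop :=
  if l is s :: l' then P s.1 s.2 /\ all_segs P l' else True.

Lemma all_segsP P l : all_segs P l -> forall s, List.In s l -> P s.1 s.2.
Proof. by elim: l => //= s l IH [Ps /IH h] t [<-|/h]. Qed.

Lemma all_segs_cat P l l' : all_segs P l -> all_segs P l' -> all_segs P (l ++ l').
Proof. by elim: l => //= s l IH [Ps /IH h] /h; split. Qed.

Variables f g : R -> R.

Lemma boxT_ok s t u v w z y1 y2 top : affine_on f s t -> affine_on f w z ->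
  all_segs (grid_ok f g) (boxT s t u v w z y1 y2 top).
Proof.
move=> h1 h2; split; first by apply: Or33; split; [|exact: affine_same].
split; first by apply: Or31.
split; first by apply: Or31.
split; first by apply: Or33; split; [|exact: affine_same].
split; first by apply: Or31.
split; first by apply: Or33; split; [|exact: affine_same].
by split; first by apply: Or32.
Qed.

Lemma gapT_ok x1 x2 x3 y1 y2 y3 : affine_on f x1 x2 -> affine_on f x2 x3 ->
  affine_on g y2 y1 -> affine_on g y1 y3 ->
  all_segs (grid_ok f g) (gapT x1 x2 x3 y1 y2 y3).
Proof.
move=> h1 h2 h3 h4; split; first exact: Or33.
split; first by apply: Or33; split; [|exact: affine_same].
split; first by apply: Or33; split; [|exact: affine_same].
by split; first by apply: Or33; split; [exact: affine_same|].
Qed.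

Lemma bridge_ok xl x xr y : all_segs (grid_ok f g) (bridge xl x xr y).
Proof.
split; first by apply: Or33; split; exact: affine_same.
split; first by apply: Or31.
split; first by apply: Or31.
by split; first by apply: Or33; split; exact: affine_same.
Qed.

Lemma line_ok x y1 y2 : all_segs (grid_ok f g) (line x y1 y2).
Proof. by split; first by apply: Or32. Qed.

Definition grid_segs_map (l : seq (sp * sp)) := [seq (grid_map f g s.1, grid_map f g s.2) | s <- l].

Lemma boxT_map s t u v w z y1 y2 top : grid_segs_map (boxT s t u v w z y1 y2 top) =
  boxT (f s) (f t) (f u) (f v) (f w) (f z) (g y1) (g y2) (g top).
Proof. by []. Qed.

Lemma gapT_map x1 x2 x3 y1 y2 y3 : grid_segs_map (gapT x1 x2 x3 y1 y2 y3) =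
  gapT (f x1) (f x2) (f x3) (g y1) (g y2) (g y3).
Proof. by []. Qed.

Lemma bridge_map xl x xr y : grid_segs_map (bridge xl x xr y) = bridge (f xl) (f x) (f xr) (g y).
Proof. by []. Qed.

Lemma line_map x y1 y2 : grid_segs_map (line x y1 y2) = line (f x) (g y1) (g y2).
Proof. by []. Qed.

Lemma grid_segs_map_cat l l' : grid_segs_map (l ++ l') = grid_segs_map l ++ grid_segs_map l'.
Proof. exact: map_cat. Qed.
End GridTemplates.

Lemma pl_swapK (R : realType) (x z : R) (l : seq (R * R)) : pl_chain x z l ->
  cancel (pl z x (pl_swap l)) (pl x z l).
Proof.
move=> ch; have := plK (pl_chain_swap ch).
by rewrite /pl_swap -map_comp (_ : _ \o _ = id) ?map_id//; apply/funext => -[].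
Qed.

Lemma pl_segs (R : realType) (x0 x0' y0 y0' : R) lx ly l : pl_chain x0 x0' lx -> pl_chain y0 y0' ly ->
  all_segs (grid_ok (pl x0 x0' lx) (pl y0 y0' ly)) l ->
  grid_map (pl x0 x0' lx) (pl y0 y0' ly) @` segs l =
  segs (grid_segs_map (pl x0 x0' lx) (pl y0 y0' ly) l).
Proof.
move=> fc gc /all_segsP lok; have fK := plK fc; have gK := plK gc.
apply: (@grid_segs _ _ (pl x0' x0 (pl_swap lx)) _ (pl y0' y0 (pl_swap ly))) => //; try exact: pl_swapK.
- by move=> s t; exact: pl_le.
- by move=> s t; apply: pl_le; exact: pl_chain_swap.
- by move=> s t; exact: pl_le.
- by move=> s t; apply: pl_le; exact: pl_chain_swap.
Qed.

Section NodeImage.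
Context {R : realType}.
Notation sp := (R * R * R)%type.
Implicit Types (X Y Z : set sp) (p q : sp).
Variables (a xl i xr e y top : R).
Hypotheses (axl : a <= xl) (xli : xl <= i) (ixr : i + 1 <= xr) (xre : xr <= e).
Hypotheses (y0 : 0 < y) (ytop : y < top).

Notation f := (pl 0 (a - 1 / 4) (node_x a xl i xr e)).
Notation g := (pl 0 (-1) (node_y y top)).

Lemma node_image X Y : X `<=` unit_box -> Y `<=` unit_box ->
  grid_map f g @` realize (env3 X Y Y) pnode =
  segs (boxwires a xl i y ++ boxwires (i + 1) xr e y ++ bridge xl (i + 1 / 2) xr y ++ gap i ++
    line (i + 1 / 2) 0 top) `|`
  (slot xl (xl + 1 / 16) (- (1 / 4)) (- (1 / 8)) @` X `|`
   slot xr (xr + 1 / 16) (- (1 / 4)) (- (1 / 8)) @` Y).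
Proof.
move=> uX uY; have fc := node_x_chain axl xli ixr xre; have gc := node_y_chain y0 ytop.
have [[A0 A1 A2 A3 A4] [A5 A6 A7 _]] := node_x_affine axl xli ixr xre.
have [B0 B1 B2] := node_y_affine y0 ytop.
have [[x1 x2 x3 x4 x5] [[x6 x7 x8 x9 x10] [x11 x12 x13 x14]]] := node_x_values axl xli ixr xre.
have [[w1 w2 w3] [w4 w5]] := node_y_values y0 ytop.
rewrite /realize image_setU; congr (_ `|` _).
  rewrite segs_setE /pnode_segs map_cat boxQE map_cat boxQE map_cat bridgeQE map_cat gapQE lineQE pl_segs//; last first.
    apply: all_segs_cat; first exact: boxT_ok.
    apply: all_segs_cat; first exact: boxT_ok.
    apply: all_segs_cat; first exact: bridge_ok.
    apply: all_segs_cat; last exact: line_ok.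
    exact: gapT_ok.
  rewrite grid_segs_map_cat boxT_map grid_segs_map_cat boxT_map grid_segs_map_cat bridge_map.
  rewrite grid_segs_map_cat gapT_map line_map.
  by rewrite x1 x2 x3 x4 x5 x6 x7 x9 x10 x11 x12 x13 x14 w1 w2 w3 w4 w5 /boxwires (_ : i + 1 - 1 / 4 = i + 3 / 4) //; field.
rewrite [boxes_set _ _]/= setU0 image_setU !qslot_qrct// !grid_slot//.
by rewrite x3 x4 x11 x12 w1 w2.
Qed.

Lemma boxform_image Z : Z `<=` unit_box ->
  grid_map f g @` realize (env3 Z set0 set0) (pboxform 128 129) = boxform a (i + 1 / 2) e top Z.
Proof.
move=> uZ; have fc := node_x_chain axl xli ixr xre; have gc := node_y_chain y0 ytop.
have [[A0 _ _ _ _] [A5 _ _ A8]] := node_x_affine axl xli ixr xre.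
have [B0 B1 B2] := node_y_affine y0 ytop.
have [[x1 x2 x3 x4 x5] [[x6 x7 x8 x9 x10] [x11 x12 x13 x14]]] := node_x_values axl xli ixr xre.
have [[w1 w2 w3] [w4 w5]] := node_y_values y0 ytop.
rewrite /realize image_setU /boxform; congr (_ `|` _).
  rewrite segs_setE /pboxform_segs boxQE pl_segs//; last exact: boxT_ok.
  by rewrite boxT_map x1 x2 x7 x8 x13 x14 w1 w2 w5.
rewrite [boxes_set _ _]/= setU0 !qslot_qrct// !grid_slot//.
by rewrite x7 x8 w1 w2.
Qed.

(** The equivalence [pnode_box] is carried from the unit square to the zone of the vertex by
    conjugation with the product map; everything outside the zone stays fixed. *)
Lemma node_step X Y : nice X -> nice Y -> equiv_rel (off_zone a e top)
  (segs (boxwires a xl i y ++ boxwires (i + 1) xr e y ++ bridge xl (i + 1 / 2) xr y ++ gap i ++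
    line (i + 1 / 2) 0 top) `|`
  (slot xl (xl + 1 / 16) (- (1 / 4)) (- (1 / 8)) @` X `|`
   slot xr (xr + 1 / 16) (- (1 / 4)) (- (1 / 8)) @` Y))
  (boxform a (i + 1 / 2) e top (hsum (hook X) Y)).
Proof.
move=> nX nY; have fc := node_x_chain axl xli ixr xre; have gc := node_y_chain y0 ytop.
have [[tX uX] _] := nX; have [[tY uY] _] := nY.
have [[x1 x2 x3 x4 x5] [[x6 x7 x8 x9 x10] [x11 x12 x13 x14]]] := node_x_values axl xli ixr xre.
rewrite -node_image// -boxform_image; last first.
  by apply: (proj2 (tangle_hsum _ _)) => //; exact: tangle_hook.
apply: equiv_conj (pnode_box nX nY).
- by apply: cont_grid; exact: cont_pl.
- by apply: (@cont_grid _ (pl (a - 1 / 4) 0 (pl_swap (node_x a xl i xr e)))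
    (pl (-1) 0 (pl_swap (node_y y top)))); exact: cont_pl.
- by apply: grid_mapK; exact: plK.
- by apply: grid_mapK; exact: pl_swapK.
- apply: grid_off_zone; try exact: pl_mono_le.
  + exact: pl_start.
  + by rewrite -x14; congr (pl _ _ _ _); field.
  + exact: pl_start.
  + have [_ [_ h]] := node_y_values y0 ytop; by rewrite -[RHS]h; congr (pl _ _ _ _); field.
Qed.
End NodeImage.

(** * The leaf and the induction on the tree *)

Section TreeForm.
Context {R : realType}.
Notation sp := (R * R * R)%type.
Implicit Types (X Y Z : set sp) (p q : sp).

Lemma cellT_ok (f g : R -> R) x1 x2 x3 y1 y2 y3 : affine_on f x1 x3 -> affine_on f x2 x3 ->
  affine_on g y3 y2 -> all_segs (grid_ok f g) (cellT x1 x2 x3 y1 y2 y3).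
Proof.
move=> h1 h2 h3; split; first exact: Or33.
by split; first by apply: Or33; split; [|exact: affine_same].
Qed.

Lemma cellT_map (f g : R -> R) x1 x2 x3 y1 y2 y3 : grid_segs_map f g (cellT x1 x2 x3 y1 y2 y3) =
  cellT (f x1) (f x2) (f x3) (g y1) (g y2) (g y3).
Proof. by []. Qed.

Section LeafStep.
Variables (a top : R).
Hypothesis top0 : 0 < top.

Definition leaf_x : seq (R * R) := [:: (256 / 256, a + 1 / 4)].
Definition leaf_y : seq (R * R) := [:: (118 / 256, - (1 / 4)); (126 / 256, 0); (256 / 256, top)].

Lemma leaf_x_chain : pl_chain 0 (a - 1 / 4) leaf_x.
Proof. by do ?split; rewrite /=; lra. Qed.

Lemma leaf_y_chain : pl_chain 0 (-1) leaf_y.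
Proof. by move: top0 => ?; do ?split; rewrite /=; lra. Qed.

Notation f := (pl 0 (a - 1 / 4) leaf_x).
Notation g := (pl 0 (-1) leaf_y).

Lemma leaf_xE t : t <= 256 / 256 -> f t = a - 1 / 4 + t / 2.
Proof. by move=> h; rewrite pl_first//; [rewrite /=; field|exact: leaf_x_chain]. Qed.

Lemma leaf_x_affine s t : s <= 256 / 256 -> t <= 256 / 256 -> affine_on f s t.
Proof. by move=> h1 h2; apply: affine_pl => //; exact: leaf_x_chain. Qed.

Lemma leaf_y_affine s t : 118 / 256 <= s -> s <= 126 / 256 -> 118 / 256 <= t -> t <= 126 / 256 ->
  affine_on g s t.
Proof. by move=> *; apply: (pl_affine (k := 1) leaf_y_chain isT); rewrite /=. Qed.

Lemma leaf_y_values :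
  [/\ g (118 / 256) = - (1 / 4), g (122 / 256) = - (1 / 8), g (126 / 256) = 0 & g (256 / 256) = top].
Proof.
have gE k kl t := @pl_piece R 0 (-1) leaf_y k t leaf_y_chain kl.
split.
- by rewrite (gE 0%N isT) /=; [field|lra|lra].
- by rewrite (gE 1%N isT) /=; [field|lra|lra].
- by rewrite (gE 1%N isT) /=; [field|lra|lra].
- by rewrite (gE 2%N isT) /=; [field|lra|lra].
Qed.

Lemma leaf_step : equiv_rel (off_zone a a top) (segs (cell a ++ line a 0 top))
  (boxform a a a top (horizontal_arcs R)).
Proof.
have a1 : affine_on f (0 / 256) (256 / 256) by apply: leaf_x_affine; lra.
have a2 : affine_on f (128 / 256) (256 / 256) by apply: leaf_x_affine; lra.
have a3 : affine_on f (0 / 256) (64 / 256) by apply: leaf_x_affine; lra.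
have a4 : affine_on f (192 / 256) (256 / 256) by apply: leaf_x_affine; lra.
have a5 : affine_on f (128 / 256) (160 / 256) by apply: leaf_x_affine; lra.
have b1 : affine_on g (126 / 256) (122 / 256) by apply: leaf_y_affine; lra.
have b2 : affine_on g (118 / 256) (122 / 256) by apply: leaf_y_affine; lra.
have fc := leaf_x_chain; have gc := leaf_y_chain; have [w1 w2 w3 w4] := leaf_y_values.
have x0 : f (0 / 256) = a - 1 / 4 by rewrite leaf_xE; [field|lra].
have x1 : f (64 / 256) = a - 1 / 8 by rewrite leaf_xE; [field|lra].
have x2 : f (128 / 256) = a by rewrite leaf_xE; [field|lra].
have x3 : f (160 / 256) = a + 1 / 16 by rewrite leaf_xE; [field|lra].
have x4 : f (192 / 256) = a + 1 / 8 by rewrite leaf_xE; [field|lra].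
have x5 : f (256 / 256) = a + 1 / 4 by rewrite leaf_xE; [field|lra].
have [_ uA] := @tangle_arcs R.
rewrite (_ : segs _ = grid_map f g @` realize (fun=> set0) pleaf); last first.
  rewrite /realize image_setU [boxes_set _ _]/= image_set0 setU0 /pleaf.
  rewrite segs_setE map_cat cellQE lineQE pl_segs//; last first.
    by apply: all_segs_cat; [exact: cellT_ok|exact: line_ok].
  by rewrite grid_segs_map_cat cellT_map line_map x0 x2 x5 w1 w2 w3 w4.
rewrite (_ : boxform _ _ _ _ _ = grid_map f g @` realize (fun=> set0)
    (padd (pboxform_segs 128 160, [::]) (map_slot (qrct 256 128 160 118 122) parcs))); last first.
  rewrite realize_padd realize_map_slot realize_parcs image_setU /boxform; congr (_ `|` _).
    rewrite /realize [boxes_set _ _]/= setU0 segs_setE /pboxform_segs boxQE pl_segs//.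
      by rewrite boxT_map x0 x1 x2 x3 x4 x5 w1 w2 w4.
    exact: boxT_ok.
  by rewrite qslot_qrct// grid_slot// x2 x3 w1 w2.
apply: equiv_conj pleaf_boxform.
- by apply: cont_grid; exact: cont_pl.
- by apply: (@cont_grid _ (pl (a - 1 / 4) 0 (pl_swap leaf_x)) (pl (-1) 0 (pl_swap leaf_y)));
    exact: cont_pl.
- by apply: grid_mapK; exact: plK.
- by apply: grid_mapK; exact: pl_swapK.
- apply: grid_off_zone; try exact: pl_mono_le.
  + exact: pl_start.
  + by rewrite -x5; congr (pl _ _ _ _); field.
  + exact: pl_start.
  + by rewrite -[RHS]w4; congr (pl _ _ _ _); field.
Qed.
End LeafStep.
End TreeForm.

Section TreeForms.
Context {R : realType}.
Notation sp := (R * R * R)%type.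
Implicit Types (X Y Z : set sp) (p q : sp) (T : btree).

Lemma segs_sub (P : sp -> Prop) l : all_segs (fun p q => segment p q `<=` P) l -> segs l `<=` P.
Proof.
by elim: l => [|s l IH] /=; [move=> _ x []|move=> [h /IH h'] x [/h|/h']].
Qed.

Lemma segment_x_ge c p q x : c <= p.1.1 -> c <= q.1.1 -> segment p q x -> c <= x.1.1.
Proof. by move=> cp cq /segmentP[s /andP[s0 s1] ->] /=; nra. Qed.

Lemma segment_x_le c p q x : p.1.1 <= c -> q.1.1 <= c -> segment p q x -> x.1.1 <= c.
Proof. by move=> cp cq /segmentP[s /andP[s0 s1] ->] /=; nra. Qed.

Lemma segment_y_ge c p q x : c <= p.1.2 -> c <= q.1.2 -> segment p q x -> c <= x.1.2.
Proof. by move=> cp cq /segmentP[s /andP[s0 s1] ->] /=; nra. Qed.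

Lemma segment_y_le c p q x : p.1.2 <= c -> q.1.2 <= c -> segment p q x -> x.1.2 <= c.
Proof. by move=> cp cq /segmentP[s /andP[s0 s1] ->] /=; nra. Qed.

Lemma all_segs_mono (P Q : sp -> sp -> Prop) l : (forall p q, P p q -> Q p q) ->
  all_segs P l -> all_segs Q l.
Proof. by move=> PQ; elim: l => //= s l IH [/PQ ? /IH]. Qed.

Definition x_within (b c : R) p q := [/\ b <= p.1.1, p.1.1 <= c, b <= q.1.1 & q.1.1 <= c].

Lemma segs_x_within b c l x : all_segs (x_within b c) l -> segs l x -> b <= x.1.1 <= c.
Proof.
move=> h; apply: (@segs_sub (fun y => b <= y.1.1 <= c)).
apply: all_segs_mono h => p q [h1 h2 h3 h4] y sy.
by rewrite (segment_x_ge _ _ sy)// (segment_x_le _ _ sy).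
Qed.

Lemma boxform_x a x e top X p : X `<=` unit_box -> a <= x -> x <= e ->
  boxform a x e top X p -> a - 1 / 4 <= p.1.1 <= e + 1 / 4.
Proof.
move=> uX ax xe [|[q /uX[/andP[q0 q1] _ _] <-]]; last by apply/andP; split; rewrite /=; lra.
apply: segs_x_within; rewrite /boxwires /boxT.
by do ?[apply: all_segs_cat]; do ?split; rewrite /=; lra.
Qed.

Lemma leaves_gt0 T : (0 < leaves T)%N.
Proof. by elim: T => //= l IH r _; lia. Qed.

Definition last_leaf (a : nat) T : R := (a + leaves T)%:R - 1.

Lemma last_leaf_ge a T : a%:R <= last_leaf a T.
Proof. by rewrite /last_leaf natrD; have := leaves_gt0 T; rewrite -(ler1n R) => ?; lra. Qed.

Lemma vertex_x_ge a T : a%:R <= vertex_x R a T.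
Proof.
case: T => //= l _; rewrite natrD; have := leaves_gt0 l; rewrite -(ler1n R) => ?; lra.
Qed.

Lemma vertex_x_le a T : vertex_x R a T <= last_leaf a T.
Proof.
rewrite /last_leaf; case: T => /= [|l r]; first by rewrite natrD addrK.
rewrite !natrD; have := leaves_gt0 r; rewrite -(ler1n R) => ?; lra.
Qed.

(** The diagram of a subtree with first leaf [a], whose upward edge is cut off at the level [top],
    together with the row below its leaves. *)
Fixpoint tree_form (a : nat) T (top : R) : seq (sp * sp) :=
  if T is Node l r then
    let b := (a + leaves l)%N in let y := vertex_y R T in
    tree_form a l y ++ tree_form b r y ++
    bridge (vertex_x R a l) (vertex_x R a T) (vertex_x R b r) y ++ gap (last_leaf a l) ++
    line (vertex_x R a T) 0 top
  else cell a%:R ++ line a%:R 0 top.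

Lemma tree_form_Node a l r top (b := (a + leaves l)%N) (y := vertex_y R (Node l r)) :
  tree_form a (Node l r) top = tree_form a l y ++ tree_form b r y ++
    bridge (vertex_x R a l) (vertex_x R a (Node l r)) (vertex_x R b r) y ++ gap (last_leaf a l) ++
    line (vertex_x R a (Node l r)) 0 top.
Proof. by []. Qed.

Lemma x_within_sub b c b' c' : b' <= b -> c <= c' ->
  forall p q, x_within b c p q -> x_within b' c' p q.
Proof. by move=> ? ? p q [? ? ? ?]; split; lra. Qed.

Lemma vertex_x_mid a l r : vertex_x R a (Node l r) = last_leaf a l + 1 / 2.
Proof. by rewrite /last_leaf /=; field. Qed.

Lemma last_leaf_next a l : (a + leaves l)%:R = last_leaf a l + 1.
Proof. by rewrite /last_leaf subrK. Qed.

Lemma last_leaf_Node a l r : last_leaf a (Node l r) = last_leaf (a + leaves l) r.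
Proof. by rewrite /last_leaf /= addnA. Qed.

Lemma bridge_x a l r : all_segs (x_within (vertex_x R a l) (vertex_x R (a + leaves l) r))
  (bridge (vertex_x R a l) (vertex_x R a (Node l r)) (vertex_x R (a + leaves l) r)
    (vertex_y R (Node l r))).
Proof.
have h1 := vertex_x_le a l; have h2 := vertex_x_ge (a + leaves l) r.
have h3 := vertex_x_mid a l r; have h4 := last_leaf_next a l.
move: h1 h2 h3 h4; move: (vertex_x R a (Node l r)) (vertex_x R a l) (vertex_x R _ r) => x xl xr.
by move: (vertex_y R _) (last_leaf a l) => y i *; do ?split; rewrite /=; lra.
Qed.

Lemma gap_x i : all_segs (x_within (i + 1 / 4) (i + 3 / 4)) (gap i).
Proof. by do ?[split]; rewrite /=; lra. Qed.

Lemma line_x x y1 y2 : all_segs (x_within x x) (line x y1 y2).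
Proof. by do ?[split]. Qed.

Lemma tree_form_x a T top :
  all_segs (x_within (a%:R - 1 / 4) (last_leaf a T + 1 / 4)) (tree_form a T top).
Proof.
elim: T a top => [|l IHl r IHr] a top.
  by rewrite /last_leaf natrD addrK; do ?[split]; rewrite /=; lra.
rewrite tree_form_Node last_leaf_Node.
have h1 := vertex_x_ge a l; have h2 := vertex_x_le (a + leaves l) r.
have h3 := last_leaf_next a l; have h4 := last_leaf_ge a l; have h5 := last_leaf_ge (a + leaves l) r.
have h6 := vertex_x_mid a l r.
apply: all_segs_cat; first by apply: all_segs_mono (IHl _ _); apply: x_within_sub; lra.
apply: all_segs_cat; first by apply: all_segs_mono (IHr _ _); apply: x_within_sub; lra.
apply: all_segs_cat; first by apply: all_segs_mono (bridge_x a l r); apply: x_within_sub; lra.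
apply: all_segs_cat; first by apply: all_segs_mono (gap_x _); apply: x_within_sub; lra.
by apply: all_segs_mono (line_x _ _ _); apply: x_within_sub; lra.
Qed.

Lemma vertex_y_Node l r : vertex_y R l + 1 <= vertex_y R (Node l r) /\
  vertex_y R r + 1 <= vertex_y R (Node l r).
Proof.
rewrite /vertex_y /= !natr1 !ler_nat.
by have := leaves_gt0 l; have := leaves_gt0 r; split; lia.
Qed.

Lemma vertex_y_ge0 T : 0 <= vertex_y R T.
Proof. exact: ler0n. Qed.

(** The zones of the two subtrees are disjoint and below the level of the vertex. Each is replaced
    by a box while the rest is kept fixed, and [node_step] merges the two boxes. *)
Lemma tree_form_equiv a T top : vertex_y R T < top ->
  equiv_rel (off_zone a%:R (last_leaf a T) top) (segs (tree_form a T top))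
    (boxform a%:R (vertex_x R a T) (last_leaf a T) top (tree_tangle T)).
Proof.
elim: T a top => [|l IHl r IHr] a top ytop.
  by rewrite /last_leaf natrD addrK; apply: leaf_step.
set y := vertex_y R (Node l r); set b := (a + leaves l)%N.
have [yl yr] := vertex_y_Node l r; have yl0 := vertex_y_ge0 l.
have h1 := vertex_x_ge a l; have h1' := vertex_x_le a l.
have h2 := vertex_x_ge b r; have h2' := vertex_x_le b r.
have h3 := last_leaf_next a l; have h4 := last_leaf_ge a l; have h5 := last_leaf_ge b r.
have h6 := vertex_x_mid a l r.
rewrite -/b in h3.
have eT : last_leaf a (Node l r) = last_leaf b r := last_leaf_Node a l r.
have [_ ul] := @tangle_tree R l; have [_ ur] := @tangle_tree R r.
(* The strands of the vertex itself run between the zones of its subtrees or not below the level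
   [y], so they can be kept fixed. *)
pose rest := bridge (vertex_x R a l) (vertex_x R a (Node l r)) (vertex_x R b r) y ++
  gap (last_leaf a l) ++ line (vertex_x R a (Node l r)) 0 top.
have rest_off p : segs rest p -> [\/ last_leaf a l + 1 / 4 <= p.1.1 <= b%:R - 1 / 4 | y <= p.1.2].
  rewrite /rest 2!segs_catr => -[|[]] hp.
  - right; apply: (@segs_sub (fun q => y <= q.1.2) _ _ p hp).
    by do ?[split] => // q sq; apply: segment_y_ge sq; rewrite /= lexx.
  - by left; have := segs_x_within (gap_x _) hp => /andP[? ?]; apply/andP; split; lra.
  - by left; have := segs_x_within (line_x _ _ _) hp => /andP[? ?]; apply/andP; split; lra.
have formE : segs (tree_form a (Node l r) top) =
    (segs (tree_form b r y) `|` segs rest) `|` segs (tree_form a l y).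
  by rewrite tree_form_Node -/b -/y 2!segs_catr -/rest setUC.
rewrite formE eT.
apply: (@equiv_trans _ _ _ ((segs (tree_form b r y) `|` segs rest) `|`
    boxform a%:R (vertex_x R a l) (last_leaf a l) y (tree_tangle l))).
  apply: equiv_frame; apply: equiv_mono (IHl a y _); last by rewrite /y; lra.
  move=> p [[]|[]] hp.
  - by apply: Or41.
  - by apply: Or42; lra.
  - by apply: Or43.
  - by apply: Or44; rewrite /y; lra.
  - by have := segs_x_within (tree_form_x _ _ _) hp => /andP[? ?]; apply: Or42; lra.
  - by case: (rest_off _ hp) => [/andP[? ?]|?]; [apply: Or42; lra|apply: Or44].
rewrite [X in equiv_rel _ X _](_ : _ = (boxform a%:R (vertex_x R a l) (last_leaf a l) y (tree_tangle l)
    `|` segs rest) `|` segs (tree_form b r y)); last by rewrite [LHS]setUC setUA setUAC.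
apply: (@equiv_trans _ _ _ ((boxform a%:R (vertex_x R a l) (last_leaf a l) y (tree_tangle l)
    `|` segs rest) `|` boxform b%:R (vertex_x R b r) (last_leaf b r) y (tree_tangle r))).
  apply: equiv_frame; apply: equiv_mono (IHr b y _); last by rewrite /y; lra.
  move=> p [[]|[]] hp.
  - by apply: Or41; lra.
  - by apply: Or42.
  - by apply: Or43.
  - by apply: Or44; rewrite /y; lra.
  - by have := boxform_x ul h1 h1' hp => /andP[? ?]; apply: Or41; lra.
  - by case: (rest_off _ hp) => [/andP[? ?]|?]; [apply: Or41; lra|apply: Or44].
have ixr : last_leaf a l + 1 <= vertex_x R b r by rewrite -h3.
have y0 : 0 < y by rewrite /y; lra.
have := node_step h1 h1' ixr h2' y0 ytop (nice_tree l) (nice_tree r).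
rewrite -h3 -h6 2!segs_catr -/rest; congr (equiv_rel _ _ _).
by rewrite /boxform; apply/seteqP; split=> p; rewrite /setU /=; tauto.
Qed.
End TreeForms.

(** * From the outermost box to the side closure *)

Section Stretch.
Context {R : realType}.
Notation sp := (R * R * R)%type.
Implicit Types (A X : set sp) (p q : sp).

Definition cutoff (N t : R) : R := Num.max 0 (Num.min 1 (2 - `|t| / N)).

Lemma cutoff_ge0 N t : 0 <= cutoff N t. Proof. by rewrite le_max lexx. Qed.
Lemma cutoff_le1 N t : cutoff N t <= 1. Proof. by rewrite ge_max ler01 ge_min lexx. Qed.

Lemma cutoff_in N t : 0 < N -> `|t| <= N -> cutoff N t = 1.
Proof.
move=> N0 tN; have h : `|t| / N <= 1 by rewrite ler_pdivrMr// mul1r.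
rewrite /cutoff (_ : Num.min _ _ = 1); first by apply/max_idPr; exact: ler01.
by apply/min_idPl; lra.
Qed.

Lemma cutoff_out N t : 0 < N -> 2 * N <= `|t| -> cutoff N t = 0.
Proof.
move=> N0 tN; have h : 2 <= `|t| / N by rewrite ler_pdivlMr.
by apply/max_idPl; rewrite ge_min; apply/orP; right; lra.
Qed.

Lemma cont_cutoff N : continuous (cutoff N).
Proof.
rewrite /cutoff; apply: cont_max; first exact: cont_cst.
apply: cont_min; first exact: cont_cst.
apply: contB; first exact: cont_cst.
apply: contM; last exact: cont_cst.
by apply: cont_norm => t; exact: cvg_id.
Qed.

(** The displacement is cut off in the two other coordinates outside a cube containing [A].
    Interpolating between an increasing map and the identity leaves it increasing. *)
Lemma stretch_y (f : R -> R) A (M N : R) : continuous f -> (forall s t, s < t -> f s < f t) ->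
  (forall t, M <= `|t| -> f t = t) -> A `<=` [set p | `|p| <= N] ->
  equiv_rel set0 A (grid_map id f @` A).
Proof.
move=> cf fm fM AN; pose N' := Num.max 1 N.
have N0 : 0 < N' by rewrite lt_max ltr01.
pose b (p : sp) := cutoff N' p.1.1 * cutoff N' p.2 * (f p.1.2 - p.1.2).
exists (fun p => (p.1.1, p.1.2 + b p, p.2)).
  apply: (@push_homeo _ _ b (Num.max (Num.max M (2 * N')) 0)) => //.
  - have c1 : continuous (fun p : sp => cutoff N' p.1.1).
      by move=> q; apply: (@continuous_comp _ _ _ (fun p : sp => p.1.1) (cutoff N') q);
        [exact: cont_x|exact: cont_cutoff].
    have c2 : continuous (fun p : sp => cutoff N' p.2).
      by move=> q; apply: (@continuous_comp _ _ _ (fun p : sp => p.2) (cutoff N') q);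
        [exact: cont_z|exact: cont_cutoff].
    have c3 : continuous (fun p : sp => f p.1.2).
      by move=> q; apply: (@continuous_comp _ _ _ (fun p : sp => p.1.2) f q);
        [exact: cont_y|exact: cf].
    by apply: contM; [apply: contM|apply: contB; last exact: cont_y].
  - move=> p; rewrite !gt_max norm3 => /andP[/andP[]]; rewrite !lt_max => hM hN _; rewrite /b.
    have [xN|xN] := leP (2 * N') `|p.1.1|; first by rewrite cutoff_out// !mul0r.
    have [zN|zN] := leP (2 * N') `|p.2|; first by rewrite (cutoff_out _ zN)// mulr0 mul0r.
    have [yM|yM] := leP M `|p.1.2|; first by rewrite fM// subrr mulr0.
    have yN : 2 * N' < `|p.1.2| by lra.
    have yM' := ltW yM.
    have /orP[/orP[h|h]|h] := hM; lra.
  - move=> x y y' z yy; rewrite /b /=.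
    have := fm _ _ yy; set l := cutoff N' x * cutoff N' z => fy.
    have l0 : 0 <= l by rewrite mulr_ge0 ?cutoff_ge0.
    have l1 : l <= 1 by rewrite mulr_ile1 ?cutoff_ge0 ?cutoff_le1.
    rewrite -subr_gt0 (_ : _ - _ = (1 - l) * (y' - y) + l * (f y' - f y)); last by ring.
    have [l2|l2] := leP l (1 / 2); nra.
apply: eq_imagel => p /AN /= pN; rewrite /b !cutoff_in// ?mul1r.
- by rewrite /grid_map addrC subrK.
- by move: pN; rewrite norm3 !ge_max => /andP[_ h]; rewrite le_max h orbT.
- by move: pN; rewrite norm3 !ge_max => /andP[/andP[h _] _]; rewrite le_max h orbT.
Qed.
Lemma stretch_x (f : R -> R) A (M N : R) : continuous f -> (forall s t, s < t -> f s < f t) ->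
  (forall t, M <= `|t| -> f t = t) -> A `<=` [set p | `|p| <= N] ->
  equiv_rel set0 A (grid_map f id @` A).
Proof.
move=> cf fm fM AN.
have := @stretch_y f (reflect_diag @` A) M N cf fm fM.
have -> : grid_map f id @` A = reflect_diag @` (grid_map id f @` (reflect_diag @` A)).
  by rewrite !image_comp; apply: eq_imagel => -[[x y] z].
move=> h; rewrite -[X in equiv_rel _ X _](reflect_image A).
apply: (@equiv_conj R set0 set0 _ _ reflect_diag reflect_diag) => //;
  try exact: cont_reflect; try exact: reflectK.
apply: h => _ [p /AN pN <-]; move: pN => /=; rewrite !norm3 !ge_max /=.
by move=> /andP[/andP[-> ->] ->].
Qed.

Lemma stretch (f g : R -> R) A (M N : R) : continuous f -> (forall s t, s < t -> f s < f t) ->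
  (forall t, M <= `|t| -> f t = t) -> continuous g -> (forall s t, s < t -> g s < g t) ->
  (forall t, M <= `|t| -> g t = t) -> A `<=` [set p | `|p| <= N] ->
  equiv_rel set0 A (grid_map f g @` A).
Proof.
move=> cf fm fM cg gm gM AN; apply: equiv_trans (stretch_x cf fm fM AN) _.
have -> : grid_map f g @` A = grid_map id g @` (grid_map f id @` A).
  by rewrite image_comp.
apply: (@stretch_y _ _ M (Num.max N M)) => // _ [p /AN pN <-]; move: pN => /=.
rewrite !norm3 !ge_max /= !le_max => /andP[/andP[h1 ->] ->]; rewrite !andbT.
have [Mt|tM] := leP M `|p.1.1|; first by rewrite fM// h1.
have M0 : 0 < M by rewrite (le_lt_trans _ tM).
move: tM; rewrite ltr_norml => /andP[/fm f1 /fm f2]; apply/orP; right.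
have e1 : f M = M by rewrite fM// gtr0_norm.
have e2 : f (- M) = - M by rewrite fM// normrN gtr0_norm.
by rewrite ler_norml -{1}e2 -{2}e1 !ltW.
Qed.
End Stretch.

Section FinalForm.
Context {R : realType}.
Notation sp := (R * R * R)%type.
Implicit Types (A X Z : set sp) (p q : sp).

Definition endsT (x1 x2 x3 x z1 z2 y1 y2 y3 y4 : R) : seq (sp * sp) :=
  path3 [:: (x3, y1, 1 / 2); (x2, y1, 1); (x1, y3, 0); (x1, y4, 0); (x, y4, 0)] ++
  path3 [:: (z1, y2, 1 / 2); (z2, y1, 1); (z2, y1, - 1); (z1, y1, - (1 / 2))].

(** The rest of the link: on the left the strand from the root passes through the point 0 of the
    x-axis into the row, and on the right the two strands leaving the row are joined. This closes NW
    with SW and NE with SE. *)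
Definition ends (x n : R) : seq (sp * sp) :=
  endsT 0 (1 / 2) (3 / 4) x (n + 1 / 4) (n + 1 / 2) (- (1 / 4)) (- (1 / 8)) 0 n.

Lemma endsT_ok f g x1 x2 x3 x z1 z2 y1 y2 y3 y4 : affine_on f x3 x2 -> affine_on f x2 x1 ->
  affine_on f z1 z2 -> affine_on f z2 z1 -> affine_on g y1 y3 -> affine_on g y2 y1 ->
  all_segs (grid_ok f g) (endsT x1 x2 x3 x z1 z2 y1 y2 y3 y4).
Proof.
move=> h1 h2 h3 h4 h5 h6; split; first by apply: Or33; split; [|exact: affine_same].
split; first exact: Or33.
split; first by apply: Or32.
split; first by apply: Or31.
split; first exact: Or33.
split; first by apply: Or33; split; exact: affine_same.
by split; first by apply: Or33; split; [|exact: affine_same].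
Qed.

Lemma endsT_map (f g : R -> R) x1 x2 x3 x z1 z2 y1 y2 y3 y4 :
  grid_segs_map f g (endsT x1 x2 x3 x z1 z2 y1 y2 y3 y4) =
  endsT (f x1) (f x2) (f x3) (f x) (f z1) (f z2) (g y1) (g y2) (g y3) (g y4).
Proof. by []. Qed.

Definition qpz (x y z : int) : qpt :=
  (QArith_base.Qmake (Z_of_int x) (xO xH), QArith_base.Qmake (Z_of_int y) (xO xH),
   QArith_base.Qmake (Z_of_int z) (xO xH)).

Lemma ptR_qpz x y z : ptR (qpz x y z) = (x%:~R / 2, y%:~R / 2, z%:~R / 2) :> sp.
Proof.
have h (u : int) : qR (QArith_base.Qmake (Z_of_int u) (xO xH)) = u%:~R / 2 :> R.
  by rewrite /qR /zR /=; congr (_ / _); congr intmul; lia.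
by rewrite /ptR !h.
Qed.

Definition pfinal_segs : seq (qpt * qpt) :=
  (polyline [:: qpz (- 6) 0 1; qpz (- 4) 0 0; qpz 0 0 0] ++
  polyline [:: qpz 2 2 0; qpz 4 2 0; qpz 6 2 1] ++
  polyline [:: qpz 2 0 0; qpz 4 0 0; qpz 6 0 (- 1)] ++
  polyline [:: qpz 0 2 0; qpz 0 6 0]) ++
  polyline [:: qpz (- 6) 0 1; qpz (- 10) 0 2; qpz (- 18) 4 0; qpz (- 18) 6 0; qpz 0 6 0] ++
  polyline [:: qpz 6 2 1; qpz 10 0 2; qpz 10 0 (- 2); qpz 6 0 (- 1)].

Lemma pfinalE : map ptR2 pfinal_segs =
  boxT (- 3) (- 2) 0 1 2 3 0 1 3 ++ endsT (- 9) (- 5) (- 3) 0 3 5 0 1 2 3.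
Proof.
rewrite /pfinal_segs !map_cat !polylineE !map_cons !ptR_qpz /=.
by do ?[congr (_ :: _)]; congr ((_, _, _), (_, _, _)); rewrite ?mulrNz; field.
Qed.

Definition pside : seq (qpt * qpt) :=
  polyline [:: qpz 0 0 0; qpz (- 2) 1 0; qpz 0 2 0] ++ polyline [:: qpz 2 0 0; qpz 4 1 0; qpz 2 2 0].

Lemma pfinal_side X : tangle X ->
  equiv_rel set0 (realize (env3 X X X) (pfinal_segs, [:: (unit_rect, 0%N)]))
    (realize (env3 X X X) (pside, [:: (unit_rect, 0%N)])).
Proof.
move=> tX; apply: (@script_equiv _ (env3 X X X) _ false [:: Simplify [::];
  Bend (qpz 2 2 0) (qpz 4 1 0) (qpz 4 0 0); Unbend (qpz 4 1 0) (qpz 4 0 0) (qpz 2 0 0);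
  Bend (qpz 0 2 0) (qpz (- 2) 1 0) (qpz (- 18) 6 0);
  Unbend (qpz (- 2) 1 0) (qpz (- 18) 6 0) (qpz 0 0 0)] _ [::]).
  by move=> [|[|]].
by vm_cast_no_check (erefl true).
Qed.

(** The closure joining NW to SW and NE to SE, which is the image of the other closure under
    [rotate_diag]. *)
Definition side_closure A := A `|` (segment (0, 0, 0) (- 1, 1 / 2, 0) `|`
  (segment (- 1, 1 / 2, 0) (0, 1, 0) `|` (segment (1, 0, 0) (2, 1 / 2, 0) `|`
  segment (2, 1 / 2, 0) (1, 1, 0)))).

Lemma rotate_segment p q : rotate_diag @` segment p q = segment (rotate_diag p) (rotate_diag q).
Proof. by apply: image_segment => s _; rewrite /rotate_diag /=; congr (_, _, _); ring. Qed.

Lemma rotate_closure A : rotate_diag @` closure_tangle A = side_closure (rotate_diag @` A).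
Proof.
rewrite /closure_tangle /side_closure !image_setU !rotate_segment /rotate_diag /= oppr0.
by rewrite !div1r; apply/seteqP; split=> p; rewrite /setU /=; tauto.
Qed.
End FinalForm.

Section FinalEquiv.
Context {R : realType}.
Notation sp := (R * R * R)%type.
Implicit Types (A X Z : set sp) (p q : sp).

Lemma chain_last (x0 y0 : R) l : pl_chain x0 y0 l -> x0 <= (last (x0, y0) l).1.
Proof.
elim: l x0 y0 => //= p l IH x0 y0 [h1 h2 /IH]; rewrite -surjective_pairing.
exact/le_trans/ltW.
Qed.

Lemma pl_last (x0 y0 : R) l t (u := last (x0, y0) l) : pl_chain x0 y0 l -> u.1 <= t ->
  pl x0 y0 l t = u.2 + (t - u.1).
Proof.
rewrite {}/u; elim: l x0 y0 => //= p l IH x0 y0 ch; have [h1 h2 h3] := ch.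
move=> ut; rewrite pl_next//; first by have := IH _ _ h3; rewrite -surjective_pairing; apply.
by apply: le_trans ut; have := chain_last h3; rewrite -surjective_pairing.
Qed.

Section Values.
Variables (x n : R).
Hypotheses (x1 : 1 <= x) (xn : x <= n).

(** Together with [final_y], it sends the box to the unit square and the corners of the wires to
    fixed integer positions, so that one script serves all trees; far away it is the identity. *)
Definition final_x : seq (R * R) := [:: (- (n + 10), - (n + 10)); (0, - 9); (7 / 8, - 2); (x, 0);
  (x + 1 / 16, 1); (n + 1 / 8, 2); (n + 1 / 2, 5); (n + 10, n + 10)].
Definition final_y : seq (R * R) := [:: (- (n + 10), - (n + 10)); (- (1 / 4), 0); (0, 2); (n, 3);
  (n + 10, n + 10)].

Lemma final_x_chain : pl_chain (- (n + 11)) (- (n + 11)) final_x.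
Proof. by move: x1 xn => ? ?; do ?split; rewrite /=; lra. Qed.

Lemma final_y_chain : pl_chain (- (n + 11)) (- (n + 11)) final_y.
Proof. by move: x1 xn => ? ?; do ?split; rewrite /=; lra. Qed.

Notation f := (pl (- (n + 11)) (- (n + 11)) final_x).
Notation g := (pl (- (n + 11)) (- (n + 11)) final_y).

Lemma final_x_out t : n + 10 <= `|t| -> f t = t.
Proof.
move: x1 xn => ? ?; rewrite ler_normr => /orP[h|h].
  by rewrite (pl_last final_x_chain) //= addrC subrK.
rewrite (pl_first final_x_chain) /=; last by lra.
by field; rewrite gt_eqF//; lra.
Qed.

Lemma final_y_out t : n + 10 <= `|t| -> g t = t.
Proof.
move: x1 xn => ? ?; rewrite ler_normr => /orP[h|h].
  by rewrite (pl_last final_y_chain) //= addrC subrK.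
rewrite (pl_first final_y_chain) /=; last by lra.
by field; rewrite gt_eqF//; lra.
Qed.

Lemma final_x_values :
  [/\ f 0 = - 9, f (1 / 2) = - 5, f (1 - 1 / 4) = - 3, f (3 / 4) = - 3 & f (1 - 1 / 8) = - 2] /\
  [/\ f x = 0, f (x + 1 / 16) = 1, f (n + 1 / 8) = 2, f (n + 1 / 4) = 3 & f (n + 1 / 2) = 5].
Proof.
move: x1 xn => ? ?.
have fE k kl t := @pl_piece R _ _ _ k t final_x_chain kl.
have e8 : 8 * (7 / 8 - 0) = 7 :> R by field.
split; split.
- by rewrite (fE 2%N isT) /=; [field|lra|lra].
- by rewrite (fE 2%N isT) /=; [field|lra|lra].
- by rewrite (fE 2%N isT) /=; [field|lra|lra].
- by rewrite (fE 2%N isT) /=; [field|lra|lra].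
- by rewrite (fE 2%N isT) /=; [field|lra|lra].
- by rewrite (fE 3%N isT) /=; [field; apply: lt0r_neq0; lra|lra|lra].
- by rewrite (fE 4%N isT) /=; [field; apply: lt0r_neq0; lra|lra|lra].
- by rewrite (fE 5%N isT) /=; [field; apply: lt0r_neq0; lra|lra|lra].
- by rewrite (fE 6%N isT) /=; [field; apply: lt0r_neq0; lra|lra|lra].
- by rewrite (fE 6%N isT) /=; [field; apply: lt0r_neq0; lra|lra|lra].
Qed.

Lemma final_y_values : [/\ g (- (1 / 4)) = 0, g (- (1 / 8)) = 1, g 0 = 2 & g n = 3].
Proof.
move: x1 xn => ? ?.
have gE k kl t := @pl_piece R _ _ _ k t final_y_chain kl.
split.
- by rewrite (gE 2%N isT) /=; [field|lra|lra].
- by rewrite (gE 2%N isT) /=; [field|lra|lra].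
- by rewrite (gE 2%N isT) /=; [field|lra|lra].
- by rewrite (gE 3%N isT) /=; [field; apply: lt0r_neq0; lra|lra|lra].
Qed.

Lemma final_x_affine :
  [/\ affine_on f (1 - 1 / 4) (1 - 1 / 8), affine_on f (n + 1 / 8) (n + 1 / 4),
    affine_on f (3 / 4) (1 / 2) & affine_on f (1 / 2) 0] /\
  [/\ affine_on f (n + 1 / 4) (n + 1 / 2), affine_on f (n + 1 / 2) (n + 1 / 4) &
    affine_on f x (x + 1 / 16)].
Proof.
move: x1 xn => ? ?.
have fA k kl s t := @pl_affine R _ _ _ k s t final_x_chain kl.
split; split.
- by apply: (fA 2%N isT); rewrite /=; lra.
- by apply: (fA 6%N isT); rewrite /=; lra.
- by apply: (fA 2%N isT); rewrite /=; lra.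
- by apply: (fA 2%N isT); rewrite /=; lra.
- by apply: (fA 6%N isT); rewrite /=; lra.
- by apply: (fA 6%N isT); rewrite /=; lra.
- by apply: (fA 4%N isT); rewrite /=; lra.
Qed.

Lemma final_y_affine : [/\ affine_on g (- (1 / 4)) 0, affine_on g (- (1 / 8)) (- (1 / 4)) &
  affine_on g (- (1 / 4)) (- (1 / 8))].
Proof.
move: x1 xn => ? ?.
have gA k kl s t := @pl_affine R _ _ _ k s t final_y_chain kl.
by split; apply: (gA 2%N isT); rewrite /=; lra.
Qed.

Lemma compact_segs l : compact (segs l : set sp).
Proof.
elim: l => [|s l IH] /=; first exact: compact0.
by apply: compactU => //; exact: compact_segment.
Qed.

Lemma compact_slot (u0 u1 v0 v1 : R) X : tangle X -> compact (slot u0 u1 v0 v1 @` X).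
Proof.
move=> tX; apply: continuous_compact; last exact: compact_tangle.
by apply: continuous_subspaceT; exact: cont_slot.
Qed.

Lemma final_equiv X : tangle X ->
  equiv_rel set0 (boxform 1 x n n X `|` segs (ends x n)) (side_closure X).
Proof.
move=> tX; have [_ uX] := tX; have fc := final_x_chain; have gc := final_y_chain.
have [N AN] : exists N, boxform 1 x n n X `|` segs (ends x n) `<=` [set p | `|p| <= N].
  have : compact (boxform 1 x n n X `|` segs (ends x n)).
    by apply: compactU; [apply: compactU; [|exact: compact_slot]|]; exact: compact_segs.
  move=> /compact_bounded [N [_ h]]; exists (N + 1) => p Ap; apply: (h (N + 1)) => //.
  by rewrite ltrDl.
apply: (@equiv_trans _ _ _ (grid_map f g @` (boxform 1 x n n X `|` segs (ends x n)))).
  apply: (stretch _ _ final_x_out _ _ final_y_out AN); try exact: cont_pl.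
    by move=> s t; exact: pl_lt.
  by move=> s t; exact: pl_lt.
have [[a1 a2 a3 a4] [a5 a6 a7]] := final_x_affine; have [b1 b2 b3] := final_y_affine.
have [[v1 v2 v3 v4 v5] [v6 v7 v8 v9 v10]] := final_x_values; have [w1 w2 w3 w4] := final_y_values.
rewrite /boxform image_setU [X in X `|` _]image_setU.
rewrite (pl_segs fc gc (boxT_ok _ _ _ _ _ _ a1 a2)) (pl_segs fc gc (endsT_ok _ _ a3 a4 a5 a6 b1 b2)).
rewrite boxT_map endsT_map grid_slot// v1 v2 v3 v4 v5 v6 v7 v8 v9 v10 w1 w2 w3 w4 slot_id image_id.
have := pfinal_side tX; congr (equiv_rel _ _ _).
  rewrite /realize [boxes_set _ _]/= setU0 /unit_rect qslot_qrct// !divr1 slot_id image_id.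
  by rewrite segs_setE pfinalE segs_catr setUAC.
rewrite /realize [boxes_set _ _]/= setU0 /unit_rect qslot_qrct// !divr1 slot_id image_id.
rewrite segs_setE /pside map_cat !polylineE !map_cons !ptR_qpz /side_closure setUC.
congr (_ `|` _); rewrite /= setU0.
by congr (segment _ _ `|` (segment _ _ `|` (segment _ _ `|` segment _ _)));
  congr (_, _, _); rewrite ?mulrNz; field.
Qed.
End Values.
End FinalEquiv.

(** * A half turn of the whole link *)

Section GlobalRotation.
Context {R : realType}.
Notation sp := (R * R * R)%type.
Implicit Types (A X Z : set sp) (p q : sp).

Definition diag_coord (p : sp) : sp := ((p.1.1 + p.1.2) / 10, (p.1.1 - p.1.2) / 10, p.2 / 10).
Definition diag_point (q : sp) : sp :=
  (5 * (q.1.1 + q.1.2), 5 * (q.1.1 - q.1.2), 10 * q.2).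

Lemma diag_coordK : cancel diag_coord diag_point.
Proof. by move=> -[[x y] z]; rewrite /diag_point /=; congr (_, _, _); field. Qed.

Lemma diag_pointK : cancel diag_point diag_coord.
Proof. by move=> -[[x y] z]; rewrite /diag_coord /=; congr (_, _, _); field. Qed.

(** After division by 10 the cube lies inside the unit ball, where [twist_map] is the half turn
    about the diagonal. *)
Lemma rotate_equiv A : (forall p, A p -> [/\ -2 <= p.1.1 <= 2, -2 <= p.1.2 <= 2 & -2 <= p.2 <= 2]) ->
  equiv_rel set0 A (rotate_diag @` A).
Proof.
move=> bA.
have cc : continuous diag_coord by rewrite /diag_coord; cont.
have cp : continuous diag_point by rewrite /diag_point; cont.
have := @equiv_conj R [set p | 10 <= norm2 p] set0 (diag_coord @` A)
  (twist_map @` (diag_coord @` A)) diag_point diag_coord cp cc diag_pointK diag_coordK.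
rewrite [diag_point @` (diag_coord @` A)]image_comp.
rewrite (_ : diag_point \o diag_coord = id) ?image_id; last first.
  by apply/funext => p /=; exact: diag_coordK.
suff -> : diag_point @` (twist_map @` (diag_coord @` A)) = rotate_diag @` A.
  by apply=> //; exists twist_map; [exact: twist_homeo|].
rewrite !image_comp; apply: eq_imagel => -[[x y] z] /bA [/= /andP[? ?] /andP[? ?] /andP[? ?]].
rewrite /= twist_in; first by rewrite /diag_point /rotate_diag /=; congr (_, _, _); field.
rewrite -[X in _ <= X](@ger0_norm R)// -sqrtr_sqr ler_sqrt ?sqr_ge0// /diag_coord /=.
rewrite (_ : _ + _ = (2 * (x ^+ 2 + y ^+ 2) + z ^+ 2) / 100); last by field.
have sq (t : R) : -2 <= t -> t <= 2 -> t ^+ 2 <= 4 by move=> *; rewrite expr2; nra.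
have ? : x ^+ 2 <= 4 by exact: sq.
have ? : y ^+ 2 <= 4 by exact: sq.
have ? : z ^+ 2 <= 4 by exact: sq.
by rewrite expr1n; lra.
Qed.

Lemma closure_equiv A : A `<=` unit_box ->
  equiv_rel set0 (closure_tangle A) (side_closure (rotate_diag @` A)).
Proof.
move=> uA; rewrite -rotate_closure; apply: rotate_equiv => p.
have seg u v : (segment u v : set sp) p -> [/\ -2 <= u.1.1 <= 2, -2 <= u.1.2 <= 2 & -2 <= u.2 <= 2] ->
    [/\ -2 <= v.1.1 <= 2, -2 <= v.1.2 <= 2 & -2 <= v.2 <= 2] ->
    [/\ -2 <= p.1.1 <= 2, -2 <= p.1.2 <= 2 & -2 <= p.2 <= 2].
  move=> /segmentP[s /andP[s0 s1] ->] [/andP[? ?] /andP[? ?] /andP[? ?]].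
  move=> [/andP[? ?] /andP[? ?] /andP[? ?]].
  by split=> /=; apply/andP; split; nra.
case=> [[[[/uA[/andP[? ?] /andP[? ?] /andP[? ?]]|]|]|]|].
  by split; apply/andP; split; lra.
all: by move=> /seg; apply; split=> /=; apply/andP; split; lra.
Qed.
End GlobalRotation.

(** * The upper half-plane: straightening the edges of the tree *)

Section Strands.
Context {R : realType}.
Notation sp := (R * R * R)%type.
Implicit Types (F K : set sp) (p q : sp) (T : btree).

Lemma tri_move F p q r : closed F -> noncollinear p q r ->
  (forall x, triangle p q r x -> F x -> x = p \/ x = q) ->
  equiv_rel F (segment p q) (segment p r `|` segment r q).
Proof.
move=> cF nc h; have := triangle_move cF (@closed0 sp) nc; rewrite !set0U; apply.
by move=> x tx [/(h x tx)|].
Qed.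

Lemma noncollinear_xy p q r :
  (q.1.1 - p.1.1) * (r.1.2 - p.1.2) != (q.1.2 - p.1.2) * (r.1.1 - p.1.1) -> noncollinear p q r.
Proof.
by move=> h; apply/eqP => -[_ _ /eqP]; rewrite /= subr_eq0; apply/negP.
Qed.

Lemma noncollinear_yz p q r :
  (q.1.2 - p.1.2) * (r.2 - p.2) != (q.2 - p.2) * (r.1.2 - p.1.2) -> noncollinear p q r.
Proof.
by move=> h; apply/eqP => -[/eqP]; rewrite /= subr_eq0 => e; move: h; rewrite e.
Qed.

Lemma noncollinear_xz p q r :
  (q.2 - p.2) * (r.1.1 - p.1.1) != (q.1.1 - p.1.1) * (r.2 - p.2) -> noncollinear p q r.
Proof.
by move=> h; apply/eqP => -[_ /eqP]; rewrite /= subr_eq0 => e; move: h; rewrite e.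
Qed.

Lemma segment_triv p q : segment p q p /\ segment p q q.
Proof.
split; apply/segmentP; [exists 0|exists 1]; rewrite ?lexx ?ler01//.
  by rewrite subr0 !mul1r !mul0r !addr0; case: p => -[].
by rewrite subrr !mul1r !mul0r !add0r; case: q => -[].
Qed.

(** [O] is an over-passing point, [P] the point below it on the parent edge of a child at abscissa
    [xc]; the edge is replaced by a horizontal and a vertical edge. *)
Section Hang.
Variables (xO xc y : R).
Let O : sp := (xO, y, 1).
Let C : sp := (xc, y, 1).
Let D : sp := (xc, y, 0).
Hypotheses (Oc : xO != xc) (y0 : 0 < y).

Lemma hang_triangle yc zc p : triangle O (xc, yc, zc) C p -> exists a b : R,
  [/\ 0 <= a, 0 <= b, a + b <= 1 & p = (xc + a * (xO - xc), y - b * (y - yc), 1 - b * (1 - zc))].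
Proof.
move=> [a [b [c [[a0 b0 c0 abc] e1 e2 e3]]]]; exists a, b; split=> //; first by lra.
have ec : c = 1 - a - b by lra.
by case: p e1 e2 e3 => -[x v] z /= -> -> ->; rewrite ec; congr (_, _, _); ring.
Qed.

Lemma hang_nc yc zc : yc < y -> noncollinear O (xc, yc, zc) C.
Proof.
move=> yy; apply: noncollinear_xy; rewrite /= subrr mulr0 eq_sym mulf_neq0// subr_eq0.
  by rewrite lt_eqF.
by rewrite eq_sym.
Qed.

Lemma hang_leaf F : closed F ->
  (forall p, F p -> p.1.1 = xc -> 0 < p.1.2 -> p.1.2 <= y -> False) ->
  (forall p, F p -> triangle O (xc, 0, 0) C p -> p = O \/ p = (xc, 0, 0)) ->
  equiv_rel F (segment O (xc, 0, 0))
    (segment O C `|` (segment C D `|` segment D (xc, 0, 0))).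
Proof.
move=> cF F1 F2; have y0' := y0.
apply: (@equiv_trans _ _ _ (segment O C `|` segment C (xc, 0, 0))).
  by apply: tri_move => // [|p tp Fp]; [exact: hang_nc|exact: F2].
apply: equiv_frame; apply: tri_move.
- by apply: closedU => //; exact: closed_segment.
- by apply: noncollinear_yz => /=; apply/eqP => e; nra.
move=> p [a [b [c [[a0 b0 c0 abc] e1 e2 e3]]]]; rewrite /= in e1 e2 e3.
have x1 : p.1.1 = xc by rewrite e1 -!mulrDl abc mul1r.
case=> [Fp|/segmentP[s /andP[s0 s1] pE]].
  have yp : p.1.2 <= 0.
    by rewrite leNgt; apply/negP => yp; apply: (F1 p Fp x1 yp); rewrite e2; nra.
  have b1 : b = 1 by nra.
  have [a1 c1] : a = 0 /\ c = 0 by lra.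
  right; case: p {Fp yp} e1 e2 e3 x1 => -[x v] z /= e1 e2 e3 ->.
  by congr (_, _, _); [rewrite e2 a1 c1; ring|rewrite e3 a1 c1; ring].
left; move: x1; rewrite pE /= => x1.
have s11 : s = 1.
  have : (1 - s) * (xO - xc) = 0 by lra.
  move/eqP; rewrite mulf_eq0 => /orP[/eqP|/eqP]; first by lra.
  by move=> e; move: Oc; rewrite -subr_eq0 e eqxx.
by rewrite s11 subrr /C; congr (_, _, _); ring.
Qed.

(** After the first triangle all others lie in the plane of abscissa [xc]. There, at positive
    ordinates up to [y], [F] has at most the over-passing point above the under-passing point of the
    child, and this point lies in none of them. *)
Lemma hang_node F yc : closed F -> 0 < yc -> yc < y ->
  (forall p, F p -> p.1.1 = xc -> 0 < p.1.2 -> p.1.2 <= y -> p = (xc, yc, 1)) ->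
  (forall p, F p -> triangle O (xc, yc, - 1) C p -> p = O \/ p = (xc, yc, - 1)) ->
  equiv_rel F (segment O (xc, yc, - 1) `|` segment (xc, yc, - 1) (xc, 0, 0))
    (segment O C `|` (segment C D `|` segment D (xc, 0, 0))).
Proof.
move=> cF yc0 ycy F1 F2; have y0' := y0; set P := (xc, yc, - 1) : sp; set Q := (xc, 0, 0) : sp.
have onOC p : segment O C p -> p.1.1 = xc -> p = C.
  move=> /segmentP[s /andP[s0 s1] ->] /= x1.
  have s11 : s = 1.
    have : (1 - s) * (xO - xc) = 0 by lra.
    move/eqP; rewrite mulf_eq0 => /orP[/eqP|/eqP]; first by lra.
    by move=> e; move: Oc; rewrite -subr_eq0 e eqxx.
  by rewrite s11 subrr /C; congr (_, _, _); ring.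
apply: (@equiv_trans _ _ _ (segment P Q `|` (segment O C `|` segment C P))).
  rewrite setUC; apply: equiv_frame; apply: tri_move.
  - by apply: closedU => //; exact: closed_segment.
  - exact: hang_nc.
  move=> p tp [Fp|/segmentP[s /andP[s0 s1] pE]]; first exact: F2.
  have [a [b [a0 b0 ab pE']]] := hang_triangle tp; right.
  have b1 : b = 1 by move: pE; rewrite pE' => -[_ /= e _]; nra.
  have a1 : a = 0 by lra.
  by rewrite pE' a1 b1 /P; congr (_, _, _); ring.
have plane p r : triangle C Q (xc, r.1, r.2) p -> p.1.1 = xc.
  by move=> [a [b [c [[_ _ _ abc] e1 _ _]]]]; rewrite e1 /= -!mulrDl abc mul1r.
apply: (@equiv_trans _ _ _ (segment O C `|` segment C Q)).
  rewrite setUC -setUA; apply: equiv_frame; apply: equiv_sym; apply: tri_move.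
  - by apply: closedU => //; exact: closed_segment.
  - by apply: noncollinear_yz => /=; apply/eqP => e; nra.
  move=> p tp [Fp|sp]; last by left; apply: onOC sp _; exact: (plane _ (yc, -1)).
  have x1 : p.1.1 = xc by exact: (plane _ (yc, -1)).
  move: tp => [a [b [c [[a0 b0 c0 abc] e1 e2 e3]]]]; rewrite /= in e2 e3.
  have [yp|yp] := leP p.1.2 0.
    right; have a1 : a = 0 by nra.
    have c1 : c = 0 by nra.
    by rewrite [p]surjective_pairing [p.1]surjective_pairing x1 e2 e3 a1 c1; congr (_, _, _); ring.
  have yp' : p.1.2 <= y by rewrite e2; nra.
  have pE := F1 p Fp x1 yp yp'; move: e2 e3; rewrite pE /= => e2 e3.
  have c1 : c = 0 by lra.
  have a1 : a = 1 by lra.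
  by exfalso; move: e2; rewrite a1 c1; lra.
apply: equiv_frame; apply: tri_move.
- by apply: closedU => //; exact: closed_segment.
- by apply: noncollinear_yz => /=; apply/eqP => e; nra.
move=> p tp [Fp|sp]; last by left; apply: onOC sp _; exact: (plane _ (y, 0)).
have x1 : p.1.1 = xc by exact: (plane _ (y, 0)).
move: tp => [a [b [c [[a0 b0 c0 abc] e1 e2 e3]]]]; rewrite /= in e2 e3.
have [yp|yp] := leP p.1.2 0.
  right; have b1 : b = 1 by nra.
  have [a1 c1] : a = 0 /\ c = 0 by lra.
  by rewrite [p]surjective_pairing [p.1]surjective_pairing x1 e2 e3 a1 c1; congr (_, _, _); ring.
have yp' : p.1.2 <= y by rewrite e2; nra.
have pE := F1 p Fp x1 yp yp'; move: e2 e3; rewrite pE /= => e2 e3.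
have a1 : a = 1 by lra.
by exfalso; nra.
Qed.
End Hang.
End Strands.

Section UpperHalf.
Context {R : realType}.
Notation sp := (R * R * R)%type.
Implicit Types (F K : set sp) (p q : sp) (T : btree).

Lemma hang_far (xO xc y yc zc : R) p : triangle (xO, y, 1) (xc, yc, zc) (xc, y, 1) p ->
  xc < xO /\ xO <= p.1.1 \/ xO < xc /\ p.1.1 <= xO -> p = (xO, y, 1).
Proof.
move=> /hang_triangle[a [b [a0 b0 ab ->]]] /= h.
have a1 : a = 1 by case: h => -[h1 h2]; nra.
have b1 : b = 0 by lra.
by rewrite a1 b1; congr (_, _, _); ring.
Qed.

Lemma hang_between (xO xc y yc zc : R) p : triangle (xO, y, 1) (xc, yc, zc) (xc, y, 1) p -> yc <= y ->
  [/\ xc <= p.1.1 <= xO \/ xO <= p.1.1 <= xc, yc <= p.1.2, p.1.2 <= y &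
    (p.1.2 <= yc -> yc < y -> p = (xc, yc, zc))].
Proof.
move=> /hang_triangle[a [b [a0 b0 ab ->]]] /= ycy; split; [|nra|nra|].
- have [h|h] := leP xc xO; [left|right]; apply/andP; split; nra.
- move=> h1 h2; have b1 : b = 1 by nra.
  have a1 : a = 0 by lra.
  by rewrite a1 b1; congr (_, _, _); ring.
Qed.

(** The tree with all edges made vertical or horizontal: a vertical line from each leaf and each
    vertex up to the level of its parent, and a bridge over the line of each vertex. *)
Fixpoint upper_form (a : nat) T (top : R) : seq (sp * sp) :=
  if T is Node l r then
    let b := (a + leaves l)%N in let y := vertex_y R T in
    (upper_form a l y ++ upper_form b r y ++
    bridge (vertex_x R a l) (vertex_x R a T) (vertex_x R b r) y) ++ line (vertex_x R a T) 0 top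
  else line a%:R 0 top.

Definition inner_form (a : nat) l r : seq (sp * sp) :=
  let b := (a + leaves l)%N in let y := vertex_y R (Node l r) in
  upper_form a l y ++ upper_form b r y ++
    bridge (vertex_x R a l) (vertex_x R a (Node l r)) (vertex_x R b r) y.

Lemma upper_form_Node a l r top : upper_form a (Node l r) top =
  inner_form a l r ++ line (vertex_x R a (Node l r)) 0 top.
Proof. by []. Qed.

Definition yx_within (b c u v : R) p q := [/\ x_within b c p q, u <= p.1.2, p.1.2 <= v, u <= q.1.2 & q.1.2 <= v].

Lemma segs_yx b c u v l x : all_segs (yx_within b c u v) l -> segs l x ->
  b <= x.1.1 <= c /\ u <= x.1.2 <= v.
Proof.
move=> h; apply: (@segs_sub _ (fun y => b <= y.1.1 <= c /\ u <= y.1.2 <= v)).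
apply: all_segs_mono h => p q [[h1 h2 h3 h4] h5 h6 h7 h8] y sy.
rewrite (segment_x_ge _ _ sy)// (segment_x_le _ _ sy)//.
by rewrite (segment_y_ge _ _ sy)// (segment_y_le _ _ sy).
Qed.

Lemma yx_sub b c u v b' c' u' v' : b' <= b -> c <= c' -> u' <= u -> v <= v' ->
  forall p q, yx_within b c u v p q -> yx_within b' c' u' v' p q.
Proof. by move=> ? ? ? ? p q [[? ? ? ?] ? ? ? ?]; split; [split|..]; lra. Qed.

Lemma upper_form_yx a T top : vertex_y R T <= top ->
  all_segs (yx_within a%:R (last_leaf a T) 0 top) (upper_form a T top).
Proof.
elim: T a top => [|l IHl r IHr] a top yt.
  by move: yt; rewrite /vertex_y /last_leaf natrD addrK /= => yt; do ?[split]; rewrite /=; lra.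
rewrite upper_form_Node last_leaf_Node; have [yl yr] := @vertex_y_Node R l r.
have h1 := @vertex_x_ge R a l; have h2 := @vertex_x_le R (a + leaves l) r.
have h1' := @vertex_x_le R a l; have h2' := @vertex_x_ge R (a + leaves l) r.
have h3 := @last_leaf_next R a l; have h4 := @last_leaf_ge R a l; have h5 := @last_leaf_ge R (a + leaves l) r.
have h6 := @vertex_x_mid R a l r; have yl0 := @vertex_y_ge0 R l.
apply: all_segs_cat; [apply: all_segs_cat; [|apply: all_segs_cat]|].
- by apply: all_segs_mono (IHl a (vertex_y R (Node l r)) _); [apply: yx_sub; lra|lra].
- by apply: all_segs_mono (IHr _ (vertex_y R (Node l r)) _); [apply: yx_sub; lra|lra].
- move: h1 h1' h2 h2' h3 h4 h5 h6 yl yt yl0; move: (vertex_x R a (Node l r)) (vertex_x R a l) (vertex_x R _ r) => x xl xr.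
  move: (vertex_y R (Node l r)) (vertex_y R l) (last_leaf a l) (last_leaf _ r) => y y' i e *.
  by do ?split; rewrite /=; lra.
- move: h6 yt yl yl0; move: (vertex_x R a (Node l r)) (vertex_y R (Node l r)) (vertex_y R l) => x y y' *.
  by do ?split; rewrite /=; lra.
Qed.

Lemma inner_form_in a l r p (x := vertex_x R a (Node l r)) (y := vertex_y R (Node l r)) :
  segs (inner_form a l r) p ->
  [/\ a%:R <= p.1.1 <= last_leaf a (Node l r), 0 <= p.1.2 <= y & p.1.1 = x -> p = (x, y, 1)].
Proof.
have [yl yr] := @vertex_y_Node R l r; have yl0 := @vertex_y_ge0 R l.
have h1 := @vertex_x_ge R a l; have h2 := @vertex_x_le R (a + leaves l) r.
have h1' := @vertex_x_le R a l; have h2' := @vertex_x_ge R (a + leaves l) r.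
have h3 := @last_leaf_next R a l; have h4 := @last_leaf_ge R a l; have h5 := @last_leaf_ge R (a + leaves l) r.
have h6 : x = _ := @vertex_x_mid R a l r; have h7 := @last_leaf_Node R a l r.
have yly : vertex_y R l <= y by rewrite /y; lra.
have yry : vertex_y R r <= y by rewrite /y; lra.
rewrite /inner_form 2!segs_catr -/x -/y => -[|[]].
- by move=> /(segs_yx (upper_form_yx a yly)) [/andP[? ?] ?];
    split=> [|//|?]; [apply/andP; split|exfalso]; lra.
- by move=> /(segs_yx (upper_form_yx _ yry)) [/andP[? ?] ?];
    split=> [|//|?]; [apply/andP; split|exfalso]; lra.
have xl : vertex_x R a l < x by lra.
have xr : x < vertex_x R (a + leaves l) r by lra.
have y0 : 0 <= y by rewrite /y; lra.
have ea : a%:R <= vertex_x R a l by [].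
have ee : vertex_x R (a + leaves l) r <= last_leaf a (Node l r) by rewrite h7.
move: xl xr y0 ea ee; clear; move: (vertex_x R a l) (vertex_x R _ r) (last_leaf _ _) x y => xl xr e x y xlx xrx y0 ea ee.
move=> [|[|[|[|[]]]]] /segmentP[s /andP[s0 s1] ->] /=.
- by split=> [||h]; [apply/andP; split; nra|apply/andP; split; nra|exfalso; nra].
- split=> [||h]; [apply/andP; split; nra|apply/andP; split; nra|].
  by congr (_, _, _); [exact: h|ring|ring].
- split=> [||h]; [apply/andP; split; nra|apply/andP; split; nra|].
  by congr (_, _, _); [exact: h|ring|ring].
- by split=> [||h]; [apply/andP; split; nra|apply/andP; split; nra|exfalso; nra].
Qed.
Lemma tree_strands_x a T p : tree_strands R a T p -> a%:R <= p.1.1 <= last_leaf a T.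
Proof.
elim: T a => [|l IHl r IHr] a //=.
have h1 := @vertex_x_ge R a l; have h2 := @vertex_x_le R (a + leaves l) r.
have h1' := @vertex_x_le R a l; have h2' := @vertex_x_ge R (a + leaves l) r.
have h3 := @last_leaf_next R a l; have h4 := @last_leaf_ge R a l; have h5 := @last_leaf_ge R (a + leaves l) r.
have h6 := @vertex_x_mid R a l r; have h7 := @last_leaf_Node R a l r.
have pe c b : (parent_end R b c).1.1 = vertex_x R b c by [].
rewrite /= in h6.
have seg u v : segment u v p -> a%:R <= u.1.1 <= last_leaf a (Node l r) ->
    a%:R <= v.1.1 <= last_leaf a (Node l r) -> a%:R <= p.1.1 <= last_leaf a (Node l r).
  move=> /segmentP[s /andP[s0 s1] ->] /andP[? ?] /andP[? ?] /=; apply/andP; split; nra.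
case=> [[[[/IHl/andP[? ?]|/IHr/andP[? ?]]|/seg]|/seg]|/seg]; try (by apply/andP; split; lra);
  by apply; rewrite ?pe /=; apply/andP; split; lra.
Qed.

Lemma closed_tree_strands a T : closed (tree_strands R a T).
Proof.
elim: T a => [|l IHl r IHr] a; first exact: closed0.
by do ?[apply: closedU]; (exact: IHl || exact: IHr || exact: closed_segment).
Qed.

Lemma closed_segs3 l : closed (segs l : set sp).
Proof. by elim: l => [|s l IH]; [exact: closed0|apply: closedU => //; exact: closed_segment]. Qed.

Lemma parent_endE a l r : parent_end R a (Node l r) =
  (vertex_x R a (Node l r), vertex_y R (Node l r), -1).
Proof. by []. Qed.

(** [F] is the remaining diagram: above the x-axis and up to the level of the root it may meet the
    strip of the subtree only in the under-passing point of the root, where the edge from the parent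
    arrives. A leaf has no strands of its own. *)
Definition upper_statement a T : Prop := if T is Node l r then forall F, closed F ->
  (forall p, F p -> a%:R <= p.1.1 <= last_leaf a T -> 0 < p.1.2 -> p.1.2 <= vertex_y R T ->
    p = parent_end R a T) ->
  equiv_rel F (tree_strands R a T)
    (segs (inner_form a l r) `|` segment (parent_end R a T) (vertex_x R a T, 0, 0)) else True.

Lemma upper_child b c (xO y : R) F : upper_statement b c -> closed F -> vertex_y R c < y ->
  xO < b%:R \/ last_leaf b c < xO ->
  (forall p, F p -> b%:R <= p.1.1 <= last_leaf b c -> 0 < p.1.2 -> p.1.2 <= y -> False) ->
  (forall p, F p -> triangle (xO, y, 1) (parent_end R b c) (vertex_x R b c, y, 1) p ->
    p = (xO, y, 1) \/ p = parent_end R b c) ->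
  equiv_rel F (tree_strands R b c `|` segment (xO, y, 1) (parent_end R b c))
    (segs (upper_form b c y) `|` (segment (xO, y, 1) (vertex_x R b c, y, 1) `|`
      segment (vertex_x R b c, y, 1) (vertex_x R b c, y, 0))).
Proof.
have := @vertex_x_ge R b c; have := @vertex_x_le R b c.
case: c => [|l r] xe xb IH cF ycy xOout F1 F2.
  have xOx : xO != b%:R by case: xOout => h; [rewrite lt_eqF|rewrite gt_eqF]; rewrite /= in xe xb; lra.
  have y0 : 0 < y by move: ycy; rewrite /vertex_y.
  rewrite [tree_strands _ _ _]/= set0U [segs _]/= setU0 (segment_sym (_, 0, 0)).
  rewrite [X in equiv_rel _ _ X](_ : _ = segment (xO, y, 1) (b%:R, y, 1) `|`
    (segment (b%:R, y, 1) (b%:R, y, 0) `|` segment (b%:R, y, 0) (b%:R, 0, 0))); last first.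
    by apply/seteqP; split=> p; rewrite /setU /=; tauto.
  by apply: hang_leaf => // p Fp e1; apply: (F1 p Fp); rewrite e1 lexx.
move: xe xb; rewrite parent_endE in F2 *; set x := vertex_x R b (Node l r) in F2 * => xe xb.
set yc := vertex_y R (Node l r) in ycy F2 *; set O : sp := (xO, y, 1) in F2 *.
set C : sp := (x, y, 1) in F2 *; set P : sp := (x, yc, -1) in F2 *.
have xOx : xO != x by case: xOout => h; [rewrite lt_eqF|rewrite gt_eqF]; lra.
have yc0 : 0 < yc.
  by rewrite /yc; have [h1 h2] := @vertex_y_Node R l r; have := @vertex_y_ge0 R l; lra.
have y0 : 0 < y by lra.
have cS := @closed_segment R.
apply: (@equiv_trans _ _ _ (segment O P `|` (segs (inner_form b l r) `|` segment P (x, 0, 0)))).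
  rewrite setUC; apply: equiv_frame; apply: IH; first exact: closedU.
  move=> p [Fp|sp] xp yp1 yp2; first by case: (F1 p Fp xp yp1); rewrite -/yc in yp2; lra.
  move: sp => /segmentP[s /andP[s0 s1] pE]; have s11 : s = 1.
    by move: yp2; rewrite pE -/yc /=; nra.
  by rewrite pE s11 parent_endE -/x -/yc subrr /=; congr (_, _, _); ring.
rewrite upper_form_Node segs_catr setUCA -setUA; apply: equiv_frame.
rewrite [segs (line _ _ _)]/= setU0 (segment_sym (_, 0, 0)) -/x.
rewrite [X in equiv_rel _ _ X](_ : _ = segment O C `|`
    (segment C (x, y, 0) `|` segment (x, y, 0) (x, 0, 0))); last first.
  by apply/seteqP; split=> p; rewrite /setU /=; tauto.
apply: hang_node => //; first by apply: closedU => //; exact: closed_segs3.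
  move=> p [Fp|/inner_form_in[_ _ h] /h //] e1 yp1 yp2.
  by case: (F1 p Fp) => //; rewrite e1 xb.
move=> p [Fp tp|/inner_form_in[_ /andP[_ h] _] tp]; first exact: F2.
by right; have [_ _ _ h'] := hang_between tp (ltW ycy); exact: h'.
Qed.
End UpperHalf.

Section UpperInduction.
Context {R : realType}.
Notation sp := (R * R * R)%type.
Implicit Types (F K : set sp) (p q : sp) (T : btree).

Lemma segment_x_between p q x (b c : R) : b <= p.1.1 <= c -> b <= q.1.1 <= c -> segment p q x ->
  b <= x.1.1 <= c.
Proof.
by move=> /andP[? ?] /andP[? ?] h; rewrite (segment_x_ge _ _ h)// (segment_x_le _ _ h).
Qed.

(** The subtrees are straightened one after the other. Their strips of abscissas are disjoint and
    the triangles of the two edges meet only at the over-passing point [O], so neither obstructs the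
    other. *)
Lemma upper_equiv a T : @upper_statement R a T.
Proof.
elim: T a => // l IHl r IHr a F cF F0.
set y := vertex_y R (Node l r) in F0 *; set b := (a + leaves l)%N.
pose x := vertex_x R a (Node l r); pose xl := vertex_x R a l; pose xr := vertex_x R b r.
pose i : R := last_leaf a l; pose e : R := last_leaf b r.
have [yl yr] := @vertex_y_Node R l r; rewrite -/y in yl yr.
have yl0 := @vertex_y_ge0 R l; have yr0 := @vertex_y_ge0 R r.
have h1 : a%:R <= xl := @vertex_x_ge R a l; have h1' : xl <= i := @vertex_x_le R a l.
have h2 : b%:R <= xr := @vertex_x_ge R b r; have h2' : xr <= e := @vertex_x_le R b r.
have h3 : b%:R = i + 1 := @last_leaf_next R a l; have h4 : x = i + 1 / 2 := @vertex_x_mid R a l r.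
have h5 : last_leaf a (Node l r) = e := @last_leaf_Node R a l r.
rewrite h5 parent_endE -/x -/y in F0 *.
pose O : sp := (x, y, 1); pose P : sp := (x, y, - 1); pose Q : sp := (x, 0, 0).
pose Pl := parent_end R a l; pose Pr := parent_end R b r.
pose Cl : sp := (xl, y, 1); pose Cr : sp := (xr, y, 1).
pose Dl : sp := (xl, y, 0); pose Dr : sp := (xr, y, 0).
rewrite -/P -/Q in F0 *.
have cS := @closed_segment R; have cT := @closed_tree_strands R.
have stl p : tree_strands R a l p -> a%:R <= p.1.1 <= i := @tree_strands_x R a l p.
have str p : tree_strands R b r p -> b%:R <= p.1.1 <= e := @tree_strands_x R b r p.
have [zl PlE] : exists zl, Pl = (xl, vertex_y R l, zl) by eexists.
have [zr PrE] : exists zr, Pr = (xr, vertex_y R r, zr) by eexists.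
have PQ p : segment P Q p -> p.1.1 = x by move=> /segmentP[s _ ->] /=; ring.
have OPl p : segment O Pl p -> a%:R <= p.1.1 <= x.
  by rewrite ?PlE ?PrE /O; apply: segment_x_between; rewrite /=; apply/andP; split; lra.
have OPr p : segment O Pr p -> x <= p.1.1 <= e.
  by rewrite ?PlE ?PrE /O; apply: segment_x_between; rewrite /=; apply/andP; split; lra.
have farl p : triangle O Pl Cl p -> x <= p.1.1 -> p = O.
  by rewrite PlE => tp xp; apply: (hang_far tp); left; split=> //; lra.
have farr p : triangle O Pr Cr p -> p.1.1 <= x -> p = O.
  by rewrite PrE => tp xp; apply: (hang_far tp); right; split=> //; lra.
have boxl p : triangle O Pl Cl p -> [/\ a%:R <= p.1.1 <= e, p.1.2 <= y & p.1.2 <= 0 -> p = Pl].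
  rewrite PlE => tp; have [c1 c2 c3 c4] := hang_between tp (ltac:(lra)).
  split=> // [|p0]; first by apply/andP; case: c1 => /andP[? ?]; split; lra.
  by apply: c4; lra.
have boxr p : triangle O Pr Cr p -> [/\ a%:R <= p.1.1 <= e, p.1.2 <= y & p.1.2 <= 0 -> p = Pr].
  rewrite PrE => tp; have [c1 c2 c3 c4] := hang_between tp (ltac:(lra)).
  split=> // [|p0]; first by apply/andP; case: c1 => /andP[? ?]; split; lra.
  by apply: c4; lra.
(* Everything except the left subtree and the edge leading to it stays fixed; [Kr] below has the
   same purpose for the right subtree. *)
pose Kl := tree_strands R b r `|` segment O Pr `|` segment P Q.
have sE : tree_strands R a (Node l r) = Kl `|` (tree_strands R a l `|` segment O Pl).
  rewrite -[LHS]/(tree_strands R a l `|` tree_strands R b r `|` segment O Pl `|` segment O Pr `|`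
    segment P Q) /Kl.
  by apply/seteqP; split=> p; rewrite /setU /=; tauto.
rewrite sE.
apply: (@equiv_trans _ _ _ (Kl `|` (segs (upper_form a l y) `|` (segment O Cl `|` segment Cl Dl)))).
  have L1 p : (F `|` Kl) p -> a%:R <= p.1.1 <= i -> 0 < p.1.2 -> p.1.2 <= y -> False.
    move=> Kp /andP[p1 p2] p3 p4; case: Kp => [Fp|[[/str/andP[? ?]|/OPr/andP[? ?]]|/PQ ?]]; try lra.
    have pP : p = P by apply: F0 => //; apply/andP; split; lra.
    by move: p2; rewrite pP /=; lra.
  have L2 p : (F `|` Kl) p -> triangle O Pl Cl p -> p = O \/ p = Pl.
    move=> Kp tp; case: Kp => [Fp|[[/str/andP[? ?]|/OPr/andP[? ?]]|/PQ ?]]; try (by left; apply: farl => //; lra).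
    have [b1 b2 b3] := boxl p tp; have [p0|p0] := leP p.1.2 0; first by right; exact: b3.
    by left; apply: farl => //; rewrite (F0 p Fp b1 p0 b2).
  apply: equiv_frame; apply: upper_child => //; last by right; rewrite -/i; lra.
  - by do ?[apply: closedU].
  - by rewrite -/y; lra.
pose Kr := segs (upper_form a l y) `|` (segment O Cl `|` segment Cl Dl) `|` segment P Q.
rewrite [X in equiv_rel _ X _](_ : _ = Kr `|` (tree_strands R b r `|` segment O Pr)); last first.
  by rewrite /Kl /Kr; apply/seteqP; split=> p; rewrite /setU /=; tauto.
apply: (@equiv_trans _ _ _ (Kr `|` (segs (upper_form b r y) `|` (segment O Cr `|` segment Cr Dr)))).
  have yly : vertex_y R l <= y by lra.
  have upl p : segs (upper_form a l y) p -> p.1.1 <= i.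
    by move=> /(segs_yx (upper_form_yx a yly)) [/andP[]].
  have OCl p : segment O Cl p -> p.1.1 <= x by apply: segment_x_le; rewrite /O /Cl /Dl /=; lra.
  have ClD p : segment Cl Dl p -> p.1.1 <= xl by apply: segment_x_le; rewrite /O /Cl /Dl /=; lra.
  have R1 p : (F `|` Kr) p -> b%:R <= p.1.1 <= e -> 0 < p.1.2 -> p.1.2 <= y -> False.
    move=> Kp /andP[p1 p2] p3 p4; case: Kp => [Fp|[[/upl ?|[/OCl ?|/ClD ?]]|/PQ ?]]; try lra.
    have pP : p = P by apply: F0 => //; apply/andP; split; lra.
    by move: p1; rewrite pP /=; lra.
  have R2 p : (F `|` Kr) p -> triangle O Pr Cr p -> p = O \/ p = Pr.
    move=> Kp tp; case: Kp => [Fp|[[/upl ?|[/OCl ?|/ClD ?]]|/PQ ?]]; try (by left; apply: farr => //; lra).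
    have [b1 b2 b3] := boxr p tp; have [p0|p0] := leP p.1.2 0; first by right; exact: b3.
    by left; apply: farr => //; rewrite (F0 p Fp b1 p0 b2).
  apply: equiv_frame; apply: upper_child => //; last by left; lra.
  - by do ?[apply: closedU => //]; exact: closed_segs3.
  - by rewrite -/y; lra.
rewrite [X in equiv_rel _ X _](_ : _ = segs (inner_form a l r) `|` segment P Q); first exact: equiv_refl.
rewrite /inner_form 2!segs_catr -/y -/b -/x -/xl -/xr /Kr.
rewrite [segs (bridge _ _ _ _)]/= setU0.
rewrite (segment_sym (xl, y, 1) (x, y, 1)) (segment_sym (xl, y, 0)) -/Cl -/Cr -/O -/Dl -/Dr.
by apply/seteqP; split=> p; rewrite /setU /=; tauto.
Qed.
End UpperInduction.

(** * The lower half-plane: turning the right vine into a row *)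

Section RaiseGap.
Context {R : realType}.
Notation sp := (R * R * R)%type.
Implicit Types (F K : set sp) (p q : sp).

Lemma sp_eq p (x y z : R) : p.1.1 = x -> p.1.2 = y -> p.2 = z -> p = (x, y, z).
Proof. by case: p => -[? ?] ? /= -> -> ->. Qed.

Lemma segmentE p q r : segment p q r -> exists s, [/\ 0 <= s, s <= 1,
  r.1.1 = (1 - s) * p.1.1 + s * q.1.1, r.1.2 = (1 - s) * p.1.2 + s * q.1.2 &
  r.2 = (1 - s) * p.2 + s * q.2].
Proof. by move=> /segmentP[s /andP[? ?] ->]; exists s. Qed.

Variables (a h xE yE zE : R).
Let Q : sp := (a - 1 / 2, - (1 / 4), 1).
Let U : sp := (a + 1 / 2, h, - 1).
Let U' : sp := (a + 1 / 2, - (1 / 4), - 1).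
Let V : sp := (a + 1 / 2, 0, 0).
Let P : sp := (a, 0, 0).
Let O : sp := (a + 1 / 2, h, 1).
Let O' : sp := (a + 1 / 2, - (1 / 4), 1).
Let E : sp := (xE, yE, zE).
Hypotheses (h1 : h < - (1 / 4)) (xEa : a + 1 / 2 < xE) (zEE : zE = - 2 * (xE - a - 1)) (yE0 : yE <= 0).

(** The strand [Q U V] passes under a vertex of the vine, which is lifted to ordinate -1/4. The
    first triangle lies in the plane z = -2(x - a), so obstructions are excluded by comparing
    heights with it; the second lies in the plane x = a + 1/2 and has no positive heights. *)
Lemma raise_under F K : closed F -> closed K ->
  (forall p, F p -> a - 1 / 2 <= p.1.1 -> p.1.2 < 0 ->
     [\/ p = Q, p.1.1 = a - 1 / 2 /\ p.2 <= 0 | a + 1 / 2 < p.1.1]) ->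
  (forall p, K p -> [\/ 0 < p.2, a + 1 / 2 < p.1.1 | p.1.2 >= 0 /\ p.1.1 < a + 1 / 2]) ->
  (forall p, K p -> p.1.2 < 0 -> p.2 <= - 2 * (p.1.1 - a) -> a + 1 / 2 < p.1.1) ->
  equiv_rel (F `|` K) (segment Q U `|` segment U V) (segment Q U' `|` segment U' V).
Proof.
move=> cF cK FP KP KP'; have h1' := h1; have cS := @closed_segment R.
apply: (@equiv_trans _ _ _ (segment U V `|` (segment Q U' `|` segment U' U))).
  rewrite (setUC (segment Q U)); apply: equiv_frame; apply: tri_move.
  - by do ?[apply: closedU].
  - by apply: noncollinear_xy => /=; apply/eqP => e; nra.
  move=> p [b [c [d [[b0 c0 d0 bcd] e1 e2 e3]]]]; rewrite /= in e1 e2 e3.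
  have py : p.1.2 <= - (1 / 4) by rewrite e2; nra.
  have px : a - 1 / 2 <= p.1.1 by rewrite e1; nra.
  have px' : p.1.1 <= a + 1 / 2 by rewrite e1; nra.
  have pz : p.2 = - 2 * (p.1.1 - a).
    have eb : b = 1 - c - d by lra.
    by rewrite e1 e3 eb; field.
  case=> [[Fp|Kp]|/segmentE[s [s0 s1 f1 f2 f3]]].
  - case: (FP p Fp px ltac:(lra)) => [->|[p1 p2]|?]; [by left|by exfalso; lra|by exfalso; lra].
  - by exfalso; have := KP' p Kp ltac:(lra) ltac:(lra); lra.
  - right; rewrite /= in f1 f2 f3.
    have s00 : s = 0 by lra.
    by apply: sp_eq; rewrite ?f1 ?f2 ?f3 s00; ring.
rewrite (setUC (segment U V)) -(setUA (segment Q U')); apply: equiv_frame; apply: equiv_sym; apply: tri_move.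
- by do ?[apply: closedU].
- by apply: noncollinear_yz => /=; apply/eqP => e; nra.
move=> p [b [c [d [[b0 c0 d0 bcd] e1 e2 e3]]]]; rewrite /= in e1 e2 e3.
have px : p.1.1 = a + 1 / 2 by rewrite e1 -!mulrDl bcd mul1r.
have py : p.1.2 <= 0 by rewrite e2; nra.
have pz : p.2 <= 0 by lra.
have top : 0 <= p.1.2 -> p = V.
  move=> p0; have b1 : b = 0 by nra.
  have d1 : d = 0 by nra.
  by apply: sp_eq => //; [rewrite e2 b1 d1|rewrite e3 b1 d1]; ring.
have [p0|p0] := leP 0 p.1.2; first by move=> _; right; exact: top.
case=> [[Fp|Kp]|/segmentE[s [s0 s1 f1 f2 f3]]].
- exfalso; case: (FP p Fp ltac:(lra) ltac:(lra)) => [pQ|[? ?]|?]; [|by lra|by lra].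
  by move: px; rewrite pQ /=; lra.
- by exfalso; case: (KP p Kp) => [?|?|[? ?]]; lra.
- left; rewrite /= in f1 f2 f3.
  have s11 : s = 1 by lra.
  by apply: sp_eq; rewrite ?f1 ?f2 ?f3 s11; ring.
Qed.

(** The strand [P O E] runs from a leaf over the vertex to the end [E] of its right child. The first
    triangle lies in the plane z = 2(x - a). *)
Lemma raise_over F : closed F ->
  (forall p, F p -> a <= p.1.1 -> p.1.1 <= a + 1 / 2 -> p.1.2 < 0 ->
     p.1.1 = a \/ p.2 < 2 * (p.1.1 - a)) ->
  (forall p, F p -> triangle O' E O p -> p = E) ->
  equiv_rel F (segment P O `|` segment O E) (segment P O' `|` segment O' E).
Proof.
move=> cF FP FE; have h1' := h1; have xEa' := xEa; have cS := @closed_segment R.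
apply: (@equiv_trans _ _ _ (segment O E `|` (segment P O' `|` segment O' O))).
  rewrite setUC; apply: equiv_frame; apply: tri_move.
  - by do ?[apply: closedU].
  - by apply: noncollinear_xy => /=; apply/eqP => e; nra.
  move=> p [b [c [d [[b0 c0 d0 bcd] e1 e2 e3]]]]; rewrite /= in e1 e2 e3.
  have px : a <= p.1.1 by rewrite e1; nra.
  have px' : p.1.1 <= a + 1 / 2 by rewrite e1; nra.
  have pz : p.2 = 2 * (p.1.1 - a).
    have eb : b = 1 - c - d by lra.
    by rewrite e1 e3 eb; field.
  case=> [Fp|/segmentE[s [s0 s1 f1 f2 f3]]].
  - have [p0|p0] := leP 0 p.1.2; last first.
      exfalso; case: (FP p Fp px px' p0) => [xa|]; last by lra.
      have [c1 d1] : c = 0 /\ d = 0 by split; nra.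
      by move: p0; rewrite e2 c1 d1; lra.
    left; have c1 : c = 0 by nra.
    have d1 : d = 0 by nra.
    have b1 : b = 1 by lra.
    by apply: sp_eq; rewrite ?e1 ?e2 ?e3 b1 c1 d1; ring.
  - right; rewrite /= in f1 f2 f3.
    have s00 : s = 0 by nra.
    by apply: sp_eq; rewrite ?f1 ?f2 ?f3 s00; ring.
rewrite setUC -setUA; apply: equiv_frame; apply: equiv_sym; apply: tri_move.
- by do ?[apply: closedU].
- by apply: noncollinear_xy => /=; apply/eqP => e; nra.
move=> p tp [Fp|/segmentE[s [s0 s1 f1 f2 f3]]]; first by right; exact: FE.
move: tp => [b [c [d [[b0 c0 d0 bcd] e1 e2 e3]]]]; rewrite /= in e1 e2 e3 f1 f2 f3.
left; have s11 : s = 1 by nra.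
by apply: sp_eq; rewrite ?f1 ?f2 ?f3 s11; ring.
Qed.
End RaiseGap.

Section Vine.
Context {R : realType}.
Notation sp := (R * R * R)%type.
Implicit Types (F K : set sp) (p q : sp) (a k : nat).

Lemma natS k : k.+1%:R = k%:R + 1 :> R.
Proof. by rewrite natr1. Qed.

Lemma upside_down_segment p q :
  upside_down @` segment p q = segment (upside_down p) (upside_down q) :> set sp.
Proof. by apply: image_segment => s _; rewrite /upside_down /=; congr (_, _, _); ring. Qed.

Lemma leaves_vine k : leaves (right_vine k) = k.+1.
Proof. by elim: k => //= k ->. Qed.

Definition vine_strands a k : set sp := upside_down @` tree_strands R a (right_vine k).
Definition vine_end a k : sp := upside_down (parent_end R a (right_vine k)).
Definition vine_over a : sp := (a%:R + 1 / 2, - (1 / 4), 1).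
Definition vine_under a : sp := (a%:R + 1 / 2, - (1 / 4), - 1).

Lemma vine_end0 a : vine_end a 0 = (a%:R, 0, 0).
Proof. by rewrite /vine_end /upside_down /= /vertex_y /= oppr0. Qed.

Lemma vine_vertex a k : vertex_x R a (right_vine k.+1) = a%:R + 1 / 2 /\
  vertex_y R (right_vine k.+1) = k.+1%:R.
Proof. by split; [rewrite /= natrD; field|rewrite /vertex_y leaves_vine]. Qed.

Lemma vine_endS a k : vine_end a k.+1 = (a%:R + 1 / 2, - k.+1%:R, - 1).
Proof. by have [h1 h2] := vine_vertex a k; rewrite /vine_end parent_endE h1 h2. Qed.

Lemma vine_strands0 a : vine_strands a 0 = set0.
Proof. by rewrite /vine_strands /= image_set0. Qed.

Lemma vine_strandsS a k : vine_strands a k.+1 = vine_strands a.+1 k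
  `|` segment (a%:R + 1 / 2, - k.+1%:R, 1) (a%:R, 0, 0)
  `|` segment (a%:R + 1 / 2, - k.+1%:R, 1) (vine_end a.+1 k)
  `|` segment (a%:R + 1 / 2, - k.+1%:R, - 1) (a%:R + 1 / 2, 0, 0).
Proof.
have [h1 h2] := vine_vertex a k.
rewrite /vine_strands -[tree_strands R a _]/(set0 `|` tree_strands R (a + 1) (right_vine k)
  `|` segment (vertex_x R a (right_vine k.+1), vertex_y R (right_vine k.+1), 1) (parent_end R a Leaf)
  `|` segment (vertex_x R a (right_vine k.+1), vertex_y R (right_vine k.+1), 1)
    (parent_end R (a + 1) (right_vine k))
  `|` segment (vertex_x R a (right_vine k.+1), vertex_y R (right_vine k.+1), - 1)
    (vertex_x R a (right_vine k.+1), 0, 0)).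
by rewrite h1 h2 set0U addn1 !image_setU !upside_down_segment -/(vine_end _ _) -/(vine_end _ 0)
  vine_end0 /upside_down /= oppr0.
Qed.

Lemma vine_strands_x a k p : vine_strands a k p -> a%:R <= p.1.1.
Proof. by move=> [q /tree_strands_x /andP[h _] <-]. Qed.

Lemma closed_vine_strands a k : closed (vine_strands a k).
Proof.
elim: k a => [|k IH] a; first by rewrite vine_strands0; exact: closed0.
by rewrite vine_strandsS; do ?[apply: closedU]; (exact: IH || exact: closed_segment).
Qed.

(** The right child is a leaf at height 0 or a vertex met at its under-passing point; the linear
    relation between [zE] and [xE] covers both cases. *)
Lemma vine_endE a k : exists xE yE zE, vine_end a.+1 k = (xE, yE, zE) /\
  [/\ a%:R + 1 / 2 < xE, xE <= a%:R + 3 / 2, zE = - 2 * (xE - a%:R - 1), yE <= 0 & - k%:R <= yE].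
Proof.
case: k => [|k].
  rewrite vine_end0; exists a.+1%:R, 0, 0; split=> //.
  by split; rewrite ?(natS a) ?mulr0n ?oppr0 ?lexx//; lra.
rewrite vine_endS; exists (a.+1%:R + 1 / 2), (- k.+1%:R), (- 1); split=> //.
by have k0 := ler0n R k.+1; split; rewrite ?(natS a) ?lexx//; lra.
Qed.

Lemma vine_far a k xE yE zE p : vine_end a.+1 k = (xE, yE, zE) ->
  triangle (vine_over a) (vine_end a.+1 k) (a%:R + 1 / 2, - k.+1%:R, 1) p ->
  vine_strands a.+1 k p -> p = vine_end a.+1 k.
Proof.
case: k => [|k] _; first by rewrite vine_strands0.
rewrite vine_strandsS vine_endS => -[b [c [d [[b0 c0 d0 bcd] e1 e2 e3]]]].
rewrite /= (natS a) in e1 e2 e3.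
have pz : p.2 = - 2 * (p.1.1 - a%:R - 1).
  have eb : b = 1 - c - d by lra.
  by rewrite e1 e3 eb; field.
have k0 : 0 <= k%:R :> R by exact: ler0n.
have px : p.1.1 <= a%:R + 3 / 2.
  have -> : p.1.1 = a%:R + 1 / 2 + c by rewrite e1 (_ : b = 1 - c - d); [field|lra].
  by lra.
have neg : p.1.2 < 0 by rewrite e2 (natS k.+1) (natS k); nra.
case=> [[[/vine_strands_x|]|]|].
- by rewrite (natS a.+1) (natS a) => ?; exfalso; lra.
- move=> /segmentE[s []]; rewrite /= (natS a) => s0 s1 f1 f2 f3.
  have s11 : s = 1 by lra.
  by exfalso; move: f2; rewrite s11; lra.
- have [x' [y' [z' [-> [x1 _ _ _ _]]]]] := vine_endE a.+1 k; rewrite (natS a) in x1.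
  move=> /segmentE[s []]; rewrite /= (natS a) => s0 s1 f1 f2 f3.
  have s00 : s = 0 by nra.
  by exfalso; move: f1 f3; rewrite s00; lra.
- move=> /segmentE[s []]; rewrite /= (natS a) => s0 s1 f1 f2 f3.
  have c1 : c = 1 by move: f1; rewrite e1 (_ : b = 1 - c - d); lra.
  have [b00 d00] : b = 0 /\ d = 0 by lra.
  by apply: sp_eq; rewrite ?e1 ?e2 ?e3 b00 c1 d00 /= ?(natS a); ring.
Qed.

(** The vine with all its vertices at ordinate -1/4. After the last leaf the under strand and the
    over strand are joined. *)
Fixpoint vine_row a k : seq (sp * sp) :=
  if k is k'.+1 then (vine_over a, (a%:R, 0, 0)) :: (vine_over a, vine_under a.+1) ::
    (vine_under a, (a%:R + 1 / 2, 0, 0)) :: vine_row a.+1 k'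
  else [:: (vine_under a, vine_over a); (vine_over a, (a%:R, 0, 0))].

(** Induction along the vine: its first vertex is raised by [raise_under] and [raise_over], and its
    raised over-passing point then serves as [Q] for the remaining vine. The final leaf is reached
    by bending the last strand through the points of [vine_under] and [vine_over]. *)
Lemma vine_equiv a k F (Q : sp := (a%:R - 1 / 2, - (1 / 4), 1)) : closed F ->
  (forall p, F p -> [\/ 0 <= p.1.2, p.1.1 < a%:R - 1 / 2,
    p.1.1 = a%:R - 1 / 2 /\ p.2 <= 0 | p = Q]) ->
  equiv_rel F (segment Q (vine_end a k) `|` vine_strands a k)
    (segment Q (vine_under a) `|` segs (vine_row a k)).
Proof.
have cS := @closed_segment R.
elim: k a F @Q => [|k IH] a F Q cF F0.
  rewrite vine_end0 vine_strands0 setU0 /= setU0.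
  apply: (@equiv_trans _ _ _ (segment Q (vine_under a) `|` segment (vine_under a) (a%:R, 0, 0))).
    apply: tri_move => //; first by apply: noncollinear_xy => /=; apply/eqP => e; nra.
    move=> p [b [c [d [[b0 c0 d0 bcd] e1 e2 e3]]]]; rewrite /= in e1 e2 e3.
    case/F0 => [y0|x1|[x1 z0]|]; [right|exfalso|exfalso|by left].
    - have [b1 d1] : b = 0 /\ d = 0 by lra.
      by apply: sp_eq; rewrite ?e1 ?e2 ?e3 b1 d1 (_ : c = 1) /=; first [ring|lra].
    - by move: x1; rewrite e1 (_ : b = 1 - c - d); lra.
    - have [c1 d1] : c = 0 /\ d = 0 by move: x1; rewrite e1 (_ : b = 1 - c - d); lra.
      by move: z0; rewrite e3 c1 d1; lra.
  apply: equiv_frame; apply: tri_move.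
  - exact: closedU.
  - by apply: noncollinear_yz => /=; apply/eqP => e; nra.
  move=> p [b [c [d [[b0 c0 d0 bcd] e1 e2 e3]]]]; rewrite /= in e1 e2 e3.
  have px : a%:R <= p.1.1 by rewrite e1 (_ : b = 1 - c - d); lra.
  case=> [/F0[y0|x1|[x1 z0]|pQ]|/segmentE[s [s0 s1 f1 f2 f3]]].
  - right; have [b1 d1] : b = 0 /\ d = 0 by lra.
    by apply: sp_eq; rewrite ?e1 ?e2 ?e3 b1 d1 (_ : c = 1) /=; first [ring|lra].
  - by exfalso; lra.
  - by exfalso; lra.
  - by exfalso; move: px; rewrite pQ /=; lra.
  - rewrite /= in f1 f2 f3; left; have c1 : c = 0 by lra.
    have db : d = 1 - b by lra.
    have px' : p.1.1 = a%:R + 1 / 2 by rewrite e1 c1 db; field.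
    have s11 : s = 1 by lra.
    by apply: sp_eq; rewrite ?f1 ?f2 ?f3 s11 /=; ring.
have [xE [yE [zE [EE [xEa xEa' zEE yE0 yEk]]]]] := vine_endE a k.
have far p := @vine_far a k xE yE zE p EE; have sx p := @vine_strands_x a.+1 k p.
have cV := @closed_vine_strands a.+1 k.
rewrite vine_strandsS vine_endS [segs _]/= -/(vine_over a) -/(vine_under a) EE in far *.
have h1 : - k.+1%:R < - (1 / 4) :> R by have := ler0n R k; rewrite (natS k); lra.
have {}IH F' := IH a.+1 F'; rewrite /= EE in IH; clear EE.
rewrite (natS a) in sx; set h : R := - k.+1%:R in h1 far *.
pose U : sp := (a%:R + 1 / 2, h, - 1); pose O : sp := (a%:R + 1 / 2, h, 1).
pose P : sp := (a%:R, 0, 0); pose V : sp := (a%:R + 1 / 2, 0, 0); pose E : sp := (xE, yE, zE).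
rewrite -/U -/O -/P -/V -/E in far *.
set W := vine_strands a.+1 k in far sx cV *; set O' := vine_over a in far *; set U' := vine_under a.
have PO (r : R) p : r <= 0 -> segment P (a%:R + 1 / 2, r, 1) p ->
    [/\ p.2 = 2 * (p.1.1 - a%:R), a%:R <= p.1.1, p.1.1 <= a%:R + 1 / 2 & p.1.1 = a%:R -> p = P].
  move=> r0 /segmentE[s [s0 s1 f1 f2 f3]]; rewrite /= in f1 f2 f3.
  split; [by rewrite f1 f3; field|by lra|by lra|move=> xa].
  have s00 : s = 0 by lra.
  by apply: sp_eq; rewrite ?f1 ?f2 ?f3 s00 /=; ring.
have OE p : segment O E p -> a%:R + 1 / 2 < p.1.1 \/ p = O.
  move=> /segmentE[s [s0 s1 f1 f2 f3]]; rewrite /= in f1 f2 f3.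
  have [s00|s00] := eqVneq s 0; [right|left].
    by apply: sp_eq; rewrite ?f1 ?f2 ?f3 s00 /=; ring.
  have sgt : 0 < s by rewrite lt_neqAle eq_sym s00.
  by rewrite f1; nra.
have QU p : segment Q U' p -> [/\ p.2 = - 2 * (p.1.1 - a%:R), p.1.1 <= a%:R + 1 / 2,
    p.1.2 = - (1 / 4) & p.1.1 = a%:R + 1 / 2 -> p = U'].
  move=> /segmentE[s [s0 s1 f1 f2 f3]]; rewrite /= in f1 f2 f3.
  split; [by rewrite f1 f3; field|by lra|by rewrite f2; field|move=> xa].
  have s11 : s = 1 by lra.
  by apply: sp_eq; rewrite ?f1 ?f2 ?f3 s11 /=; ring.
have UV p : segment U' V p -> p.1.1 = a%:R + 1 / 2 /\ p.2 <= 0.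
  move=> /segmentE[s [s0 s1 f1 f2 f3]]; rewrite /= in f1 f2 f3.
  by split; [rewrite f1; field|lra].
pose K := W `|` segment O P `|` segment O E.
rewrite [X in equiv_rel _ X _](_ : _ = K `|` (segment Q U `|` segment U V)); last first.
  by apply/seteqP; split=> p; rewrite /K /setU /=; tauto.
(* The under strand is raised first, while the over strand is still below it in the plane. *)
apply: (@equiv_trans _ _ _ (K `|` (segment Q U' `|` segment U' V))).
  apply: equiv_frame; apply: raise_under => //; first by do ?[apply: closedU].
  - move=> p /F0[?|?|[? ?]|->] *; [by exfalso; lra|by exfalso; lra|by apply: Or32|by apply: Or31].
  - move=> p [[/sx ?|]|/OE[?|->]]; [by apply: Or32; lra| |by apply: Or32|by apply: Or31].
    rewrite segment_sym => /PO[|e1 e2 e3 e4]; first by lra.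
    have [e5|e5] := eqVneq p.1.1 a%:R; first by rewrite (e4 e5); apply: Or33; split; rewrite /=; lra.
    have : a%:R < p.1.1 by rewrite lt_neqAle eq_sym e5.
    by move=> ?; apply: Or31; lra.
  - move=> p [[/sx ?|]|/OE[//|->]]; [by lra| |by rewrite /=; lra].
    rewrite segment_sym => /PO[|e1 e2 e3 e4]; first by lra.
    have [e5|e5] := eqVneq p.1.1 a%:R; first by rewrite (e4 e5) /=; lra.
    have : a%:R < p.1.1 by rewrite lt_neqAle eq_sym e5.
    by lra.
pose K2 := segment Q U' `|` segment U' V `|` W.
rewrite [X in equiv_rel _ X _](_ : _ = K2 `|` (segment P O `|` segment O E)); last first.
  by rewrite (segment_sym P); apply/seteqP; split=> p; rewrite /K /K2 /setU /=; tauto.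
apply: (@equiv_trans _ _ _ (K2 `|` (segment P O' `|` segment O' E))).
  apply: equiv_frame; apply: raise_over => //; first by do ?[apply: closedU].
  - move=> p Fp p1 p2 p3.
    case: Fp => [/F0[?|?|[? ?]|pQ]|[[/QU[? ? ? ?]|/UV[? ?]]|/sx ?]]; try (by exfalso; lra).
    + by exfalso; move: p1; rewrite pQ /=; lra.
    + by have [|e5] := eqVneq p.1.1 a%:R; [left|right; have : a%:R < p.1.1 by rewrite lt_neqAle eq_sym e5]; lra.
    + by right; lra.
  - move=> p Fp tp; case: (Fp) => [|[]]; last by exact: far.
    + move: tp => [b [c [d [[b0 c0 d0 bcd] e1 e2 e3]]]]; rewrite /= in e1 e2 e3.
      have p1 : a%:R + 1 / 2 <= p.1.1 by rewrite e1 (_ : b = 1 - c - d); [nra|lra].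
      case/F0 => [?|?|[? ?]|pQ]; [|by exfalso; lra|by exfalso; lra|by exfalso; move: p1; rewrite pQ /=; lra].
      have [b1 d1] : b = 0 /\ d = 0 by split; nra.
      by apply: sp_eq; rewrite ?e1 ?e2 ?e3 b1 d1 (_ : c = 1) /=; first [ring|lra].
    + move: tp => [b [c [d [[b0 c0 d0 bcd] e1 e2 e3]]]]; rewrite /= in e1 e2 e3 => h'.
      have p1 : p.1.1 = a%:R + 1 / 2 + c * (xE - a%:R - 1 / 2).
        by rewrite e1 (_ : b = 1 - c - d); [ring|lra].
      have [p2 p3] : p.1.1 <= a%:R + 1 / 2 /\ (p.1.1 = a%:R + 1 / 2 -> p.2 <= 0).
        by case: h' => [/QU[? ? ? ?]|/UV[? ?]]; split=> // *; lra.
      have c1 : c = 0 by nra.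
      by exfalso; move: p1 p3; rewrite e3 c1 mul0r addr0 => -> /(_ erefl); lra.
pose K3 := segment Q U' `|` segment U' V `|` segment P O'.
rewrite [X in equiv_rel _ X _](_ : _ = K3 `|` (segment O' E `|` W)); last first.
  by apply/seteqP; split=> p; rewrite /K3 /K2 /setU /=; tauto.
rewrite [X in equiv_rel _ _ X](_ : _ = K3 `|` (segment O' (vine_under a.+1) `|` segs (vine_row a.+1 k))); last first.
  by rewrite (segment_sym O' P); apply/seteqP; split=> p; rewrite /K3 /setU /=; tauto.
have O'E : O' = (a.+1%:R - 1 / 2, - (1 / 4), 1) by rewrite (natS a); congr (_, _, _); field.
apply: equiv_frame; rewrite O'E; apply: IH; first by do ?[apply: closedU].
have -> : a.+1%:R - 1 / 2 = a%:R + 1 / 2 :> R by rewrite (natS a); field.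
move=> p [/F0[?|?|[? ?]|->]|[[/QU[? h2 ? h3]|/UV[? ?]]|/segmentE[s [s0 s1 f1 f2 f3]]]].
- by apply: Or41.
- by apply: Or42; lra.
- by apply: Or42; lra.
- by apply: Or42; rewrite /=; lra.
- have [/h3 ->|ne] := eqVneq p.1.1 (a%:R + 1 / 2).
    by apply: Or43; split; rewrite //=; lra.
  by apply: Or42; rewrite lt_neqAle ne.
- by apply: Or43.
- have [s11|ne] := eqVneq s 1.
    by apply: Or44; apply: sp_eq; rewrite ?f1 ?f2 ?f3 s11 /=; field.
  have : s < 1 by rewrite lt_neqAle ne.
  by move=> s1'; apply: Or42; rewrite f1 /=; nra.
Qed.
End Vine.

Section Lower.
Context {R : realType}.
Notation sp := (R * R * R)%type.
Implicit Types (F K : set sp) (p q : sp) (a k : nat).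

Lemma vine_strands_y a k p : @vine_strands R a k p -> - k%:R <= p.1.2.
Proof.
elim: k a p => [|k IH] a p; first by rewrite vine_strands0.
have k0 := ler0n R k; have k1 := @natS R k.
have [xE [yE [zE [EE [_ _ _ _ yEk]]]]] := @vine_endE R a k.
rewrite vine_strandsS EE => -[[[/IH ?|]|]|]; first by lra.
all: by apply: segment_y_ge => /=; lra.
Qed.

(** The strand from the root around to the point 0 is pulled tight until it runs through
    [vine_over 0], as if one more vertex preceded the vine; then [vine_equiv] starts from this
    point. *)
Lemma lower_equiv k F : closed F -> (forall p, F p -> 0 <= p.1.2) ->
  equiv_rel F (upside_down @` upper_tangle R (right_vine k.+1))
    (segment (0, 0, 0) (@vine_over R 0) `|` (segment (@vine_over R 0) (@vine_under R 1)
      `|` segs (@vine_row R 1 k.+1))).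
Proof.
move=> cF F0; have cS := @closed_segment R.
have far p := @vine_far R 0 k.+1 (1 + 1 / 2) (- k.+1%:R) (- 1) p.
have [v1 v2] := @vine_vertex R 1 k; have cW := @closed_vine_strands R 1 k.+1.
have Wx p := @vine_strands_x R 1 k.+1 p; have Wy p := @vine_strands_y 1 k.+1 p.
rewrite /upper_tangle leaves_vine v1 3!image_setU 3!upside_down_segment -/(@vine_strands R 1 k.+1).
rewrite -/(@vine_end R 1 k.+1); move: far Wx Wy cW; set W := @vine_strands R 1 k.+1 => far Wx Wy cW.
rewrite /upside_down [(_, _, _).1.1]/= [(_, _, _).1.2]/= [(_, _, _).2]/= vine_endS oppr0 in far *.
move/(fun h p => h p erefl): far; rewrite (@natS R k.+1).
have m1 : 1 <= k.+1%:R :> R by rewrite ler1n.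
set m : R := k.+1%:R in m1 Wy *; rewrite ?mulr1n ?mulr0n ?add0r in Wx * => far.
pose U : sp := (1 + 1 / 2, - m, - 1); pose B : sp := (1 + 1 / 2, - (m + 1), 0).
pose A : sp := (0, - (m + 1), 0); pose P : sp := (0, 0, 0); pose O : sp := (1 / 2, - (m + 1), 1).
rewrite -/U -/B -/A -/P -/O in far *.
apply: (@equiv_trans _ _ _ ((W `|` segment A P) `|` segment U A)).
  apply: equiv_sym; rewrite [X in equiv_rel _ _ X](_ : _ = (W `|` segment A P) `|` (segment U B `|` segment B A)).
    apply: equiv_frame; apply: tri_move; [by do ?[apply: closedU]| |].
      by apply: noncollinear_xy => /=; apply/eqP => e; nra.
    move=> p [b [c [d [[b0 c0 d0 bcd] e1 e2 e3]]]]; rewrite /= in e1 e2 e3.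
    have eb : p.1.2 = - m - c - d by rewrite e2 (_ : b = 1 - c - d); [ring|lra].
    case=> [/F0 ?|[/Wy ?|/segmentE[s [s0 s1 f1 f2 f3]]]]; [by exfalso; lra|left|right].
      have [c1 d1] : c = 0 /\ d = 0 by lra.
      by apply: sp_eq; rewrite ?e1 ?e2 ?e3 c1 d1 (_ : b = 1) /=; first [ring|lra].
    rewrite /= in f1 f2 f3; have [b1 d1] : b = 0 /\ d = 0 by lra.
    by apply: sp_eq; rewrite ?e1 ?e2 ?e3 b1 d1 (_ : c = 1) /=; first [ring|lra].
  by apply/seteqP; split=> p; rewrite /setU /=; tauto.
apply: (@equiv_trans _ _ _ ((W `|` segment U A) `|` (segment P O `|` segment O A))).
  rewrite [X in equiv_rel _ X _](_ : _ = (W `|` segment U A) `|` segment P A); last first.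
    by rewrite (segment_sym P); apply/seteqP; split=> p; rewrite /setU /=; tauto.
  apply: equiv_frame; apply: tri_move; [by do ?[apply: closedU]| |].
    by apply: noncollinear_xy => /=; apply/eqP => e; nra.
  move=> p [b [c [d [[b0 c0 d0 bcd] e1 e2 e3]]]]; rewrite /= in e1 e2 e3.
  case=> [/F0 ?|[/Wx ?|/segmentE[s [s0 s1 f1 f2 f3]]]]; [left|by exfalso; lra|right].
    have [c1 d1] : c = 0 /\ d = 0 by split; nra.
    by apply: sp_eq; rewrite ?e1 ?e2 ?e3 c1 d1 (_ : b = 1) /=; first [ring|lra].
  rewrite /= in f1 f2 f3; have s11 : s = 1 by lra.
  by apply: sp_eq; rewrite ?f1 ?f2 ?f3 s11 /=; ring.
apply: (@equiv_trans _ _ _ ((W `|` segment P O) `|` segment O U)).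
  apply: equiv_sym; rewrite [X in equiv_rel _ _ X](_ : _ = (W `|` segment P O) `|` (segment O A `|` segment A U)).
    apply: equiv_frame; apply: tri_move; [by do ?[apply: closedU]| |].
      by apply: noncollinear_xy => /=; apply/eqP => e; nra.
    move=> p [b [c [d [[b0 c0 d0 bcd] e1 e2 e3]]]]; rewrite /= in e1 e2 e3.
    have eb : p.1.2 = - (m + 1) + c by rewrite e2 (_ : b = 1 - c - d); [ring|lra].
    case=> [/F0 ?|[/Wy ?|/segmentE[s [s0 s1 f1 f2 f3]]]]; [by exfalso; lra|right|left].
      have [b1 d1] : b = 0 /\ d = 0 by lra.
      by apply: sp_eq; rewrite ?e1 ?e2 ?e3 b1 d1 (_ : c = 1) /=; first [ring|lra].
    rewrite /= in f1 f2 f3; have c1 : c = 0 by lra.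
    have s11 : s = 1 by nra.
    by apply: sp_eq; rewrite ?f1 ?f2 ?f3 s11 /=; ring.
  by rewrite (segment_sym A U); apply/seteqP; split=> p; rewrite /setU /=; tauto.
pose O' : sp := (1 / 2, - (1 / 4), 1).
have OE : @vine_over R 0 = O' by rewrite /vine_over mulr0n add0r.
apply: (@equiv_trans _ _ _ (W `|` (segment P O' `|` segment O' U))).
  rewrite -setUA; apply: equiv_frame.
  have := @raise_over R 0 (- (m + 1)) (1 + 1 / 2) (- m) (- 1).
  rewrite add0r; apply; first by lra.
  - by lra.
  - by exact: closedU.
  - by move=> p [/F0 ?|/Wx ?] *; [exfalso|right]; lra.
  - move=> p [/F0 ?|Wp] tp; last by apply: far => //; rewrite OE.
    move: tp => [b [c [d [[b0 c0 d0 bcd] e1 e2 e3]]]]; rewrite /= in e1 e2 e3.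
    by exfalso; nra.
rewrite OE [X in equiv_rel _ X _](_ : _ = segment P O' `|` (segment O' U `|` W)); last first.
  by apply/seteqP; split=> p; rewrite /setU /=; tauto.
apply: equiv_frame; have := @vine_equiv R 1 k.+1 (F `|` segment P O').
have -> : 1%:R - 1 / 2 = 1 / 2 :> R by field.
rewrite vine_endS mulr1n; apply; first exact: closedU.
move=> p [/F0 ?|/segmentE[s [s0 s1 f1 f2 f3]]]; first by apply: Or41.
rewrite /= in f1 f2 f3; have [s11|ne] := eqVneq s 1.
  by apply: Or44; apply: sp_eq; rewrite ?f1 ?f2 ?f3 s11 /=; field.
have : s < 1 by rewrite lt_neqAle ne.
by move=> s1'; apply: Or42; rewrite f1 /=; nra.
Qed.
End Lower.

(** * Joining the two halves along the x-axis *)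

Section Merge.
Context {R : realType}.
Notation sp := (R * R * R)%type.
Implicit Types (F K : set sp) (p q : sp) (a k : nat) (T : btree).

Fixpoint grid a k : seq (sp * sp) :=
  if k is k'.+1 then cell a%:R ++ gap a%:R ++ grid a.+1 k' else cell a%:R.

Lemma gridS a k : segs (grid a k.+1) =
  segs (cell a%:R) `|` (segs (gap a%:R) `|` segs (grid a.+1 k)).
Proof.
by rewrite -[grid a k.+1]/(cell a%:R ++ (gap a%:R ++ grid a.+1 k)) (segs_catr (cell _)) (segs_catr (gap _)).
Qed.

Lemma grid_cat a j k : segs (grid a (j + k.+1)) =
  segs (grid a j) `|` (segs (gap (a + j)%:R) `|` segs (grid (a + j).+1 k)).
Proof.
elim: j a => [|j IH] a; first by rewrite add0n addn0 gridS.
by rewrite addSn !gridS IH addSn addnS !setUA.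
Qed.

(** The row contains exactly one gap for each vertex of the tree, the one between the last leaf of
    its left subtree and the next leaf. *)
Lemma tree_form_split a T top : segs (tree_form a T top) =
  segs (grid a (leaves T).-1) `|` segs (upper_form a T top).
Proof.
elim: T a top => [|l IHl r IHr] a top; first exact: (segs_catr (cell _)).
rewrite tree_form_Node upper_form_Node /inner_form.
have l0 := leaves_gt0 l; have r0 := leaves_gt0 r.
have -> : (leaves (Node l r)).-1 = ((leaves l).-1 + (leaves r).-1.+1)%N by rewrite /=; lia.
have -> : last_leaf a l = (a + (leaves l).-1)%:R :> R.
  by rewrite /last_leaf -(prednK l0) addnS -natr1 addrK.
rewrite grid_cat -addnS prednK // !(segs_catr (tree_form _ _ _)) IHl IHr.
rewrite (segs_catr (bridge _ _ _ _)) (segs_catr (gap _)) (segs_catr (_ ++ _ ++ _)).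
rewrite !(segs_catr (upper_form _ _ _)).
by apply/seteqP; split=> p; rewrite /setU /=; tauto.
Qed.

Definition row_start a : set sp :=
  segment (a%:R - 1 / 2, - (1 / 4), 1) (a%:R - 1 / 4, - (1 / 4), 1 / 2).
Definition row_end a : set sp :=
  segment (a%:R + 1 / 4, - (1 / 8), 1 / 2) (vine_over a) `|` (segment (vine_over a) (vine_under a)
    `|` segment (vine_under a) (a%:R + 1 / 4, - (1 / 4), - (1 / 2))).

(** Both sides are the same set: the segments of the row are cut at distance 1/4 from the leaves,
    where cells and gaps meet. *)
Lemma row_grid a k :
  segment (a%:R - 1 / 2, - (1 / 4), 1) (vine_under a) `|` segs (vine_row a k) =
  row_start a `|` (segs (grid a k) `|` row_end (a + k)).
Proof.
have split_under b : segment (b%:R - 1 / 2, - (1 / 4), 1) (vine_under b) =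
    row_start b `|` (segment (b%:R - 1 / 4, - (1 / 4), 1 / 2) (b%:R + 1 / 4, - (1 / 4), - (1 / 2)) `|`
    segment (b%:R + 1 / 4, - (1 / 4), - (1 / 2)) (vine_under b)) :> set sp.
  rewrite (@segment_split _ _ _ (b%:R - 1 / 4, - (1 / 4), 1 / 2) (1 / 4)); first last.
  - by rewrite /vine_under /=; congr (_, _, _); field.
  - by lra.
  congr (_ `|` _); apply: (@segment_split _ _ _ _ (2 / 3)); first by lra.
  by rewrite /vine_under /=; congr (_, _, _); field.
have split_over b : segment (vine_over b) (b%:R, 0, 0) = segment (b%:R, 0, 0) (b%:R + 1 / 4, - (1 / 8), 1 / 2) `|`
    segment (b%:R + 1 / 4, - (1 / 8), 1 / 2) (vine_over b) :> set sp.
  rewrite segment_sym; apply: (@segment_split _ _ _ _ (1 / 2)); first by lra.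
  by rewrite /vine_over /=; congr (_, _, _); field.
have cellE b : segs (cell b%:R) = segment (b%:R, 0, 0) (b%:R + 1 / 4, - (1 / 8), 1 / 2) `|`
    segment (b%:R - 1 / 4, - (1 / 4), 1 / 2) (b%:R + 1 / 4, - (1 / 4), - (1 / 2)) :> set sp.
  by rewrite /= setU0.
elim: k a => [|k IH] a.
  rewrite addn0 [segs (grid a 0)]cellE [segs (vine_row _ _)]/= setU0 split_under split_over /row_end.
  rewrite (segment_sym (vine_under a) (vine_over a)) (segment_sym _ (vine_under a)).
  by apply/seteqP; split=> p; rewrite /setU /=; tauto.
have oE : (a.+1%:R - 1 / 2, - (1 / 4), 1) = vine_over a :> sp.
  by rewrite (@natS R a); congr (_, _, _); field.
have rE : row_start a.+1 = segment (vine_over a) (a%:R + 3 / 4, - (1 / 4), 1 / 2).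
  by rewrite /row_start oE (@natS R a); congr (segment _ (_, _, _)); field.
have gapE : segs (gap a%:R) = (segment (a%:R + 1 / 4, - (1 / 8), 1 / 2) (vine_over a) `|`
    segment (vine_over a) (a%:R + 3 / 4, - (1 / 4), 1 / 2)) `|`
    (segment (a%:R + 1 / 4, - (1 / 4), - (1 / 2)) (vine_under a) `|`
     segment (vine_under a) (a%:R + 1 / 2, 0, 0)) :> set sp.
  by rewrite /= setU0 setUA.
have {}IH := IH a.+1; rewrite oE rE addSnnS in IH.
have -> : segs (vine_row a k.+1) = segment (vine_over a) (a%:R, 0, 0) `|`
    segment (vine_under a) (a%:R + 1 / 2, 0, 0) `|`
    (segment (vine_over a) (vine_under a.+1) `|` segs (vine_row a.+1 k)) :> set sp.
  by rewrite [vine_row _ _]/= [segs _]/=; apply/seteqP; split=> p; rewrite /setU /=; tauto.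
rewrite gridS IH cellE gapE split_under split_over.
by apply/seteqP; split=> p; rewrite /setU /=; tauto.
Qed.
End Merge.

(** * Thompson links as side closures, and the conclusion *)

Section Final.
Context {R : realType}.
Notation sp := (R * R * R)%type.
Implicit Types (F K : set sp) (p q : sp) (a k : nat) (T : btree).

Lemma tree_strands_y a T p : tree_strands R a T p -> 0 <= p.1.2.
Proof.
elim: T a => [|l IHl r IHr] a //=; have y0 := @vertex_y_ge0 R.
case=> [[[[/IHl //|/IHr //]|]|]|]; by apply: segment_y_ge => /=; auto.
Qed.

Lemma upper_tangle_y T p : upper_tangle R T p -> 0 <= p.1.2.
Proof.
have y0 := @vertex_y_ge0 R T; have h0 : 0 <= (leaves T)%:R :> R by [].
by case=> [[[/tree_strands_y //|]|]|]; apply: segment_y_ge.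
Qed.

Lemma closed_upper_tangle T : closed (upper_tangle R T).
Proof. by do ?[apply: closedU]; [exact: closed_tree_strands|exact: closed_segment..]. Qed.

Lemma vine_row_y a k p : segs (vine_row a k : seq (sp * sp)) p -> p.1.2 <= 0.
Proof.
have sy u v : u.1.2 <= 0 -> v.1.2 <= 0 -> segment u v p -> p.1.2 <= 0 by exact: segment_y_le.
elim: k a => [|k IH] a /=; first by case=> [|[]] //; apply: sy => /=; lra.
by case=> [|[|[|/IH //]]]; apply: sy => /=; lra.
Qed.

(** After [upper_equiv], the edge added below the root and the edge sprouting from it meet in the
    under-passing point of the root; one triangle move replaces them by a straight vertical line. *)
Lemma root_equiv l r F (n : R := (leaves (Node l r))%:R) (x := vertex_x R 1 (Node l r)) :
  closed F -> (forall p, F p -> p.1.2 <= 0) ->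
  equiv_rel F (upper_tangle R (Node l r)) (segs (upper_form 1 (Node l r) n) `|`
    (segment (x, n, 0) (0, n, 0) `|` segment (0, n, 0) (0, 0, 0))).
Proof.
move=> cF F0; have cS := @closed_segment R.
have x1 : 1 <= x := @vertex_x_ge R 1 (Node l r).
have lE : last_leaf 1 (Node l r) = n by rewrite /last_leaf natrD addrAC subrr add0r.
have n1 : 2 <= n by rewrite ler_nat /=; have := leaves_gt0 l; have := leaves_gt0 r; lia.
have yE : vertex_y R (Node l r) = n - 1.
  by rewrite /vertex_y /n -[in RHS](@prednK (leaves (Node l r))) ?leaves_gt0// -natr1 addrK.
pose P : sp := (x, n - 1, - 1); pose V : sp := (x, 0, 0); pose A : sp := (x, n, 0).
pose B : sp := (0, n, 0); pose O : sp := (0, 0, 0).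
have pE : parent_end R 1 (Node l r) = P by rewrite parent_endE yE.
rewrite /upper_tangle -/n -/x pE -/A -/B -/O.
have PA p : segment P A p -> n - 1 <= p.1.2 /\ (p.1.2 = n - 1 -> p = P).
  move=> /segmentE[s [s0 s1 f1 f2 f3]]; rewrite /= in f1 f2 f3; split; first by lra.
  move=> e; have s00 : s = 0 by lra.
  by apply: sp_eq; rewrite ?f1 ?f2 ?f3 s00 /=; ring.
have AB p : segment A B p -> p.1.2 = n.
  by move=> /segmentE[s [s0 s1 f1 f2 f3]]; rewrite f2 /=; ring.
have BO p : segment B O p -> p.1.1 = 0.
  by move=> /segmentE[s [s0 s1 f1 f2 f3]]; rewrite f1 /=; ring.
pose K := segment P A `|` segment A B `|` segment B O.
apply: (@equiv_trans _ _ _ (K `|` (segs (inner_form 1 l r) `|` segment P V))).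
  rewrite [X in equiv_rel _ X _](_ : _ = K `|` tree_strands R 1 (Node l r)); last first.
    by rewrite [RHS]setUC /K !setUA.
  apply: equiv_frame; have := @upper_equiv R 1 (Node l r); rewrite /upper_statement lE yE pE -/x.
  apply; first by do ?[apply: closedU].
  move=> p [/F0 ?|[[/PA[h1 h2]|/AB ?]|/BO ?]] /andP[? ?] ? ?; [by exfalso; lra| |by exfalso; lra|by exfalso; lra].
  by apply: h2; lra.
pose K' := segs (inner_form 1 l r) `|` segment A B `|` segment B O.
rewrite [X in equiv_rel _ X _](_ : _ = K' `|` (segment V P `|` segment P A)); last first.
  by rewrite (segment_sym V); apply/seteqP; split=> p; rewrite /K /K' /setU /=; tauto.
rewrite [X in equiv_rel _ _ X](_ : _ = K' `|` segment V A); last first.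
  rewrite upper_form_Node segs_catr -/x [segs (line _ _ _)]/= setU0.
  rewrite /K' -/V -/A; move: (segs (inner_form 1 l r)) => I.
  by apply/seteqP; split=> p; rewrite /setU /=; tauto.
apply: equiv_frame; apply: equiv_sym; apply: tri_move.
- by do ?[apply: closedU => //]; exact: closed_segs3.
- by apply: noncollinear_yz => /=; apply/eqP => e; nra.
move=> p [b [c [d [[b0 c0 d0 bcd] e1 e2 e3]]]]; rewrite /= in e1 e2 e3.
have px : p.1.1 = x by rewrite e1 -!mulrDl bcd mul1r.
case=> [/F0 ?|[[/inner_form_in[_ _ /(_ px) pO]|/AB ?]|/BO ?]].
- left; have [c1 d1] : c = 0 /\ d = 0 by split; nra.
  by apply: sp_eq; rewrite ?e1 ?e2 ?e3 c1 d1 (_ : b = 1) /=; first [ring|lra].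
- by exfalso; move: e3; rewrite pO /=; lra.
- right; have [b1 d1] : b = 0 /\ d = 0 by split; nra.
  by apply: sp_eq; rewrite ?e1 ?e2 ?e3 b1 d1 (_ : c = 1) /=; first [ring|lra].
- by exfalso; lra.
Qed.

Lemma link_equiv l r (n : R := (leaves (Node l r))%:R) (x := vertex_x R 1 (Node l r)) :
  equiv_rel set0 (positive_thompson_link R (Node l r))
    (segs (tree_form 1 (Node l r) n) `|` segs (ends x n)).
Proof.
have [k kE] : exists k, leaves (Node l r) = k.+2.
  by exists (leaves (Node l r)).-2; have := leaves_gt0 l; have := leaves_gt0 r; rewrite /=; lia.
have cS := @closed_segment R.
rewrite /positive_thompson_link /thompson_link kE [k.+2.-1]/=.
apply: equiv_trans.
  apply: equiv_frame; apply: lower_equiv; first by rewrite set0U; exact: closed_upper_tangle.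
  by move=> p [//|/upper_tangle_y].
rewrite setUC; apply: equiv_trans.
  apply: equiv_frame; apply: root_equiv.
    by rewrite set0U; do ?[apply: closedU => //]; exact: closed_segs3.
  move=> p [//|[|[|/vine_row_y //]]]; apply: segment_y_le; rewrite /=; lra.
have O1 : (1%:R - 1 / 2, - (1 / 4), 1) = vine_over 0 :> sp.
  by rewrite /vine_over mulr0n add0r; congr (_, _, _); field.
have := @row_grid R 1 k.+1; rewrite O1 => ->; rewrite -/x -/n tree_form_split kE [k.+2.-1]/=.
rewrite [X in equiv_rel _ X _](_ : _ = segs (grid 1 k.+1) `|` segs (upper_form 1 (Node l r) n) `|`
  segs (ends x n)); first exact: equiv_refl.
have nE : (1 + k.+1)%:R = n by rewrite /n kE.
rewrite /row_end /row_start nE /ends /endsT segs_catr ![segs (path3 _)]/= !setU0.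
rewrite O1 /vine_over /vine_under nE mulr0n add0r mulr1n.
rewrite (segment_sym (0, 0, 0)) (segment_sym (1 / 2, - (1 / 4), 1) (1 - 1 / 4, _, _)).
rewrite (segment_sym (0, n, 0) (0, 0, 0)) (segment_sym (x, n, 0)).
have -> : 1 - 1 / 4 = 3 / 4 :> R by field.
move: (segs (grid _ _)) (segs (upper_form _ _ _)) => G U.
by apply/seteqP; split=> p; rewrite /setU /=; tauto.
Qed.

Lemma equiv_side_closure (X Y : set sp) : X =~ Y -> equiv_rel set0 (side_closure X) (side_closure Y).
Proof.
move=> XY; rewrite /side_closure !(setUC X) !(setUC Y); apply: equiv_frame.
apply: equiv_mono XY => p [//|]; case=> [|[|[|]]] sp.
- by apply: Or41; apply: segment_x_le sp; rewrite /=; lra.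
- by apply: Or41; apply: segment_x_le sp; rewrite /=; lra.
- by apply: Or42; apply: segment_x_ge sp; rewrite /=; lra.
- by apply: Or42; apply: segment_x_ge sp; rewrite /=; lra.
Qed.

(** The whole tree, with the row below it, is replaced by one box, and the remaining [ends] close
    that box at its two sides. *)
Lemma tree_link_equiv T : (2 <= leaves T)%N ->
  equiv_rel set0 (positive_thompson_link R T) (side_closure (tree_tangle T)).
Proof.
case: T => // l r _; apply: equiv_trans (link_equiv l r) _.
set n : R := (leaves (Node l r))%:R; set x := vertex_x R 1 (Node l r).
have lE : last_leaf 1 (Node l r) = n by rewrite /last_leaf natrD addrAC subrr add0r.
have x1 : 1 <= x := @vertex_x_ge R 1 (Node l r).
have xn : x <= n by rewrite -lE; exact: vertex_x_le.
have yn : vertex_y R (Node l r) < n.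
  by rewrite ltr_nat ltn_predL; exact: leaves_gt0.
apply: (@equiv_trans _ _ _ (boxform 1 x n n (tree_tangle (Node l r)) `|` segs (ends x n))).
  rewrite !(setUC _ (segs (ends x n))); apply: equiv_frame.
  have := @tree_form_equiv R 1 (Node l r) n yn; rewrite lE -/x mulr1n; apply: equiv_mono => p [//|].
  rewrite /ends /endsT segs_catr /= => -[|] h.
  - case: h => [h|[h|[h|[h|[]]]]].
    + by apply: Or41; apply: segment_x_le h; rewrite /=; lra.
    + by apply: Or41; apply: segment_x_le h; rewrite /=; lra.
    + by apply: Or41; apply: segment_x_le h; rewrite /=; lra.
    + by apply: Or44; apply: segment_y_ge h; rewrite /=; lra.
  - by case: h => [h|[h|[h|[]]]]; apply: Or42; apply: segment_x_ge h; rewrite /=; lra.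
by apply: final_equiv => //; exact: tangle_tree.
Qed.
End Final.

Theorem corollary1 (R : realType) (t : wtree) (ht : all_weights_positive t) :
  exists T : btree,
    (2 <= leaves T)%N /\
    isotopic (arborescent_link R t) (positive_thompson_link R T).
Proof.
have [[[_ uA] _] _ _] := @trees_ofP R t ht; have [T [T2 TA]] := @tree_tangle_surj R t ht.
exists T; split=> //; apply: (@equiv_isotopic _ set0).
(* Both links are side closures: of the rotated arborescent tangle on one side and of the tree
   tangle of [T] on the other. *)
apply: equiv_trans (closure_equiv uA) (equiv_trans _ (equiv_sym (tree_link_equiv T2))).
exact: equiv_sym (equiv_side_closure TA).
Qed.
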